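(* Let $f_i:E_i\to\mathbb R\cup\{+\infty\}$, $i=1,\dots,n$, be Borel functions each having a well-defined barycenter, and suppose $$\sum_{i=1}^n c_i f_i(x_i)\ge \langle x,Qx\rangle\quad\text{for all }x=(x_1,\dots,x_n)\in E.$$ Then $$\prod_{i=1}^n\Big(\int_{E_i}e^{-f_i}\,dx_i\Big)^{c_i}\le e^{D_g(\mathbf c,Q)-\mathcal Q(f_1,\dots,f_n)}.$$ Moreover this inequality is sharp: the constant $D_g(\mathbf c,Q)$ cannot be replaced by any smaller constant.
   Context: Let $n\ge 1$, $E_i=\mathbb{R}^{d_i}$, $E=\bigoplus_{i=1}^n E_i$, $\pi_i:E\to E_i$ the coordinate projection, $x_i=\pi_i(x)$. Fix a symmetric linear map $Q$ on $E$ and positive reals $\mathbf c=(c_i)_{i=1}^n$. For a Gaussian probability measure $\mu_i$ with density $\rho_i$, $h(\mu_i)=-\int\rho_i\log\rho_i$. For probability measures $\mu_i$ on $E_i$, $\Pi(\mu_1,\dots,\mu_n)$ is the set of Borel probability measures $\mu$ on $E$ with $\pi_i\sharp\mu=\mu_i$ for all $i$. $D_g(\mathbf c,Q)\in\mathbb R\cup\{+\infty\}$ is the smallest constant $D$ such that $\sum_i c_i h(\mu_i)\le\sup_{\mu\in\Pi(\mu_1,\dots,\mu_n)}\int_E\langle x,Qx\rangle d\mu+D$ holds for all centered nondegenerate Gaussian measures $\mu_i$ on $E_i$. A Borel $f_i:E_i\to\mathbb R\cup\{+\infty\}$ has well-defined barycenter if $0<\int e^{-f_i}dx_i<\infty$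 and $\int |x_i|e^{-f_i}dx_i<\infty$, in which case $\mathsf{bar}(f_i)=\big(\int_{E_i}e^{-f_i}dx_i\big)^{-1}\int_{E_i}x_ie^{-f_i}dx_i\in E_i$. With $b=(\mathsf{bar}(f_1),\dots,\mathsf{bar}(f_n))\in E$, define $\mathcal Q(f_1,\dots,f_n)=\langle b,Qb\rangle$. *)

(* Defs.v *)
From HB Require Import structures.
From mathcomp Require Import all_boot all_order all_algebra.
From mathcomp Require Import all_classical all_reals all_analysis measurable_realfun.
Set Implicit Arguments. Unset Strict Implicit. Unset Printing Implicit Defensive.
Import Order.TTheory GRing.Theory Num.Theory.
Import numFieldNormedType.Exports.
Local Open Scope classical_set_scope.
Local Open Scope ring_scope.

Section Defs.
Context {R : realType}.

(* d-dimensional Lebesgue measure on R^d = d.-tuple R, defined as the iterated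
   product of the one-dimensional Lebesgue measure:
   lebR 0 = Dirac mass at the unique point of R^0,
   lebR (d+1) A = \int dx lebR d {t | x :: t \in A}  (= product_measure1). *)
Fixpoint lebR (k : nat) : set (k.-tuple R) -> \bar R :=
  match k return set (k.-tuple R) -> \bar R with
  | 0 => fun A => (if `[< A [tuple] >] then 1 else 0)%:E
  | k'.+1 => fun A =>
      (\int[@lebesgue_measure R]_x @lebR k' [set t | A (cons_tuple x t)])%E
  end.

Definition tdot (k : nat) (x y : k.-tuple R) : R := \sum_(j < k) tnth x j * tnth y j.
Definition tnorm (k : nat) (x : k.-tuple R) : R := Num.sqrt (tdot x x).
Definition trow (k : nat) (x : k.-tuple R) : 'rV[R]_k := \row_j tnth x j.

Definition qform (k : nat) (Q : 'M[R]_k) (x : k.-tuple R) : R :=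
  (trow x *m Q *m (trow x)^T) 0 0.

Definition posdef (k : nat) (S : 'M[R]_k) : Prop :=
  S^T = S /\ forall v : 'rV[R]_k, v != 0 -> 0 < (v *m S *m v^T) 0 0.

Definition gauss_density (k : nat) (S : 'M[R]_k) (x : k.-tuple R) : R :=
  expR (- qform (invmx S) x / 2) / Num.sqrt ((2 * pi) ^+ k * \det S).

Definition gauss_measure (k : nat) (S : 'M[R]_k) (A : set (k.-tuple R)) : \bar R :=
  (\int[@lebR k]_(x in A) (gauss_density S x)%:E)%E.

Definition gauss_entropy (k : nat) (S : 'M[R]_k) : \bar R :=
  (- \int[@lebR k]_x (gauss_density S x * ln (gauss_density S x))%:E)%E.

(* E = (+)_i E_i, E_i = R^{d i}, realized as R^N with N = sum_i d_i;
   block i occupies coordinates off i, ..., off i + d i - 1 *)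
Variables (n : nat) (d : 'I_n -> nat).

Definition dimE : nat := \sum_(i < n) d i.
Definition off (i : 'I_n) : nat := \sum_(j < n | (j < i)%N) d j.

Definition block_proj (i : 'I_n) (x : dimE.-tuple R) : (d i).-tuple R :=
  [tuple nth 0 x (off i + k) | k < d i].

Definition glue (xs : forall i : 'I_n, (d i).-tuple R) : dimE.-tuple R :=
  [tuple nth 0 (flatten [seq tval (xs i) | i <- enum 'I_n]) k | k < dimE].

Definition gauss_coupling (S : forall i : 'I_n, 'M[R]_(d i))
    (mu : probability (dimE.-tuple R) R) : Prop :=
  forall (i : 'I_n) (A : set ((d i).-tuple R)), measurable A ->
    mu (block_proj i @^-1` A) = gauss_measure (S i) A.

Definition Dg_admissible (c : 'I_n -> R) (Q : 'M[R]_dimE) (D : R) : Prop :=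
  forall S : forall i : 'I_n, 'M[R]_(d i), (forall i, posdef (S i)) ->
    (\sum_(i < n) (c i)%:E * gauss_entropy (S i) <=
     ereal_sup [set (\int[mu]_x (qform Q x)%:E)%E
                | mu in [set mu | gauss_coupling S mu]] + D%:E)%E.

(* D_g(c, Q) : the smallest admissible constant (+oo if none) *)
Definition Dg (c : 'I_n -> R) (Q : 'M[R]_dimE) : \bar R :=
  ereal_inf [set D%:E | D in [set D | Dg_admissible c Q D]].

Definition mass (k : nat) (f : k.-tuple R -> \bar R) : \bar R :=
  (\int[@lebR k]_x expeR (- f x))%E.

Definition has_barycenter (k : nat) (f : k.-tuple R -> \bar R) : Prop :=
  (0 < mass f < +oo)%E /\
  (\int[@lebR k]_x ((tnorm x)%:E * expeR (- f x)) < +oo)%E.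

Definition bar (k : nat) (f : k.-tuple R -> \bar R) : k.-tuple R :=
  [tuple fine (\int[@lebR k]_x ((tnth x j)%:E * expeR (- f x)))%E / fine (mass f)
  | j < k].

Definition calQ (Q : 'M[R]_dimE) (f : forall i : 'I_n, (d i).-tuple R -> \bar R) : R :=
  qform Q (glue (fun i => bar (f i))).

End Defs.

(* Main.v *)
Require Import Defs.
From HB Require Import structures.
From mathcomp Require Import all_boot all_order all_algebra.
From mathcomp Require Import all_classical all_reals all_analysis measurable_realfun.
From mathcomp Require Import ring lra.
Set Implicit Arguments. Unset Strict Implicit. Unset Printing Implicit Defensive.
Import Order.TTheory GRing.Theory Num.Theory.
Import numFieldNormedType.Exports.
Local Open Scope classical_set_scope.
Local Open Scope ring_scope.
Import HBNNSimple.

(* With [g_i = exp (- f_i)] the hypothesis reads [prod_i g_i(x_i)^(c_i) <= exp (- <x,Qx>)].  Truncating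
   the [g_i] and adding [e |x|^2] to the quadratic form makes them dominated by Gaussians.  The doubling
   map sends a density to that of [(X + Y) / sqrt 2], [X] and [Y] being independent copies; as quadratic
   forms are invariant under the rotation [((x+y)/sqrt 2, (x-y)/sqrt 2)], it preserves the constraint up
   to a constant governed by [M], the supremum of [prod_i (int g_i)^(c_i)] over feasible even families.

   Doubling a nearly optimal even family many times loses little, and by a central limit theorem the
   densities, slightly smoothed, become Gaussian in relative entropy.  Integrating the logarithm of the
   constraint against a coupling of these Gaussians yields [ln M <= D] for every admissible [D].  For
   an arbitrary family each doubling step still only involves even fibres, while the barycenters grow
   like [sqrt 2 ^ j]; comparing exponents as [j] grows gives
   [sum_i c_i ln (int g_i) + <b,Qb> <= ln M].

   For sharpness, [D < Dg] provides covariances [S_i] violating the Gaussian inequality.  Maximising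
   [eps ln det S + tr (Q S)] over the covariances [S] with diagonal blocks [S_i] gives a block diagonal
   matrix [diag (A_i) = Q + eps S^-1 >= Q] with [sum_i tr (A_i S_i)] close to the supremum over couplings,
   and [f_i = <x, A_i x> / c_i], set to [+oo] outside a large ball, is a counterexample. *)

(** * Lebesgue measure on tuples *)

(** The central limit theorem has to be uniform. A family that nearly attains the supremum [M] stays
    useful through [J] doublings only if its relative defect is of order [2^-J], so [J] must be
    fixed before the family is chosen. Uniformity comes from the term [e |x|^2]: changing the signs
    of blocks does not affect an even family, so the constraint may be evaluated where all cross
    terms help; the diagonal blocks of [Q] are nonnegative as soon as some [D] is admissible, and
    what remains is a Gaussian tail whose constants do not depend on the family. The limit theorem
    is proved only against Gaussian test kernels. Smoothing by a narrow Gaussian turns it into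
    pointwise estimates, and the slack [e |x|^2] also pays for the smoothing. As far as possible
    only nonnegative functions are integrated, where Tonelli and changes of variables hold without
    integrability conditions; odd terms are removed by averaging an integrand with its
    reflection. *)

Section LebesgueTuple.
Context {R : realType}.
Local Open Scope ereal_scope.
Notation leb := (@lebesgue_measure R).

Definition consp (k : nat) (p : R * k.-tuple R) : k.+1.-tuple R := cons_tuple p.1 p.2.

Lemma measurable_consp k : measurable_fun setT (@consp k).
Proof. exact: (measurable_cons measurable_fst measurable_snd). Qed.

HB.instance Definition _ k := isMeasurableFun.Build _ _ _ _ (@consp k) (@measurable_consp k).

Lemma lebRSE k A : @lebR R k.+1 A = (leb \x (@lebR R k)) (@consp k @^-1` A).
Proof.
rewrite /= /product_measure1; apply: eq_integral => x _ /=.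
congr (lebR _); apply/seteqP; split => t /=; rewrite /xsection /= ?inE //; by rewrite -(rwP asboolP).
Qed.

Lemma lebR0E : @lebR R 0 = \d_([tuple] : 0.-tuple R).
Proof.
apply/funext => A /=; rewrite diracE; case: asboolP => h.
  by rewrite mem_set.
by rewrite memNset.
Qed.
(** Product measures ask for a sigma-finite structure, while inside the induction below [lebR k] is
    only known to satisfy the axioms; this packs it locally. *)
Lemma sigma_finite_pack d (T : measurableType d) (m : {measure set T -> \bar R}) :
  sigma_finite setT m ->
  exists m' : {sigma_finite_measure set T -> \bar R}, (m' : set T -> \bar R) = m.
Proof.
move=> h; pose c := isSFinite.Build _ _ _ (m : set T -> \bar R) (sfinite_measure_sigma_finite h).
pose c' := isSigmaFinite.Build _ _ _ (m : set T -> \bar R) h.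
pose m' : {sigma_finite_measure set T -> \bar R} := HB.pack (Measure.sort m) c c'.
by exists m'.
Qed.

Definition box k (n : nat) : set (k.-tuple R) := [set t | forall j, (`|tnth t j| <= n%:R)%R].

Lemma measurable_box k n : measurable (@box k n).
Proof.
have -> : @box k n = \bigcap_(j in setT) ((fun t => tnth t j) @^-1` `[(- n%:R)%R, n%:R]).
  apply/seteqP; split => [t h j _|t h j]; first by rewrite /= in_itv /= -ler_norml.
  by have := h j I; rewrite /= in_itv /= -ler_norml.
apply: fin_bigcap_measurable => // j _.
by rewrite -[X in measurable X]setTI; exact: measurable_tnth.
Qed.

Lemma sigma_finite_box k (m : set (k.-tuple R) -> \bar R) :
  (forall n, m (@box k n) < +oo) -> sigma_finite setT m.
Proof.
move=> h; exists (@box k); last by move=> n; split; [exact: measurable_box | exact: h].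
apply/esym; rewrite -subTset => t _; exists (\max_j Num.bound `|tnth t j|)%N => // j.
rewrite (le_trans (ltW (archi_boundP (normr_ge0 _)))) // ler_nat.
exact: (leq_bigmax (F := fun j => Num.bound `|tnth t j|)).
Qed.

(** The four facts are proved together: additivity in dimension [k+1] comes from a product measure,
    which needs sigma-finiteness in dimension [k], and this follows from finiteness on the cubes
    [box], which exhaust the space. *)
Lemma lebR_axioms k :
  [/\ @lebR R k set0 = 0, (forall A, 0 <= @lebR R k A),
   semi_sigma_additive (@lebR R k) & forall n, @lebR R k (@box k n) < +oo].
Proof.
elim: k => [|k [m0 mge0 madd mfin]].
  rewrite lebR0E; split.
  - exact: measure0.
  - exact: measure_ge0.
  - exact: measure_semi_sigma_additive.
  - by move=> n; rewrite diracE ltry.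
pose c := isMeasure.Build _ _ _ (@lebR R k) m0 mge0 madd.
pose m : {measure set (k.-tuple R) -> \bar R} := HB.pack (@lebR R k) c.
have [m' mE] := @sigma_finite_pack _ _ m (sigma_finite_box mfin).
have E : @lebR R k.+1 = pushforward (leb \x m') (@consp k).
  by apply/funext => A; rewrite lebRSE mE.
rewrite E; split.
- by apply: (@measure0 _ _ _ (pushforward (leb \x m') (@consp k))); exact: measurable_consp.
- by apply: (@measure_ge0 _ _ _ (pushforward (leb \x m') (@consp k))); exact: measurable_consp.
- by apply: (@measure_semi_sigma_additive _ _ _ (pushforward (leb \x m') (@consp k))); exact: measurable_consp.
move=> n; rewrite /pushforward.
have -> : @consp k @^-1` @box k.+1 n = `[(- n%:R)%R, n%:R]%classic `*` @box k n.
  apply/seteqP; split => [[a t] h|[a t] [/= ha ht] j].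
    split; first by have := h ord0; rewrite /= in_itv /= -ler_norml.
    by move=> j; have := h (lift ord0 j); rewrite tnthS.
  have [i ->|->] := unliftP ord0 j; first by rewrite tnthS; exact: ht.
  by move: ha; rewrite in_itv /= -ler_norml.
rewrite product_measure1E //; last exact: measurable_box.
rewrite lte_mul_pinfty //.
- rewrite -[X in X \is a fin_num]/(leb `[(- n%:R)%R, n%:R]%classic) lebesgue_measure_itv.
  by case: ifP => // _; rewrite -EFinB.
- by rewrite mE; exact: mfin.
Qed.

HB.instance Definition _ k := isMeasure.Build _ _ _ (@lebR R k)
  (let: And4 a _ _ _ := lebR_axioms k in a)
  (let: And4 _ a _ _ := lebR_axioms k in a)
  (let: And4 _ _ a _ := lebR_axioms k in a).
HB.instance Definition _ k := Measure_isSigmaFinite.Build _ _ _ (@lebR R k)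
  (let: And4 _ _ _ a := lebR_axioms k in sigma_finite_box a).

Lemma int_lebR0 (f : 0.-tuple R -> \bar R) : \int[@lebR R 0]_x f x = f [tuple].
Proof.
rewrite lebR0E integral_dirac//; first by rewrite diracT mul1e.
move=> _ A _; rewrite setTI.
have [h|h] := pselect ((f @^-1` A) [tuple]).
  rewrite (_ : _ @^-1` _ = setT) //; apply/seteqP; split=> // x _; by rewrite /preimage /= tuple0.
rewrite (_ : _ @^-1` _ = set0) //; apply/seteqP; split=> // x /=; by rewrite tuple0.
Qed.

Lemma int_lebRS k (f : k.+1.-tuple R -> \bar R) : measurable_fun setT f ->
  (forall x, 0 <= f x) ->
  \int[@lebR R k.+1]_x f x = \int[leb]_a \int[@lebR R k]_t f (consp (a, t)).
Proof.
move=> mf f0.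
have -> : \int[@lebR R k.+1]_x f x = \int[pushforward (leb \x (@lebR R k)) (@consp k)]_x f x.
  by apply: eq_measure_integral => [|mc A mA _]; [exact: measurable_consp|rewrite -[LHS]/(@lebR R k.+1 A) lebRSE].
rewrite ge0_integral_pushforward //=; last exact: measurable_consp.
rewrite fubini_tonelli1 //; apply: measurableT_comp => //; exact: measurable_consp.
Qed.
End LebesgueTuple.

(** * Translations, reflections and dilations of the line *)

Section LineChange.
Context {R : realType}.
Local Open Scope ereal_scope.
Notation leb := (@lebesgue_measure R).
Implicit Type f : R -> \bar R.

Lemma lebesgue_measure_shift (a : R) (A : set R) : measurable A ->
  leb ((fun x => x + a)%R @^-1` A) = leb A.
Proof.
move=> mA; have ms : measurable_fun setT (fun x : measurableTypeR R => (x + a)%R : measurableTypeR R).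
  by apply: measurable_funD.
have -> : leb ((fun x => x + a)%R @^-1` A) = pushforward leb (fun x : measurableTypeR R => (x + a)%R : measurableTypeR R) A by [].
apply/esym/lebesgue_measure_unique => //= _ [[u v]] _ <-.
rewrite /pushforward (_ : _ @^-1` _ = `](u - a)%R, (v - a)%R]%classic).
  rewrite !lebesgue_measure_itv/= !lte_fin ltrD2r; case: ifPn => // _.
  by rewrite -!EFinB; congr EFin; ring.
by apply/seteqP; split => x /=; rewrite !in_itv /= ltrBlDr lerBrDr.
Qed.

Lemma int_shift (a : R) f : measurable_fun setT f -> (forall x, 0 <= f x) ->
  \int[leb]_x f (x + a)%R = \int[leb]_x f x.
Proof.
move=> mf f0; have ms : measurable_fun setT (fun x : measurableTypeR R => (x + a)%R : measurableTypeR R).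
  by apply: measurable_funD.
rewrite -[LHS](@ge0_integral_pushforward _ _ _ _ R _ ms leb setT f) //.
by apply: eq_measure_integral => A mA _; exact: lebesgue_measure_shift.
Qed.

Lemma lebesgue_measure_scale (a : R) (A : set R) : (0 < a)%R -> measurable A ->
  a%:E * leb ((fun x => a * x)%R @^-1` A) = leb A.
Proof.
move=> a0 mA; have ms : measurable_fun setT (fun x : measurableTypeR R => (a * x)%R : measurableTypeR R).
  by apply: measurable_funM.
have a0' : (0 <= a)%R by exact: ltW.
have -> : a%:E * leb ((fun x => a * x)%R @^-1` A) = mscale (NngNum a0') (pushforward leb (fun x : measurableTypeR R => (a * x)%R : measurableTypeR R)) A by [].
apply/esym/lebesgue_measure_unique => //= _ [[u v]] _ <-.
transitivity (a%:E * leb ((fun x => a * x)%R @^-1` `]u, v])); last by [].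
rewrite (_ : _ @^-1` _ = `](u / a)%R, (v / a)%R]%classic).
  rewrite !lebesgue_measure_itv/= !lte_fin ltr_pM2r ?invr_gt0 //; case: ifPn => // _.
    by rewrite -!EFinB -EFinM; congr EFin; field; rewrite gt_eqF.
  by rewrite mule0.
by apply/seteqP; split => x /=; rewrite !in_itv /= ltr_pdivrMr // ler_pdivlMr // mulrC.
Qed.

Lemma int_opp f : measurable_fun setT f -> (forall x, 0 <= f x) ->
  \int[leb]_x f (- x)%R = \int[leb]_x f x.
Proof.
move=> mf f0; have ms : measurable_fun setT (-%R : measurableTypeR R -> measurableTypeR R) by [].
rewrite -[LHS](@ge0_integral_pushforward _ _ _ _ R _ ms leb setT f) //.
by apply: eq_measure_integral => A mA _; exact: lebesgue_measureN.
Qed.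

Lemma int_scale (a : R) f : a != 0%R -> measurable_fun setT f -> (forall x, 0 <= f x) ->
  \int[leb]_x f (a * x)%R = (`|a|^-1)%:E * \int[leb]_x f x.
Proof.
move=> a0 mf f0.
wlog ap : f a a0 mf f0 / (0 < a)%R.
  move=> W; case: (ltrgtP a 0%R) => [al|ag|/eqP]; last by rewrite (negbTE a0).
    have H := W (fun x => f (- x)%R) (- a)%R _ _ _ _.
    rewrite -(int_opp mf f0) -[in RHS]normrN -H ?oppr_eq0 ?oppr_gt0 //.
      by apply: eq_integral => x _; rewrite mulNr opprK.
    exact: measurableT_comp.
  exact: W.
have ms : measurable_fun setT (fun x : measurableTypeR R => (a * x)%R : measurableTypeR R).
  by apply: measurable_funM.
have a0' : (0 <= a)%R by exact: ltW.
rewrite -[LHS](@ge0_integral_pushforward _ _ _ _ R _ ms leb setT f) //.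
rewrite (_ : \int[leb]_x f x = \int[mscale (NngNum a0') (pushforward leb (fun x : measurableTypeR R => (a * x)%R : measurableTypeR R))]_x f x).
  rewrite ge0_integral_mscale //= muleA -EFinM gtr0_norm // mulVf // ?mul1e //.
by apply: eq_measure_integral => A mA _; apply/esym; exact: lebesgue_measure_scale.
Qed.

End LineChange.

Lemma mcomp d1 d2 d3 (T1 : measurableType d1) (T2 : measurableType d2) (T3 : measurableType d3)
    (h : T2 -> T3) (f : T1 -> T2) :
  measurable_fun setT h -> measurable_fun setT f -> measurable_fun setT (fun x => h (f x)).
Proof. exact: measurableT_comp. Qed.

Lemma mpair d1 d2 d3 (T1 : measurableType d1) (T2 : measurableType d2) (T3 : measurableType d3)
    (f : T1 -> T2) (g : T1 -> T3) :
  measurable_fun setT f -> measurable_fun setT g -> measurable_fun setT (fun x => (f x, g x)).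
Proof. by move=> mf mg; apply/measurable_fun_pairP; split. Qed.

(** * Vector operations on tuples *)

Section Tuples.
Context {R : realType}.
Variable k : nat.
Implicit Types x y z : k.-tuple R.

Definition tadd x y : k.-tuple R := [tuple tnth x j + tnth y j | j < k].
Definition tscale (a : R) x : k.-tuple R := [tuple a * tnth x j | j < k].
Definition tzero : k.-tuple R := [tuple 0 | j < k].
Definition rowt (v : 'rV[R]_k) : k.-tuple R := [tuple v 0 j | j < k].

Lemma rowtK v : trow (rowt v) = v.
Proof. by apply/rowP => j; rewrite mxE tnth_mktuple. Qed.
Lemma trowK x : rowt (trow x) = x.
Proof. by apply: eq_from_tnth => j; rewrite tnth_mktuple mxE. Qed.
Lemma trow_inj : injective (@trow R k).
Proof. exact: can_inj trowK. Qed.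
Lemma trowD x y : trow (tadd x y) = trow x + trow y.
Proof. by apply/rowP => j; rewrite !mxE tnth_mktuple. Qed.
Lemma trowZ a x : trow (tscale a x) = a *: trow x.
Proof. by apply/rowP => j; rewrite !mxE tnth_mktuple. Qed.
Lemma trow0 : trow tzero = 0.
Proof. by apply/rowP => j; rewrite !mxE tnth_mktuple. Qed.
Lemma tnthD x y j : tnth (tadd x y) j = tnth x j + tnth y j.
Proof. by rewrite tnth_mktuple. Qed.
Lemma tnthZ a x j : tnth (tscale a x) j = a * tnth x j.
Proof. by rewrite tnth_mktuple. Qed.
Lemma tnth_tzero j : tnth tzero j = 0.
Proof. by rewrite tnth_mktuple. Qed.

Context d (T : measurableType d).

Lemma measurable_tadd (f g : T -> k.-tuple R) : measurable_fun setT f ->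
  measurable_fun setT g -> measurable_fun setT (fun t => tadd (f t) (g t)).
Proof.
move=> /measurable_fun_tnthP mf /measurable_fun_tnthP mg.
apply/measurable_fun_tnthP => i.
rewrite [X in measurable_fun _ X](_ : _ = (fun t => tnth (f t) i + tnth (g t) i)).
  by apply: measurable_funD; [exact: mf | exact: mg].
by apply/funext => t /=; rewrite tnthD.
Qed.

Lemma measurable_tscale (a : T -> R) (f : T -> k.-tuple R) : measurable_fun setT a ->
  measurable_fun setT f -> measurable_fun setT (fun t => tscale (a t) (f t)).
Proof.
move=> ma /measurable_fun_tnthP mf.
apply/measurable_fun_tnthP => i.
rewrite [X in measurable_fun _ X](_ : _ = (fun t => a t * tnth (f t) i)).
  by apply: measurable_funM => //; exact: mf.
by apply/funext => t /=; rewrite tnthZ.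
Qed.

End Tuples.
Arguments tzero {R k}.

(** * Changes of variables in several dimensions *)

Section LebRChange.
Context {R : realType}.
Local Open Scope ereal_scope.
Notation leb := (@lebesgue_measure R).

Lemma consp_tadd k (a b : R) (t u : k.-tuple R) :
  tadd (consp (a, t)) (consp (b, u)) = consp ((a + b)%R, tadd t u).
Proof.
apply: eq_from_tnth => j; rewrite tnthD.
have [i ->|->] := unliftP ord0 j; first by rewrite !tnthS tnthD.
by [].
Qed.

Lemma consp_tscale k (a b : R) (t : k.-tuple R) :
  tscale a (consp (b, t)) = consp ((a * b)%R, tscale a t).
Proof.
apply: eq_from_tnth => j; rewrite tnthZ.
by have [i ->|->] := unliftP ord0 j; rewrite ?tnthS ?tnthZ.
Qed.

Lemma consp_surj k (y : k.+1.-tuple R) : y = consp (thead y, [tuple of behead y]).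
Proof. by rewrite /consp /= [LHS]tuple_eta; apply/val_inj. Qed.

Lemma measurable_fubini_consp k (f : k.+1.-tuple R -> \bar R) : measurable_fun setT f ->
  (forall x, 0 <= f x) -> measurable_fun setT (fun a => \int[@lebR R k]_t f (consp (a, t))).
Proof.
move=> mf f0.
apply: (@measurable_fun_fubini_tonelli_F _ _ _ _ R (@lebR R k) (f \o @consp R k)) => [|x]; last exact: f0.
by apply: measurableT_comp => //; exact: measurable_consp.
Qed.

Lemma measurable_fun_conspr k (f : k.+1.-tuple R -> \bar R) (a : R) : measurable_fun setT f ->
  measurable_fun setT (fun t => f (consp (a, t))).
Proof.
move=> mf; apply: measurableT_comp => //; apply: measurableT_comp; first exact: measurable_consp.
exact: pair1_measurable.
Qed.

Lemma int_lebR_shift k (f : k.-tuple R -> \bar R) (y : k.-tuple R) :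
  measurable_fun setT f -> (forall x, 0 <= f x) ->
  \int[@lebR R k]_x f (tadd x y) = \int[@lebR R k]_x f x.
Proof.
elim: k f y => [|k IH] f y mf f0; first by rewrite !int_lebR0 tuple0; congr f; rewrite [RHS]tuple0.
have mD : measurable_fun setT (fun x => f (tadd x y)).
  by apply: measurableT_comp => //; apply: measurable_tadd.
rewrite (int_lebRS mD); last by move=> x; exact: f0.
rewrite (int_lebRS mf f0) [y]consp_surj.
under eq_integral => a _ do under eq_integral => t _ do rewrite consp_tadd.
rewrite -[RHS](int_shift (thead y)); last 2 first.
- exact: measurable_fubini_consp.
- by move=> a; apply: integral_ge0.
apply: eq_integral => a _.
by rewrite (IH (fun t => f (consp ((a + thead y)%R, t)))) //; exact: measurable_fun_conspr.
Qed.

Lemma int_lebR_scale k (f : k.-tuple R -> \bar R) (a : R) : a != 0%R ->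
  measurable_fun setT f -> (forall x, 0 <= f x) ->
  \int[@lebR R k]_x f (tscale a x) = ((`|a| ^- k)%R)%:E * \int[@lebR R k]_x f x.
Proof.
move=> a0; elim: k f => [|k IH] f mf f0.
  by rewrite !int_lebR0 tuple0 expr0 invr1 mul1e; congr f; rewrite [RHS]tuple0.
have mD : measurable_fun setT (fun x => f (tscale a x)).
  by apply: measurableT_comp => //; apply: measurable_tscale.
have mF := measurable_fubini_consp mf f0.
rewrite (int_lebRS mD); last by move=> x; exact: f0.
rewrite (int_lebRS mf f0).
under eq_integral => b _ do under eq_integral => t _ do rewrite consp_tscale.
under eq_integral => b _.
  rewrite (IH (fun t => f (consp ((a * b)%R, t)))) //; last exact: measurable_fun_conspr.
  over.
rewrite ge0_integralZl; last 4 first.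
- exact: measurableT.
- by apply: (mcomp mF); exact: measurable_funM.
- by move=> b _; apply: integral_ge0.
- by rewrite lee_fin invr_ge0 exprn_ge0.
rewrite (int_scale (f := fun b => \int[@lebR R k]_t f (consp (b, t)))) //; last first.
  by move=> b; apply: integral_ge0.
by rewrite muleA -EFinM -invfM exprSr.
Qed.

Lemma int_lebR_opp k (f : k.-tuple R -> \bar R) :
  measurable_fun setT f -> (forall x, 0 <= f x) ->
  \int[@lebR R k]_x f (tscale (-1) x) = \int[@lebR R k]_x f x.
Proof.
by move=> mf f0; rewrite int_lebR_scale ?oppr_eq0 ?oner_eq0 // normrN1 expr1n invr1 mul1e.
Qed.

(* Substitutes [y = sqrt 2 s - x] and then [x = (s + t) / sqrt 2], one variable at a time, so that only
   translations and dilations are needed. *)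
Lemma int_rotation k (f : k.-tuple R * k.-tuple R -> \bar R) :
  let r := (Num.sqrt 2)^-1%R in
  measurable_fun setT f -> (forall x, 0 <= f x) ->
  \int[@lebR R k]_x \int[@lebR R k]_y f (x, y) =
  \int[@lebR R k]_s \int[@lebR R k]_t
     f (tscale r (tadd s t), tscale r (tadd s (tscale (-1) t))).
Proof.
move=> r mf f0.
have r2 : (Num.sqrt 2 : R) != 0%R by rewrite gt_eqF // sqrtr_gt0.
have s2 : (Num.sqrt 2 * Num.sqrt 2 = 2 :> R)%R by rewrite -expr2 sqr_sqrtr.
pose c := (`|Num.sqrt 2 : R| ^- k)%R.
have c0 : (0 < c)%R by rewrite invr_gt0 exprn_gt0 // normr_gt0.
have m2 : measurable_fun setT (fun xs : k.-tuple R * k.-tuple R =>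
    f (xs.1, tadd (tscale (Num.sqrt 2) xs.2) (tscale (-1) xs.1))).
  apply: (mcomp mf); apply: mpair => //.
  by apply: measurable_tadd; apply: measurable_tscale.
have E1 x : \int[@lebR R k]_y f (x, y) =
  (c^-1)%:E * \int[@lebR R k]_s f (x, tadd (tscale (Num.sqrt 2) s) (tscale (-1) x)).
  have m3 : measurable_fun setT (fun y => f (x, y)) by apply: (mcomp mf); exact: mpair.
  have m4 : measurable_fun setT (fun y => f (x, tadd y (tscale (-1) x))).
    by apply: (mcomp m3); apply: measurable_tadd.
  rewrite -(int_lebR_shift (tscale (-1) x) m3) //.
  by rewrite (int_lebR_scale (f := fun y => f (x, tadd y (tscale (-1) x)))) // muleA -EFinM mulVf ?gt_eqF // mul1e.
under eq_integral => x _ do rewrite E1.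
have cV0 : (0 <= c^-1)%R by rewrite invr_ge0 ltW.
rewrite ge0_integralZl //; last 2 first.
- exact: (measurable_fun_fubini_tonelli_F _ m2).
- by move=> x _; apply: integral_ge0.
rewrite (fubini_tonelli _ m2) //= -ge0_integralZl //=; last 2 first.
- exact: (measurable_fun_fubini_tonelli_G _ m2).
- by move=> x _; apply: integral_ge0.
apply: eq_integral => s _.
have m5 : measurable_fun setT (fun x => f (x, tadd (tscale (Num.sqrt 2) s) (tscale (-1) x))).
  by apply: (mcomp m2 (f := fun x => (x, s))); exact: mpair.
have r0 : r != 0%R by rewrite invr_eq0.
have rV : c^-1%R = (`|r| ^- k)%R by rewrite /r /c normfV exprVn.
rewrite -(int_lebR_shift (tscale r s) m5) // rV -(int_lebR_scale r0) //; last first.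
  by apply: (mcomp m5); apply: measurable_tadd.
apply: eq_integral => t _; congr (f (_, _)); apply: eq_from_tnth => j;
  rewrite !(tnthD, tnthZ); first by rewrite -mulrDr addrC.
have -> : (Num.sqrt 2 = 2 * r :> R)%R by rewrite /r -[X in (X / _)%R]s2 mulfK.
ring.
Qed.

End LebRChange.

(** * Gaussian-dominated functions and doubling *)

Section Dot.
Context {R : realType}.
Implicit Type k : nat.

Lemma tdotE k (x y : k.-tuple R) : tdot x y = (trow x *m (trow y)^T) 0 0.
Proof. by rewrite mxE; apply: eq_bigr => j _; rewrite !mxE. Qed.

Lemma tdotC k (x y : k.-tuple R) : tdot x y = tdot y x.
Proof. by apply: eq_bigr => j _; rewrite mulrC. Qed.

Lemma tdotDl k (x y z : k.-tuple R) : tdot (tadd x y) z = tdot x z + tdot y z.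
Proof. by rewrite -big_split /=; apply: eq_bigr => j _; rewrite tnthD mulrDl. Qed.

Lemma tdotDr k (x y z : k.-tuple R) : tdot x (tadd y z) = tdot x y + tdot x z.
Proof. by rewrite tdotC tdotDl !(tdotC x). Qed.

Lemma tdotZl k a (x y : k.-tuple R) : tdot (tscale a x) y = a * tdot x y.
Proof. by rewrite mulr_sumr; apply: eq_bigr => j _; rewrite tnthZ mulrA. Qed.

Lemma tdotZr k a (x y : k.-tuple R) : tdot x (tscale a y) = a * tdot x y.
Proof. by rewrite tdotC tdotZl tdotC. Qed.

Lemma tdot_ge0 k (x : k.-tuple R) : 0 <= tdot x x.
Proof. by apply: sumr_ge0 => j _; rewrite -expr2 sqr_ge0. Qed.

Lemma tdot_consp k a b (t u : k.-tuple R) :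
  tdot (consp (a, t)) (consp (b, u)) = a * b + tdot t u.
Proof.
rewrite /tdot big_ord_recl; congr (_ + _).
by apply: eq_bigr => j _; rewrite !tnthS.
Qed.

Lemma tdot_tuple0 (x y : 0.-tuple R) : tdot x y = 0.
Proof. by rewrite /tdot big_ord0. Qed.

Lemma tdot_CS k (x y : k.-tuple R) : tdot x y ^+ 2 <= tdot x x * tdot y y.
Proof.
have h (s t : R) : 0 <= s ^+ 2 * tdot x x + 2 * s * t * tdot x y + t ^+ 2 * tdot y y.
  have := tdot_ge0 (tadd (tscale s x) (tscale t y)).
  rewrite !(tdotDl, tdotDr, tdotZl, tdotZr) (tdotC y x) => h.
  by have -> : s ^+ 2 * tdot x x + 2 * s * t * tdot x y + t ^+ 2 * tdot y y =
    s * (s * tdot x x) + s * (t * tdot x y) +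
    (t * (s * tdot x y) + t * (t * tdot y y)) by ring.
have [y0|y0] := eqVneq (tdot y y) 0.
  (* With [tdot y y = 0] this choice of [s] and [t] turns the nonnegative form into
     [-2 (tdot x y)^2]. *)
  rewrite y0 mulr0; have := h (- tdot x y) (tdot x x / 2 + 1); rewrite y0.
  have := tdot_ge0 x; set A := tdot x x; set B := tdot x y => A0 H.
  by nra.
have yp : 0 < tdot y y by rewrite lt_def y0 tdot_ge0.
have := h (tdot y y) (- tdot x y).
rewrite (_ : _ + _ = tdot y y * (tdot x x * tdot y y - tdot x y ^+ 2)); last by ring.
by rewrite pmulr_rge0 // subr_ge0.
Qed.

Definition r2 : R := (Num.sqrt 2)^-1.

Lemma r2_sqr : r2 * r2 = 2^-1 :> R.
Proof. by rewrite /r2 -invfM -expr2 sqr_sqrtr. Qed.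

Definition rotp k (s t : k.-tuple R) := tscale r2 (tadd s t).
Definition rotm k (s t : k.-tuple R) := tscale r2 (tadd s (tscale (-1) t)).

Lemma tdot_rot k (s t : k.-tuple R) :
  tdot (rotp s t) (rotp s t) + tdot (rotm s t) (rotm s t) = tdot s s + tdot t t.
Proof.
rewrite !(tdotDl, tdotDr, tdotZl, tdotZr) (tdotC t s).
have := r2_sqr; set r := r2; set A := tdot s s; set B := tdot s t; set C := tdot t t => rr.
rewrite (_ : _ + _ = (r * r) * 2 * (A + C)); last by ring.
by rewrite rr mulVf ?mul1r.
Qed.

Lemma rotpK k (s t : k.-tuple R) : rotp (rotp s t) (rotm s t) = s.
Proof.
apply: eq_from_tnth => j; rewrite !(tnthD, tnthZ).
rewrite (_ : _ * _ = r2 * r2 * 2 * tnth s j); last by ring.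
by rewrite r2_sqr mulVf ?mul1r.
Qed.

Section Meas.
Context d (T : measurableType d).

Lemma measurable_tdot k (f g : T -> k.-tuple R) : measurable_fun setT f ->
  measurable_fun setT g -> measurable_fun setT (fun t => tdot (f t) (g t)).
Proof.
move=> /measurable_fun_tnthP mf /measurable_fun_tnthP mg.
apply: measurable_sum => i; apply: measurable_funM; [exact: mf|exact: mg].
Qed.

Lemma measurable_qform k (Q : 'M[R]_k) (f : T -> k.-tuple R) : measurable_fun setT f ->
  measurable_fun setT (fun t => qform Q (f t)).
Proof.
move=> /measurable_fun_tnthP mf.
rewrite [X in measurable_fun _ X](_ : _ =
  (fun t => \sum_j (\sum_i tnth (f t) i * Q i j) * tnth (f t) j)); last first.
  apply/funext => t; rewrite /qform mxE; apply: eq_bigr => j _; rewrite !mxE; congr (_ * _).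
  by apply: eq_bigr => i _; rewrite !mxE.
apply: measurable_sum => j; apply: measurable_funM; last exact: mf.
apply: measurable_sum => i; apply: measurable_funM; [exact: mf|exact: measurable_cst].
Qed.

Lemma measurable_expR_comp (f : T -> R) : measurable_fun setT f ->
  measurable_fun setT (fun t => expR (f t)).
Proof. by move=> mf; apply: mcomp => //; exact: measurable_expR. Qed.

Lemma measurable_rotp k (f g : T -> k.-tuple R) : measurable_fun setT f ->
  measurable_fun setT g -> measurable_fun setT (fun t => rotp (f t) (g t)).
Proof. by move=> mf mg; apply: measurable_tscale => //; exact: measurable_tadd. Qed.

Lemma measurable_rotm k (f g : T -> k.-tuple R) : measurable_fun setT f ->
  measurable_fun setT g -> measurable_fun setT (fun t => rotm (f t) (g t)).
Proof.
by move=> mf mg; apply: measurable_tscale => //; apply: measurable_tadd => //;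
  exact: measurable_tscale.
Qed.
End Meas.
End Dot.

(** * Gaussian integrals and Gaussian-dominated functions *)

Section GaussKernel.
Context {R : realType}.
Notation leb := (@lebesgue_measure R).

Lemma int_gauss1 (a : R) : 0 < a ->
  (\int[leb]_x (expR (- a * x ^+ 2))%:E = (Num.sqrt (pi / a))%:E)%E.
Proof.
move=> a0; have sa : 0 < Num.sqrt a by rewrite sqrtr_gt0.
under eq_integral => x _.
  rewrite (_ : - a * x ^+ 2 = - (Num.sqrt a * x) ^+ 2); last first.
    by rewrite exprMn sqr_sqrtr ?ltW // mulNr.
  over.
rewrite (int_scale (f := fun y => (gauss_fun y)%:E)) ?gt_eqF //; last 2 first.
- by apply/measurable_EFinP; exact: measurable_gauss_fun.
- by move=> x; rewrite lee_fin gauss_fun_ge0.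
rewrite integralT_gauss -EFinM gtr0_norm // mulrC; congr EFin.
by rewrite sqrtrM ?pi_ge0 // sqrtrV // ltW.
Qed.

Lemma int_gauss1_lin (a b : R) : 0 < a ->
  (\int[leb]_x (expR (- a * x ^+ 2 + 2 * b * x))%:E =
   (Num.sqrt (pi / a) * expR (b ^+ 2 / a))%:E)%E.
Proof.
move=> a0.
have m1 : measurable_fun setT (fun x : R => (expR (- a * x ^+ 2 + 2 * b * x))%:E).
  apply/measurable_EFinP; apply: measurable_expR_comp; apply: measurable_funD;
    apply: measurable_funM => //; exact: measurable_funX.
rewrite -(int_shift (b / a) m1); last by move=> x; rewrite lee_fin expR_ge0.
under eq_integral => x _.
  rewrite (_ : - a * _ + _ = - a * x ^+ 2 + b ^+ 2 / a); last by field; rewrite gt_eqF.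
  rewrite expRD EFinM; over.
have m2 : measurable_fun setT (fun x : R => (expR (- a * x ^+ 2))%:E).
  apply/measurable_EFinP; apply: measurable_expR_comp.
  apply: measurable_funM => //; exact: measurable_funX.
rewrite ge0_integralZr; last 4 first.
- exact: measurableT.
- exact: m2.
- by move=> x _; rewrite lee_fin expR_ge0.
- by rewrite lee_fin expR_ge0.
by rewrite int_gauss1 // EFinM.
Qed.

Lemma measurable_gk k (a : R) : measurable_fun setT (fun x : k.-tuple R => expR (- a * tdot x x)).
Proof.
by apply: measurable_expR_comp; apply: measurable_funM => //; apply: measurable_tdot.
Qed.

Lemma int_gk k (a : R) : 0 < a ->
  (\int[@lebR R k]_x (expR (- a * tdot x x))%:E = (Num.sqrt (pi / a) ^+ k)%:E)%E.
Proof.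
move=> a0; elim: k => [|k IH]; first by rewrite int_lebR0 tdot_tuple0 mulr0 expR0 expr0.
rewrite int_lebRS; last 2 first.
- by apply/measurable_EFinP; exact: measurable_gk.
- by move=> x; rewrite lee_fin expR_ge0.
under eq_integral => b _.
  under eq_integral => t _.
    rewrite tdot_consp mulrDr expRD EFinM -expr2; over.
  rewrite ge0_integralZl; last 4 first.
  - exact: measurableT.
  - by apply/measurable_EFinP; exact: measurable_gk.
  - by move=> x _; rewrite lee_fin expR_ge0.
  - by rewrite lee_fin expR_ge0.
  rewrite IH; over.
rewrite ge0_integralZr; last 4 first.
- exact: measurableT.
- apply/measurable_EFinP; apply: measurable_expR_comp.
  by apply: measurable_funM => //; exact: measurable_funX.
- by move=> x _; rewrite lee_fin expR_ge0.
- by rewrite lee_fin exprn_ge0.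
by rewrite int_gauss1 // -EFinM exprS.
Qed.

(** The working class of functions: it is stable under doubling with the same rate [a], and
    multiplication by [|x|^2] or [|x|^4] only costs half of the rate, so all the integrals of the
    main argument are finite. *)
Definition gb k (K a : R) (g : k.-tuple R -> R) : Prop :=
  [/\ 0 < a, measurable_fun setT g & forall x, 0 <= g x <= K * expR (- a * tdot x x)].

Lemma gb_ge0 k K a (g : k.-tuple R -> R) x : gb K a g -> 0 <= g x.
Proof. by case=> _ _ /(_ x) /andP[]. Qed.

Lemma gb_K0 k K a (g : k.-tuple R -> R) : gb K a g -> 0 <= K.
Proof.
case=> _ _ /(_ tzero) /andP[h1 h2]; have := le_trans h1 h2.
by rewrite pmulr_lge0 ?expR_gt0.
Qed.

Lemma gb_measurable k K a (g : k.-tuple R -> R) : gb K a g -> measurable_fun setT g.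
Proof. by case. Qed.

Lemma ge0_le_int k (f g : k.-tuple R -> R) : measurable_fun setT f -> measurable_fun setT g ->
  (forall x, 0 <= f x <= g x) ->
  (\int[@lebR R k]_x (f x)%:E <= \int[@lebR R k]_x (g x)%:E)%E.
Proof.
move=> mf mg fg; apply: ge0_le_integral => //.
- by move=> x _; rewrite lee_fin; case/andP: (fg x).
- exact/measurable_EFinP.
- exact/measurable_EFinP.
- by move=> x _; rewrite lee_fin; case/andP: (fg x).
Qed.

Lemma int_ge0 k (f : k.-tuple R -> R) : (forall x, 0 <= f x) ->
  (0 <= \int[@lebR R k]_x (f x)%:E)%E.
Proof. by move=> f0; apply: integral_ge0 => x _; rewrite lee_fin. Qed.

Lemma int_scaler k (f : k.-tuple R -> R) (c : R) : 0 <= c -> measurable_fun setT f ->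
  (forall x, 0 <= f x) ->
  (\int[@lebR R k]_x (c * f x)%:E = c%:E * \int[@lebR R k]_x (f x)%:E)%E.
Proof.
move=> c0 mf f0; under eq_integral => x _ do rewrite EFinM.
rewrite ge0_integralZl //; first exact/measurable_EFinP.
by move=> x _; rewrite lee_fin.
Qed.

Lemma gb_int_le k K a (g : k.-tuple R -> R) : gb K a g ->
  (\int[@lebR R k]_x (g x)%:E <= (K * Num.sqrt (pi / a) ^+ k)%:E)%E.
Proof.
move=> G; have [a0 mg hg] := G; have K0 := gb_K0 G.
rewrite EFinM -int_gk // -(int_scaler K0 (measurable_gk a)); last by move=> x; exact: expR_ge0.
apply: ge0_le_int => //; apply: measurable_funM => //; exact: measurable_gk.
Qed.

Lemma gb_int_fin k K a (g : k.-tuple R -> R) : gb K a g ->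
  (\int[@lebR R k]_x (g x)%:E)%E \is a fin_num.
Proof.
move=> G; rewrite ge0_fin_numE; first by apply: (le_lt_trans (gb_int_le G)); rewrite ltry.
by apply: int_ge0 => x; exact: gb_ge0 G.
Qed.

(** [fine] sends an infinite integral to 0, so identities about [Int] go through [IntE] or [integE],
    which record finiteness. *)
Definition Int k (g : k.-tuple R -> R) : R := fine (\int[@lebR R k]_x (g x)%:E)%E.

Lemma IntE k K a (g : k.-tuple R -> R) : gb K a g ->
  ((Int g)%:E = \int[@lebR R k]_x (g x)%:E)%E.
Proof. by move=> G; rewrite fineK // (gb_int_fin G). Qed.

Lemma Int_ge0 k K a (g : k.-tuple R -> R) : gb K a g -> 0 <= Int g.
Proof. by move=> G; rewrite fine_ge0 // int_ge0 // => x; exact: gb_ge0 G. Qed.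

Lemma Int_le k K a (g : k.-tuple R -> R) : gb K a g ->
  Int g <= K * Num.sqrt (pi / a) ^+ k.
Proof. by move=> G; rewrite -lee_fin (IntE G) (gb_int_le G). Qed.

Lemma expR_sqr_lb (y : R) : 0 <= y -> y ^+ 2 / 4 <= expR y.
Proof.
move=> y0; rewrite [in expR y](_ : y = y / 2 + y / 2); last by field.
rewrite expRD; have := @expR_ge1Dx R (y / 2); have := expR_ge0 (y / 2); nra.
Qed.

(** Half of the exponent absorbs the polynomial: [expR_sqr_lb] at [y = a |x|^2 / 2] reads
    [a^2 |x|^4 / 16 <= exp (a |x|^2 / 2)], whence the constant [16 / a ^+ 2]. *)
Lemma gb_moment4 k K a (g : k.-tuple R -> R) : gb K a g ->
  gb (16 / a ^+ 2 * K) (a / 2) (fun x => tdot x x ^+ 2 * g x).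
Proof.
move=> G; have [a0 mg hg] := G; have K0 := gb_K0 G; split; first by rewrite divr_gt0.
  by apply: measurable_funM => //; apply: measurable_funX; apply: measurable_tdot.
move=> x; have /andP[g0 gK] := hg x; rewrite mulr_ge0 ?sqr_ge0 //=.
have h := @expR_sqr_lb (a / 2 * tdot x x) (mulr_ge0 (divr_ge0 (ltW a0) (ler0n _ 2)) (tdot_ge0 x)).
apply: (@le_trans _ _ (16 / a ^+ 2 * expR (a / 2 * tdot x x) * (K * expR (- a * tdot x x)))).
  apply: ler_pM => //; first exact: sqr_ge0.
  rewrite -ler_pdivrMl ?divr_gt0 ?exprn_gt0 //; apply: le_trans h.
  by rewrite le_eqVlt; apply/orP; left; apply/eqP; field; rewrite gt_eqF.
rewrite (_ : - (a / 2) * _ = a / 2 * tdot x x + - a * tdot x x); last by field.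
by rewrite expRD le_eqVlt; apply/orP; left; apply/eqP; ring.
Qed.

Lemma gb_moment2 k K a (g : k.-tuple R -> R) : gb K a g ->
  gb (2 / a * K) (a / 2) (fun x => tdot x x * g x).
Proof.
move=> G; have [a0 mg hg] := G; have K0 := gb_K0 G; split; first by rewrite divr_gt0.
  by apply: measurable_funM => //; apply: measurable_tdot.
move=> x; have /andP[g0 gK] := hg x; have x0 := tdot_ge0 x; rewrite mulr_ge0 //=.
have h := @expR_ge1Dx R (a / 2 * tdot x x).
apply: (@le_trans _ _ (2 / a * expR (a / 2 * tdot x x) * (K * expR (- a * tdot x x)))).
  apply: ler_pM => //; rewrite -ler_pdivrMl ?divr_gt0 //; apply: le_trans h.
  rewrite (_ : (2 / a)^-1 = a / 2); first by rewrite lerDr.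
  by field; rewrite gt_eqF.
rewrite (_ : - (a / 2) * _ = a / 2 * tdot x x + - a * tdot x x); last by field.
by rewrite expRD le_eqVlt; apply/orP; left; apply/eqP; ring.
Qed.

Lemma gb_scale k K a (g : k.-tuple R -> R) c : 0 <= c -> gb K a g -> gb (c * K) a (fun x => c * g x).
Proof.
move=> c0 [a0 mg hg]; split => //; first exact: measurable_funM.
move=> x; have /andP[g0 gK] := hg x.
by rewrite mulr_ge0 //= -mulrA ler_wpM2l.
Qed.

Lemma Int_scale k K a (g : k.-tuple R -> R) c : 0 <= c -> gb K a g ->
  Int (fun x => c * g x) = c * Int g.
Proof.
move=> c0 G; apply: EFin_inj; rewrite (IntE (gb_scale c0 G)) EFinM (IntE G) int_scaler //.
  exact: gb_measurable G.
by move=> x; exact: gb_ge0 G.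
Qed.

End GaussKernel.

(** * The doubling map *)

Section Doubling.
Context {R : realType}.
Variable k : nat.
Implicit Types g : k.-tuple R -> R.

(* If [X], [Y] are independent with density [g], this is the density of [(X + Y) / sqrt 2]. *)
Definition dbl g (s : k.-tuple R) : R := Int (fun t => g (rotp s t) * g (rotm s t)).

(** The rate [a] is preserved because the rotation is an isometry: the exponents add up to
    [|s|^2 + |t|^2], so the bound factors into one in [s] and one in [t]. *)
Lemma gb_fibre K a g s : gb K a g ->
  gb (K ^+ 2 * expR (- a * tdot s s)) a (fun t => g (rotp s t) * g (rotm s t)).
Proof.
move=> [a0 mg hg]; split => //.
  by apply: measurable_funM; apply: (mcomp mg); [apply: measurable_rotp|apply: measurable_rotm].
move=> t; have /andP[u0 uK] := hg (rotp s t); have /andP[v0 vK] := hg (rotm s t).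
rewrite mulr_ge0 //=; apply: (le_trans (ler_pM u0 v0 uK vK)).
rewrite mulrACA -expr2 -expRD -mulrDr tdot_rot mulrDr expRD mulrA.
by [].
Qed.

Lemma gb_dbl K a g : gb K a g -> gb (K ^+ 2 * Num.sqrt (pi / a) ^+ k) a (dbl g).
Proof.
move=> G; have [a0 mg hg] := G; split => //; last first.
  move=> s; rewrite (Int_ge0 (gb_fibre s G)) /=.
  by apply: (le_trans (Int_le (gb_fibre s G))); rewrite mulrAC.
rewrite /dbl /Int; apply: (mcomp (h := @fine R)); first exact: fine_measurable.
apply: (@measurable_fun_fubini_tonelli_F _ _ _ _ R (@lebR R k)
  (fun st => (g (rotp st.1 st.2) * g (rotm st.1 st.2))%:E)).
  apply/measurable_EFinP; apply: measurable_funM; apply: (mcomp mg).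
    by apply: measurable_rotp.
  by apply: measurable_rotm.
by move=> st; rewrite lee_fin mulr_ge0 // (gb_ge0 _ G).
Qed.

(** [int_rotation] carries the product density to the coordinates [s], [t]. By [rotpK] the rotated
    sum is [s] itself, so [h] comes out of the integral in [t], and that integral is [dbl g s]. *)
Lemma int_dbl K a g (h : k.-tuple R -> \bar R) : gb K a g ->
  measurable_fun setT h -> (forall x, 0 <= h x)%E ->
  (\int[@lebR R k]_s (h s * (dbl g s)%:E) =
   \int[@lebR R k]_x (\int[@lebR R k]_y (h (rotp x y) * (g x * g y)%:E)))%E.
Proof.
move=> G mh h0; have [a0 mg hg] := G.
have g0 x : 0 <= g x by exact: gb_ge0 G.
rewrite (int_rotation (f := fun xy => (h (rotp xy.1 xy.2) * (g xy.1 * g xy.2)%:E)%E)); last 2 first.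
- apply: emeasurable_funM; first by apply: (mcomp mh); apply: measurable_rotp.
  by apply/measurable_EFinP; apply: measurable_funM; apply: (mcomp mg).
- by move=> x; rewrite mule_ge0 // lee_fin mulr_ge0.
apply: eq_integral => s _.
rewrite /dbl (IntE (gb_fibre s G)) -ge0_integralZl; last 4 first.
- exact: measurableT.
- by apply/measurable_EFinP; exact: gb_measurable (gb_fibre s G).
- by move=> x _; rewrite lee_fin mulr_ge0.
- exact: h0.
apply: eq_integral => t _ /=; rewrite -/(rotp s t) -/(rotm s t).
by rewrite rotpK.
Qed.

Lemma Int_dbl K a g : gb K a g -> Int (dbl g) = Int g ^+ 2.
Proof.
move=> G; have [a0 mg hg] := G.
apply: EFin_inj; rewrite (IntE (gb_dbl G)).
have := int_dbl (h := fun=> 1%E) G.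
under eq_integral => s _ do rewrite mul1e.
move=> ->; last 2 first.
- exact: measurable_cst.
- by move=> x.
under eq_integral => x _.
  under eq_integral => y _ do rewrite mul1e.
  rewrite int_scaler ?(gb_ge0 _ G) //; last by move=> y; exact: gb_ge0 G.
  rewrite -(IntE G) -EFinM mulrC; over.
rewrite int_scaler ?(Int_ge0 G) //; last by move=> y; exact: gb_ge0 G.
by rewrite -(IntE G) -EFinM expr2.
Qed.

Lemma dbl_even g : (forall x, g (tscale (-1) x) = g x) -> forall x, dbl g (tscale (-1) x) = dbl g x.
Proof.
move=> ge x; rewrite /dbl; congr (fine _); apply: eq_integral => t _; congr EFin.
have -> : rotp (tscale (-1) x) t = tscale (-1) (rotm x t).
  by apply: eq_from_tnth => j; rewrite !(tnthD, tnthZ); ring.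
have -> : rotm (tscale (-1) x) t = tscale (-1) (rotp x t).
  by apply: eq_from_tnth => j; rewrite !(tnthD, tnthZ); ring.
by rewrite !ge mulrC.
Qed.

Lemma fibre_even g s t : let h := (fun t => g (rotp s t) * g (rotm s t)) in
  h (tscale (-1) t) = h t.
Proof.
move=> h; rewrite /h mulrC; congr (g _ * g _); apply: eq_from_tnth => j;
  by rewrite !(tnthD, tnthZ); ring.
Qed.
End Doubling.
Arguments dbl {R k} g s.

(** * Positive definite matrices *)

Section PosDef.
Context {R : realType}.

Definition bil k (Q : 'M[R]_k) (u v : 'rV[R]_k) : R := (u *m Q *m v^T) 0 0.
Definition psd k (A : 'M[R]_k) : Prop := A^T = A /\ forall v : 'rV[R]_k, 0 <= bil A v v.
Definition nsq m k (B : 'M[R]_(m, k)) : R := \sum_i \sum_j B i j ^+ 2.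

Lemma qformE k (Q : 'M[R]_k) x : qform Q x = bil Q (trow x) (trow x).
Proof. by []. Qed.

Lemma bilDl k Q (u v w : 'rV[R]_k) : bil Q (u + v) w = bil Q u w + bil Q v w.
Proof. by rewrite /bil !mulmxDl mxE. Qed.
Lemma bilDr k Q (u v w : 'rV[R]_k) : bil Q w (u + v) = bil Q w u + bil Q w v.
Proof. by rewrite /bil raddfD /= mulmxDr mxE. Qed.
Lemma bilZl k Q a (u v : 'rV[R]_k) : bil Q (a *: u) v = a * bil Q u v.
Proof. by rewrite /bil -!scalemxAl mxE. Qed.
Lemma bilZr k Q a (u v : 'rV[R]_k) : bil Q u (a *: v) = a * bil Q u v.
Proof. by rewrite /bil linearZ /= -scalemxAr mxE. Qed.
Lemma bil_addM k (Q P : 'M[R]_k) (u v : 'rV[R]_k) : bil (Q + P) u v = bil Q u v + bil P u v.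
Proof. by rewrite /bil mulmxDr mulmxDl mxE. Qed.
Lemma bil_scaleM k a (Q : 'M[R]_k) (u v : 'rV[R]_k) : bil (a *: Q) u v = a * bil Q u v.
Proof. by rewrite /bil -scalemxAr -scalemxAl mxE. Qed.
Lemma mx11_tr (M : 'M[R]_1) : M^T 0 0 = M 0 0.
Proof. by rewrite mxE. Qed.
Lemma mx00D (M N : 'M[R]_1) : (M + N) 0 0 = M 0 0 + N 0 0.
Proof. by rewrite mxE. Qed.
Lemma bilC k (Q : 'M[R]_k) (u v : 'rV[R]_k) : Q^T = Q -> bil Q u v = bil Q v u.
Proof. by move=> hQ; rewrite /bil -mx11_tr !trmx_mul trmxK hQ mulmxA. Qed.

Lemma bil_sum k (Q : 'M[R]_k) (u v : 'rV[R]_k) :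
  bil Q u v = \sum_i \sum_j u 0 i * Q i j * v 0 j.
Proof.
rewrite /bil mxE exchange_big /=; apply: eq_bigr => j _.
by rewrite !mxE mulr_suml.
Qed.

Lemma bil_gram m k (B : 'M[R]_(m, k)) (v : 'rV[R]_k) :
  bil (B^T *m B) v v = nsq (v *m B^T).
Proof.
rewrite /bil mulmxA -mulmxA -[B *m v^T]trmxK trmx_mul trmxK mxE /nsq big_ord_recl big_ord0 addr0.
by apply: eq_bigr => j _; rewrite [in X in _ * X]mxE expr2.
Qed.

Lemma nsq_ge0 m k (B : 'M[R]_(m, k)) : 0 <= nsq B.
Proof. by apply: sumr_ge0 => i _; apply: sumr_ge0 => j _; rewrite sqr_ge0. Qed.

Lemma nsq_row k (v : 'rV[R]_k) : nsq v = \sum_j v 0 j ^+ 2.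
Proof. by rewrite /nsq big_ord_recl big_ord0 addr0. Qed.

Lemma tdot_nsq k (x : k.-tuple R) : tdot x x = nsq (trow x).
Proof. by rewrite nsq_row; apply: eq_bigr => j _; rewrite mxE expr2. Qed.

Lemma nsq_eq0 k (v : 'rV[R]_k) : (nsq v == 0) = (v == 0).
Proof.
rewrite nsq_row psumr_eq0; last by move=> j _; exact: sqr_ge0.
apply/allP/eqP => [h|-> j _]; last by rewrite mxE expr0n eqxx.
apply/rowP => j; rewrite mxE; apply/eqP; rewrite -sqrf_eq0.
exact: (h j (mem_index_enum _)).
Qed.

Lemma nsq_mulmx m k (v : 'rV[R]_m) (B : 'M[R]_(m, k)) : nsq (v *m B) <= nsq v * nsq B.
Proof.
rewrite !nsq_row /nsq exchange_big mulr_sumr /=; apply: ler_sum => j _.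
rewrite mxE; have := tdot_CS (rowt v) (rowt ((col j B)^T)).
have -> : tdot (rowt v) (rowt (col j B)^T) = \sum_i v 0 i * B i j.
  by apply: eq_bigr => i _; rewrite !tnth_mktuple !mxE.
have -> : tdot (rowt v) (rowt v) = \sum_i v 0 i ^+ 2.
  by apply: eq_bigr => i _; rewrite !tnth_mktuple expr2.
have -> // : tdot (rowt (col j B)^T) (rowt (col j B)^T) = \sum_i B i j ^+ 2.
by apply: eq_bigr => i _; rewrite !tnth_mktuple !mxE expr2.
Qed.

Lemma psd_gram m k (B : 'M[R]_(m, k)) : psd (B^T *m B).
Proof. by split; [rewrite trmx_mul trmxK | move=> v; rewrite bil_gram nsq_ge0]. Qed.

Lemma posdef_psd k (S : 'M[R]_k) : posdef S -> psd S.
Proof.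
move=> [hS h]; split => // v; have [->|v0] := eqVneq v 0; last exact: ltW (h v v0).
by rewrite /bil !mul0mx mxE.
Qed.

Lemma posdef_addr k (S A : 'M[R]_k) : posdef S -> psd A -> posdef (S + A).
Proof.
move=> [hS h] [hA hA0]; split; first by rewrite linearD /= hS hA.
move=> v v0; rewrite mulmxDr mulmxDl mxE; apply: ltr_pwDl; first exact: h.
exact: hA0.
Qed.

Lemma bil_scalar k (a : R) (v : 'rV[R]_k) : bil a%:M v v = a * nsq v.
Proof.
rewrite /bil mul_mx_scalar -scalemxAl mxE nsq_row mxE; congr (_ * _).
by apply: eq_bigr => j _; rewrite !mxE expr2.
Qed.

Lemma posdef_scalar k (a : R) : 0 < a -> posdef (a%:M : 'M[R]_k).
Proof.
move=> a0; split; first by rewrite tr_scalar_mx.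
move=> v v0; rewrite -/(bil _ _ _) bil_scalar mulr_gt0 // lt_def nsq_ge0 andbT.
by rewrite nsq_eq0.
Qed.

Lemma posdef_unit k (S : 'M[R]_k) : posdef S -> S \in unitmx.
Proof.
move=> [hS h]; rewrite -row_free_unit -kermx_eq0; apply/eqP/row_matrixP => i; rewrite row0.
apply/eqP/negPn/negP => v0; have := h _ v0.
have -> : row i (kermx S) *m S = 0 by rewrite -row_mul mulmx_ker row0.
by rewrite mul0mx mxE ltxx.
Qed.

(** Cholesky factorisation by induction on the dimension: the first row is split off and the Schur
    complement is again psd. When the corner entry vanishes, positivity forces the whole row to
    vanish. *)
Lemma psd_decomp k (A : 'M[R]_k) : psd A -> exists B : 'M[R]_k, A = B^T *m B.
Proof.
elim: k A => [|k IH] A [sA A0]; first by exists 0; apply/matrixP => -[].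
pose A' : 'M[R]_(1 + k) := A.
pose a := A' 0 0; pose u := ursubmx A'; pose A2 := drsubmx A'.
have EA : A' = block_mx a%:M u u^T A2.
  rewrite -[A']submxK; congr block_mx; last first.
    by rewrite /u trmx_ursub [A'^T]sA.
  apply/matrixP => i j; rewrite !ord1 !mxE /a /= mulr1n; congr (A' _ _); exact/val_inj.
have sA2 : A2^T = A2 by rewrite /A2 trmx_drsub [A'^T]sA.
have bE (s : R) (w : 'rV[R]_k) : 0 <= s ^+ 2 * a + 2 * s * (u *m w^T) 0 0 + bil A2 w w.
  have A0' (v : 'rV[R]_(1 + k)) : 0 <= (v *m A' *m v^T) 0 0 by exact: A0.
  have := A0' (row_mx s%:M w); rewrite EA mul_row_block.
  rewrite tr_row_mx mul_row_col tr_scalar_mx !mulmxDl !mx00D.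
  have -> : (s%:M *m a%:M *m s%:M : 'M[R]_1) 0 0 = s ^+ 2 * a.
    by rewrite -!scalar_mxM mxE mulr1n; ring.
  have -> : (w *m u^T *m s%:M : 'M[R]_1) 0 0 = s * (u *m w^T) 0 0.
    by rewrite mul_mx_scalar mxE -[w]trmxK -trmx_mul trmxK mx11_tr.
  have -> : (s%:M *m u *m w^T : 'M[R]_1) 0 0 = s * (u *m w^T) 0 0.
    by rewrite mul_scalar_mx -scalemxAl mxE.
  rewrite -/(bil A2 w w) => h; apply: (le_trans h); rewrite le_eqVlt; apply/orP; left; apply/eqP; ring.
have a0 : 0 <= a by have := bE 1 0; rewrite trmx0 mulmx0 mxE /bil !mul0mx mxE; lra.
suff [B EB] : exists B : 'M[R]_(1 + k), A' = B^T *m B by exists B.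
have [az|anz] := eqVneq a 0.
  have uz (w : 'rV[R]_k) : (u *m w^T) 0 0 = 0.
    (* With [a = 0] the form is affine in the first coordinate [s], and this value of [s] would make
       it equal to [-1]. *)
    have := bE (- ((bil A2 w w + 1) / (2 * (u *m w^T) 0 0))) w; rewrite az.
    have [//|nz] := eqVneq ((u *m w^T) 0 0) 0.
    move: nz; set Y := (u *m w^T) 0 0; set X := bil A2 w w => nz.
    rewrite (_ : _ + _ + _ = - 1); first lra.
    by field.
  have u0 : u = 0.
    apply/rowP => j; have := uz (delta_mx 0 j).
    by rewrite trmx_delta -colE !mxE.
  have [B2 EB2] : exists B : 'M[R]_k, A2 = B^T *m B.
    by apply: IH; split => // w; have := bE 0 w; rewrite expr0n /= !mul0r mulr0 mul0r !add0r.
  exists (block_mx 0 0 0 B2); rewrite EA az u0 tr_block_mx mulmx_block.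
  have z0 : (0%:M : 'M[R]_1) = 0 by apply/matrixP => i j; rewrite !mxE mul0rn.
  by rewrite !trmx0 !mul0mx !mulmx0 !addr0 add0r -EB2 z0.
have ap : 0 < a by rewrite lt_def anz a0.
have sa0 : Num.sqrt a != 0 by rewrite gt_eqF // sqrtr_gt0.
have sa2 : Num.sqrt a * Num.sqrt a = a by rewrite -expr2 sqr_sqrtr.
pose b := (Num.sqrt a)^-1 *: u.
have [B2 EB2] : exists B : 'M[R]_k, A2 - b^T *m b = B^T *m B.
  apply: IH; split.
    by rewrite linearB /= trmx_mul trmxK sA2.
  move=> w; set t := (u *m w^T) 0 0.
  have -> : bil (A2 - b^T *m b) w w = bil A2 w w - a^-1 * t ^+ 2.
    rewrite bil_addM -scaleN1r bil_scaleM bil_gram nsq_row big_ord_recl big_ord0 addr0.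
    rewrite /b linearZ /= -scalemxAr mxE -[w *m u^T]trmxK trmx_mul trmxK mx11_tr -/t.
    by rewrite exprMn exprVn sqr_sqrtr // mulN1r.
  (* The minimiser over the first coordinate; the minimum is the Schur complement at [w]. *)
  have := bE (- t / a) w; rewrite -/t.
  by rewrite (_ : _ + _ + _ = bil A2 w w - a^-1 * t ^+ 2) //; field.
exists (block_mx (Num.sqrt a)%:M b 0 B2).
rewrite EA tr_block_mx mulmx_block !trmx0 !mul0mx !mulmx0 !addr0 -EB2.
rewrite tr_scalar_mx -scalar_mxM sa2; congr block_mx.
- by rewrite mul_scalar_mx /b scalerA mulfV // scale1r.
- by rewrite mul_mx_scalar /b linearZ /= scalerA mulfV // scale1r.
- by rewrite addrC subrK.
Qed.

(** Replaces the smallest eigenvalue: in [S = L^T L] the factor is invertible, so [v] is recovered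
    from [v L^T] by a matrix of finite Hilbert-Schmidt norm. *)
Lemma posdef_lb k (S : 'M[R]_k) : posdef S ->
  exists2 l : R, 0 < l & forall v, l * nsq v <= bil S v v.
Proof.
move=> pS; have [L EL] := psd_decomp (posdef_psd pS).
have uL : L^T \in unitmx.
  by have := posdef_unit pS; rewrite EL unitmx_mul => /andP[].
pose M := invmx L^T; pose l := (nsq M + 1)^-1.
have M1 : 0 < nsq M + 1 by rewrite ltr_wpDl // nsq_ge0.
exists l; first by rewrite invr_gt0.
move=> v; rewrite EL bil_gram -{1}[v](mulmxK uL) -/M.
rewrite /l ler_pdivrMl //; apply: (le_trans (nsq_mulmx _ _)).
by rewrite mulrC ler_wpM2r ?nsq_ge0 // lerDl.
Qed.

Lemma posdef_decomp k (S : 'M[R]_k) : posdef S ->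
  exists2 l : R, 0 < l & exists B : 'M[R]_k, S = l%:M + B^T *m B.
Proof.
move=> pS; have [l l0 hl] := posdef_lb pS; exists l => //.
have [B EB] : exists B : 'M[R]_k, S - l%:M = B^T *m B.
  apply: psd_decomp; split; first by rewrite linearB /= tr_scalar_mx (proj1 pS).
  move=> v; rewrite bil_addM -scaleN1r bil_scaleM bil_scalar mulN1r subr_ge0; exact: hl.
by exists B; rewrite -EB addrC subrK.
Qed.

Lemma posdef_inv k (S : 'M[R]_k) : posdef S -> posdef (invmx S).
Proof.
move=> pS; have uS := posdef_unit pS; split; first by rewrite trmx_inv (proj1 pS).
move=> v v0; have w0 : v *m invmx S != 0.
  by apply: contra v0 => /eqP h; rewrite -[v](mulmxKV uS) h mul0mx.
have := proj2 pS _ w0; rewrite mulmxKV // trmx_mul trmx_inv (proj1 pS).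
by rewrite -mx11_tr !trmx_mul trmxK trmx_inv (proj1 pS).
Qed.

(** Sylvester's determinant identity: the products of [M] and [N] in both orders are block
    triangular. *)
Lemma det_1Dmul m k (u : 'M[R]_(k, m)) (v : 'M[R]_(m, k)) :
  \det (1%:M + u *m v) = \det (1%:M + v *m u).
Proof.
pose M : 'M[R]_(m + k) := block_mx 1%:M v (- u) 1%:M.
pose N : 'M[R]_(m + k) := block_mx 1%:M (- v) 0 1%:M.
have E1 : M *m N = block_mx 1%:M 0 (- u) (1%:M + u *m v).
  rewrite /M /N mulmx_block !mul1mx !mulmx1 !mulmx0 !addr0.
  by congr block_mx; rewrite ?addNr // mulNmx mulmxN opprK addrC.
have E2 : N *m M = block_mx (1%:M + v *m u) 0 (- u) 1%:M.
  rewrite /M /N mulmx_block !mul1mx !mulmx1 !mul0mx !add0r.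
  by congr block_mx; rewrite ?addrN // mulNmx mulmxN opprK.
have := det_mulmx M N; rewrite E1 det_lblock det1 mul1r => ->.
by have := det_mulmx N M; rewrite E2 det_lblock det1 mulr1 mulrC => <-.
Qed.

(** Matrix determinant lemma. With the Sherman-Morrison formula [invmx_rank1] it allows covariances
    to be built up one rank at a time. *)
Lemma det_rank1 k (S : 'M[R]_k) (b : 'rV[R]_k) : posdef S ->
  \det (S + b^T *m b) = \det S * (1 + bil (invmx S) b b).
Proof.
move=> pS; have uS := posdef_unit pS.
have -> : S + b^T *m b = S *m (1%:M + (invmx S *m b^T) *m b).
  by rewrite mulmxDr mulmx1 !mulmxA mulmxV // mul1mx.
by rewrite det_mulmx det_1Dmul det_mx11 [X in _ * X]mxE [X in _ * (X + _)]mxE /bil mulmxA.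
Qed.

Lemma invmx_rank1 k (S : 'M[R]_k) (b : 'rV[R]_k) : posdef S ->
  let V := invmx S in
  invmx (S + b^T *m b) = V - (1 + bil V b b)^-1 *: (V *m b^T *m b *m V).
Proof.
move=> pS V; have uS := posdef_unit pS; have pV : psd V := posdef_psd (posdef_inv pS).
set be := bil V b b; have be0 : 0 <= be by exact: (proj2 pV).
have be1 : 1 + be != 0 by rewrite gt_eqF // ltr_pwDl.
have pT := posdef_addr pS (psd_gram b); have uT := posdef_unit pT.
apply: (can_inj (mulKmx uT)); rewrite mulmxV //.
have E : b *m V *m b^T = be%:M by rewrite [LHS]mx11_scalar.
rewrite mulmxBr mulmxDl mulmxV // -scalemxAr mulmxDl !mulmxA mulmxV // mul1mx.
have -> : b^T *m b *m V *m b^T *m b *m V = be *: (b^T *m b *m V).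
  have -> : b^T *m b *m V *m b^T *m b *m V = b^T *m (b *m V *m b^T) *m b *m V by rewrite !mulmxA.
  by rewrite E mul_mx_scalar -!scalemxAl.
rewrite -[X in _ *: (X + _)]scale1r -scalerDl scalerA mulVf // scale1r.
by rewrite addrK.
Qed.

Lemma gram_split k m (B : 'M[R]_(1 + m, k)) :
  B^T *m B = (usubmx B)^T *m usubmx B + (dsubmx B)^T *m dsubmx B.
Proof. by rewrite -{1 2}[B]vsubmxK tr_col_mx mul_row_col. Qed.

(** The rows of [B] are added one at a time, each multiplying the determinant by a factor at least
    1. Applied to [posdef_decomp] this gives [posdef_det] without eigenvalues. *)
Lemma det_gram_gt0 k m (S : 'M[R]_k) (B : 'M[R]_(m, k)) : posdef S -> 0 < \det S ->
  0 < \det (S + B^T *m B).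
Proof.
elim: m B => [|m IH] B pS dS; first by rewrite (flatmx0 B) mulmx0 addr0.
pose b := usubmx (B : 'M[R]_(1 + m, k)); pose B' := dsubmx (B : 'M[R]_(1 + m, k)).
rewrite (gram_split (B : 'M[R]_(1 + m, k))) -/b -/B' (addrC (b^T *m b)) addrA det_rank1; last first.
  exact: posdef_addr (psd_gram _).
rewrite mulr_gt0 ?IH // ltr_pwDl //.
exact: (proj2 (posdef_psd (posdef_inv (posdef_addr pS (psd_gram B'))))).
Qed.

Lemma posdef_det k (S : 'M[R]_k) : posdef S -> 0 < \det S.
Proof.
move=> pS; have [l l0 [B ->]] := posdef_decomp pS.
apply: det_gram_gt0; first exact: posdef_scalar.
by rewrite det_scalar exprn_gt0.
Qed.

End PosDef.

(** * Gaussian densities and their moments *)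

Section Gauss.
Context {R : realType}.
Notation leb := (@lebesgue_measure R).
Implicit Type k m : nat.

Lemma sqrtr_exp (a : R) n : 0 <= a -> Num.sqrt (a ^+ n) = Num.sqrt a ^+ n.
Proof.
by move=> a0; elim: n => [|n IH]; rewrite ?expr0 ?sqrtr1 // !exprS sqrtrM // IH.
Qed.

Definition phi1 (z : R) : R := expR (- z ^+ 2 / 2) / Num.sqrt (2 * pi).
Definition gd1 k (z : k.-tuple R) : R := gauss_density (1%:M : 'M[R]_k) z.
Definition tmul m k (z : m.-tuple R) (B : 'M[R]_(m, k)) : k.-tuple R := rowt (trow z *m B).

Let pi2 : 0 < 2 * pi :> R. Proof. by rewrite mulr_gt0 // pi_gt0. Qed.

Lemma phi1_ge0 z : 0 <= phi1 z.
Proof. by rewrite divr_ge0 ?expR_ge0 ?sqrtr_ge0. Qed.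

Lemma gd_ge0 k (S : 'M[R]_k) x : 0 <= gauss_density S x.
Proof. by rewrite divr_ge0 ?expR_ge0 ?sqrtr_ge0. Qed.

Lemma gd_gt0 k (S : 'M[R]_k) x : posdef S -> 0 < gauss_density S x.
Proof.
move=> pS; rewrite divr_gt0 ?expR_gt0 // sqrtr_gt0 mulr_gt0 ?exprn_gt0 //.
exact: posdef_det.
Qed.

Lemma measurable_phi1 : measurable_fun setT phi1.
Proof.
apply: measurable_funM => //; apply: measurable_expR_comp; apply: measurable_funM => //.
by apply: measurable_oppr_fun || apply: measurableT_comp => //.
Qed.

Lemma measurable_gd k (S : 'M[R]_k) : measurable_fun setT (gauss_density S).
Proof.
apply: measurable_funM => //; apply: measurable_expR_comp; apply: measurable_funM => //.
apply: measurableT_comp => //; exact: (measurable_qform _ (f := id)).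
Qed.

Lemma gd_scalar k (a : R) (x : k.-tuple R) : 0 < a ->
  gauss_density (a%:M) x = expR (- (2 * a)^-1 * tdot x x) / Num.sqrt (2 * pi * a) ^+ k.
Proof.
move=> a0; rewrite /gauss_density invmx_scalar qformE bil_scalar -tdot_nsq det_scalar -exprMn.
rewrite sqrtr_exp; last by rewrite ltW // mulr_gt0.
by congr (expR _ / _); field; rewrite gt_eqF.
Qed.

Lemma int_gd_scalar k (a : R) : 0 < a ->
  (\int[@lebR R k]_x (gauss_density a%:M x)%:E = 1)%E.
Proof.
move=> a0; have s0 : 0 < Num.sqrt (2 * pi * a) by rewrite sqrtr_gt0 mulr_gt0.
under eq_integral => x _ do rewrite gd_scalar // mulrC.
rewrite int_scaler; last 3 first.
- by rewrite invr_ge0 exprn_ge0 // sqrtr_ge0.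
- exact: measurable_gk.
- by move=> x; exact: expR_ge0.
have i0 : 0 < (2 * a)^-1 by rewrite invr_gt0 mulr_gt0.
rewrite int_gk // invrK -EFinM; congr EFin.
by rewrite (_ : pi * _ = 2 * pi * a) ?mulVf ?expf_eq0 ?gt_eqF ?andbF //; ring.
Qed.

Lemma gd1E k (z : k.-tuple R) : gd1 z = expR (- (tdot z z) / 2) / Num.sqrt (2 * pi) ^+ k.
Proof. by rewrite /gd1 gd_scalar // !mulr1; congr (expR _ / _); field. Qed.

Lemma gd1_consp k a (t : k.-tuple R) : gd1 (consp (a, t)) = phi1 a * gd1 t.
Proof.
rewrite !gd1E /phi1 tdot_consp exprS invfM mulrACA -expRD; congr (expR _ * _); rewrite expr2; by field.
Qed.

Lemma int_gd1 k : (\int[@lebR R k]_x (gd1 x)%:E = 1)%E.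
Proof. exact: int_gd_scalar. Qed.

Lemma int_phi1 : (\int[leb]_z (phi1 z)%:E = 1)%E.
Proof.
under eq_integral => z _ do rewrite /phi1 EFinM.
rewrite ge0_integralZr; last 4 first.
- exact: measurableT.
- apply/measurable_EFinP; apply: measurable_expR_comp; apply: measurable_funM => //.
  by apply: measurableT_comp => //.
- by move=> x _; rewrite lee_fin expR_ge0.
- by rewrite lee_fin invr_ge0 sqrtr_ge0.
under eq_integral => z _.
  rewrite (_ : - z ^+ 2 / 2 = - (2^-1) * z ^+ 2); last by field.
  over.
rewrite int_gauss1 ?invr_gt0 // invrK -EFinM (mulrC pi) mulfV // gt_eqF //.
by rewrite sqrtr_gt0.
Qed.

(** A covariance grows by [b^T b] when an independent [z b], with [z] standard on the line, is
    added. The proof completes the square in [z]; the rank one formulas identify the exponent and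
    the constant that are left. *)
Lemma gd_rank1 k (S : 'M[R]_k) (b : 'rV[R]_k) x : posdef S ->
  ((gauss_density (S + b^T *m b) x)%:E =
  \int[leb]_z (phi1 z * gauss_density S (tadd x (tscale (- z) (rowt b))))%:E)%E.
Proof.
move=> pS; set V := invmx S; set be := bil V b b; set et := bil V (trow x) b.
have sV : V^T = V by exact: (proj1 (posdef_inv pS)).
have be0 : 0 <= be by exact: (proj2 (posdef_psd (posdef_inv pS))).
have be1 : 0 < 1 + be by rewrite ltr_pwDl.
set q := qform V x; set N := Num.sqrt ((2 * pi) ^+ k * \det S).
have dS := posdef_det pS.
have E z : phi1 z * gauss_density S (tadd x (tscale (- z) (rowt b))) =
   expR (- q / 2) / (Num.sqrt (2 * pi) * N) * expR (- ((1 + be) / 2) * z ^+ 2 + 2 * (et / 2) * z).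
  rewrite /phi1 /gauss_density -/V -/N qformE trowD trowZ rowtK !(bilDl, bilDr, bilZl, bilZr).
  rewrite (bilC b (trow x) sV) -/et -/be -qformE -/q invfM.
  rewrite mulrACA -expRD [RHS]mulrAC -expRD; congr (expR _ * _); by field.
under eq_integral => z _ do rewrite E EFinM.
rewrite ge0_integralZl; last 4 first.
- exact: measurableT.
- apply/measurable_EFinP; apply: measurable_expR_comp; apply: measurable_funD;
    apply: measurable_funM => //; exact: measurable_funX.
- by move=> z _; rewrite lee_fin expR_ge0.
- by rewrite lee_fin divr_ge0 ?expR_ge0 // mulr_ge0 ?sqrtr_ge0.
rewrite int_gauss1_lin ?divr_gt0 // -EFinM; congr EFin.
rewrite /gauss_density invmx_rank1 // -/V -/be.
have -> : qform (V - (1 + be)^-1 *: (V *m b^T *m b *m V)) x = q - et ^+ 2 / (1 + be).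
  rewrite qformE bil_addM -scaleN1r !bil_scaleM -qformE -/q mulN1r; congr (_ - _).
  rewrite mulrC; congr (_ / _); rewrite /bil !mulmxA.
  have -> : trow x *m V *m b^T = et%:M by rewrite [LHS]mx11_scalar.
  rewrite mul_scalar_mx -!scalemxAl mxE expr2; congr (_ * _).
  rewrite -mx11_tr !trmx_mul trmxK sV mulmxA; by [].
rewrite det_rank1 // -/be -/V mulrA sqrtrM; last by rewrite mulr_ge0 ?exprn_ge0 ?ltW.
rewrite -/N (_ : pi / ((1 + be) / 2) = 2 * pi / (1 + be)); last by field; rewrite gt_eqF.
have -> : Num.sqrt (2 * pi / (1 + be)) = Num.sqrt (2 * pi) / Num.sqrt (1 + be).
  by rewrite sqrtrM ?(ltW pi2) // sqrtrV // ltW.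
rewrite (_ : - (q - et ^+ 2 / (1 + be)) / 2 = - q / 2 + (et / 2) ^+ 2 / ((1 + be) / 2)); last first.
  by field; rewrite gt_eqF.
have N0 : N != 0 by rewrite gt_eqF // sqrtr_gt0 mulr_gt0 // exprn_gt0.
have s1 : Num.sqrt (1 + be) != 0 by rewrite gt_eqF // sqrtr_gt0.
have s2 : Num.sqrt (2 * pi) != 0 :> R by rewrite gt_eqF // sqrtr_gt0.
rewrite expRD; field; by rewrite N0 s1 s2.
Qed.

Lemma tmul_consp m k a (t : m.-tuple R) (B : 'M[R]_(1 + m, k)) :
  tmul (consp (a, t)) (B : 'M[R]_(m.+1, k)) =
  tadd (tscale a (rowt (usubmx B))) (tmul t (dsubmx B)).
Proof.
apply: trow_inj; rewrite trowD trowZ !rowtK.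
have -> : trow (consp (a, t)) = row_mx a%:M (trow t) :> 'rV_(1 + m).
  apply/rowP => j; rewrite -[j]splitK; case: (fintype.split j) => i /=.
    rewrite row_mxEl !mxE (ord1 i) /= mulr1n.
    by [].
  by rewrite row_mxEr !mxE !(tnth_nth 0).
transitivity (row_mx a%:M (trow t) *m col_mx (usubmx B) (dsubmx B)); first by rewrite vsubmxK.
by rewrite mul_row_col mul_scalar_mx.
Qed.

Lemma measurable_tmul m k (B : 'M[R]_(m, k)) d (T : measurableType d) (f : T -> m.-tuple R) :
  measurable_fun setT f -> measurable_fun setT (fun t => tmul (f t) B).
Proof.
move=> /measurable_fun_tnthP mf; apply/measurable_fun_tnthP => j.
rewrite [X in measurable_fun _ X](_ : _ = (fun t => \sum_i tnth (f t) i * B i j)); last first.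
  apply/funext => t /=; rewrite tnth_mktuple mxE; apply: eq_bigr => i _; by rewrite mxE.
by apply: measurable_sum => i; apply: measurable_funM => //; exact: mf.
Qed.

(* [N(0, S + B^T B)] is the law of [X + Z B] with [X ~ N(0, S)] and [Z] standard; together with
   [posdef_decomp] this reduces Gaussian integrals to scalar covariances. *)
Lemma gd_gram m k (S : 'M[R]_k) (B : 'M[R]_(m, k)) x : posdef S ->
  ((gauss_density (S + B^T *m B) x)%:E =
  \int[@lebR R m]_z (gd1 z * gauss_density S (tadd x (tscale (-1) (tmul z B))))%:E)%E.
Proof.
elim: m B x => [|m IH] B x pS.
  rewrite int_lebR0 (flatmx0 B) mulmx0 addr0 gd1E tdot_tuple0 oppr0 mul0r expR0 expr0 divr1 mul1r.
  congr (gauss_density _ _)%:E; apply: trow_inj; rewrite trowD trowZ rowtK mulmx0 scaler0 addr0.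
  by [].
pose b := usubmx (B : 'M[R]_(1 + m, k)); pose B' := dsubmx (B : 'M[R]_(1 + m, k)).
have mz : measurable_fun setT (fun z : m.+1.-tuple R => (gd1 z * gauss_density S (tadd x (tscale (-1) (tmul z B))))%:E).
  apply/measurable_EFinP; apply: measurable_funM; first exact: measurable_gd.
  apply: (mcomp (measurable_gd S)); apply: measurable_tadd => //; apply: measurable_tscale => //.
  exact: measurable_tmul.
rewrite (int_lebRS mz); last by move=> z; rewrite lee_fin mulr_ge0 ?gd_ge0.
rewrite (gram_split (B : 'M[R]_(1 + m, k))) -/b -/B' (addrC (b^T *m b)) addrA gd_rank1; last first.
  exact: posdef_addr (psd_gram _).
apply: eq_integral => z0 _; rewrite EFinM (IH B' (tadd x (tscale (- z0) (rowt b))) pS).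
rewrite -int_scaler; last 3 first.
- exact: phi1_ge0.
- apply: measurable_funM; first exact: measurable_gd.
  apply: (mcomp (measurable_gd S)); apply: measurable_tadd => //; apply: measurable_tscale => //.
  exact: (measurable_tmul _ (f := id)).
- by move=> z; rewrite mulr_ge0 ?gd_ge0.
apply: eq_integral => t _; rewrite gd1_consp mulrA; congr (_ * gauss_density _ _)%:E.
rewrite tmul_consp -/b -/B'; apply: trow_inj; rewrite !(trowD, trowZ, rowtK).
by rewrite scalerDr scalerA mulN1r addrA.
Qed.

Lemma int_gd_gram m k (S : 'M[R]_k) (B : 'M[R]_(m, k)) (h : k.-tuple R -> R) : posdef S ->
  measurable_fun setT h -> (forall x, 0 <= h x) ->
  (\int[@lebR R k]_x (h x * gauss_density (S + B^T *m B) x)%:E =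
   \int[@lebR R m]_z \int[@lebR R k]_x (h (tadd x (tmul z B)) * gauss_density S x * gd1 z)%:E)%E.
Proof.
move=> pS mh h0.
have mj : measurable_fun setT (fun xz : k.-tuple R * m.-tuple R =>
    (h xz.1 * gauss_density S (tadd xz.1 (tscale (-1) (tmul xz.2 B))) * gd1 xz.2)%:E).
  apply/measurable_EFinP; apply: measurable_funM; last first.
    by apply: (mcomp (h := @gd1 m)); first exact: measurable_gd.
  apply: measurable_funM; first exact: mcomp.
  apply: (mcomp (measurable_gd S)); apply: measurable_tadd => //; apply: measurable_tscale => //.
  exact: measurable_tmul.
transitivity (\int[@lebR R k]_x \int[@lebR R m]_z
    (h x * gauss_density S (tadd x (tscale (-1) (tmul z B))) * gd1 z)%:E)%E.
  apply: eq_integral => x _; rewrite EFinM gd_gram // -ge0_integralZl; last 4 first.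
  - exact: measurableT.
  - apply/measurable_EFinP; apply: measurable_funM; first exact: measurable_gd.
    apply: (mcomp (measurable_gd S)); apply: measurable_tadd => //; apply: measurable_tscale => //.
    exact: (measurable_tmul _ (f := id)).
  - by move=> z _; rewrite lee_fin mulr_ge0 ?gd_ge0.
  - by rewrite lee_fin.
  by apply: eq_integral => z _; rewrite -EFinM -mulrA (mulrC (gd1 z)).
rewrite (fubini_tonelli _ mj); last by move=> xz; rewrite lee_fin !mulr_ge0 ?gd_ge0.
apply: eq_integral => z _ /=.
have m1 : measurable_fun setT (fun x => (h x * gauss_density S (tadd x (tscale (-1) (tmul z B))) * gd1 z)%:E).
  by apply: (mcomp mj (f := fun x => (x, z))); exact: mpair.
rewrite -(int_lebR_shift (tmul z B) m1); last by move=> x; rewrite lee_fin !mulr_ge0 ?gd_ge0.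
apply: eq_integral => x _; congr (_ * gauss_density _ _ * _)%:E; apply: trow_inj.
by rewrite !(trowD, trowZ) scaleN1r addrK.
Qed.

Lemma int_gd k (S : 'M[R]_k) : posdef S -> (\int[@lebR R k]_x (gauss_density S x)%:E = 1)%E.
Proof.
move=> pS; have [l l0 [B ->]] := posdef_decomp pS.
under eq_integral => x _ do rewrite -[gauss_density _ _]mul1r.
rewrite (int_gd_gram B (h := fun=> 1)) //; last exact: posdef_scalar.
rewrite -(int_gd1 k); apply: eq_integral => z _.
under eq_integral => x _ do rewrite mul1r mulrC.
rewrite int_scaler ?gd_ge0 //; last exact: gd_ge0.
  by rewrite int_gd_scalar // mule1.
exact: measurable_gd.
Qed.

End Gauss.

Ltac pos := repeat (first [ done | exact: gd_ge0 | exact: tdot_ge0 | exact: nsq_ge0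
  | exact: expR_ge0 | exact: sqr_ge0 | exact: sqrtr_ge0 | apply: mulr_ge0
  | apply: addr_ge0 | apply: exprn_ge0 | apply: divr_ge0 | exact: ltW]).

(** * Second and fourth moments of Gaussians *)

Section Moments.
Context {R : realType}.
Notation leb := (@lebesgue_measure R).
Implicit Type k m : nat.

Lemma ge0_int_add k (f g : k.-tuple R -> R) : measurable_fun setT f -> measurable_fun setT g ->
  (forall x, 0 <= f x) -> (forall x, 0 <= g x) ->
  (\int[@lebR R k]_x (f x + g x)%:E = \int[@lebR R k]_x (f x)%:E + \int[@lebR R k]_x (g x)%:E)%E.
Proof.
move=> mf mg f0 g0; under eq_integral => x _ do rewrite EFinD.
rewrite ge0_integralD; last 5 first.
- exact: measurableT.
- by move=> x _; rewrite lee_fin.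
- exact/measurable_EFinP.
- by move=> x _; rewrite lee_fin.
- exact/measurable_EFinP.
by [].
Qed.

(** Used wherever an odd term has to drop out: the symmetrised integrand loses it pointwise, and
    only nonnegative functions are integrated. *)
Lemma int_even k (f : k.-tuple R -> R) : measurable_fun setT f -> (forall x, 0 <= f x) ->
  (\int[@lebR R k]_x (f x)%:E = \int[@lebR R k]_x ((f x + f (tscale (-1) x)) / 2)%:E)%E.
Proof.
move=> mf f0; have mf' : measurable_fun setT (fun x => f (tscale (-1) x)).
  by apply: (mcomp mf); apply: measurable_tscale.
have mE : measurable_fun setT (fun x => (f x)%:E) by exact/measurable_EFinP.
under [RHS]eq_integral => x _ do rewrite mulrC.
rewrite int_scaler ?ge0_int_add //; last 2 first.
- exact: measurable_funD.
- by move=> x; rewrite addr_ge0.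
rewrite (int_lebR_opp (f := fun x => (f x)%:E)) //; set I := (\int[_]_x _)%E.
have I0 : (0 <= I)%E by apply: int_ge0.
by case: I I0 => [r| |] //= _; [rewrite -EFinD -EFinM; congr EFin; field|rewrite gt0_muley // lte_fin invr_gt0].
Qed.

Lemma int_gd_scale k (a : R) (h : k.-tuple R -> R) : 0 < a -> measurable_fun setT h ->
  (forall x, 0 <= h x) ->
  (\int[@lebR R k]_x (h x * gauss_density a%:M x)%:E =
   \int[@lebR R k]_z (h (tscale (Num.sqrt a) z) * gd1 z)%:E)%E.
Proof.
move=> a0 mh h0; have sa : 0 < Num.sqrt a by rewrite sqrtr_gt0.
pose F x := (h x * gauss_density (a%:M : 'M[R]_k) x)%:E.
have mF : measurable_fun setT F.
  by apply/measurable_EFinP; apply: measurable_funM => //; exact: measurable_gd.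
have F0 x : (0 <= F x)%E by rewrite lee_fin mulr_ge0 ?gd_ge0.
have c0 : 0 < `|Num.sqrt a| ^+ k by rewrite exprn_gt0 // normr_gt0 gt_eqF.
have := int_lebR_scale (negbT (gt_eqF sa)) mF F0.
move/(congr1 (fun y => ((`|Num.sqrt a| ^+ k)%:E * y)%E)).
have K y : ((`|Num.sqrt a| ^+ k)%:E * ((`|Num.sqrt a| ^- k)%:E * y) = y)%E.
  by rewrite muleA -EFinM mulfV ?mul1e // gt_eqF.
rewrite K => KE; transitivity (\int[@lebR R k]_x F x)%E; first by [].
rewrite -KE.
have E z : F (tscale (Num.sqrt a) z) = (`|Num.sqrt a| ^- k * (h (tscale (Num.sqrt a) z) * gd1 z))%:E.
  rewrite /F gd_scalar // gd1E; congr EFin.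
  have -> : tdot (tscale (Num.sqrt a) z) (tscale (Num.sqrt a) z) = a * tdot z z.
    by rewrite tdotZl tdotZr mulrA -expr2 sqr_sqrtr ?ltW.
  rewrite gtr0_norm //.
  rewrite sqrtrM ?exprMn; last by rewrite mulr_ge0 // pi_ge0.
  have s2 : Num.sqrt (2 * pi) ^+ k != 0 :> R.
    by rewrite expf_neq0 // gt_eqF // sqrtr_gt0 mulr_gt0 // pi_gt0.
  have s3 : Num.sqrt a ^+ k != 0 by rewrite expf_neq0 // gt_eqF.
  have -> : - (2 * a)^-1 * (a * tdot z z) = - tdot z z / 2 by field; rewrite gt_eqF.
  by field; rewrite s2 s3.
under [in RHS]eq_integral => z _ do rewrite -[h _ * _]mul1r -(mulfV (lt0r_neq0 c0)) -mulrA.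
rewrite int_scaler; last 3 first.
- exact: ltW.
- apply: measurable_funM => //; apply: measurable_funM; last exact: measurable_gd.
  by apply: (mcomp mh); apply: measurable_tscale.
- move=> z; apply: mulr_ge0; last by rewrite mulr_ge0 ?gd_ge0.
  by rewrite invr_ge0 ltW.
by congr (_ * _)%E; apply: eq_integral => z _; rewrite E.
Qed.

(* [1 + x <= exp x] squeezes the second moment between difference quotients of the explicit integrals
   of [exp (- (1 + e) z^2 / 2)] at [e = 0]. *)
Lemma phi1_secmom : (\int[leb]_z (phi1 z * z ^+ 2)%:E = 1)%E.
Proof.
have s0 : 0 < Num.sqrt (2 * pi) :> R by rewrite sqrtr_gt0 mulr_gt0 // pi_gt0.
have mq a : measurable_fun setT (fun z : R => expR (- a * z ^+ 2)).
  by apply: measurable_expR_comp; apply: measurable_funM => //; exact: measurable_funX.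
have m2 : measurable_fun setT (fun z : R => phi1 z * z ^+ 2).
  by apply: measurable_funM; [exact: measurable_phi1|exact: measurable_funX].
set M := (\int[_]_z _)%E.
have M0 : (0 <= M)%E by apply: integral_ge0 => z _; rewrite lee_fin mulr_ge0 ?phi1_ge0 ?sqr_ge0.
pose N := (Num.sqrt (2 * pi))^-1 : R.
have N0 : 0 <= N by rewrite invr_ge0 ltW.
have p1E z : phi1 z = N * expR (- (2^-1) * z ^+ 2).
  by rewrite /phi1 mulrC; congr (_ * expR _); by field.
have I e : -1 < e ->
   (\int[leb]_z (N * expR (- ((1 + e) / 2) * z ^+ 2))%:E = ((Num.sqrt (1 + e))^-1)%:E)%E.
  move=> e1; have e2 : 0 < 1 + e by lra.
  under eq_integral => z _ do rewrite EFinM.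
  rewrite ge0_integralZl; last 4 first.
  - exact: measurableT.
  - by apply/measurable_EFinP; exact: mq.
  - by move=> z _; rewrite lee_fin expR_ge0.
  - by rewrite lee_fin.
  rewrite int_gauss1 ?divr_gt0 // -EFinM; congr EFin.
  rewrite (_ : pi / ((1 + e) / 2) = 2 * pi / (1 + e)); last by field; rewrite gt_eqF.
  have p0 : 0 <= 2 * pi :> R by rewrite mulr_ge0 // pi_ge0.
  rewrite [Num.sqrt (_ / _)]sqrtrM // sqrtrV ?ltW // mulrA mulVf ?mul1r //.
  by rewrite gt_eqF.
have mphi := @measurable_phi1 R.
have HD c : 0 <= c -> (\int[leb]_z (phi1 z + c * (phi1 z * z ^+ 2))%:E = 1 + c%:E * M)%E.
  move=> c0; under eq_integral => z _ do rewrite EFinD.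
  rewrite ge0_integralD; last 5 first.
  - exact: measurableT.
  - by move=> z _; rewrite lee_fin phi1_ge0.
  - exact/measurable_EFinP.
  - by move=> z _; rewrite lee_fin mulr_ge0 // mulr_ge0 ?phi1_ge0 ?sqr_ge0.
  - by apply/measurable_EFinP; exact: measurable_funM.
  rewrite int_phi1; under eq_integral => z _ do rewrite EFinM.
  rewrite ge0_integralZl; last 4 first.
  - exact: measurableT.
  - exact/measurable_EFinP.
  - by move=> z _; rewrite lee_fin mulr_ge0 ?phi1_ge0 ?sqr_ge0.
  - by rewrite lee_fin.
  by [].
have lower f : 0 < f < 1 -> (1 + (f / 2)%:E * M <= ((Num.sqrt (1 - f))^-1)%:E)%E.
  move=> /andP[f0 f1]; rewrite -I; last lra.
  rewrite -HD; last by rewrite divr_ge0 // ltW.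
  apply: ge0_le_integral => //.
  - by move=> z _; rewrite lee_fin addr_ge0 ?phi1_ge0 // mulr_ge0 ?divr_ge0 ?(ltW f0) // mulr_ge0 ?phi1_ge0 ?sqr_ge0.
  - by apply/measurable_EFinP; apply: measurable_funD => //; exact: measurable_funM.
  - by apply/measurable_EFinP; apply: measurable_funM => //; exact: mq.
  move=> z _; rewrite lee_fin p1E.
  have -> : - ((1 - f) / 2) * z ^+ 2 = - (2^-1) * z ^+ 2 + f / 2 * z ^+ 2 by field.
  rewrite expRD; have h := @expR_ge1Dx R (f / 2 * z ^+ 2).
  set E := expR (- (2^-1) * z ^+ 2) in h *.
  have E0 : 0 <= E by exact: expR_ge0.
  rewrite (_ : _ + _ = N * (E * (1 + f / 2 * z ^+ 2))); last by ring.
  by rewrite ler_wpM2l // ler_wpM2l.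
have upper e : 0 < e -> (1 <= ((Num.sqrt (1 + e))^-1)%:E + (e / 2)%:E * M)%E.
  move=> e0; rewrite -I; last lra.
  rewrite -int_phi1 -[((e / 2)%:E * M)%E]ge0_integralZl; last 4 first.
  - exact: measurableT.
  - exact/measurable_EFinP.
  - by move=> z _; rewrite lee_fin mulr_ge0 ?phi1_ge0 ?sqr_ge0.
  - by rewrite lee_fin divr_ge0 // ltW.
  rewrite -ge0_integralD; last 5 first.
  - exact: measurableT.
  - by move=> z _; rewrite lee_fin mulr_ge0 ?expR_ge0.
  - by apply/measurable_EFinP; apply: measurable_funM => //; exact: mq.
  - by move=> z _; rewrite lee_fin mulr_ge0 ?divr_ge0 ?(ltW e0) // mulr_ge0 ?phi1_ge0 ?sqr_ge0.
  - by apply/measurable_EFinP; exact: measurable_funM.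
  apply: ge0_le_integral => //.
  - by move=> z _; rewrite lee_fin phi1_ge0.
  - by apply/measurable_EFinP.
  - apply/measurable_EFinP; apply: measurable_funD; last exact: measurable_funM.
    by apply: measurable_funM => //; exact: mq.
  move=> z _; rewrite lee_fin p1E.
  have -> : - ((1 + e) / 2) * z ^+ 2 = - (2^-1) * z ^+ 2 + - (e / 2 * z ^+ 2) by field.
  rewrite expRD; have h := @expR_ge1Dx R (- (e / 2 * z ^+ 2)).
  set E := expR (- (2^-1) * z ^+ 2) in h *.
  have E0 : 0 <= E by exact: expR_ge0.
  rewrite -[leLHS]mulr1 (_ : _ + _ = N * E * (expR (- (e / 2 * z ^+ 2)) + e / 2 * z ^+ 2)); last by ring.
  by rewrite ler_wpM2l // ?mulr_ge0 //; lra.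
have sqV (y s : R) : 0 < s -> 0 <= y -> y <= (Num.sqrt s)^-1 -> y ^+ 2 * s <= 1.
  move=> s1 y0; rewrite -ler_pdivlMr // div1r => h.
  have : y ^+ 2 <= (Num.sqrt s)^-1 ^+ 2 by rewrite lerXn2r // nnegrE invr_ge0 sqrtr_ge0.
  by rewrite exprVn sqr_sqrtr // ltW.
have sqV' (y s : R) : 0 < s -> 0 <= y -> y <= (Num.sqrt s)^-1 -> y * y * s <= 1.
  by move=> *; rewrite -expr2; exact: sqV.
move: M0 lower upper; clear HD; clearbody M; case: M => [mm| |] // M0 lower upper; last first.
  have h1 : (0 : R) < 2^-1 by rewrite invr_gt0.
  have h2 : (2^-1 : R) < 1 by lra.
  by have := lower 2^-1; rewrite h1 h2 => /(_ isT); rewrite gt0_muley ?lte_fin ?divr_gt0 ?invr_gt0 // addey // leye_eq.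
congr EFin; rewrite lee_fin in M0; case: (ltrgtP mm 1) => // h; exfalso.
(* With this [e] the product [(1 - e mm) (1 + e)] exceeds 1 by [e (1 - mm) (1 - mm / 2) > 0],
   against the squared form of [upper]. *)
- pose e := (1 - mm) / 2; have e0 : 0 < e by rewrite /e; lra.
  have := upper e e0; rewrite -EFinM -EFinD lee_fin => H.
  have e1 : 0 < 1 + e by lra.
  have y0 : 0 <= 1 - e / 2 * mm by rewrite /e; nra.
  have y1 : 1 - e / 2 * mm <= (Num.sqrt (1 + e))^-1 by lra.
  have := sqV' _ _ e1 y0 y1.
  have -> : (1 - e / 2 * mm) * (1 - e / 2 * mm) = 1 - e * mm + (e * mm / 2) ^+ 2 by field.
  move=> H1; have H2 : (1 - e * mm) * (1 + e) <= 1.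
    by have := mulr_ge0 (sqr_ge0 (e * mm / 2)) (ltW e1); lra.
  have : 0 < e * ((1 - mm) * (1 - mm / 2)) by rewrite !mulr_gt0 //; lra.
  rewrite (_ : e * _ = (1 - e * mm) * (1 + e) - 1); first lra.
  by rewrite /e; field.
(* This [f] lies below 1 and satisfies [f * mm = (mm - 1) / 2]; with it the squared form of [lower]
   fails for [mm > 1]. *)
- pose f := (mm - 1) / (2 * mm); have mm0 : 0 < mm by lra.
  have fm : f * mm = (mm - 1) / 2 by rewrite /f; field; rewrite gt_eqF.
  have f0 : 0 < f by rewrite /f divr_gt0 //; lra.
  have f1 : f < 1 by nra.
  have ff : 0 < f < 1 by rewrite f0.
  have := lower f ff; rewrite -EFinM -EFinD lee_fin => H.
  have e1 : 0 < 1 - f by lra.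
  have y0 : 0 <= 1 + f / 2 * mm by nra.
  have := sqV' _ _ e1 y0 H.
  have -> : f / 2 * mm = (mm - 1) / 4 by rewrite mulrAC fm; field.
  nra.
Qed.

Lemma gd1_secmom k (v : k.-tuple R) :
  (\int[@lebR R k]_z (tdot v z ^+ 2 * gd1 z)%:E = (tdot v v)%:E)%E.
Proof.
elim: k v => [|k IH] v; first by rewrite int_lebR0 !tdot_tuple0 expr0n mul0r.
have mz : measurable_fun setT (fun z : k.+1.-tuple R => (tdot v z ^+ 2 * gd1 z)%:E).
  apply/measurable_EFinP; apply: measurable_funM; last exact: measurable_gd.
  by apply: measurable_funX; apply: measurable_tdot.
rewrite (int_lebRS mz); last by move=> z; rewrite lee_fin mulr_ge0 ?gd_ge0 ?sqr_ge0.
rewrite [v]consp_surj; set a := thead v; set w := [tuple of behead v].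
have mw (b : R) : measurable_fun setT (fun z : k.-tuple R => (b + tdot w z) ^+ 2 * gd1 z).
  apply: measurable_funM; last exact: measurable_gd.
  by apply: measurable_funX; apply: measurable_funD => //; apply: measurable_tdot.
have mw0 : measurable_fun setT (fun z : k.-tuple R => tdot w z ^+ 2 * gd1 z).
  apply: measurable_funM; last exact: measurable_gd.
  by apply: measurable_funX; apply: measurable_tdot.
(* Symmetrising in [z] removes the cross term and leaves the induction hypothesis for [w]. *)
have E b : (\int[@lebR R k]_z ((b + tdot w z) ^+ 2 * gd1 z)%:E = (b ^+ 2 + tdot w w)%:E)%E.
  rewrite int_even //; last by move=> z; rewrite mulr_ge0 ?sqr_ge0 ?gd_ge0.
  have gdN z : gd1 (tscale (-1) z) = gd1 z :> R.
    by rewrite !gd1E tdotZl tdotZr mulrA mulrNN !mul1r.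
  under eq_integral => z _.
    rewrite gdN tdotZr (_ : _ / 2 = b ^+ 2 * gd1 z + tdot w z ^+ 2 * gd1 z); last by field.
    over.
  rewrite ge0_int_add; last 4 first.
  - by apply: measurable_funM => //; exact: measurable_gd.
  - exact: mw0.
  - by move=> z; rewrite mulr_ge0 ?sqr_ge0 ?gd_ge0.
  - by move=> z; rewrite mulr_ge0 ?sqr_ge0 ?gd_ge0.
  rewrite IH int_scaler ?sqr_ge0 //; last 2 first.
  - exact: measurable_gd.
  - by move=> z; exact: gd_ge0.
  by rewrite int_gd1 mule1.
under eq_integral => b _.
  under eq_integral => t _ do rewrite tdot_consp gd1_consp mulrCA.
  rewrite int_scaler ?phi1_ge0 //; last by move=> z; rewrite mulr_ge0 ?sqr_ge0 ?gd_ge0.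
  rewrite E -EFinM (_ : phi1 b * ((a * b) ^+ 2 + tdot w w) = a ^+ 2 * (phi1 b * b ^+ 2) + tdot w w * phi1 b); last by ring.
  rewrite EFinD (EFinM (a ^+ 2) (phi1 b * b ^+ 2)) (EFinM (tdot w w) (phi1 b)).
  over.
have mp2 : measurable_fun setT (fun z : R => phi1 z * z ^+ 2).
  by apply: measurable_funM; [exact: measurable_phi1|exact: measurable_funX].
rewrite ge0_integralD; last 5 first.
- exact: measurableT.
- by move=> z _; rewrite -EFinM lee_fin mulr_ge0 ?sqr_ge0 // mulr_ge0 ?phi1_ge0 ?sqr_ge0.
- by apply/measurable_EFinP; apply: measurable_funM.
- by move=> z _; rewrite -EFinM lee_fin mulr_ge0 ?tdot_ge0 ?phi1_ge0.
- by apply/measurable_EFinP; apply: measurable_funM => //; exact: measurable_phi1.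
rewrite ge0_integralZl; last 4 first.
- exact: measurableT.
- exact/measurable_EFinP.
- by move=> z _; rewrite lee_fin mulr_ge0 ?phi1_ge0 ?sqr_ge0.
- by rewrite lee_fin sqr_ge0.
rewrite ge0_integralZl; last 4 first.
- exact: measurableT.
- by apply/measurable_EFinP; exact: measurable_phi1.
- by move=> z _; rewrite lee_fin phi1_ge0.
- by rewrite lee_fin tdot_ge0.
by rewrite phi1_secmom int_phi1 !mule1 -EFinD tdot_consp expr2.
Qed.

Lemma gd_scalar_secmom k (a : R) (v : k.-tuple R) : 0 < a ->
  (\int[@lebR R k]_x (tdot v x ^+ 2 * gauss_density a%:M x)%:E = (a * tdot v v)%:E)%E.
Proof.
move=> a0; rewrite (int_gd_scale (h := fun x => tdot v x ^+ 2)) //; last 2 first.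
- by apply: measurable_funX; apply: measurable_tdot.
- by move=> x; exact: sqr_ge0.
under eq_integral => z _ do rewrite tdotZr exprMn sqr_sqrtr ?ltW // -mulrA.
rewrite int_scaler ?ltW //; last 2 first.
- by apply: measurable_funM; [apply: measurable_funX; apply: measurable_tdot|exact: measurable_gd].
- by move=> z; rewrite mulr_ge0 ?sqr_ge0 ?gd_ge0.
by rewrite gd1_secmom -EFinM.
Qed.

Lemma tdot_tmul m k (v : k.-tuple R) (z : m.-tuple R) (B : 'M[R]_(m, k)) :
  tdot v (tmul z B) = tdot (tmul v B^T) z.
Proof. by rewrite !tdotE !rowtK trmx_mul mulmxA. Qed.

Lemma gd_secmom k (S : 'M[R]_k) (v : k.-tuple R) : posdef S ->
  (\int[@lebR R k]_x (tdot v x ^+ 2 * gauss_density S x)%:E = (bil S (trow v) (trow v))%:E)%E.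
Proof.
move=> pS; have [l l0 [B ->]] := posdef_decomp pS; have pl := @posdef_scalar R k l l0.
have mt b : measurable_fun setT (fun x : k.-tuple R => (b + tdot v x) ^+ 2 * gauss_density l%:M x).
  apply: measurable_funM; last exact: measurable_gd.
  by apply: measurable_funX; apply: measurable_funD => //; apply: measurable_tdot.
rewrite (int_gd_gram B (h := fun x => tdot v x ^+ 2)) //; last 2 first.
- by apply: measurable_funX; apply: measurable_tdot.
- by move=> x; exact: sqr_ge0.
have E b : (\int[@lebR R k]_x ((b + tdot v x) ^+ 2 * gauss_density l%:M x)%:E =
    (b ^+ 2 + l * tdot v v)%:E)%E.
  rewrite int_even //; last by move=> z; rewrite mulr_ge0 ?sqr_ge0 ?gd_ge0.
  have gdN z : gauss_density l%:M (tscale (-1) z) = gauss_density l%:M z :> R.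
    by rewrite !gd_scalar // tdotZl tdotZr (mulrA (-1)) mulrNN !mul1r.
  under eq_integral => z _.
    rewrite gdN tdotZr (_ : _ / 2 = b ^+ 2 * gauss_density l%:M z +
      tdot v z ^+ 2 * gauss_density l%:M z); last by field.
    over.
  rewrite ge0_int_add; last 4 first.
  - by apply: measurable_funM => //; exact: measurable_gd.
  - by apply: measurable_funM; [apply: measurable_funX; apply: measurable_tdot|exact: measurable_gd].
  - by move=> z; rewrite mulr_ge0 ?sqr_ge0 ?gd_ge0.
  - by move=> z; rewrite mulr_ge0 ?sqr_ge0 ?gd_ge0.
  rewrite gd_scalar_secmom // int_scaler ?sqr_ge0 //; last 2 first.
  - exact: measurable_gd.
  - by move=> z; exact: gd_ge0.
  by rewrite int_gd // mule1.
under eq_integral => z _.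
  under eq_integral => x _ do rewrite tdotDr addrC mulrC.
  rewrite int_scaler ?gd_ge0 //; last by move=> x; rewrite mulr_ge0 ?sqr_ge0 ?gd_ge0.
  rewrite E -EFinM mulrC mulrDl tdot_tmul; over.
rewrite ge0_int_add; last 4 first.
- by apply: measurable_funM; [apply: measurable_funX; apply: measurable_tdot|exact: measurable_gd].
- by apply: measurable_funM => //; exact: measurable_gd.
- by move=> z; rewrite mulr_ge0 ?sqr_ge0 ?gd_ge0.
- by move=> z; rewrite mulr_ge0 ?gd_ge0 // mulr_ge0 ?tdot_ge0 ?ltW.
rewrite gd1_secmom int_scaler; last 3 first.
- by rewrite mulr_ge0 ?tdot_ge0 ?ltW.
- exact: measurable_gd.
- by move=> z; exact: gd_ge0.
rewrite int_gd1 mule1 -EFinD; congr EFin.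
by rewrite bil_addM bil_scalar bil_gram !tdot_nsq rowtK addrC.
Qed.

Lemma gb_gd k (S : 'M[R]_k) : posdef S -> exists K a, gb K a (gauss_density S).
Proof.
move=> pS; have [l l0 hl] := posdef_lb (posdef_inv pS).
exists (Num.sqrt ((2 * pi) ^+ k * \det S))^-1, (l / 2); split; first by rewrite divr_gt0.
  exact: measurable_gd.
move=> x; rewrite gd_ge0 /= /gauss_density mulrC ler_wpM2l ?invr_ge0 ?sqrtr_ge0 //.
rewrite ler_expR tdot_nsq qformE; have := hl (trow x); lra.
Qed.

Lemma gb_gd1 k : gb ((Num.sqrt (2 * pi) ^+ k)^-1) 2^-1 (@gd1 R k).
Proof.
split; [by rewrite invr_gt0 | exact: measurable_gd | move=> x].
rewrite gd_ge0 /= gd1E mulrC; set E1 := expR _; set E2 := expR _.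
have -> : E1 = E2 by congr expR; field.
by [].
Qed.

Definition M4 k : R := Int (fun z : k.-tuple R => tdot z z ^+ 2 * gd1 z).

Lemma M4E k : ((M4 k)%:E = \int[@lebR R k]_z (tdot z z ^+ 2 * gd1 z)%:E)%E.
Proof. exact: (IntE (gb_moment4 (@gb_gd1 k))). Qed.

Lemma M4_ge0 k : 0 <= M4 k.
Proof. exact: (Int_ge0 (gb_moment4 (@gb_gd1 k))). Qed.

Lemma tdot_add_sqr_le k (x y : k.-tuple R) :
  tdot (tadd x y) (tadd x y) ^+ 2 <= 8 * tdot x x ^+ 2 + 8 * tdot y y ^+ 2.
Proof.
have h := tdot_ge0 (tadd x (tscale (-1) y)); have h2 := tdot_ge0 (tadd x y).
have -> : 8 * tdot x x ^+ 2 + 8 * tdot y y ^+ 2 =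
  (2 * tdot x x + 2 * tdot y y) ^+ 2 + (2 * tdot x x - 2 * tdot y y) ^+ 2 by ring.
apply: ler_wpDr; first exact: sqr_ge0.
rewrite lerXn2r // ?nnegrE ?addr_ge0 ?mulr_ge0 ?tdot_ge0 //.
move: h; rewrite !(tdotDl, tdotDr, tdotZl, tdotZr) (tdotC y x); lra.
Qed.

Lemma tmul_le m k (z : m.-tuple R) (B : 'M[R]_(m, k)) :
  tdot (tmul z B) (tmul z B) <= nsq B * tdot z z.
Proof. by rewrite !tdot_nsq rowtK mulrC nsq_mulmx. Qed.

(** Fourth moment of [X + Z B], bounded through [|x + y|^4 <= 8 |x|^4 + 8 |y|^4]. Only the size
    [nsq B] enters, so the bound is uniform over covariances of bounded trace. *)
Lemma gd_mom4 m k (a : R) (B : 'M[R]_(m, k)) : 0 < a ->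
  (\int[@lebR R k]_x (tdot x x ^+ 2 * gauss_density (a%:M + B^T *m B) x)%:E <=
   (8 * a ^+ 2 * M4 k + 8 * nsq B ^+ 2 * M4 m)%:E)%E.
Proof.
move=> a0; have pa := @posdef_scalar R k a a0.
have mt4 j : measurable_fun setT (fun x : j.-tuple R => tdot x x ^+ 2).
  by apply: measurable_funX; apply: measurable_tdot.
have mt4k := mt4 k; have mt4m := mt4 m.
rewrite (int_gd_gram B (h := fun x => tdot x x ^+ 2)) //; last by move=> x; exact: sqr_ge0.
have I4 : (\int[@lebR R k]_x (tdot x x ^+ 2 * gauss_density a%:M x)%:E = (a ^+ 2 * M4 k)%:E)%E.
  rewrite (int_gd_scale (h := fun x => tdot x x ^+ 2)) //; last by move=> x; exact: sqr_ge0.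
  under eq_integral => z _.
    rewrite tdotZl tdotZr mulrA -expr2 sqr_sqrtr ?ltW // exprMn -mulrA; over.
  rewrite int_scaler ?sqr_ge0 -?M4E //.
    by apply: measurable_funM => //; exact: measurable_gd.
  by move=> z; rewrite mulr_ge0 ?sqr_ge0 ?gd_ge0.
have mtm (z : m.-tuple R) : measurable_fun setT (fun x : k.-tuple R => tdot (tadd x (tmul z B)) (tadd x (tmul z B)) ^+ 2).
  by apply: measurable_funX; apply: measurable_tdot; apply: measurable_tadd.
apply: (@le_trans _ _ (\int[@lebR R m]_z (8 * a ^+ 2 * M4 k * gd1 z + 8 * nsq B ^+ 2 * (tdot z z ^+ 2 * gd1 z))%:E)%E).
  apply: ge0_le_integral => //.
  - move=> z _; apply: int_ge0 => x.
    by apply: mulr_ge0; [apply: mulr_ge0; [exact: sqr_ge0|exact: gd_ge0]|exact: gd_ge0].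
  - apply: (measurable_fun_fubini_tonelli_G (fun xz : k.-tuple R * m.-tuple R => (tdot (tadd xz.1 (tmul xz.2 B)) (tadd xz.1 (tmul xz.2 B)) ^+ 2 *
         gauss_density a%:M xz.1 * gd1 xz.2)%:E)).
      apply/measurable_EFinP; apply: measurable_funM; last by apply: (mcomp (h := @gd1 R m)); first exact: measurable_gd.
      apply: measurable_funM; last by apply: (mcomp (measurable_gd _)).
      by apply: measurable_funX; apply: measurable_tdot; apply: measurable_tadd => //; exact: measurable_tmul.
    by move=> xz; rewrite lee_fin !mulr_ge0 ?sqr_ge0 ?gd_ge0 ?tdot_ge0 ?nsq_ge0.
  - apply/measurable_EFinP; apply: measurable_funD; apply: measurable_funM => //; first exact: measurable_gd.
    by apply: measurable_funM => //; exact: measurable_gd.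
  move=> z _.
  apply: (@le_trans _ _ (\int[@lebR R k]_x (gd1 z * (8 * (tdot x x ^+ 2 * gauss_density a%:M x) +
      8 * (nsq B * tdot z z) ^+ 2 * gauss_density a%:M x))%:E)%E).
    apply: ge0_le_int => [||x].
    - by apply: measurable_funM => //; apply: measurable_funM => //; exact: measurable_gd.
    - apply: measurable_funM => //; apply: measurable_funD; apply: measurable_funM => //; last exact: measurable_gd.
      by apply: measurable_funM => //; exact: measurable_gd.
    rewrite !mulr_ge0 ?sqr_ge0 ?gd_ge0 ?tdot_ge0 ?nsq_ge0 //= mulrC ler_wpM2l ?gd_ge0 //.
    set G := gauss_density _ _; set T := tdot x x ^+ 2; set N := (nsq B * _) ^+ 2.
    have -> : 8 * (T * G) + 8 * N * G = (8 * T + 8 * N) * G by ring.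
    rewrite ler_wpM2r ?gd_ge0 // /T /N.
    apply: (le_trans (tdot_add_sqr_le _ _)); rewrite lerD2l ler_wpM2l //.
    rewrite lerXn2r ?nnegrE ?mulr_ge0 ?nsq_ge0 ?tdot_ge0 //; exact: tmul_le.
  rewrite int_scaler ?gd_ge0 //; last 2 first.
  - apply: measurable_funD; apply: measurable_funM => //; last exact: measurable_gd.
    by apply: measurable_funM => //; exact: measurable_gd.
  - by move=> x; rewrite addr_ge0 // !mulr_ge0 ?gd_ge0 ?sqr_ge0 ?tdot_ge0 ?nsq_ge0.
  rewrite ge0_int_add; last 4 first.
  - by apply: measurable_funM => //; apply: measurable_funM => //; exact: measurable_gd.
  - by apply: measurable_funM => //; exact: measurable_gd.
  - by move=> x; rewrite !mulr_ge0 ?gd_ge0 ?sqr_ge0 ?tdot_ge0 ?nsq_ge0.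
  - by move=> x; rewrite !mulr_ge0 ?gd_ge0 ?sqr_ge0 ?tdot_ge0 ?nsq_ge0.
  rewrite int_scaler //; last 2 first.
  - by apply: measurable_funM => //; exact: measurable_gd.
  - by move=> x; rewrite !mulr_ge0 ?gd_ge0 ?sqr_ge0 ?tdot_ge0 ?nsq_ge0.
  rewrite I4 int_scaler; last 3 first.
  - by rewrite mulr_ge0 ?sqr_ge0.
  - exact: measurable_gd.
  - by move=> x; exact: gd_ge0.
  rewrite (int_gd pa) mule1.
  change ((gd1 z * (8 * (a ^+ 2 * M4 k) + 8 * (nsq B * tdot z z) ^+ 2))%:E <=
    (8 * a ^+ 2 * M4 k * gd1 z + 8 * nsq B ^+ 2 * (tdot z z ^+ 2 * gd1 z))%:E)%E.
  rewrite lee_fin.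
  by rewrite le_eqVlt; apply/orP; left; apply/eqP; ring.
have mg := @measurable_gd R m 1%:M.
rewrite ge0_int_add; last 4 first.
- by apply: measurable_funM.
- by apply: measurable_funM => //; apply: measurable_funM.
- by move=> x; have M40 := M4_ge0 k; pos.
- by move=> x; pos.
have M40 := M4_ge0 k.
rewrite int_scaler; last 3 first.
- by pos.
- exact: mg.
- by move=> x; pos.
rewrite int_scaler; last 3 first.
- by pos.
- by apply: measurable_funM.
- by move=> x; pos.
by rewrite int_gd1 mule1 -M4E -EFinM -EFinD.
Qed.

End Moments.

(** * Signed integrals and covariance matrices *)

Section Signed.
Context {R : realType}.
Variable k : nat.
Implicit Types (p f g : k.-tuple R -> R).
Notation mu := (@lebR R k).

Definition integ f := mu.-integrable setT (EFin \o f).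

Lemma gb_integrable K a g : gb K a g -> integ g.
Proof.
move=> G; apply/integrableP; split; first by apply/measurable_EFinP; exact: gb_measurable G.
under eq_integral => x _ do rewrite /= ger0_norm ?(gb_ge0 _ G) //.
by rewrite (le_lt_trans (gb_int_le G)) // ltry.
Qed.

Lemma integ_le f g : measurable_fun setT f -> integ g -> (forall x, `|f x| <= g x) -> integ f.
Proof.
move=> mf ig fg; apply: (le_integrable measurableT _ _ ig).
  exact/measurable_EFinP.
move=> x _ /=; rewrite lee_fin; apply: (le_trans (fg x)); exact: ler_norm.
Qed.

Lemma integE f : integ f -> ((Int f)%:E = \int[mu]_x (f x)%:E)%E.
Proof. by move=> i; rewrite /Int fineK //; exact: integrable_fin_num. Qed.

Lemma integD f g : integ f -> integ g -> integ (fun x => f x + g x).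
Proof.
move=> i1 i2; have := integrableD measurableT i1 i2.
by apply: eq_integrable => // x _.
Qed.

Lemma integZ c f : integ f -> integ (fun x => c * f x).
Proof.
move=> i; have := integrableZl measurableT c i.
by apply: eq_integrable => // x _.
Qed.

Lemma IntD f g : integ f -> integ g -> Int (fun x => f x + g x) = Int f + Int g.
Proof.
move=> i1 i2; apply: EFin_inj; rewrite (integE (integD i1 i2)) EFinD (integE i1) (integE i2).
by rewrite -integralD_EFin.
Qed.

Lemma IntZ c f : integ f -> Int (fun x => c * f x) = c * Int f.
Proof.
move=> i; apply: EFin_inj; rewrite (integE (integZ c i)) EFinM (integE i).
by rewrite -integralZl.
Qed.

Lemma integ0 : integ (fun=> 0).
Proof. exact: integrable0. Qed.

Lemma Int_sum (I : Type) (s : seq I) (F : I -> k.-tuple R -> R) : (forall i, integ (F i)) ->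
  integ (fun x => \sum_(i <- s) F i x) /\
  Int (fun x => \sum_(i <- s) F i x) = \sum_(i <- s) Int (F i).
Proof.
move=> iF; elim: s => [|i s [IH1 IH2]].
  have -> : (fun x => \sum_(i <- [::]) F i x) = (fun=> 0) by apply/funext => x; rewrite big_nil.
  split; first exact: integ0.
  by rewrite big_nil /Int integral0.
have -> : (fun x => \sum_(j <- i :: s) F j x) = (fun x => F i x + \sum_(j <- s) F j x).
  by apply/funext => x; rewrite big_cons.
split; first exact: integD.
by rewrite IntD // IH2 big_cons.
Qed.

Lemma tnth_sqr_le (x : k.-tuple R) i : tnth x i ^+ 2 <= tdot x x.
Proof.
rewrite /tdot (bigD1 i) //= -expr2 lerDl; apply: sumr_ge0 => j _.
by rewrite -expr2 sqr_ge0.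
Qed.

(** Second moments about 0; this is the covariance matrix for the even densities to which it is
    applied. *)
Definition covm p : 'M[R]_k := \matrix_(i, j) Int (fun x => tnth x i * tnth x j * p x).

Lemma covm_integ K a p i j : gb K a p -> integ (fun x => tnth x i * tnth x j * p x).
Proof.
move=> G; apply: (integ_le _ (gb_integrable (gb_moment2 G))).
  apply: measurable_funM; last exact: gb_measurable G.
  by apply: measurable_funM; exact: measurable_tnth.
move=> x; rewrite normrM (ger0_norm (gb_ge0 x G)) ler_wpM2r ?(gb_ge0 x G) //.
have h1 := tnth_sqr_le x i; have h2 := tnth_sqr_le x j; rewrite ler_norml.
have h3 := sqr_ge0 (tnth x i - tnth x j); have h4 := sqr_ge0 (tnth x i + tnth x j).
by apply/andP; split; lra.
Qed.

Lemma Int_qform K a p (Q : 'M[R]_k) : gb K a p ->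
  integ (fun x => qform Q x * p x) /\
  Int (fun x => qform Q x * p x) = \sum_i \sum_j Q i j * covm p i j.
Proof.
move=> G.
have E : (fun x => qform Q x * p x) =
  (fun x => \sum_i \sum_j Q i j * (tnth x i * tnth x j * p x)).
  apply/funext => x; rewrite qformE bil_sum mulr_suml; apply: eq_bigr => i _.
  by rewrite mulr_suml; apply: eq_bigr => j _; rewrite !mxE; ring.
have H1 i j := integZ (Q i j) (covm_integ i j G).
have H2 i := Int_sum (index_enum 'I_k) (H1 i).
have [H3 H4] := Int_sum (index_enum 'I_k) (fun i => proj1 (H2 i)).
rewrite E; split => //; rewrite H4; apply: eq_bigr => i _.
rewrite (proj2 (H2 i)); apply: eq_bigr => j _.
by rewrite mxE IntZ //; exact: covm_integ G.
Qed.

Lemma qform_gram1 (v x : k.-tuple R) : qform ((trow v)^T *m trow v) x = tdot v x ^+ 2.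
Proof.
rewrite qformE bil_gram nsq_row big_ord_recl big_ord0 addr0.
by rewrite -[_ *m _]trmxK mx11_tr trmx_mul !trmxK tdotE.
Qed.

Lemma covm_secmom K a p (v : k.-tuple R) : gb K a p ->
  (\int[mu]_x (tdot v x ^+ 2 * p x)%:E = (bil (covm p) (trow v) (trow v))%:E)%E.
Proof.
move=> G; have [H1 H2] := Int_qform ((trow v)^T *m trow v) G.
rewrite bil_sum; transitivity (Int (fun x => qform ((trow v)^T *m trow v) x * p x))%:E.
  by rewrite (integE H1); apply: eq_integral => x _; rewrite qform_gram1.
rewrite H2; congr EFin; apply: eq_bigr => i _; apply: eq_bigr => j _.
by rewrite !mxE big_ord_recl big_ord0 addr0 !mxE; ring.
Qed.

Lemma covm_sym p : (covm p)^T = covm p.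
Proof.
by apply/matrixP => i j; rewrite !mxE; congr (fine _); apply: eq_integral => x _;
  rewrite (mulrC (tnth x j)).
Qed.

Lemma covm_psd K a p : gb K a p -> psd (covm p).
Proof.
move=> G; split; first exact: covm_sym.
move=> v; rewrite -[v]rowtK -lee_fin -(covm_secmom _ G); apply: int_ge0 => x.
by rewrite mulr_ge0 ?sqr_ge0 ?(gb_ge0 _ G).
Qed.

Lemma sym_bil_inj (A B : 'M[R]_k) : A^T = A -> B^T = B ->
  (forall v, bil A v v = bil B v v) -> A = B.
Proof.
move=> sA sB h; apply/matrixP => i j.
have E (M : 'M[R]_k) : M^T = M -> M i j *+ 2 = bil M (delta_mx 0 i + delta_mx 0 j) (delta_mx 0 i + delta_mx 0 j)
   - bil M (delta_mx 0 i) (delta_mx 0 i) - bil M (delta_mx 0 j) (delta_mx 0 j).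
  move=> sM; rewrite !(bilDl, bilDr) (bilC (delta_mx 0 j) (delta_mx 0 i) sM).
  have -> : bil M (delta_mx 0 i) (delta_mx 0 j) = M i j.
    by rewrite /bil -rowE trmx_delta -colE !mxE.
  ring.
have := E A sA; rewrite !h -(E B sB) => /eqP; rewrite -subr_eq0 -mulrnBl mulrn_eq0 /= subr_eq0.
by move/eqP.
Qed.

Lemma covm_gd (S : 'M[R]_k) : posdef S -> covm (gauss_density S) = S.
Proof.
move=> pS; have [K [a G]] := gb_gd pS.
apply: sym_bil_inj; [exact: covm_sym | exact: (proj1 pS) | move=> v].
by rewrite -[v]rowtK; apply: EFin_inj; rewrite -(covm_secmom _ G) gd_secmom.
Qed.

Lemma secmom_norm K a p (B : 'M[R]_k) : gb K a p -> covm p = B^T *m B ->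
  (\int[mu]_x (tdot x x * p x)%:E = (nsq B)%:E)%E.
Proof.
move=> G E; have [H1 H2] := Int_qform 1%:M G.
transitivity (Int (fun x => qform 1%:M x * p x))%:E.
  by rewrite (integE H1); apply: eq_integral => x _; rewrite qformE bil_scalar mul1r -tdot_nsq.
rewrite H2 E; congr EFin; rewrite /nsq [RHS]exchange_big; apply: eq_bigr => i _.
rewrite (bigD1 i) //= big1 ?addr0; last by move=> j ji; rewrite mxE eq_sym (negbTE ji) mul0r.
rewrite [X in X * _]mxE eqxx mul1r [LHS]mxE; apply: eq_bigr => j _; by rewrite mxE expr2.
Qed.

End Signed.

Section Taylor.
Context {R : realType}.

Lemma expR_le_quad (r : R) : 0 <= r -> expR (- r) <= 1 - r + r ^+ 2.
Proof.
move=> r0; rewrite expRN; have h := @expR_ge1Dx R r; have e0 := expR_gt0 r.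
rewrite -[leLHS]mul1r ler_pdivrMr //.
have : (1 - r + r ^+ 2) * (1 + r) <= (1 - r + r ^+ 2) * expR r.
  by rewrite ler_wpM2l //; nra.
have -> : (1 - r + r ^+ 2) * (1 + r) = 1 + r ^+ 3 by ring.
have r3 : 0 <= r ^+ 3 by exact: exprn_ge0.
lra.
Qed.

End Taylor.

(** * A central limit theorem for doubling *)

Section Cosh.
Context {R : realType}.
Implicit Types u v A r : R.

Lemma ge0_of_derive (f f' : R -> R) : (forall x : R, is_derive x 1 f (f' x)) -> f 0 = 0 ->
  (forall x, 0 <= x -> 0 <= f' x) -> forall x, 0 <= x -> 0 <= f x.
Proof.
move=> df f0 f'0 x x0.
have [c|c] := @MVT_segment R f f' 0 x x0 (fun y _ => df y).
  apply: continuous_subspaceT => y; apply: differentiable_continuous.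
  by apply/derivable1_diffP; have [] := df y.
rewrite in_itv /= => /andP[c0 _]; rewrite f0 !subr0 => ->.
by rewrite mulr_ge0 // f'0.
Qed.

Lemma expR_le2 u : 0 <= u -> expR u <= 1 + u + u ^+ 2 * expR u.
Proof.
move=> u0; have h := @expR_ge1Dx R (- u); have e0 := expR_gt0 u.
have h1 : (1 - u) * expR u <= 1.
  have : (1 - u) * expR u <= expR (- u) * expR u by rewrite ler_wpM2r // ltW.
  by rewrite -expRD addNr expR0.
by have := mulr_ge0 u0 (ltW e0); nra.
Qed.

(** Hyperbolic cosine and sine. Two chains of estimates follow, [ch_ge1], [sh_ge], [ch_ge] from
    below and [ch_le1], [sh_le], [ch_le] from above; in each chain a bound is differentiated and
    reduced to the preceding one. *)
Definition ch u := (expR u + expR (- u)) / 2.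
Definition sh u := (expR u - expR (- u)) / 2.

Lemma is_derive_expRN u : is_derive u 1 (expR \o -%R : R -> R) (- expR (- u)).
Proof.
have h := @is_derive1_comp R expR -%R u (expR (- u)) (-1) (is_derive_expR _) (is_deriveNid _ _).
by apply: (is_derive_eq h); rewrite ?mulN1r ?mulrN1.
Qed.

Lemma chE : ch = 2^-1 *: (expR + (expR \o -%R)) :> (R -> R).
Proof. by apply/funext => u; rewrite /ch mulrC. Qed.
Lemma shE : sh = 2^-1 *: (expR - (expR \o -%R)) :> (R -> R).
Proof. by apply/funext => u; rewrite /sh mulrC. Qed.

Lemma is_derive_sh u : is_derive u 1 sh (ch u).
Proof.
rewrite shE; have h := is_deriveZ 2^-1 (is_deriveB (is_derive_expR u) (is_derive_expRN u)).
by apply: (is_derive_eq h); rewrite /ch opprK mulrC.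
Qed.

Lemma is_derive_ch u : is_derive u 1 ch (sh u).
Proof.
rewrite chE; have h := is_deriveZ 2^-1 (is_deriveD (is_derive_expR u) (is_derive_expRN u)).
by apply: (is_derive_eq h); rewrite /sh mulrC.
Qed.

Lemma ch_ge1 u : 1 <= ch u.
Proof.
rewrite /ch expRN; have e0 := expR_gt0 u; set e := expR u in e0 *.
rewrite ler_pdivlMr // mul1r -subr_ge0.
have -> : e + e^-1 - 2 = (e - 1) ^+ 2 / e by field; rewrite gt_eqF.
by rewrite divr_ge0 ?sqr_ge0 ?ltW.
Qed.

Lemma sh_ge u : 0 <= u -> u <= sh u.
Proof.
move=> u0; rewrite -subr_ge0; pose f : R -> R := sh - id.
have D (x : R) : is_derive x 1 f (ch x - 1) := is_deriveB (is_derive_sh x) (is_derive_id _ _).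
apply: (ge0_of_derive D _ _ u0) => [|x x0].
- by rewrite /f /= fctE /sh oppr0 subrr mul0r subr0.
- by rewrite subr_ge0 ch_ge1.
Qed.

Lemma ch_ge u : 0 <= u -> 1 + u ^+ 2 / 2 <= ch u.
Proof.
move=> u0; rewrite -subr_ge0; pose f : R -> R := ch - (cst 1 + 2^-1 *: (id ^+ 2)).
have -> : ch u - (1 + u ^+ 2 / 2) = f u by rewrite /f !fctE /= [_ / 2]mulrC.
have D (x : R) : is_derive x 1 f (sh x - x).
  have h := is_deriveB (is_derive_ch x) (is_deriveD (is_derive_cst (1 : R) x (1 : R)) (is_deriveZ 2^-1 (is_deriveX 2 (is_derive_id x 1)))).
  apply: (is_derive_eq h); rewrite /= add0r ?expr1; congr (_ - _).
  by rewrite /GRing.scale /=; field.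
apply: (ge0_of_derive D _ _ u0) => [|x x0].
- by rewrite /f !fctE /ch oppr0 expR0 /= expr0n /= /GRing.scale /= mulr0; field.
- by rewrite subr_ge0 sh_ge.
Qed.

Lemma ch_le1 u : 0 <= u -> ch u <= 1 + 3 * u ^+ 2 * expR u.
Proof.
move=> u0; have h1 := expR_le2 u0; have h2 := expR_le_quad u0; have := expR_ge1Dx u.
rewrite /ch; have : 0 <= u ^+ 2 by exact: sqr_ge0.
by set q := u ^+ 2 in h1 h2 *; nra.
Qed.

Lemma sh_le u : 0 <= u -> sh u <= u + u ^+ 3 * expR u.
Proof.
move=> u0; rewrite -subr_ge0; pose f : R -> R := (id + id ^+ 3 * expR) - sh.
have -> : u + u ^+ 3 * expR u - sh u = f u by rewrite /f !fctE.
have D (x : R) : is_derive x 1 f (1 + (x ^+ 3 * expR x + 3 * x ^+ 2 * expR x) - ch x).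
  have h := is_deriveB (is_deriveD (is_derive_id x 1) (is_deriveM (is_deriveX 3 (is_derive_id x 1)) (is_derive_expR x))) (is_derive_sh x).
  by apply: (is_derive_eq h); rewrite /GRing.scale /= !fctE; ring.
apply: (ge0_of_derive D _ _ u0) => [|x x0].
- by rewrite /f !fctE /sh oppr0 subrr mul0r subr0 add0r expr0n /= mul0r.
- have := ch_le1 x0; have : 0 <= x ^+ 3 * expR x by rewrite mulr_ge0 ?exprn_ge0 ?expR_ge0.
  lra.
Qed.

Lemma ch_le u : 0 <= u -> ch u <= 1 + u ^+ 2 / 2 + u ^+ 4 * expR u.
Proof.
move=> u0; rewrite -subr_ge0; pose f : R -> R := (cst 1 + 2^-1 *: (id ^+ 2) + id ^+ 4 * expR) - ch.
have -> : 1 + u ^+ 2 / 2 + u ^+ 4 * expR u - ch u = f u by rewrite /f !fctE /= [_ / 2]mulrC.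
have D (x : R) : is_derive x 1 f (x + (x ^+ 4 * expR x + 4 * x ^+ 3 * expR x) - sh x).
  have h := is_deriveB (is_deriveD (is_deriveD (is_derive_cst (1 : R) x (1 : R)) (is_deriveZ 2^-1 (is_deriveX 2 (is_derive_id x 1)))) (is_deriveM (is_deriveX 4 (is_derive_id x 1)) (is_derive_expR x))) (is_derive_ch x).
  by apply: (is_derive_eq h); rewrite /GRing.scale /= !fctE; field.
apply: (ge0_of_derive D _ _ u0) => [|x x0].
- by rewrite /f !fctE /ch oppr0 expR0 /= !expr0n /= /GRing.scale /= mulr0 mul0r; field.
- have := sh_le x0; have : 0 <= x ^+ 4 * expR x by rewrite mulr_ge0 ?exprn_ge0 ?expR_ge0.
  have : 0 <= x ^+ 3 * expR x by rewrite mulr_ge0 ?exprn_ge0 ?expR_ge0.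
  lra.
Qed.

Lemma ch_even u : ch `|u| = ch u.
Proof. by case: (ger0P u) => // _; rewrite /ch opprK addrC. Qed.

Lemma xexp_le1 u : u * expR (- u) <= 1.
Proof.
rewrite expRN ler_pdivrMr ?expR_gt0 // mul1r; have := expR_ge1Dx u; lra.
Qed.

(* With [A = b|x|^2], [r = b|w|^2] and [u = 2b<x,w>], the average of the kernels [exp(-b|x+w|^2)] and
   [exp(-b|x-w|^2)] is [exp(-A-r) cosh u]; the error [r^2] of its second order expansion is uniform in [x]. *)
Definition ckern : R := 3 + 256 * expR 2.

Lemma cosh_kernel A r u : 0 <= A -> 0 <= r -> u ^+ 2 <= 4 * A * r ->
  expR (- A - r) * ch u + expR (- A) * r <= expR (- A) * (1 + u ^+ 2 / 2) + ckern * r ^+ 2 /\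
  expR (- A) * (1 + u ^+ 2 / 2) <= expR (- A - r) * ch u + expR (- A) * r + ckern * r ^+ 2.
Proof.
move=> A0 r0; wlog u0 : u / 0 <= u => [W|] uAr.
  by have := W `|u| (normr_ge0 u); rewrite ch_even -normrX ger0_norm ?sqr_ge0 //; apply.
have eA0 := expR_gt0 (- A); have eA1 : expR (- A) <= 1 by rewrite -expR0 ler_expR; lra.
have AeA := xexp_le1 A.
have e2 : 1 <= expR 2 :> R by have := @expR_ge1Dx R 2; lra.
have lo := ch_ge u0; have hi := ch_le u0.
have c3 : 3 <= ckern by rewrite /ckern; lra.
have ck5 : 5 <= ckern by rewrite /ckern; lra.
have r20 : 0 <= r ^+ 2 by exact: sqr_ge0.
have X0 : 0 <= expR (- A - r) * ch u by rewrite mulr_ge0 ?expR_ge0 // (le_trans ler01 (ch_ge1 u)).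
have u20 : 0 <= u ^+ 2 by exact: sqr_ge0.
case: (leP 1 r) => r1.
  have rr : r <= r ^+ 2 by nra.
  have X1 : expR (- A - r) * ch u <= 1.
    have uA : u <= A + r.
      rewrite -(@ler_pXn2r _ 2) // ?nnegrE ?addr_ge0 //; have := sqr_ge0 (A - r); nra.
    apply: (@le_trans _ _ (expR (- A - r) * expR u)).
      rewrite ler_wpM2l ?expR_ge0 // /ch.
      have : expR (- u) <= expR u by rewrite ler_expR; lra.
      lra.
    by rewrite -expRD -expR0 ler_expR; lra.
  have T1 : expR (- A) * (u ^+ 2 / 2) <= 2 * r.
    apply: (@le_trans _ _ (expR (- A) * (2 * A * r))); first by rewrite ler_wpM2l ?expR_ge0 //; lra.
    by nra.
  have T2 : expR (- A) * r <= r by nra.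
  have T3 : 0 <= expR (- A) * (u ^+ 2 / 2) by rewrite mulr_ge0 ?expR_ge0 ?divr_ge0.
  have ckr : 5 * r ^+ 2 <= ckern * r ^+ 2 by rewrite ler_wpM2r.
  by rewrite mulrDr mulr1; split; nra.
have r1' : r <= 1 by exact: ltW.
have Er : expR (- A - r) = expR (- A) * expR (- r) by rewrite expRD.
have er0 := expR_gt0 (- r).
have er1 : expR (- r) <= 1 by rewrite -expR0 ler_expR; lra.
have erhi := expR_le_quad r0; have erlo := @expR_ge1Dx R (- r).
(* From [u <= 2 sqrt A] for [r <= 1]; thus [expR u] costs a factor [expR 2] and half of the decay
   [expR (- A)]. *)
have uA2 : u <= A / 2 + 2.
  rewrite -(@ler_pXn2r _ 2) // ?nnegrE ?addr_ge0 ?divr_ge0 //; have := sqr_ge0 (A / 2 - 2); nra.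
rewrite Er -!mulrA; split.
  have S1 : expR (- r) * ch u <= 1 + u ^+ 2 / 2 - r + r ^+ 2 * (1 + 2 * A) + u ^+ 4 * expR u.
    have U4 : 0 <= u ^+ 4 * expR u by rewrite mulr_ge0 ?exprn_ge0 ?expR_ge0.
    apply: (@le_trans _ _ (expR (- r) * (1 + u ^+ 2 / 2) + u ^+ 4 * expR u)).
      apply: (le_trans (ler_wpM2l (ltW er0) hi)); rewrite mulrDr lerD2l.
      by rewrite -[leRHS]mul1r ler_wpM2r.
    rewrite lerD2r; apply: (@le_trans _ _ ((1 - r + r ^+ 2) * (1 + u ^+ 2 / 2))).
      by rewrite ler_wpM2r // addr_ge0 ?divr_ge0.
    have h1 : r ^+ 2 * (u ^+ 2 / 2) <= r ^+ 2 * (2 * A) by rewrite ler_wpM2l //; nra.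
    have h2 : 0 <= r * (u ^+ 2 / 2) by rewrite mulr_ge0 ?divr_ge0.
    lra.
  have S2 : expR (- A) * (u ^+ 4 * expR u) <= 256 * expR 2 * r ^+ 2.
    have U4 : u ^+ 4 <= 16 * A ^+ 2 * r ^+ 2.
      rewrite (_ : u ^+ 4 = u ^+ 2 ^+ 2); last by rewrite -exprM.
      rewrite (_ : 16 * _ * _ = (4 * A * r) ^+ 2); last by ring.
      by rewrite lerXn2r // nnegrE ?mulr_ge0.
    have EU : expR u <= expR (A / 2) * expR 2 by rewrite -expRD ler_expR.
    apply: (@le_trans _ _ (expR (- A) * (16 * A ^+ 2 * r ^+ 2 * (expR (A / 2) * expR 2)))).
      rewrite ler_wpM2l ?expR_ge0 // ler_pM ?exprn_ge0 ?expR_ge0 //.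
    (* One factor 16 of the constant 256 in [ckern] arises here, the other one in [U4]. *)
    have Q : A ^+ 2 * (expR (- A) * expR (A / 2)) <= 16.
      rewrite -expRD (_ : - A + A / 2 = - (A / 2)); last by field.
      rewrite expRN ler_pdivrMr ?expR_gt0 //.
      by have := @expR_sqr_lb R (A / 2) (divr_ge0 A0 (ler0n _ 2)); lra.
    rewrite (_ : expR (- A) * _ = 16 * r ^+ 2 * expR 2 * (A ^+ 2 * (expR (- A) * expR (A / 2)))); last by ring.
    apply: (@le_trans _ _ (16 * r ^+ 2 * expR 2 * 16)); last by nra.
    by rewrite ler_wpM2l // !mulr_ge0 ?expR_ge0.
  have S3 := ler_wpM2l (ltW eA0) S1.
  have S4 : expR (- A) * (r ^+ 2 * (1 + 2 * A)) <= 3 * r ^+ 2.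
    rewrite mulrCA (mulrC 3); rewrite ler_wpM2l //; nra.
  rewrite /ckern; lra.
have S1 : 1 + u ^+ 2 / 2 <= expR (- r) * ch u + r + r ^+ 2 * (2 * A).
  have h : (1 - r) * (1 + u ^+ 2 / 2) <= expR (- r) * ch u.
    by rewrite ler_pM // ?subr_ge0 // addr_ge0 ?divr_ge0.
  have h2 : r * (u ^+ 2 / 2) <= r * (2 * A * r) by rewrite ler_wpM2l //; lra.
  lra.
have S3 := ler_wpM2l (ltW eA0) S1.
have S4 : expR (- A) * (r ^+ 2 * (2 * A)) <= 2 * r ^+ 2.
  rewrite mulrCA (mulrC 2 (r ^+ 2)); rewrite ler_wpM2l //; nra.
have ckr : 3 * r ^+ 2 <= ckern * r ^+ 2 by rewrite ler_wpM2r.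
lra.
Qed.
End Cosh.

(** * Kernel averages and the exchange argument *)

Section Kernel.
Context {R : realType}.
Implicit Type k m : nat.

Lemma EFin_eq (x y : R) : x = y -> x%:E = y%:E.
Proof. by move=> ->. Qed.

Lemma ckern_ge0 : 0 <= ckern :> R.
Proof.
rewrite /ckern; apply: addr_ge0; first exact: ler0n.
by apply: mulr_ge0; [exact: ler0n | exact: expR_ge0].
Qed.

Definition ker k (b : R) (x : k.-tuple R) : R := expR (- b * tdot x x).

(* Expectation of [ker b (x + l Y N)] when [Y] has density [q]. *)
Definition Ek m k (N : 'M[R]_(m, k)) (q : m.-tuple R -> R) b l (x : k.-tuple R) : \bar R :=
  (\int[@lebR R m]_y (ker b (tadd x (tscale l (tmul y N))) * q y)%:E)%E.

Lemma ker_ge0 k b (x : k.-tuple R) : 0 <= ker b x.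
Proof. exact: expR_ge0. Qed.

Lemma measurable_ker k b d (T : measurableType d) (f : T -> k.-tuple R) :
  measurable_fun setT f -> measurable_fun setT (fun t => ker b (f t)).
Proof. by move=> mf; exact: (mcomp (measurable_gk b)). Qed.

Lemma tmulZ m k c (y : m.-tuple R) (N : 'M[R]_(m, k)) : tmul (tscale c y) N = tscale c (tmul y N).
Proof. by apply: trow_inj; rewrite trowZ !rowtK trowZ scalemxAl. Qed.
Lemma tmulD m k (y z : m.-tuple R) (N : 'M[R]_(m, k)) : tmul (tadd y z) N = tadd (tmul y N) (tmul z N).
Proof. by apply: trow_inj; rewrite trowD !rowtK trowD mulmxDl. Qed.
Lemma tmul1 k (y : k.-tuple R) : tmul y 1%:M = y.
Proof. by apply: trow_inj; rewrite rowtK mulmx1. Qed.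

Lemma ker_sym k b (x w : k.-tuple R) :
  (ker b (tadd x w) + ker b (tadd x (tscale (-1) w))) / 2 =
  expR (- (b * tdot x x) - b * tdot w w) * ch (2 * b * tdot x w).
Proof.
rewrite /ker !(tdotDl, tdotDr, tdotZl, tdotZr) (tdotC w x) /ch.
set v := - (b * tdot x x) - b * tdot w w; set u := 2 * b * tdot x w.
rewrite (_ : - b * (tdot x x + tdot x w + (tdot x w + tdot w w)) = v + - u); last by rewrite /v /u; ring.
rewrite (_ : - b * _ = v + u); last by rewrite /v /u; ring.
by rewrite (expRD v) (expRD v) -mulrDr addrC mulrA.
Qed.

(** [cosh_kernel] integrated against [q], whose evenness symmetrises the kernel. Up to an error of
    order [l^4], uniform in [x], only the second moments [S] and [s] of [q] appear: laws with equal
    covariance have almost equal kernel averages at small scale. Negative terms sit on the opposite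
    side because the averages are extended reals. *)
Lemma Ek_taylor m k K a (N : 'M[R]_(m, k)) q (S : k.-tuple R -> R) s M b l x :
  gb K a q -> (forall y, q (tscale (-1) y) = q y) -> Int q = 1 ->
  (forall v, \int[@lebR R m]_y (tdot v (tmul y N) ^+ 2 * q y)%:E = (S v)%:E)%E ->
  (\int[@lebR R m]_y (tdot (tmul y N) (tmul y N) * q y)%:E = s%:E)%E ->
  (\int[@lebR R m]_y (tdot (tmul y N) (tmul y N) ^+ 2 * q y)%:E <= M%:E)%E ->
  0 <= b ->
  let e := expR (- (b * tdot x x)) in
  (Ek N q b l x + (e * (b * l ^+ 2 * s))%:E <=
     (e * (1 + 2 * b ^+ 2 * l ^+ 2 * S x) + ckern * b ^+ 2 * l ^+ 4 * M)%:E)%E /\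
  ((e * (1 + 2 * b ^+ 2 * l ^+ 2 * S x))%:E <=
     Ek N q b l x + (e * (b * l ^+ 2 * s) + ckern * b ^+ 2 * l ^+ 4 * M)%:E)%E.
Proof.
move=> G qe q1 hS hs hM b0 e.
have q0 y : 0 <= q y by exact: gb_ge0 G.
have mq : measurable_fun setT q by exact: gb_measurable G.
have e0 : 0 <= e by exact: expR_ge0.
have c0 := ckern_ge0.
have mN : measurable_fun setT (fun y : m.-tuple R => tmul y N) by exact: (measurable_tmul N (f := id)).
have mT : measurable_fun setT (fun y => tdot (tmul y N) (tmul y N)) by exact: measurable_tdot.
have mX : measurable_fun setT (fun y => tdot x (tmul y N)) by exact: measurable_tdot.
pose U y := expR (- (b * tdot x x) - b * (l ^+ 2 * tdot (tmul y N) (tmul y N))) *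
   ch (2 * b * (l * tdot x (tmul y N))).
have U0 y : 0 <= U y by rewrite mulr_ge0 ?expR_ge0 // (le_trans ler01 (ch_ge1 _)).
have UE y : U y = (ker b (tadd x (tscale l (tmul y N))) + ker b (tadd x (tscale l (tmul (tscale (-1) y) N)))) / 2.
  rewrite tmulZ (_ : tscale l (tscale (-1) _) = tscale (-1) (tscale l (tmul y N))); last first.
    by apply: eq_from_tnth => j; rewrite !tnthZ; ring.
  by rewrite ker_sym !(tdotZl, tdotZr) /U (mulrA l l) -expr2.
have mU : measurable_fun setT U.
  rewrite (_ : U = fun y => (ker b (tadd x (tscale l (tmul y N))) + ker b (tadd x (tscale l (tmul (tscale (-1) y) N)))) / 2); last by apply/funext.
  apply: measurable_funM => //; apply: measurable_funD; apply: measurable_ker; apply: measurable_tadd => //; apply: measurable_tscale => //.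
  by apply: measurable_tmul; apply: measurable_tscale.
have EE : Ek N q b l x = (\int[@lebR R m]_y (U y * q y)%:E)%E.
  rewrite /Ek int_even; last 2 first.
  - apply: measurable_funM => //; apply: measurable_ker; apply: measurable_tadd => //; exact: measurable_tscale.
  - by move=> y; rewrite mulr_ge0 ?ker_ge0.
  by apply: eq_integral => y _; apply: EFin_eq; rewrite qe UE -mulrDl mulrAC.
have CK y := @cosh_kernel R (b * tdot x x) (b * (l ^+ 2 * tdot (tmul y N) (tmul y N))) (2 * b * (l * tdot x (tmul y N)))
   (mulr_ge0 b0 (tdot_ge0 _)) (mulr_ge0 b0 (mulr_ge0 (sqr_ge0 l) (tdot_ge0 _))).
have CS y : (2 * b * (l * tdot x (tmul y N))) ^+ 2 <= 4 * (b * tdot x x) * (b * (l ^+ 2 * tdot (tmul y N) (tmul y N))).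
  rewrite (_ : _ ^+ 2 = 4 * (b ^+ 2 * l ^+ 2) * tdot x (tmul y N) ^+ 2); last by ring.
  rewrite (_ : 4 * (b * tdot x x) * _ = 4 * (b ^+ 2 * l ^+ 2) * (tdot x x * tdot (tmul y N) (tmul y N))); last by ring.
  by apply: ler_wpM2l; [apply: mulr_ge0 => //; apply: mulr_ge0; exact: sqr_ge0 | exact: tdot_CS].
have q1E : (\int[@lebR R m]_y (q y)%:E = 1)%E by rewrite -(IntE G) q1.
pose c1 := e * (b * l ^+ 2); pose c2 := 2 * e * b ^+ 2 * l ^+ 2; pose c3 := ckern * b ^+ 2 * l ^+ 4.
have l20 := sqr_ge0 l; have b20 := sqr_ge0 b.
have c10 : 0 <= c1 by apply: mulr_ge0 => //; exact: mulr_ge0.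
have c20 : 0 <= c2 by apply: mulr_ge0 => //; apply: mulr_ge0 => //; exact: mulr_ge0.
have l40 : 0 <= l ^+ 4 by rewrite (_ : l ^+ 4 = (l ^+ 2) ^+ 2) ?sqr_ge0 // -exprM.
have c30 : 0 <= c3 by apply: mulr_ge0 => //; exact: mulr_ge0.
pose f1 y := tdot (tmul y N) (tmul y N) * q y; pose f2 y := tdot x (tmul y N) ^+ 2 * q y.
pose f3 y := tdot (tmul y N) (tmul y N) ^+ 2 * q y.
have mf1 : measurable_fun setT f1 by exact: measurable_funM.
have mf2 : measurable_fun setT f2 by apply: measurable_funM => //; exact: measurable_funX.
have mf3 : measurable_fun setT f3 by apply: measurable_funM => //; exact: measurable_funX.
have f10 y : 0 <= f1 y by rewrite mulr_ge0 ?tdot_ge0.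
have f20 y : 0 <= f2 y by rewrite mulr_ge0 ?sqr_ge0.
have f30 y : 0 <= f3 y by rewrite mulr_ge0 ?sqr_ge0.
have i1 : (\int[@lebR R m]_y (c1 * f1 y)%:E = (c1 * s)%:E)%E by rewrite int_scaler // hs.
have i2 : (\int[@lebR R m]_y (e * q y + c2 * f2 y)%:E = (e + c2 * S x)%:E)%E.
  rewrite ge0_int_add ?int_scaler ?q1E ?hS ?mule1 //; last 4 first.
  - exact: measurable_funM.
  - exact: measurable_funM.
  - by move=> y; rewrite mulr_ge0.
  - by move=> y; rewrite mulr_ge0.
have i3 : (\int[@lebR R m]_y (c3 * f3 y)%:E <= (c3 * M)%:E)%E.
  by rewrite int_scaler // (EFinM c3 M); apply: lee_wpmul2l => //; rewrite lee_fin.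
have mUq : measurable_fun setT (fun y => U y * q y) by exact: measurable_funM.
have Uq0 y : 0 <= U y * q y by rewrite mulr_ge0.
have mc1 : measurable_fun setT (fun y => c1 * f1 y) by exact: measurable_funM.
have mc3 : measurable_fun setT (fun y => c3 * f3 y) by exact: measurable_funM.
have mc2 : measurable_fun setT (fun y => e * q y + c2 * f2 y).
  by apply: measurable_funD; exact: measurable_funM.
have p1 y : 0 <= c1 * f1 y by rewrite mulr_ge0.
have p2 y : 0 <= e * q y + c2 * f2 y by apply: addr_ge0; exact: mulr_ge0.
have p3 y : 0 <= c3 * f3 y by rewrite mulr_ge0.
rewrite EE; split.
- rewrite (_ : e * (b * l ^+ 2 * s) = c1 * s); last by rewrite /c1; ring.
  rewrite -i1 -ge0_int_add //.
  rewrite (_ : e * _ + _ = (e + c2 * S x) + c3 * M); last by rewrite /c2 /c3; ring.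
  apply: (@le_trans _ _ (\int[@lebR R m]_y ((e * q y + c2 * f2 y) + c3 * f3 y)%:E)%E); last first.
    by rewrite ge0_int_add // i2 (EFinD _ (c3 * M)); apply: leeD2l.
  apply: ge0_le_int => [||y]; [exact: measurable_funD | exact: measurable_funD |].
  rewrite addr_ge0 //=; have [h _] := CK y (CS y).
  have := ler_wpM2r (q0 y) h; rewrite -/e -/(U y) /f1 /f2 /f3 /c1 /c2 /c3.
  set T := tdot (tmul y N) _; set X := tdot x _ => h1.
  rewrite (_ : U y * q y + _ = (U y + e * (b * (l ^+ 2 * T))) * q y); last by ring.
  apply: (le_trans h1); rewrite le_eqVlt; apply/orP; left; apply/eqP; by field.
- rewrite (_ : e * (1 + _) = e + c2 * S x); last by rewrite /c2; ring.
  rewrite -i2 (_ : e * _ + _ = c1 * s + c3 * M); last by rewrite /c1 /c3; ring.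
  apply: (@le_trans _ _ (\int[@lebR R m]_y (U y * q y + (c1 * f1 y + c3 * f3 y))%:E)%E); last first.
    rewrite ge0_int_add ?ge0_int_add // ?i1 //; last 2 first.
    - exact: measurable_funD.
    - by move=> y; rewrite addr_ge0.
    by rewrite (EFinD (c1 * s)); apply: leeD2l; apply: leeD2l.
  apply: ge0_le_int => [||y]; first exact: mc2.
    by apply: measurable_funD => //; exact: measurable_funD.
  rewrite p2 /=; have [_ h] := CK y (CS y).
  have := ler_wpM2r (q0 y) h; rewrite -/e -/(U y) /f1 /f2 /f3 /c1 /c2 /c3.
  set T := tdot (tmul y N) _; set X := tdot x _ => h1.
  rewrite (_ : U y * q y + _ = (U y + e * (b * (l ^+ 2 * T)) + ckern * (b * (l ^+ 2 * T)) ^+ 2) * q y); last by ring.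
  apply: le_trans h1; rewrite le_eqVlt; apply/orP; left; apply/eqP; by field.
Qed.

Lemma measurable_Ek2 m n k (N : 'M[R]_(m, k)) (N' : 'M[R]_(n, k)) (q : m.-tuple R -> R) b l l' x :
  measurable_fun setT q -> (forall y, 0 <= q y) ->
  measurable_fun setT (fun z : n.-tuple R => Ek N q b l (tadd x (tscale l' (tmul z N')))).
Proof.
move=> mq q0; rewrite /Ek.
apply: (measurable_fun_fubini_tonelli_F (fun zy : n.-tuple R * m.-tuple R =>
  (ker b (tadd (tadd x (tscale l' (tmul zy.1 N'))) (tscale l (tmul zy.2 N))) * q zy.2)%:E)).
  apply/measurable_EFinP; apply: measurable_funM; last exact: (mcomp mq).
  apply: measurable_ker; apply: measurable_tadd.
    by apply: measurable_tadd => //; apply: measurable_tscale => //; exact: measurable_tmul.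
  by apply: measurable_tscale => //; exact: measurable_tmul.
by move=> zy; rewrite lee_fin mulr_ge0 ?ker_ge0.
Qed.

Lemma Ek_ge0 m k (N : 'M[R]_(m, k)) q b l x : (forall y, 0 <= q y) -> (0 <= Ek N q b l x)%E.
Proof. by move=> q0; apply: int_ge0 => y; rewrite mulr_ge0 ?ker_ge0. Qed.

(** For independent [Y] and [Z] with densities [q] and [q'] both sides are the expectation of the
    kernel at [x + l Y N + l Z N']. This is the hybrid term of the exchange in [clt_iter]. *)
Lemma Ek_swap m n k (N : 'M[R]_(m, k)) (N' : 'M[R]_(n, k)) (q : m.-tuple R -> R) (q' : n.-tuple R -> R) b l x :
  measurable_fun setT q -> (forall y, 0 <= q y) ->
  measurable_fun setT q' -> (forall y, 0 <= q' y) ->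
  (\int[@lebR R n]_z (Ek N q b l (tadd x (tscale l (tmul z N'))) * (q' z)%:E) =
   \int[@lebR R m]_y (Ek N' q' b l (tadd x (tscale l (tmul y N))) * (q y)%:E))%E.
Proof.
move=> mq q0 mq' q'0.
pose F (zy : n.-tuple R * m.-tuple R) :=
  (ker b (tadd (tadd x (tscale l (tmul zy.1 N'))) (tscale l (tmul zy.2 N))) * (q zy.2 * q' zy.1))%:E.
have mF : measurable_fun setT F.
  apply/measurable_EFinP; apply: measurable_funM; last by apply: measurable_funM; [exact: (mcomp mq)|exact: (mcomp mq')].
  apply: measurable_ker; apply: measurable_tadd.
    by apply: measurable_tadd => //; apply: measurable_tscale => //; exact: measurable_tmul.
  by apply: measurable_tscale => //; exact: measurable_tmul.
have F0 zy : (0 <= F zy)%E by rewrite lee_fin !mulr_ge0 ?ker_ge0.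
have mk p r (N1 : 'M[R]_(p, k)) (y0 : k.-tuple R) (g : p.-tuple R -> R) : measurable_fun setT g ->
    measurable_fun setT (fun y => ker b (tadd y0 (tscale r (tmul y N1))) * g y).
  move=> mg; apply: measurable_funM => //; apply: measurable_ker; apply: measurable_tadd => //.
  by apply: measurable_tscale => //; exact: (measurable_tmul N1 (f := id)).
transitivity (\int[@lebR R n]_z \int[@lebR R m]_y F (z, y))%E.
  apply: eq_integral => z _; rewrite muleC /Ek -int_scaler //; last 2 first.
  - exact: mk.
  - by move=> y; rewrite mulr_ge0 ?ker_ge0.
  apply: eq_integral => y _; apply: EFin_eq => /=.
  by set X := ker _ _; set Y := q y; set Z := q' z; ring.
rewrite (fubini_tonelli F) //; apply: eq_integral => y _.
rewrite muleC /Ek -int_scaler //; last 2 first.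
- exact: mk.
- by move=> z; rewrite mulr_ge0 ?ker_ge0.
apply: eq_integral => z _; apply: EFin_eq => /=.
rewrite (_ : tadd (tadd x (tscale l (tmul z N'))) _ = tadd (tadd x (tscale l (tmul y N))) (tscale l (tmul z N'))).
  by set X := ker _ _; set Y := q y; set Z := q' z; ring.
by apply: eq_from_tnth => j; rewrite !tnthD addrAC.
Qed.

Lemma Ek_dbl m k K a (N : 'M[R]_(m, k)) q b l x : gb K a q ->
  Ek N (dbl q) b l x =
  (\int[@lebR R m]_y (Ek N q b (l * r2) (tadd x (tscale (l * r2) (tmul y N))) * (q y)%:E))%E.
Proof.
move=> G; have q0 y : 0 <= q y by exact: gb_ge0 G.
have mq : measurable_fun setT q by exact: gb_measurable G.
rewrite /Ek; under eq_integral => y _ do rewrite EFinM.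
rewrite (int_dbl (h := fun y => (ker b (tadd x (tscale l (tmul y N))))%:E) G); last 2 first.
- apply/measurable_EFinP; apply: measurable_ker; apply: measurable_tadd => //.
  by apply: measurable_tscale => //; exact: (measurable_tmul N (f := id)).
- by move=> y; rewrite lee_fin ker_ge0.
apply: eq_integral => y _; rewrite muleC -int_scaler //; last 2 first.
- apply: measurable_funM => //; apply: measurable_ker; apply: measurable_tadd => //.
  by apply: measurable_tscale => //; exact: (measurable_tmul N (f := id)).
- by move=> z; rewrite mulr_ge0 ?ker_ge0.
apply: eq_integral => z _; apply: EFin_eq; rewrite mulrCA.
rewrite (_ : tadd x _ = tadd (tadd x (tscale (l * r2) (tmul y N))) (tscale (l * r2) (tmul z N))) //.
rewrite /rotp tmulZ tmulD; apply: eq_from_tnth => j; by rewrite !(tnthD, tnthZ) mulrA mulrDr addrA.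
Qed.

Lemma gd1_ge0 m (z : m.-tuple R) : 0 <= gd1 z. Proof. exact: gd_ge0. Qed.
Lemma measurable_gd1 m : measurable_fun setT (@gd1 R m). Proof. exact: measurable_gd. Qed.

(** The standard Gaussian is a fixed point of doubling, so the Gaussian side of [clt_iter] can be
    doubled along with [p] without changing. *)
Lemma dbl_gd1 m : dbl (@gd1 R m) = @gd1 R m.
Proof.
apply/funext => s; rewrite /dbl.
transitivity (Int (fun t : m.-tuple R => gd1 s * gd1 t)).
  rewrite /Int; apply: (congr1 fine); apply: eq_integral => t _; apply: EFin_eq.
  rewrite !gd1E mulrACA -expRD [RHS]mulrACA -expRD.
  rewrite (_ : _ + - tdot (rotm s t) (rotm s t) / 2 = - tdot s s / 2 + - tdot t t / 2) //.
  by have := tdot_rot s t; lra.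
rewrite (Int_scale _ (gb_gd1 m)) ?gd1_ge0 //.
by rewrite /Int int_gd1 /= mulr1.
Qed.

Lemma gd1_even m (z : m.-tuple R) : gd1 (tscale (-1) z) = gd1 z.
Proof. by rewrite !gd1E tdotZl tdotZr (mulrA (-1)) mulrNN !mul1r. Qed.

Lemma gb_iter_dbl k K a (p : k.-tuple R -> R) j : gb K a p -> exists K', gb K' a (iter j dbl p).
Proof. by move=> G; elim: j => [|j [K' G']]; [exists K|exists (K' ^+ 2 * Num.sqrt (pi / a) ^+ k); exact: gb_dbl]. Qed.

Lemma Int_iter_dbl k K a (p : k.-tuple R -> R) j : gb K a p -> Int p = 1 -> Int (iter j dbl p) = 1.
Proof.
move=> G p1; elim: j => [//|j IH]; have [K' G'] := gb_iter_dbl j G.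
by rewrite iterS (Int_dbl G') IH expr1n.
Qed.

Lemma iter_dbl_even k (p : k.-tuple R -> R) j : (forall x, p (tscale (-1) x) = p x) ->
  forall x, iter j dbl p (tscale (-1) x) = iter j dbl p x.
Proof. by move=> pe; elim: j => [//|j IH] x; rewrite iterS dbl_even. Qed.

Lemma avg_le n (q : n.-tuple R -> R) (f g : n.-tuple R -> \bar R) D :
  (\int[@lebR R n]_z (q z)%:E = 1)%E -> measurable_fun setT q -> (forall z, 0 <= q z) ->
  measurable_fun setT f -> measurable_fun setT g -> (forall z, 0 <= f z)%E -> (forall z, 0 <= g z)%E ->
  0 <= D -> (forall z, f z <= g z + D%:E)%E ->
  (\int[@lebR R n]_z (f z * (q z)%:E) <= \int[@lebR R n]_z (g z * (q z)%:E) + D%:E)%E.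
Proof.
move=> q1 mq q0 mf mg f0 g0 D0 fg.
have mqE : measurable_fun setT (fun z => (q z)%:E) by exact/measurable_EFinP.
apply: (@le_trans _ _ (\int[@lebR R n]_z (g z * (q z)%:E + (D * q z)%:E))%E).
  apply: ge0_le_integral => //.
  - by move=> z _; rewrite mule_ge0 // lee_fin.
  - exact: emeasurable_funM.
  - apply: emeasurable_funD; first exact: emeasurable_funM.
    by apply/measurable_EFinP; exact: measurable_funM.
  move=> z _; rewrite EFinM -ge0_muleDl // ?lee_fin // lee_wpmul2r // lee_fin //.
rewrite ge0_integralD; last 5 first.
- exact: measurableT.
- by move=> z _; rewrite mule_ge0 // lee_fin.
- exact: emeasurable_funM.
- by move=> z _; rewrite lee_fin mulr_ge0.
- by apply/measurable_EFinP; exact: measurable_funM.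
by rewrite int_scaler // q1 mule1.
Qed.

(* Doubling both densities and exchanging the two factors one after the other costs twice the error at
   scale [l / sqrt 2]; since [2 (l / sqrt 2)^4 = l^4 / 2], each doubling halves the error. *)
Lemma clt_iter m k K a (p : k.-tuple R -> R) (B : 'M[R]_(m, k)) (b C : R) : gb K a p -> Int p = 1 -> 0 <= C ->
  (forall l x, Ek 1%:M p b l x <= Ek B (@gd1 R m) b l x + (C * l ^+ 4)%:E /\
               Ek B (@gd1 R m) b l x <= Ek 1%:M p b l x + (C * l ^+ 4)%:E)%E ->
  forall j l x, (Ek 1%:M (iter j dbl p) b l x <= Ek B (@gd1 R m) b l x + (C * l ^+ 4 / 2 ^+ j)%:E /\
               Ek B (@gd1 R m) b l x <= Ek 1%:M (iter j dbl p) b l x + (C * l ^+ 4 / 2 ^+ j)%:E)%E.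
Proof.
move=> G p1 C0 H0; elim=> [|j IH] l x; first by rewrite expr0 divr1; exact: H0.
have [K' G'] := gb_iter_dbl j G; have q1 := Int_iter_dbl j G p1.
set q := iter j dbl p in IH G' q1 *.
have q1E : (\int[@lebR R k]_y (q y)%:E = 1)%E by rewrite -(IntE G') q1.
have mq := gb_measurable G'; have q0 y : 0 <= q y by exact: gb_ge0 G'.
have Gg := @gb_gd1 R m; have g0 := @gd1_ge0 m; have mg := @measurable_gd1 m.
rewrite iterS -/q (Ek_dbl _ _ _ _ G') -{1 2}[@gd1 R m]dbl_gd1 (Ek_dbl _ _ _ _ Gg).
set lm := l * r2; set D := C * lm ^+ 4 / 2 ^+ j.
have lm4 : lm ^+ 4 = l ^+ 4 / 4.
  rewrite /lm exprMn (_ : r2 ^+ 4 = (r2 * r2) ^+ 2); last by ring.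
  by rewrite r2_sqr; field.
have l40 : 0 <= l ^+ 4 by rewrite (_ : l ^+ 4 = (l ^+ 2) ^+ 2) ?sqr_ge0 // -exprM.
have lm40 : 0 <= lm ^+ 4 by rewrite lm4 divr_ge0.
have D0 : 0 <= D by apply: divr_ge0; [exact: mulr_ge0|exact: exprn_ge0].
have -> : C * l ^+ 4 / 2 ^+ j.+1 = D + D.
  have P0 : (2:R) ^+ j != 0 by rewrite expf_neq0 // pnatr_eq0.
  have half (x0 y z : R) : z != 0 -> x0 * y / (2 * z) = x0 * (y / 4) / z + x0 * (y / 4) / z.
    by move=> z0; field.
  by rewrite /D lm4 (exprS 2 j) half.
have mEp := measurable_Ek2 (1%:M : 'M[R]_k) (1%:M : 'M[R]_k) b lm lm x mq q0.
have mEpB := measurable_Ek2 (1%:M : 'M[R]_k) B b lm lm x mq q0.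
have mEg1 := measurable_Ek2 B (1%:M : 'M[R]_k) b lm lm x mg g0.
have mEgB := measurable_Ek2 B B b lm lm x mg g0.
have e1 y := Ek_ge0 (1%:M : 'M[R]_k) b lm y q0; have e2 y := Ek_ge0 B b lm y g0.
have ig1 := @int_gd1 R m.
have U1 := avg_le q1E mq q0 mEp mEg1 (fun z => e1 _) (fun z => e2 _) D0 (fun y => (IH lm _).1).
have U2 := avg_le ig1 mg g0 mEpB mEgB (fun z => e1 _) (fun z => e2 _) D0 (fun y => (IH lm _).1).
have L1 := avg_le ig1 mg g0 mEgB mEpB (fun z => e2 _) (fun z => e1 _) D0 (fun y => (IH lm _).2).
have L2 := avg_le q1E mq q0 mEg1 mEp (fun z => e2 _) (fun z => e1 _) D0 (fun y => (IH lm _).2).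
have sw := Ek_swap (1%:M : 'M[R]_k) B b lm x mq q0 mg g0.
rewrite !EFinD !addeA; split.
- by apply: (le_trans U1); apply: leeD2r; rewrite -sw.
- by apply: (le_trans L1); apply: leeD2r; rewrite sw.
Qed.

End Kernel.

(** * From kernel averages to relative entropy *)

Section CLT.
Context {R : realType}.
Variable k : nat.
Implicit Types (p q : k.-tuple R -> R) (x y : k.-tuple R).

(** [|rotp x y|^2] and [|rotm x y|^2] add up to [|x|^2 + |y|^2], and evenness of [q] lets the two be
    averaged. This keeps the total second moment available to [Ek_lb] after any number of
    doublings. *)
Lemma secmom_dbl K a q s : gb K a q -> (forall x, q (tscale (-1) x) = q x) -> Int q = 1 ->
  (\int[@lebR R k]_x (tdot x x * q x)%:E = s%:E)%E ->
  (\int[@lebR R k]_x (tdot x x * dbl q x)%:E = s%:E)%E.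
Proof.
move=> G qe q1 hs.
have q0 y : 0 <= q y by exact: gb_ge0 G.
have mq := gb_measurable G.
have q1E : (\int[@lebR R k]_y (q y)%:E = 1)%E by rewrite -(IntE G) q1.
have mid : measurable_fun setT (fun x : k.-tuple R => x) by exact: measurable_id.
have mT : measurable_fun setT (fun x : k.-tuple R => tdot x x) by exact: measurable_tdot.
have mTq : measurable_fun setT (fun x => tdot x x * q x) by exact: measurable_funM.
have Tq0 x : 0 <= tdot x x * q x by rewrite mulr_ge0 ?tdot_ge0.
have s0 : 0 <= s by rewrite -lee_fin -hs; exact: int_ge0.
under eq_integral => y _ do rewrite EFinM.
rewrite (int_dbl (h := fun y => (tdot y y)%:E) G); last 2 first.
- exact/measurable_EFinP.
- by move=> y; rewrite lee_fin tdot_ge0.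
have inner x : (\int[@lebR R k]_y ((tdot (rotp x y) (rotp x y))%:E * (q x * q y)%:E) =
   (tdot x x / 2 * q x + s / 2 * q x)%:E)%E.
  transitivity (\int[@lebR R k]_y (tdot (rotp x y) (rotp x y) * (q x * q y))%:E)%E => //.
  rewrite int_even; last 2 first.
  - apply: measurable_funM; last by apply: measurable_funM.
    by apply: measurable_tdot; exact: measurable_rotp.
  - by move=> y; rewrite mulr_ge0 ?tdot_ge0 ?mulr_ge0.
  transitivity (\int[@lebR R k]_y (tdot x x / 2 * q x * q y + q x / 2 * (tdot y y * q y))%:E)%E.
    apply: eq_integral => y _; apply: EFin_eq; rewrite qe.
    have := tdot_rot x y; rewrite /rotm /rotp.
    set A := tdot _ _; set B := tdot _ _; set X := tdot x x; set Y := tdot y y => h.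
    rewrite -mulrDl h; by field.
  have h1 : 0 <= tdot x x / 2 * q x by rewrite mulr_ge0 ?divr_ge0 ?tdot_ge0.
  have h2 : 0 <= q x / 2 by rewrite divr_ge0.
  rewrite ge0_int_add; last 4 first.
  - exact: measurable_funM.
  - exact: measurable_funM.
  - by move=> y; apply: mulr_ge0.
  - by move=> y; apply: mulr_ge0.
  by rewrite !int_scaler // q1E hs mule1 -EFinM -EFinD; apply: EFin_eq; field.
under eq_integral => x _ do rewrite inner.
transitivity (\int[@lebR R k]_x (2^-1 * (tdot x x * q x) + s / 2 * q x)%:E)%E.
  by apply: eq_integral => x _; apply: EFin_eq; field.
have h3 : 0 <= s / 2 by rewrite divr_ge0.
rewrite ge0_int_add; last 4 first.
- exact: measurable_funM.
- exact: measurable_funM.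
- by move=> y; apply: mulr_ge0 => //; rewrite invr_ge0.
- by move=> y; apply: mulr_ge0.
rewrite !int_scaler ?invr_ge0 // q1E hs mule1 -EFinM -EFinD; apply: EFin_eq; by field.
Qed.

Lemma secmom_iter_dbl K a q s j : gb K a q -> (forall x, q (tscale (-1) x) = q x) -> Int q = 1 ->
  (\int[@lebR R k]_x (tdot x x * q x)%:E = s%:E)%E ->
  (\int[@lebR R k]_x (tdot x x * iter j dbl q x)%:E = s%:E)%E.
Proof.
move=> G qe q1 hs; elim: j => [//|j IH]; have [K' G'] := gb_iter_dbl j G.
rewrite iterS; apply: (secmom_dbl G') => //; first exact: iter_dbl_even.
exact: Int_iter_dbl G q1.
Qed.

Lemma ker_le1 b x : 0 <= b -> ker b x <= 1.
Proof. by move=> b0; rewrite /ker -expR0 ler_expR mulNr oppr_le0 mulr_ge0 ?tdot_ge0. Qed.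

(* Jensen: [exp (-u) >= exp (-m) (1 + m - u)] where [m] is the mean of [u]. *)
Lemma Ek_lb K a q s b x : gb K a q -> Int q = 1 -> 0 <= b -> 0 <= s ->
  (\int[@lebR R k]_x (tdot x x * q x)%:E = s%:E)%E ->
  ((expR (- (2 * b * (tdot x x + s))))%:E <= Ek 1%:M q b (-1) x)%E.
Proof.
move=> G q1 b0 s0 hs.
have q0 y : 0 <= q y by exact: gb_ge0 G.
have mq := gb_measurable G.
have q1E : (\int[@lebR R k]_y (q y)%:E = 1)%E by rewrite -(IntE G) q1.
have mT : measurable_fun setT (fun x : k.-tuple R => tdot x x) by exact: measurable_tdot.
set m := 2 * b * (tdot x x + s).
have m0 : 0 <= m by rewrite mulr_ge0 ?mulr_ge0 ?addr_ge0 ?tdot_ge0.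
pose kf y := ker b (tadd x (tscale (-1) (tmul y 1%:M))) * q y.
have kf0 y : 0 <= kf y by rewrite mulr_ge0 ?ker_ge0.
have mkf : measurable_fun setT kf.
  apply: measurable_funM => //; apply: measurable_ker; apply: measurable_tadd => //.
  by apply: measurable_tscale => //; exact: (measurable_tmul _ (f := id)).
pose uf y := expR (- m) * (2 * b * tdot x x) * q y + expR (- m) * (2 * b) * (tdot y y * q y).
have c1 : 0 <= expR (- m) * (2 * b * tdot x x) by rewrite mulr_ge0 ?expR_ge0 // mulr_ge0 ?tdot_ge0 // mulr_ge0.
have c2 : 0 <= expR (- m) * (2 * b) by rewrite mulr_ge0 ?expR_ge0 // mulr_ge0.
have mTq : measurable_fun setT (fun x => tdot x x * q x) by exact: measurable_funM.
have Tq0 y : 0 <= tdot y y * q y by rewrite mulr_ge0 ?tdot_ge0.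
have muf : measurable_fun setT uf by apply: measurable_funD; exact: measurable_funM.
have uf0 y : 0 <= uf y by apply: addr_ge0; exact: mulr_ge0.
have iuf : (\int[@lebR R k]_y (uf y)%:E = (expR (- m) * m)%:E)%E.
  rewrite /uf ge0_int_add; last 4 first.
  - exact: measurable_funM.
  - exact: measurable_funM.
  - by move=> y; apply: mulr_ge0.
  - by move=> y; apply: mulr_ge0.
  by rewrite !int_scaler // q1E hs mule1 -EFinM -EFinD; apply: EFin_eq; rewrite /m; ring.
have key : ((expR (- m) * (1 + m))%:E <= \int[@lebR R k]_y (kf y + uf y)%:E)%E.
  have e1 : 0 <= expR (- m) * (1 + m) by rewrite mulr_ge0 ?expR_ge0 ?addr_ge0.
  rewrite -[leLHS]mule1 -q1E -int_scaler //.
  apply: ge0_le_int => [||y]; [exact: measurable_funM | exact: measurable_funD |].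
  rewrite mulr_ge0 //= /kf /uf.
  set u := 2 * b * (tdot x x + tdot y y).
  have h1 : expR (- u) <= ker b (tadd x (tscale (-1) (tmul y 1%:M))).
    rewrite /ker ler_expR tmul1 !(tdotDl, tdotDr, tdotZl, tdotZr) (tdotC y x) /u.
    have : 0 <= b * tdot (tadd x y) (tadd x y) by rewrite mulr_ge0 ?tdot_ge0.
    by rewrite !(tdotDl, tdotDr) (tdotC y x); lra.
  have h2 : expR (- m) * (1 + m - u) <= expR (- u).
    have -> : expR (- u) = expR (- m) * expR (m - u) by rewrite -expRD; apply: congr1; ring.
    by apply: ler_wpM2l; [exact: expR_ge0 | rewrite -addrA expR_ge1Dx].
  have h3 : expR (- m) * (1 + m) <= ker b (tadd x (tscale (-1) (tmul y 1%:M))) + expR (- m) * u.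
    by move: h1 h2; rewrite mulrBr; lra.
  have := ler_wpM2r (q0 y) h3; set ke := ker _ _; set ee := expR _.
  rewrite (_ : (ke + ee * u) * q y = ke * q y + (ee * (2 * b * tdot x x) * q y + ee * (2 * b) * (tdot y y * q y))) //.
  by rewrite /u; ring.
move: key; rewrite ge0_int_add // iuf.
rewrite (_ : expR (- m) * (1 + m) = expR (- m) + expR (- m) * m); last by ring.
by rewrite EFinD leeD2rE.
Qed.

Lemma Ek_le1 m (N : 'M[R]_(m, k)) K a (q : m.-tuple R -> R) b l x : gb K a q -> Int q = 1 -> 0 <= b ->
  (Ek N q b l x <= 1)%E.
Proof.
move=> G q1 b0.
have q0 (y : m.-tuple R) : 0 <= q y by exact: gb_ge0 G.
have mq := gb_measurable G.
have q1E : (\int[@lebR R m]_y (q y)%:E = 1)%E by rewrite -(IntE G) q1.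
rewrite -q1E; apply: ge0_le_int => [||y] //.
- apply: measurable_funM => //; apply: measurable_ker; apply: measurable_tadd => //.
  by apply: measurable_tscale => //; exact: (measurable_tmul _ (f := id)).
- by rewrite mulr_ge0 ?ker_ge0 //= ler_piMl // ker_le1.
Qed.

Lemma gd1_tmul_norm m (B : 'M[R]_(m, k)) :
  (\int[@lebR R m]_z (tdot (tmul z B) (tmul z B) * gd1 z)%:E = (nsq B)%:E)%E.
Proof.
have E z : tdot (tmul z B) (tmul z B) = qform (B *m B^T) z.
  by have := bil_gram B^T (trow z); rewrite !trmxK tdot_nsq rowtK qformE => ->.
have [I1 I2] := Int_qform (B *m B^T) (@gb_gd1 R m).
under eq_integral => z _ do rewrite E.
rewrite -integE // I2 covm_gd; last exact: posdef_scalar.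
apply: EFin_eq; rewrite /nsq; apply: eq_bigr => i _.
rewrite (bigD1 i) //= big1 ?addr0 => [|j ji]; last by rewrite [X in _ * X]mxE eq_sym (negbTE ji) mulr0.
by rewrite !mxE eqxx mulr1; apply: eq_bigr => j _; rewrite mxE expr2.
Qed.

(** [p] and the Gaussian have the same covariance [B^T B], so their expansions [Ek_taylor] share all
    terms but the errors, whose sum is [C]; [clt_iter] then divides [C] by [2 ^+ j]. The scale [-1]
    is the one occurring in the convolution [smoothed]. *)
Lemma kernel_clt K a p (B : 'M[R]_k) Mp b j x : gb K a p -> (forall x, p (tscale (-1) x) = p x) ->
  Int p = 1 -> covm p = B^T *m B ->
  (\int[@lebR R k]_y (tdot y y ^+ 2 * p y)%:E <= Mp%:E)%E -> 0 <= b ->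
  let C := ckern * b ^+ 2 * (Mp + nsq B ^+ 2 * M4 k) in
  (Ek 1%:M (iter j dbl p) b (-1) x <= Ek B (@gd1 R k) b (-1) x + (C / 2 ^+ j)%:E /\
   Ek B (@gd1 R k) b (-1) x <= Ek 1%:M (iter j dbl p) b (-1) x + (C / 2 ^+ j)%:E)%E.
Proof.
move=> G pe p1 hB hM b0 C.
have Mp0 : 0 <= Mp.
  rewrite -lee_fin (le_trans _ hM) //; apply: int_ge0 => y; rewrite mulr_ge0 ?sqr_ge0 //; exact: gb_ge0 G.
have C0 : 0 <= C.
  have h1 := ckern_ge0 (R := R); have h2 := M4_ge0 (R := R) k.
  by apply: mulr_ge0; [apply: mulr_ge0 => //; exact: sqr_ge0|apply: addr_ge0 => //; apply: mulr_ge0 => //; exact: sqr_ge0].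
have := @clt_iter R k k K a p B b C G p1 C0 _ j (-1) x.
rewrite (_ : C * (-1) ^+ 4 = C); last by ring.
apply => l {}x.
have [u1 l1] := @Ek_taylor R k k K a 1%:M p (fun v => bil (covm p) (trow v) (trow v)) (nsq B) Mp b l x G pe p1
  (fun v => (etrans (eq_integral _ _ (fun y _ => congr1 (fun z => (tdot v z ^+ 2 * p y)%:E) (tmul1 y))) (covm_secmom v G)))
  (etrans (eq_integral _ _ (fun y _ => congr1 (fun z => (tdot z z * p y)%:E) (tmul1 y))) (secmom_norm G hB))
  ltac:(under eq_integral => y _ do rewrite tmul1; exact: hM) b0.
have gM : (\int[@lebR R k]_y (tdot (tmul y B) (tmul y B) ^+ 2 * gd1 y)%:E <= (nsq B ^+ 2 * M4 k)%:E)%E.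
  rewrite EFinM M4E -int_scaler; last 3 first.
  - exact: sqr_ge0.
  - by apply: measurable_funM; [apply: measurable_funX; exact: measurable_tdot | exact: measurable_gd1].
  - by move=> z; apply: mulr_ge0; [exact: sqr_ge0 | exact: gd1_ge0].
  apply: ge0_le_int => [||y].
  - apply: measurable_funM; last exact: measurable_gd1.
    by apply: measurable_funX; apply: measurable_tdot; exact: (measurable_tmul _ (f := id)).
  - apply: measurable_funM => //; apply: measurable_funM; last exact: measurable_gd1.
    by apply: measurable_funX; exact: measurable_tdot.
  - have g0 := gd1_ge0 y; rewrite mulr_ge0 ?sqr_ge0 //= mulrA; apply: ler_wpM2r => //.
    by rewrite -exprMn ler_sqr ?nnegrE ?mulr_ge0 ?tdot_ge0 ?nsq_ge0 // tmul_le.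
have gS v : (\int[@lebR R k]_y (tdot v (tmul y B) ^+ 2 * gd1 y)%:E = (bil (covm p) (trow v) (trow v))%:E)%E.
  under eq_integral => y _ do rewrite tdot_tmul.
  by rewrite gd1_secmom hB bil_gram tdot_nsq rowtK.
have [u2 l2] := @Ek_taylor R k k _ _ B (@gd1 R k) (fun v => bil (covm p) (trow v) (trow v)) (nsq B) _ b l x
  (@gb_gd1 R k) (@gd1_even R k) ltac:(by rewrite /Int int_gd1) gS (gd1_tmul_norm B) gM b0.
have fp : Ek 1%:M p b l x \is a fin_num.
  rewrite ge0_fin_numE; first by rewrite (le_lt_trans (Ek_le1 _ _ _ G p1 b0)) ?ltry.
  by apply: Ek_ge0 => y; exact: gb_ge0 G.
have fg : Ek B (@gd1 R k) b l x \is a fin_num.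
  rewrite ge0_fin_numE; last by apply: Ek_ge0 => z; exact: gd1_ge0.
  by rewrite (le_lt_trans (Ek_le1 _ _ _ (@gb_gd1 R k) _ b0)) ?ltry // /Int int_gd1.
move: u1 l1 u2 l2; rewrite -(fineK fp) -(fineK fg) -!EFinD !lee_fin /C.
set eP := fine _; set eG := fine _; set X := expR _; set Y := bil _ _ _; set L := l ^+ 4.
set Mg := nsq B ^+ 2 * M4 k; set cb := ckern * b ^+ 2.
set T1 := X * (b * l ^+ 2 * nsq B); set T2 := X * (1 + _).
rewrite (_ : cb * (Mp + Mg) * L = cb * L * Mp + cb * L * Mg); last by ring.
by move=> *; split; lra.
Qed.

(** Convolution with [N(0, de)]: the density of [Y + sqrt de Z] with [Y ~ q] and [Z] standard. *)
Definition smoothed (de : R) q x : R := Int (fun y => gauss_density de%:M (tadd x (tscale (-1) y)) * q y).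

Lemma gd_scalar_ker de x : 0 < de ->
  gauss_density de%:M x = (Num.sqrt (2 * pi * de) ^+ k)^-1 * ker (2 * de)^-1 x.
Proof. by move=> d0; rewrite gd_scalar // /ker mulrC. Qed.

Lemma smoothedE de K a q x : 0 < de -> gb K a q -> Int q = 1 ->
  ((smoothed de q x)%:E = (Num.sqrt (2 * pi * de) ^+ k)^-1%:E * Ek 1%:M q (2 * de)^-1 (-1) x)%E.
Proof.
move=> d0 G q1; have q0 y : 0 <= q y by exact: gb_ge0 G.
have mq := gb_measurable G.
have b0 : 0 <= (2 * de)^-1 by rewrite invr_ge0 mulr_ge0 // ltW.
have K0 : 0 <= (Num.sqrt (2 * pi * de) ^+ k)^-1 by rewrite invr_ge0 exprn_ge0 ?sqrtr_ge0.
have mk : measurable_fun setT (fun y => ker (2 * de)^-1 (tadd x (tscale (-1) (tmul y 1%:M))) * q y).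
  apply: measurable_funM => //; apply: measurable_ker; apply: measurable_tadd => //.
  by apply: measurable_tscale => //; exact: (measurable_tmul _ (f := id)).
have k0 y : 0 <= ker (2 * de)^-1 (tadd x (tscale (-1) (tmul y 1%:M))) * q y by rewrite mulr_ge0 ?ker_ge0.
have E : (\int[@lebR R k]_y (gauss_density de%:M (tadd x (tscale (-1) y)) * q y)%:E =
   (Num.sqrt (2 * pi * de) ^+ k)^-1%:E * Ek 1%:M q (2 * de)^-1 (-1) x)%E.
  rewrite /Ek -int_scaler //; apply: eq_integral => y _; apply: EFin_eq.
  by rewrite gd_scalar_ker // tmul1 mulrA.
rewrite /smoothed /Int E fineK // fin_numM // ge0_fin_numE; last exact: Ek_ge0.
by rewrite (le_lt_trans (Ek_le1 _ _ _ G q1 b0)) ?ltry.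
Qed.

Lemma gd_gramE m (B : 'M[R]_(m, k)) de x : 0 < de ->
  ((gauss_density (de%:M + B^T *m B) x)%:E =
   (Num.sqrt (2 * pi * de) ^+ k)^-1%:E * Ek B (@gd1 R m) (2 * de)^-1 (-1) x)%E.
Proof.
move=> d0; rewrite gd_gram; last exact: posdef_scalar.
have K0 : 0 <= (Num.sqrt (2 * pi * de) ^+ k)^-1 by rewrite invr_ge0 exprn_ge0 ?sqrtr_ge0.
rewrite /Ek -int_scaler //; last 2 first.
- apply: measurable_funM; last exact: measurable_gd1.
  apply: measurable_ker; apply: measurable_tadd => //.
  by apply: measurable_tscale => //; exact: (measurable_tmul _ (f := id)).
- by move=> y; rewrite mulr_ge0 ?ker_ge0 ?gd1_ge0.
by apply: eq_integral => y _; apply: EFin_eq; rewrite gd_scalar_ker // mulrC mulrA.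
Qed.

Lemma ln_le_sub1 (u : R) : 0 < u -> ln u <= u - 1.
Proof. by move=> u0; have := @expR_ge1Dx R (ln u); rewrite lnK ?posrE //; lra. Qed.

(* Outside the ball the crude bound [E1 >= exp (- (|x|^2 + s) / de)] is dominated by the fourth moment. *)
Lemma split_bound (E1 E2 eta de s rho t : R) : 0 < de -> 0 <= s -> 1 <= rho -> 0 <= t ->
  0 < E2 <= 1 -> 0 <= eta -> E2 <= E1 + eta -> expR (- ((t + s) / de)) <= E1 ->
  - ln E1 <= - ln E2 + (eta * expR ((rho + s) / de) + (1 + s) / (de * rho) * t ^+ 2).
Proof.
move=> d0 s0 r1 t0 /andP[e20 e21] eta0 h1 h2.
have e10 : 0 < E1 by exact: lt_le_trans (expR_gt0 _) h2.
have r0 : 0 < rho by exact: lt_le_trans r1.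
have p1 : 0 <= eta * expR ((rho + s) / de) by rewrite mulr_ge0 ?expR_ge0.
have p2 : 0 <= (1 + s) / (de * rho) * t ^+ 2.
  by rewrite mulr_ge0 ?sqr_ge0 // divr_ge0 ?addr_ge0 // ltW // mulr_gt0.
case: (leP t rho) => tr.
- have h3 : ln (E2 / E1) <= E2 / E1 - 1 by apply: ln_le_sub1; rewrite divr_gt0.
  rewrite ln_div ?posrE // in h3.
  suff : E2 / E1 - 1 <= eta * expR ((rho + s) / de) by lra.
  have -> : E2 / E1 - 1 = (E2 - E1) / E1 by rewrite mulrBl divff ?gt_eqF.
  apply: (@le_trans _ _ (eta / E1)).
    by rewrite ler_wpM2r ?invr_ge0 ?(ltW e10) //; lra.
  rewrite ler_wpM2l // -[expR _]invrK -expRN lef_pV2 ?posrE ?expR_gt0 //.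
  apply: le_trans h2; rewrite ler_expR lerN2 ler_wpM2r ?invr_ge0 ?(ltW d0) //; lra.
- have h3 : - ((t + s) / de) <= ln E1 by rewrite -[leLHS]expRK ler_ln ?posrE ?expR_gt0.
  have h4 : ln E2 <= 0 by rewrite -ln1 ler_ln ?posrE.
  suff : (t + s) / de <= (1 + s) / (de * rho) * t ^+ 2 by lra.
  have -> : (1 + s) / (de * rho) * t ^+ 2 = ((1 + s) * (t ^+ 2 / rho)) / de.
    by field; rewrite !gt_eqF.
  rewrite ler_wpM2r ?invr_ge0 ?(ltW d0) //.
  have h5 : t <= t ^+ 2 / rho by rewrite ler_pdivlMr // expr2 ler_wpM2l // ltW.
  have h6 : 1 <= t by lra.
  have h7 : s * 1 <= s * (t ^+ 2 / rho) by rewrite ler_wpM2l //; lra.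
  by rewrite mulrDl mul1r; lra.
Qed.

(* The relative entropy of [N(0, S)] with respect to the smoothed density is at most [e]; the pointwise
   bound by [w] avoids discussing integrability of the logarithm of that density. *)
Definition kl_close (p : k.-tuple R -> R) (de : R) j e :=
  exists S : 'M[R]_k, exists w : k.-tuple R -> R,
  [/\ posdef S, measurable_fun setT w, forall x, 0 <= w x,
      (\int[@lebR R k]_x (w x * gauss_density S x)%:E <= e%:E)%E &
      forall x, 0 < smoothed de (iter j dbl p) x /\
         - ln (smoothed de (iter j dbl p) x) <= - ln (gauss_density S x) + w x].

(** [j0] comes before [p] in the quantifiers, which permits fixing the number of doublings before
    the family. The error consists of two parts of size [e / 2]: the kernel estimate inside the ball
    [|x|^2 <= rho] and the tail outside. *)
Lemma clt_kl K a de e : 0 < de -> 0 < e -> exists j0, forall j, (j0 <= j)%N -> forall p,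
  gb K a p -> (forall x, p (tscale (-1) x) = p x) -> Int p = 1 -> kl_close p de j e.
Proof.
move=> d0 e0.
(* A member [p0] of the class yields [0 < a] and [0 <= K], from which the signs of the constants
   follow; if there is none, nothing is to be shown. *)
case: (pselect (exists p0 : k.-tuple R -> R, gb K a p0)) => [[p0 G0]|nG]; last first.
  by exists 0%N => j _ p G; exfalso; apply: nG; exists p.
have G2 := gb_moment2 G0; have G4 := gb_moment4 G0.
set K2 := 2 / a * K in G2; set K4 := 16 / a ^+ 2 * K in G4.
have a20 : 0 < a / 2 by case: G2.
set sq := Num.sqrt (pi / (a / 2)) ^+ k.
have sq0 : 0 <= sq by rewrite exprn_ge0 ?sqrtr_ge0.
have K20 := gb_K0 G2; have K40 := gb_K0 G4.
(* Bounds for the second and fourth moments of every [p] in the class. *)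
pose sb := K2 * sq; pose Mp := K4 * sq.
have sb0 : 0 <= sb by exact: mulr_ge0.
have Mp0 : 0 <= Mp by exact: mulr_ge0.
have M40 := M4_ge0 (R := R) k; have ck0 := ckern_ge0 (R := R).
(* Bounds the fourth moment of the limiting Gaussian ([gd_mom4] with [nsq B <= sb]); [rho] is then
   so large that the tail part of [w] integrates to at most [e / 2]. *)
pose V := 8 * de ^+ 2 * M4 k + 8 * sb ^+ 2 * M4 k.
have V0 : 0 <= V by rewrite addr_ge0 // mulr_ge0 // mulr_ge0 ?sqr_ge0.
pose rho := 1 + 2 * (1 + sb) * V / (de * e).
have de0 := ltW d0; have e0w := ltW e0.
have r1 : 1 <= rho by rewrite lerDl; apply: divr_ge0; pos.
pose b := (2 * de)^-1.
have b0 : 0 <= b by rewrite invr_ge0 mulr_ge0 // ltW.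
pose Cb := ckern * b ^+ 2 * (Mp + sb ^+ 2 * M4 k).
have Cb0 : 0 <= Cb.
  by apply: mulr_ge0; [apply: mulr_ge0 => //; exact: sqr_ge0|apply: addr_ge0 => //; apply: mulr_ge0 => //; exact: sqr_ge0].
pose Ex := expR ((rho + sb) / de).
(* [T <= 2 ^+ j] is exactly the condition [eta * Ex <= e / 2] below. *)
pose T := 2 * Cb * Ex / e.
have T0 : 0 <= T by rewrite divr_ge0 ?(ltW e0) // mulr_ge0 ?expR_ge0 // mulr_ge0.
exists (Num.bound T) => j jT p G pe p1.
have p0' y : 0 <= p y by exact: gb_ge0 G.
have [B hB] := psd_decomp (covm_psd G).
pose s := nsq B; have s0 : 0 <= s by exact: nsq_ge0.
have hs := secmom_norm G hB.
have ssb : s <= sb by rewrite -lee_fin -hs (le_trans (gb_int_le (gb_moment2 G))).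
have hM : (\int[@lebR R k]_y (tdot y y ^+ 2 * p y)%:E <= Mp%:E)%E.
  exact: (le_trans (gb_int_le (gb_moment4 G))).
have [Kj Gj] := gb_iter_dbl j G; have pj1 := Int_iter_dbl j G p1.
have hsj := secmom_iter_dbl j G pe p1 hs.
pose eta := Cb / 2 ^+ j.
have eta0 : 0 <= eta by rewrite divr_ge0 ?exprn_ge0.
have etaE : eta * Ex <= e / 2.
  have hb : T <= 2 ^+ j.
    apply: (le_trans (ltW (archi_boundP T0))).
    rewrite (le_trans (_ : (Num.bound T)%:R <= j%:R)) ?ler_nat //.
    by rewrite -natrX ler_nat ltnW // ltn_expl.
  have P0 : 0 < (2:R) ^+ j by rewrite exprn_gt0.
  rewrite /eta mulrAC ler_pdivrMr //.
  have : T * e <= 2 ^+ j * e by rewrite ler_wpM2r // ltW.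
  rewrite /T mulfVK ?gt_eqF //; lra.
exists (de%:M + B^T *m B), (fun x => eta * Ex + (1 + sb) / (de * rho) * tdot x x ^+ 2).
have rho0 : 0 < rho by exact: lt_le_trans r1.
have pS : posdef (de%:M + B^T *m B) by apply: posdef_addr (psd_gram B); exact: posdef_scalar.
have c0 : 0 <= (1 + sb) / (de * rho) by rewrite divr_ge0 ?addr_ge0 // ltW // mulr_gt0.
have c1 : 0 <= eta * Ex by rewrite mulr_ge0 ?expR_ge0.
have mT2 : measurable_fun setT (fun x : k.-tuple R => tdot x x ^+ 2) by apply: measurable_funX; exact: measurable_tdot.
have mg := measurable_gd (de%:M + B^T *m B).
split => //.
- by apply: measurable_funD => //; exact: measurable_funM.
- by move=> x; rewrite addr_ge0 // mulr_ge0 // sqr_ge0.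
- under eq_integral => x _ do rewrite mulrDl -(mulrA ((1 + sb) / (de * rho))).
  have mTg : measurable_fun setT (fun x => tdot x x ^+ 2 * gauss_density (de%:M + B^T *m B) x) by exact: measurable_funM.
  have Tg0 x : 0 <= tdot x x ^+ 2 * gauss_density (de%:M + B^T *m B) x by rewrite mulr_ge0 ?sqr_ge0 ?gd_ge0.
  have gg0 x := gd_ge0 (de%:M + B^T *m B) x.
  rewrite ge0_int_add; last 4 first.
  + exact: measurable_funM.
  + exact: measurable_funM.
  + by move=> y; apply: mulr_ge0.
  + by move=> y; apply: mulr_ge0.
  rewrite !int_scaler // int_gd // mule1.
  apply: (@le_trans _ _ ((eta * Ex)%:E + ((1 + sb) / (de * rho))%:E * V%:E)%E).
    apply: leeD2l; apply: lee_wpmul2l; first by rewrite lee_fin.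
    apply: (le_trans (gd_mom4 B d0)); rewrite lee_fin /V lerD2l.
    by apply: ler_wpM2r => //; apply: ler_wpM2l => //; rewrite ler_sqr ?nnegrE.
  rewrite -EFinM -EFinD lee_fin.
  suff : (1 + sb) / (de * rho) * V <= e / 2 by lra.
  have -> : (1 + sb) / (de * rho) * V = (1 + sb) * V / de / rho by field; rewrite !gt_eqF.
  rewrite ler_pdivrMr //.
  have -> : e / 2 * rho = e / 2 + (1 + sb) * V / de by rewrite /rho; field; rewrite !gt_eqF.
  by rewrite lerDr divr_ge0 // ltW.
move=> x.
have [_ L] := kernel_clt (b := b) j x G pe p1 hB hM b0.
pose E1 := fine (Ek 1%:M (iter j dbl p) b (-1) x); pose E2 := fine (Ek B (@gd1 R k) b (-1) x).
have f1 : Ek 1%:M (iter j dbl p) b (-1) x = E1%:E.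
  rewrite fineK // ge0_fin_numE; first by rewrite (le_lt_trans (Ek_le1 _ _ _ Gj pj1 b0)) ?ltry.
  by apply: Ek_ge0 => y; exact: gb_ge0 Gj.
have g1 : Int (@gd1 R k) = 1 by rewrite /Int int_gd1.
have f2 : Ek B (@gd1 R k) b (-1) x = E2%:E.
  rewrite fineK // ge0_fin_numE; first by rewrite (le_lt_trans (Ek_le1 _ _ _ (@gb_gd1 R k) g1 b0)) ?ltry.
  by apply: Ek_ge0 => y; exact: gd1_ge0.
pose N := (Num.sqrt (2 * pi * de) ^+ k)^-1.
have N0 : 0 < N by rewrite invr_gt0 exprn_gt0 // sqrtr_gt0 !mulr_gt0 // pi_gt0.
have cE : smoothed de (iter j dbl p) x = N * E1.
  by have := smoothedE x d0 Gj pj1; rewrite f1 -EFinM => -[].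
have gE : gauss_density (de%:M + B^T *m B) x = N * E2.
  by have := gd_gramE B x d0; rewrite f2 -EFinM => -[].
have lb : expR (- ((tdot x x + s) / de)) <= E1.
  have := Ek_lb x Gj pj1 b0 s0 hsj; rewrite f1 lee_fin /b.
  by rewrite (_ : 2 * (2 * de)^-1 * (tdot x x + s) = (tdot x x + s) / de) //; field; rewrite gt_eqF.
have E10 : 0 < E1 by exact: lt_le_trans (expR_gt0 _) lb.
have E20 : 0 < E2 by rewrite -(pmulr_rgt0 _ N0) -gE; exact: gd_gt0.
have E21 : E2 <= 1 by rewrite -lee_fin -f2 (Ek_le1 _ _ _ (@gb_gd1 R k)).
have up : E2 <= E1 + eta.
  move: L; rewrite f1 f2 -EFinD lee_fin => L; apply: (le_trans L); rewrite lerD2l /eta.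
  rewrite ler_wpM2r ?invr_ge0 ?exprn_ge0 // /Cb -/s; apply: ler_wpM2l.
    by rewrite mulr_ge0 ?sqr_ge0.
  by rewrite lerD2l; apply: ler_wpM2r => //; rewrite ler_sqr ?nnegrE.
have lb' : expR (- ((tdot x x + sb) / de)) <= E1.
  by apply: le_trans lb; rewrite ler_expR lerN2 ler_wpM2r ?invr_ge0 ?(ltW d0) // lerD2l.
rewrite cE gE; split; first exact: mulr_gt0.
have E2b : 0 < E2 <= 1 by rewrite E20 E21.
have := split_bound d0 sb0 r1 (tdot_ge0 x) E2b eta0 up lb'.
by rewrite !lnM ?posrE // -/Ex; lra.
Qed.

End CLT.

(** * Blocks, couplings and entropy *)

Section Blocks.
Context {R : realType}.
Variables (n : nat) (d : 'I_n -> nat).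
Notation N := (dimE d).
Notation fam := (forall i : 'I_n, (d i).-tuple R).
Implicit Types (x y z : N.-tuple R) (i : 'I_n).

Lemma sum_blocks (V : nmodType) (F : 'I_N -> V) :
  \sum_s F s = \sum_i \sum_(k < d i) F (tagnat.Rank i k).
Proof.
rewrite sig_big_dep (reindex tagnat.rank) /=; last exact: tagnat.rank_bij_on.
by apply: eq_bigr => -[i k] _.
Qed.

Lemma tnth_block i x k : tnth (block_proj i x) k = tnth x (tagnat.Rank i k).
Proof.
rewrite tnth_mktuple (tnth_nth 0); congr nth.
by rewrite /tagnat.Rank tagnat.rankEsum.
Qed.

Lemma sumn_take_off i : sumn (take i [seq d j | j <- enum 'I_n]) = off d i.
Proof.
rewrite /off (big_ord_narrow (ltnW (ltn_ord i))) sumnE (big_nth 0%N) size_take size_map size_enum_ord ltn_ord.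
rewrite big_mkord; apply: eq_bigr => j _.
rewrite nth_take // (nth_map i) ?size_enum_ord ?(ltn_trans (ltn_ord j)) //; congr d; apply: val_inj => /=.
by rewrite nth_enum_ord // (ltn_trans (ltn_ord j)).
Qed.

(** The coordinate [tagnat.Rank i k] read by the projection and the position [flatten_index] in the
    flattened sequence are both [off d i + k]. *)
Lemma block_glue (xs : fam) i : block_proj i (Defs.glue xs) = xs i.
Proof.
apply: eq_from_tnth => k; rewrite tnth_block tnth_mktuple /tagnat.Rank tagnat.rankEsum /= -/(off d i).
set ss := map _ _.
have shE : shape ss = [seq d j | j <- enum 'I_n].
  by rewrite /shape -map_comp; apply: eq_map => j; rewrite /= size_tuple.
have kl : (k < nth 0 (shape ss) i)%N by rewrite shE (nth_map i) ?size_enum_ord // nth_ord_enum.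
have E : (off d i + k = flatten_index (shape ss) i k)%N by rewrite /flatten_index shE sumn_take_off.
rewrite nth_flatten [(_ + _)%N]E flatten_indexKl // flatten_indexKr //.
by rewrite (nth_map i) ?size_enum_ord // nth_ord_enum -tnth_nth.
Qed.

Lemma block_inj x y : (forall i, block_proj i x = block_proj i y) -> x = y.
Proof.
move=> h; apply: eq_from_tnth => s; rewrite -(tagnat.sig2K s).
by have := congr1 (fun t => tnth t (tagnat.sig2 s)) (h (tagnat.sig1 s)); rewrite /= !tnth_block.
Qed.

Lemma block_tadd i x y : block_proj i (tadd x y) = tadd (block_proj i x) (block_proj i y).
Proof. by apply: eq_from_tnth => k; rewrite tnthD !tnth_block tnthD. Qed.
Lemma block_tscale i a x : block_proj i (tscale a x) = tscale a (block_proj i x).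
Proof. by apply: eq_from_tnth => k; rewrite tnthZ !tnth_block tnthZ. Qed.
Lemma block_rotp i x y : block_proj i (rotp x y) = rotp (block_proj i x) (block_proj i y).
Proof. by rewrite block_tscale block_tadd. Qed.
Lemma block_rotm i x y : block_proj i (rotm x y) = rotm (block_proj i x) (block_proj i y).
Proof. by rewrite block_tscale block_tadd block_tscale. Qed.

Lemma measurable_block i : measurable_fun setT (@block_proj R n d i).
Proof.
apply/measurable_fun_tnthP => k.
rewrite (_ : _ \o _ = fun x => tnth x (tagnat.Rank i k)); last by apply/funext => x /=; rewrite tnth_block.
exact: measurable_tnth.
Qed.

Lemma tdot_blocks x : tdot x x = \sum_i tdot (block_proj i x) (block_proj i x).
Proof.
rewrite /tdot sum_blocks; apply: eq_bigr => i _; apply: eq_bigr => k _.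
by rewrite tnth_block.
Qed.

Definition bmask i x : N.-tuple R := [tuple if tagnat.sig1 s == i then tnth x s else 0 | s < N].

Lemma block_bmask i x j : block_proj j (bmask i x) = if j == i then block_proj j x else tzero.
Proof.
apply: eq_from_tnth => k; rewrite tnth_block tnth_mktuple tagnat.Rank1K.
by case: ifP; rewrite ?tnth_block ?tnth_tzero.
Qed.

Lemma qformD (Q : 'M[R]_N) x y : Q^T = Q ->
  qform Q (tadd x y) = qform Q x + qform Q y + 2 * bil Q (trow x) (trow y).
Proof.
move=> hQ; rewrite !qformE trowD bilDl !bilDr (bilC (trow y) (trow x) hQ); ring.
Qed.
Lemma qformZ (Q : 'M[R]_N) a x : qform Q (tscale a x) = a ^+ 2 * qform Q x.
Proof. by rewrite !qformE trowZ bilZl bilZr; ring. Qed.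

(* Signs are added block by block, each making its cross term nonnegative. *)
Lemma sign_choice (Q : 'M[R]_N) x : Q^T = Q -> exists x',
  (forall i, block_proj i x' = block_proj i x \/ block_proj i x' = tscale (-1) (block_proj i x)) /\
  \sum_i qform Q (bmask i x) <= qform Q x'.
Proof.
move=> hQ.
have H (s : seq 'I_n) : uniq s -> exists x',
  (forall i, i \in s -> block_proj i x' = block_proj i x \/ block_proj i x' = tscale (-1) (block_proj i x)) /\
  (forall i, i \notin s -> block_proj i x' = tzero) /\
  \sum_(i <- s) qform Q (bmask i x) <= qform Q x'.
  elim: s => [|i s IH] /=.
    exists tzero; split => //; split; last by rewrite big_nil qformE trow0 /bil mul0mx mul0mx mxE.
    by move=> i _; apply: eq_from_tnth => k; rewrite tnth_block !tnth_tzero.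
  move=> /andP[nis us]; have [x' [h1 [h2 h3]]] := IH us.
  pose sg : R := if 0 <= bil Q (trow x') (trow (bmask i x)) then 1 else -1.
  have sg2 : sg ^+ 2 = 1 by rewrite /sg; case: ifP => _; ring.
  have bl j : block_proj j (tadd x' (tscale sg (bmask i x))) =
     if j == i then tscale sg (block_proj j x) else block_proj j x'.
    rewrite block_tadd block_tscale block_bmask; case: eqP => [->|_].
      by rewrite h2 //; apply: eq_from_tnth => k; rewrite tnthD tnth_tzero add0r.
    by apply: eq_from_tnth => k; rewrite tnthD tnthZ tnth_tzero mulr0 addr0.
  exists (tadd x' (tscale sg (bmask i x))); split.
    move=> j; rewrite inE bl; case: eqP => [-> _|_ /= js]; last exact: h1.
    rewrite /sg; case: ifP => _; [left|by right].
    by apply: eq_from_tnth => k; rewrite tnthZ mul1r.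
  split.
    by move=> j; rewrite inE negb_or bl => /andP[/negbTE -> js]; exact: h2.
  rewrite big_cons qformD // qformZ sg2 mul1r trowZ bilZr addrC.
  rewrite -addrA; apply: lerD => //; rewrite lerDl; apply: mulr_ge0 => //.
  rewrite /sg; case: ifP => [b0|/negbT]; first by rewrite mul1r.
  by rewrite -ltNge mulN1r oppr_ge0 => /ltW.
have [x' [h1 [_ h3]]] := H (enum 'I_n) (enum_uniq _).
exists x'; split; first by move=> i; apply: h1; rewrite mem_enum.
by apply: le_trans h3; rewrite big_enum.
Qed.

End Blocks.

Section Young.
Context {R : realType}.

(** Weighted Young inequality combined with [|u Q|^2 <= nsq Q |u|^2]; the weight [t] decides which
    argument absorbs the cross term. *)
Lemma bil_young k (Q : 'M[R]_k) (u v : 'rV[R]_k) t : 0 < t ->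
  2 * bil Q u v <= t * nsq Q * nsq u + nsq v / t.
Proof.
move=> t0.
apply: (@le_trans _ _ (t * nsq (u *m Q) + nsq v / t)).
  rewrite /bil mxE !nsq_row !mulr_sumr mulr_suml -big_split /=; apply: ler_sum => j _.
  rewrite [v^T _ _]mxE; set a := (u *m Q) 0 j; set b := v 0 j.
  have : 0 <= (t * a - b) ^+ 2 / t by rewrite divr_ge0 ?sqr_ge0 // ltW.
  rewrite (_ : (t * a - b) ^+ 2 / t = t * a ^+ 2 + b ^+ 2 / t - 2 * (a * b)); last by field; rewrite gt_eqF.
  by lra.
rewrite lerD2r -mulrA; apply: ler_wpM2l; first exact: ltW.
by rewrite mulrC nsq_mulmx.
Qed.

Lemma qform_le k (Q : 'M[R]_k) x : qform Q x <= (nsq Q + 1) * tdot x x.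
Proof.
have := bil_young Q (trow x) (trow x) (@ltr01 R).
rewrite -qformE mul1r divr1 -tdot_nsq.
have : 0 <= nsq Q * tdot x x by rewrite mulr_ge0 ?nsq_ge0 ?tdot_ge0.
have := tdot_ge0 x; lra.
Qed.

End Young.

(** * Integration against measures whose image has a density *)

Section Density.
Context {R : realType} {d1 d2 : measure_display} {T : measurableType d1} {T' : measurableType d2}.
Variables (mu : {measure set T -> \bar R}) (lam : {measure set T' -> \bar R}).
Variables (phi : T -> T') (w : T' -> R).
Hypotheses (mphi : measurable_fun setT phi) (mw : measurable_fun setT w) (w0 : forall x, 0 <= w x).
Hypothesis H : forall A, measurable A -> mu (phi @^-1` A) = (\int[lam]_(x in A) (w x)%:E)%E.

Lemma density_indic (r : R) (A : set T') : 0 <= r -> measurable A ->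
  (\int[mu]_x (r * \1_A (phi x))%:E = \int[lam]_x (r * \1_A x * w x)%:E)%E.
Proof.
move=> r0 mA.
have mpA : measurable (phi @^-1` A) by rewrite -[_ @^-1` _]setTI; exact: mphi.
have -> : (\int[mu]_x (r * \1_A (phi x))%:E = r%:E * mu (phi @^-1` A))%E.
  under eq_integral => x _ do rewrite EFinM.
  rewrite ge0_integralZl //; last first.
    have mI : measurable_fun setT (\1_A : T' -> R) by exact: measurable_indic.
    by apply/measurable_EFinP; exact: (mcomp mI mphi).
  by rewrite -[X in mu X](setIT (phi @^-1` A)) -integral_indic.
rewrite H // integral_mkcond.
under [in RHS]eq_integral => x _ do rewrite -mulrA EFinM.
rewrite ge0_integralZl //; last 2 first.
- by apply/measurable_EFinP; apply: measurable_funM => //; exact: measurable_indic.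
- by move=> x _; rewrite lee_fin mulr_ge0.
congr (_ * _)%E; apply: eq_integral => x _; rewrite patchE indicE.
by case: ifP => _; rewrite ?mul1r ?mul0r.
Qed.

Lemma density_nnsfun (h : {nnsfun T' >-> R}) :
  (\int[mu]_x (h (phi x))%:E = \int[lam]_x (h x * w x)%:E)%E.
Proof.
have fin := fimfunP h.
have mi r : measurable (h @^-1` [set r]) by [].
transitivity (\sum_(k \in range h) \int[mu]_x (k * \1_(h @^-1` [set k]) (phi x))%:E)%E.
  under eq_integral => x _ do rewrite fimfunE -fsumEFin //.
  rewrite ge0_integral_fsum //.
  - move=> r; apply/measurable_EFinP; apply: measurable_funM => //.
    have mI : measurable_fun setT (\1_(h @^-1` [set r]) : T' -> R) by exact: measurable_indic.
    exact: (mcomp mI mphi).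
  - by move=> r x _; rewrite nnfun_muleindic_ge0.
transitivity (\sum_(k \in range h) \int[lam]_x (k * \1_(h @^-1` [set k]) x * w x)%:E)%E.
  apply: eq_fsbigr => r; rewrite inE => -[y _ <-].
  exact: density_indic.
rewrite -ge0_integral_fsum //; last 2 first.
- move=> r; apply/measurable_EFinP; apply: measurable_funM => //; apply: measurable_funM => //.
- by move=> r x _; rewrite EFinM mule_ge0 // ?nnfun_muleindic_ge0 // lee_fin.
apply: eq_integral => x _; rewrite [in RHS]fimfunE.
rewrite fsumEFin //; congr EFin; rewrite !fsbig_finite //= mulr_suml; by apply: eq_bigr.
Qed.

(** The passage from indicators ([density_indic]) to simple functions ([density_nnsfun]) to
    increasing limits. It serves for the block projections of a coupling and, with [phi = id], for
    Gaussian measures. *)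
Lemma density_change (f : T' -> R) : measurable_fun setT f -> (forall x, 0 <= f x) ->
  (\int[mu]_x (f (phi x))%:E = \int[lam]_x (f x * w x)%:E)%E.
Proof.
move=> mf f0.
have mfE : measurable_fun setT (EFin \o f) by exact/measurable_EFinP.
pose h := nnsfun_approx measurableT mfE.
have hc x : (h^~ x @ \oo --> f x).
  have := @cvg_nnsfun_approx _ _ _ _ measurableT _ mfE (fun x _ => f0 x) x I.
  by move/fine_cvgP => [_].
have nd x : nondecreasing_seq (h^~ x).
  by move=> m n mn; exact/lefP/(nd_nnsfun_approx measurableT mfE mn).
have mh n : measurable_fun setT (h n) by exact: measurable_funP.
have L : (\int[mu]_x (f (phi x))%:E = limn (fun n => \int[mu]_x (h n (phi x))%:E))%E.
  rewrite -monotone_convergence //.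
  - apply: eq_integral => x _; apply/esym/cvg_lim => //.
    by apply: cvg_EFin; [exact: nearW | exact: hc].
  - by move=> n; apply/measurable_EFinP; exact: (measurableT_comp (mh n)).
  - by move=> n x _; rewrite lee_fin.
  - by move=> x _ m n mn; rewrite lee_fin; exact: nd.
rewrite L; under eq_fun => n do rewrite density_nnsfun.
rewrite -monotone_convergence //.
- apply: eq_integral => x _; apply/cvg_lim => //.
  by apply: cvg_EFin; [exact: nearW | apply: cvgMl; exact: hc].
- by move=> n; apply/measurable_EFinP; exact: measurable_funM.
- by move=> n x _; rewrite lee_fin mulr_ge0.
- by move=> x _ m n mn; rewrite lee_fin ler_wpM2r //; exact: nd.
Qed.

Lemma density_integrable (f : T' -> R) : measurable_fun setT f ->
  lam.-integrable setT (fun x => (f x * w x)%:E) ->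
  mu.-integrable setT (fun x => (f (phi x))%:E) /\
  (\int[mu]_x (f (phi x))%:E = \int[lam]_x (f x * w x)%:E)%E.
Proof.
move=> mf fi.
have mfp : measurable_fun setT (fun x => f (phi x)) by exact: measurableT_comp mf mphi.
have mfw : measurable_fun setT (fun x => f x * w x) by exact: measurable_funM.
have aw x : `|f x| * w x = `|f x * w x| by rewrite normrM (ger0_norm (w0 x)).
have I : mu.-integrable setT (fun x => (f (phi x))%:E).
  apply/integrableP; split; first exact/measurable_EFinP.
  have /integrableP[_] := fi; apply: le_lt_trans.
  rewrite (density_change (f := fun x => `|f x|)) //.
    by under eq_integral => x _ do rewrite aw.
  exact: measurableT_comp.
split => //.
pose fp x := Num.max (f x) 0; pose fn x := Num.max (- f x) 0.
have mfp' : measurable_fun setT fp by exact: measurable_maxr.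
have mfn' : measurable_fun setT fn by apply: measurable_maxr => //; exact: measurableT_comp.
rewrite integralE [in RHS]integralE; congr (_ - _)%E.
- transitivity (\int[mu]_x (fp (phi x))%:E)%E.
    by apply: eq_integral => x _; rewrite funeposE /fp EFin_max.
  rewrite density_change //; last by move=> x; rewrite le_max lexx orbT.
  apply: eq_integral => x _; rewrite funeposE -EFin_max; congr EFin.
  by rewrite /fp maxr_pMl // mul0r.
- transitivity (\int[mu]_x (fn (phi x))%:E)%E.
    by apply: eq_integral => x _; rewrite funenegE /fn EFin_max.
  rewrite density_change //; last by move=> x; rewrite le_max lexx orbT.
  apply: eq_integral => x _; rewrite funenegE -EFinN -EFin_max; congr EFin.
  by rewrite /fn maxr_pMl // mul0r mulNr.
Qed.

End Density.

(** * Gaussian entropy and traces *)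

Section Entropy.
Context {R : realType}.
Variable k : nat.
Implicit Type S : 'M[R]_k.

Definition nrm S : R := ln (Num.sqrt ((2 * pi) ^+ k * \det S)).
(** Closed form of the differential entropy of [N(0, S)], as [gauss_entropyE] shows; [nrm] is the
    logarithm of the normalising constant. *)
Definition ent S : R := k%:R / 2 + nrm S.

Lemma gd_norm_gt0 S : posdef S -> 0 < Num.sqrt ((2 * pi) ^+ k * \det S).
Proof.
move=> pS; have d0 := posdef_det pS.
by rewrite sqrtr_gt0 mulr_gt0 // exprn_gt0 // mulr_gt0 // pi_gt0.
Qed.

Lemma lngd S x : posdef S -> - ln (gauss_density S x) = qform (invmx S) x / 2 + nrm S.
Proof.
move=> pS; rewrite /gauss_density ln_div ?posrE ?expR_gt0 ?gd_norm_gt0 // expRK /nrm; ring.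
Qed.

Lemma Int_trace S (Q : 'M[R]_k) : posdef S ->
  integ (fun x => qform Q x * gauss_density S x) /\
  Int (fun x => qform Q x * gauss_density S x) = \tr (Q *m S).
Proof.
move=> pS; have [K [a G]] := gb_gd pS; have [I1 I2] := Int_qform Q G; split => //.
rewrite I2 covm_gd // /mxtrace; apply: eq_bigr => i _; rewrite mxE; apply: eq_bigr => j _.
by case: pS => /matrixP /(_ i j) + _; rewrite mxE => ->.
Qed.

Lemma integ_lngd S : posdef S ->
  integ (fun x => - ln (gauss_density S x) * gauss_density S x) /\
  Int (fun x => - ln (gauss_density S x) * gauss_density S x) = ent S.
Proof.
move=> pS; have [K [a G]] := gb_gd pS; have [I1 I2] := Int_trace (invmx S) pS.
have E : (fun x => - ln (gauss_density S x) * gauss_density S x) =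
   (fun x => 2^-1 * (qform (invmx S) x * gauss_density S x) + nrm S * gauss_density S x).
  by apply/funext => x; rewrite lngd //; ring.
have gi := gb_integrable G.
have i1 := integZ 2^-1 I1; have i2 := integZ (nrm S) gi.
rewrite E; split; first exact: integD.
rewrite IntD // !IntZ // I2 mulVmx ?posdef_unit // mxtrace1 /ent.
by rewrite /Int int_gd //=; ring.
Qed.

Lemma gauss_entropyE S : posdef S -> gauss_entropy S = (ent S)%:E.
Proof.
move=> pS; have [I1 I2] := integ_lngd pS.
have E : (fun x => gauss_density S x * ln (gauss_density S x)) =
    (fun x => -1 * (- ln (gauss_density S x) * gauss_density S x)).
  by apply/funext => x; ring.
have I := integZ (-1) I1; have J := IntZ (-1) I1.
rewrite /gauss_entropy.
under eq_integral => x _ do rewrite (congr1 (fun h => h x) E).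
by rewrite -integE // J I2 -EFinN mulN1r opprK.
Qed.

End Entropy.

(** * Integrals against couplings *)

Section Coupling.
Context {R : realType}.
Variables (n : nat) (d : 'I_n -> nat).
Notation N := (dimE d).
Variables (S : forall i : 'I_n, 'M[R]_(d i)) (mu : probability (N.-tuple R) R).
Hypotheses (pS : forall i, posdef (S i)) (cpl : gauss_coupling S mu).

Lemma coupling_integrable i (f : (d i).-tuple R -> R) : measurable_fun setT f ->
  integ (fun x => f x * gauss_density (S i) x) ->
  mu.-integrable setT (fun x => (f (block_proj i x))%:E) /\
  (\int[mu]_x (f (block_proj i x))%:E = (Int (fun x => f x * gauss_density (S i) x))%:E)%E.
Proof.
move=> mf I; rewrite (integE I).
apply: (density_integrable (phi := @block_proj R n d i)) => //.
- exact: measurable_block.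
- exact: measurable_gd.
- by move=> x; exact: gd_ge0.
- by move=> A mA; exact: cpl.
Qed.

(** [|qform Q x|] is at most a multiple of [|x|^2], a sum of functions of single blocks, and those
    are integrated by the marginals. *)
Lemma qform_coupling_integrable (Q : 'M[R]_N) :
  mu.-integrable setT (fun x => (qform Q x)%:E).
Proof.
pose C := nsq Q + 1.
have C0 : 0 <= C by rewrite addr_ge0 ?nsq_ge0.
have h i : mu.-integrable setT (fun x => (C * tdot (block_proj i x) (block_proj i x))%:E).
  have [K [a G]] := gb_gd (pS i); have mT : measurable_fun setT (fun x : (d i).-tuple R => tdot x x) by exact: measurable_tdot.
  apply: (coupling_integrable (f := fun x => C * tdot x x) _ _).1; first exact: measurable_funM.
  rewrite (_ : (fun x => _) = fun x => C * (tdot x x * gauss_density (S i) x)).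
    exact: integZ (gb_integrable (gb_moment2 G)).
  by apply/funext => x; rewrite mulrA.
apply: (le_integrable measurableT _ _ (integrable_sum measurableT (index_enum 'I_n) (P := xpredT) (fun i _ => h i))).
  by apply/measurable_EFinP; exact: measurable_qform.
move=> x _ /=; rewrite sumEFin -mulr_sumr -tdot_blocks lee_fin [leRHS]ger0_norm; last first.
  by rewrite mulr_ge0 ?tdot_ge0.
rewrite ler_norml; apply/andP; split; last exact: qform_le.
rewrite lerNl; have := qform_le (- Q) x; rewrite !qformE.
have -> : bil (- Q) (trow x) (trow x) = - bil Q (trow x) (trow x) by rewrite /bil mulmxN mulNmx mxE.
suff -> : nsq (- Q) = nsq Q by [].
by apply: eq_bigr => i _; apply: eq_bigr => j _; rewrite mxE sqrrN.
Qed.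

(** Weak duality: a separable majorant of [qform Q] has the same integral under every coupling,
    because it only sees the marginals. *)
Lemma coupling_le (Q : 'M[R]_N) (c : R) (f : forall i, (d i).-tuple R -> R) :
  (forall i, measurable_fun setT (f i)) ->
  (forall i, integ (fun x => f i x * gauss_density (S i) x)) ->
  (forall x, qform Q x <= c + \sum_i f i (block_proj i x)) ->
  (\int[mu]_x (qform Q x)%:E <= (c + \sum_i Int (fun x => f i x * gauss_density (S i) x))%:E)%E.
Proof.
move=> mf If H.
have h i := coupling_integrable (mf i) (If i).
have hi := integrable_sum measurableT (index_enum 'I_n) (P := xpredT) (fun i _ => (h i).1).
have hc : mu.-integrable setT (fun=> c%:E) by exact: finite_measure_integrable_cst.
have hs := integrableD measurableT hc hi.
apply: (@le_trans _ _ (\int[mu]_x (c%:E + \sum_(i < n) (f i (block_proj i x))%:E))%E).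
  apply: le_integral => //; first exact: qform_coupling_integrable.
  by move=> x _; rewrite sumEFin -EFinD lee_fin.
have hcE : (\int[mu]_x c%:E = c%:E)%E.
  apply: (etrans (integral_cst mu (measurableT : measurable [set: N.-tuple R]) c%:E)).
  exact: (etrans (congr1 (fun t => c%:E * t)%E (probability_setT mu)) (mule1 _)).
rewrite integralD // hcE.
rewrite integral_sum //; last by move=> i; exact: (h i).1.
rewrite (eq_bigr (fun i => (Int (fun x => f i x * gauss_density (S i) x))%:E)).
  by rewrite sumEFin -EFinD.
by move=> i _; exact: (h i).2.
Qed.

End Coupling.

(** * Even families *)

Section ProdSup.
Context {R : realType}.
Variables (n : nat) (d : 'I_n -> nat) (c : 'I_n -> R).
Hypothesis hc : forall i, 0 < c i.
Notation fam := (forall i : 'I_n, (d i).-tuple R).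

Lemma prod_sup_le (f : forall i, (d i).-tuple R -> R) (t : 'I_n -> R) A :
  0 <= A -> (forall i, 0 <= t i) -> (forall i r, r < t i -> exists y, r < f i y) ->
  (forall y : fam, \prod_i f i (y i) `^ c i <= A) -> \prod_i t i `^ c i <= A.
Proof.
move=> A0 t0 ht H.
have [[i ti]|tpos] := pselect (exists i, t i = 0).
  rewrite (bigD1 i) //= ti powR0 ?mul0r // gt_eqF //.
have tp i : 0 < t i by rewrite lt_neqAle t0 andbT eq_sym; apply/eqP => ti; apply: tpos; exists i.
set P := \prod_i _; have P0 : 0 <= P by apply: prodr_ge0 => i _; exact: powR_ge0.
pose s := \sum_i c i; have s0 : 0 <= s by apply: sumr_ge0 => i _; exact: ltW.
(* Suprema need not be attained: each [t i] is shrunk by [exp (- eta)] so that some value of [f i]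
   lies above it, at a total cost [exp (- eta * s)]. *)
have key eta : 0 < eta -> P * expR (- eta * s) <= A.
  move=> eta0; pose th := expR (- eta).
  have th1 : th < 1 by rewrite -expR0 ltr_expR oppr_lt0.
  have ex i : exists y, th * t i < f i y by apply: ht; rewrite gtr_pMl.
  pose y i := projT1 (cid (ex i)).
  have hy i : th * t i < f i (y i) by exact: (projT2 (cid (ex i))).
  apply: le_trans (H y).
  rewrite /s mulr_sumr expR_sum /P -big_split /=; apply: ler_prod => i _.
  rewrite mulr_ge0 ?powR_ge0 ?expR_ge0 //= expRM mulrC -powRM ?expR_ge0 //.
  have h0 : 0 <= th * t i by rewrite mulr_ge0 ?expR_ge0.
  by apply: ge0_ler_powR; rewrite ?nnegrE ?(ltW (hc i)) // ?(ltW (hy i)) // (le_trans h0) // ltW.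
apply/ler_addgt0Pr => e e0.
have D0 : 0 < P * s + 1 by rewrite ltr_wpDl // mulr_ge0.
have eta0 : 0 < e / (P * s + 1) by rewrite divr_gt0.
set eta := e / _ in eta0.
have h1 : P * (1 - eta * s) <= A.
  apply: le_trans (key _ eta0); apply: ler_wpM2l => //.
  by rewrite mulNr; exact: expR_ge1Dx.
have h2 : eta * (P * s) <= e.
  by rewrite /eta mulrAC ler_pdivrMr // ler_pM2l // lerDl.
have : P * (1 - eta * s) = P - eta * (P * s) by ring.
lra.
Qed.

(* [T i <= W i * sup (f i)], so the pointwise constraint passes to the suprema and hence to the [T i]. *)
Lemma prodint (f w : forall i, (d i).-tuple R -> R) (T W : 'I_n -> R) A : 0 <= A ->
  (forall i, measurable_fun setT (f i)) -> (forall i, measurable_fun setT (w i)) ->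
  (forall i x, 0 <= f i x) -> (forall i x, 0 <= w i x) ->
  (forall i, (\int[@lebR R (d i)]_x (f i x * w i x)%:E = (T i)%:E)%E) ->
  (forall i, (\int[@lebR R (d i)]_x (w i x)%:E = (W i)%:E)%E) -> (forall i, 0 < W i) ->
  (forall y : fam, \prod_i f i (y i) `^ c i <= A) ->
  \prod_i T i `^ c i <= A * \prod_i W i `^ c i.
Proof.
move=> A0 mf mw f0 w0 hT hW W0 H.
have T0 i : 0 <= T i by rewrite -lee_fin -hT; apply: int_ge0 => x; exact: mulr_ge0.
have TW i : T i / W i * W i = T i by rewrite divfK // gt_eqF.
rewrite (eq_bigr (fun i => (T i / W i) `^ c i * W i `^ c i)); last first.
  by move=> i _; rewrite -powRM ?TW ?divr_ge0 // ltW.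
rewrite big_split /=; apply: ler_wpM2r; first by apply: prodr_ge0 => i _; exact: powR_ge0.
apply: (prod_sup_le (f := f)) => // [i|i r rT]; first by rewrite divr_ge0 // ltW.
apply: contrapT => nex.
have fr y : f i y <= r by rewrite leNgt; apply/negP => h; apply: nex; exists y.
have r0 : 0 <= r by exact: (le_trans (f0 i [tuple 0 | j < d i]) (fr _)).
have : ((T i)%:E <= (r * W i)%:E)%E.
  rewrite -hT EFinM -hW -int_scaler //; apply: ge0_le_int => [||x].
  - by apply: measurable_funM; [exact: mf | exact: mw].
  - by apply: measurable_funM => //; exact: mw.
  by rewrite mulr_ge0 // ler_wpM2r.
by rewrite lee_fin leNgt -ltr_pdivlMr // rT.
Qed.

End ProdSup.

Lemma powR_inv (R : realType) (x r : R) : 0 < x -> x^-1 `^ r = (x `^ r)^-1.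
Proof.
move=> x0; have p0 : 0 < x `^ r by exact: powR_gt0.
apply: (mulIf (lt0r_neq0 p0)); rewrite mulVf ?gt_eqF // -powRM ?invr_ge0 ?(ltW x0) //.
by rewrite mulVf ?gt_eqF // powR1.
Qed.

(** * Feasible families and doubling *)

Section Feas.
Context {R : realType}.
Variables (n : nat) (d : 'I_n -> nat) (c : 'I_n -> R) (hn : (0 < n)%N).
Hypothesis hc : forall i, 0 < c i.
Notation N := (dimE d).
Notation ffam := (forall i : 'I_n, (d i).-tuple R -> R).
Implicit Types (g p : ffam) (Q : 'M[R]_N).

Definition feas Q A g := forall x : N.-tuple R,
  \prod_i g i (block_proj i x) `^ c i <= A * expR (- qform Q x).
Definition prod_Int g := \prod_i Int (g i) `^ c i.
Definition gbf g := forall i, exists K a, gb K a (g i).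
Definition evf g := forall i x, g i (tscale (-1) x) = g i x.

Lemma prod_Int_ge0 g : 0 <= prod_Int g.
Proof. by apply: prodr_ge0 => i _; exact: powR_ge0. Qed.

Lemma feas_fam Q A g (y : forall i : 'I_n, (d i).-tuple R) : feas Q A g ->
  \prod_i g i (y i) `^ c i <= A * expR (- qform Q (Defs.glue y)).
Proof.
move=> /(_ (Defs.glue y)); under eq_bigr => i _ do rewrite block_glue.
by [].
Qed.

Lemma qform_rot Q (s t : N.-tuple R) : Q^T = Q ->
  qform Q (rotp s t) + qform Q (rotm s t) = qform Q s + qform Q t.
Proof.
move=> hQ; rewrite /rotp /rotm !qformZ // !qformD // !qformZ trowZ bilZr.
have : r2 ^+ 2 = 2^-1 :> R by rewrite expr2 r2_sqr.
by move=> ->; field.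
Qed.

Lemma prod_scale (s : 'I_n -> R) (t : 'I_n -> R) : (forall i, 0 <= s i) -> (forall i, 0 <= t i) ->
  \prod_i (s i * t i) `^ c i = (\prod_i s i `^ c i) * \prod_i t i `^ c i.
Proof. by move=> s0 t0; rewrite -big_split /=; apply: eq_bigr => i _; rewrite powRM. Qed.

Lemma prod_expR (u : 'I_n -> R) : \prod_i expR (u i) `^ c i = expR (\sum_i c i * u i).
Proof. by rewrite expR_sum; apply: eq_bigr => i _; rewrite -expRM mulrC. Qed.

Section Even.
Variables (Q : 'M[R]_N) (e : R).
Hypotheses (hQ : Q^T = Q) (e0 : 0 < e) (hd : forall i x, 0 <= qform Q (bmask i x)).
Let Q' := Q + e%:M.

Lemma symQ' : Q'^T = Q'.
Proof. by rewrite /Q' linearD /= hQ tr_scalar_mx. Qed.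

Lemma qformQ' (x : N.-tuple R) : qform Q' x = qform Q x + e * tdot x x.
Proof. by rewrite !qformE bil_addM bil_scalar tdot_nsq. Qed.

Lemma tdot_bmask i (x : N.-tuple R) : tdot (bmask i x) (bmask i x) = tdot (block_proj i x) (block_proj i x).
Proof.
rewrite tdot_blocks (bigD1 i) //= block_bmask eqxx big1 ?addr0 // => j ji.
by rewrite block_bmask (negbTE ji) /tdot big1 // => k _; rewrite tnth_tzero mul0r.
Qed.

(** An even family takes the same values at [x] and at the point [x'] of [sign_choice], where the
    cross terms are favourable. The diagonal blocks of [Q] contribute nonnegatively by [hd], so
    [e |x|^2] survives. *)
Lemma even_feas_diag A g : 0 <= A -> evf g -> feas Q' A g -> forall x : N.-tuple R,
  \prod_i g i (block_proj i x) `^ c i <= A * expR (- (e * tdot x x)).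
Proof.
move=> A0 ge F x; have [x' [h1 h2]] := sign_choice x symQ'.
have -> : \prod_i g i (block_proj i x) `^ c i = \prod_i g i (block_proj i x') `^ c i.
  by apply: eq_bigr => i _; case: (h1 i) => ->; rewrite ?ge.
apply: (le_trans (F x')); apply: ler_wpM2l => //; rewrite ler_expR lerN2; apply: le_trans h2.
rewrite tdot_blocks mulr_sumr; apply: ler_sum => i _.
by rewrite qformQ' tdot_bmask lerDr.
Qed.

(** Rates for which the Gaussian weights [w i], raised to the powers [c i], multiply to
    [exp (- e |x|^2)], the decay supplied by [even_feas_diag]. *)
Let a i := e / c i.
Let a0 i : 0 < a i. Proof. by rewrite divr_gt0. Qed.
Let w i (x : (d i).-tuple R) := expR (- a i * tdot x x).
Let W i := Num.sqrt (pi / a i) ^+ (d i).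
Let W0 i : 0 < W i.
Proof. by rewrite exprn_gt0 // sqrtr_gt0 divr_gt0 // pi_gt0. Qed.
Definition MW := \prod_i W i `^ c i.

Lemma prod_weight (y : forall i : 'I_n, (d i).-tuple R) :
  \prod_i expR (a i * tdot (y i) (y i)) `^ c i = expR (e * tdot (Defs.glue y) (Defs.glue y)).
Proof.
rewrite prod_expR tdot_blocks mulr_sumr; congr expR; apply: eq_bigr => i _.
by rewrite block_glue mulrA /a mulrCA divff ?mulr1 // gt_eqF.
Qed.

Lemma even_prodint A g (y : forall i : 'I_n, (d i).-tuple R) : 0 <= A -> evf g -> feas Q' A g ->
  (forall i x, 0 <= g i x) ->
  \prod_i (expR (a i * tdot (y i) (y i)) * g i (y i)) `^ c i <= A.
Proof.
move=> A0 ge F g0; rewrite prod_scale ?prod_weight //.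
have := even_feas_diag A0 ge F (Defs.glue y); under eq_bigr => i _ do rewrite block_glue.
move=> h; apply: le_trans (ler_wpM2l (expR_ge0 _) h) _.
by rewrite mulrCA -expRD subrr expR0 mulr1.
Qed.

Let mw i : measurable_fun setT (w (i := i)). Proof. exact: measurable_gk. Qed.
Let mwi i : measurable_fun setT (fun x : (d i).-tuple R => expR (a i * tdot x x)).
Proof.
by have := @measurable_gk R (d i) (- a i); under eq_fun do rewrite opprK.
Qed.
Let wwi i x : expR (a i * tdot x x) * w (i := i) x = 1.
Proof. by rewrite /w -expRD mulNr subrr expR0. Qed.

(** Bounds the set whose supremum is [even_sup] below, so that [sup] is a genuine least upper
    bound. *)
Lemma even_prod_Int_le A g : 0 <= A -> gbf g -> evf g -> feas Q' A g -> prod_Int g <= A * MW.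
Proof.
move=> A0 gg ge F.
have g0 i x : 0 <= g i x by have [K [b G]] := gg i; exact: gb_ge0 G.
have mg i : measurable_fun setT (g i) by have [K [b G]] := gg i; exact: gb_measurable G.
apply: (@prodint R n d c hc (fun i x => expR (a i * tdot x x) * g i x) w _ W) => //.
- by move=> i; apply: measurable_funM; [exact: mwi | exact: mg].
- by move=> i x; rewrite mulr_ge0 ?expR_ge0.
- by move=> i x; exact: expR_ge0.
- move=> i; have [K [b G]] := gg i; rewrite (IntE G); apply: eq_integral => x _; apply: EFin_eq.
  by rewrite mulrAC wwi mul1r.
- by move=> i; exact: int_gk.
- by move=> y; exact: even_prodint.
Qed.

Definition even_sup := sup [set prod_Int g | g in [set g | [/\ gbf g, evf g & feas Q' 1 g]]].

(** Homogeneity: multiplying every [g i] by one number [s] with [s] to the power [sum c] equal to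
    [A^-1] reduces to the constraint with constant 1. *)
Lemma prod_Int_le A g : 0 < A -> gbf g -> evf g -> feas Q' A g -> prod_Int g <= A * even_sup.
Proof.
move=> A0 gg ge F.
pose C := \sum_i c i.
have C0 : 0 < C.
  rewrite /C (bigD1 (Ordinal hn)) //=; apply: ltr_wpDr => //; apply: sumr_ge0 => i _; exact: ltW.
pose s := expR (- ln A / C).
have sE : \prod_(i < n) s `^ c i = A^-1.
  rewrite (prod_expR (fun=> - ln A / C)) -mulr_suml mulrCA divff ?gt_eqF // mulr1 expRN lnK //.
have s0 : 0 < s by exact: expR_gt0.
have g0 i x : 0 <= g i x by have [K [b G]] := gg i; exact: gb_ge0 G.
pose g' : ffam := fun i x => s * g i x.
have E' : prod_Int g' = A^-1 * prod_Int g.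
  rewrite /prod_Int /g' -sE -prod_scale; last 2 first.
  - by move=> i; exact: ltW.
  - by move=> i; have [K [b G]] := gg i; exact: Int_ge0 G.
  by apply: eq_bigr => i _; have [K [b G]] := gg i; rewrite (Int_scale _ G) // ltW.
rewrite -ler_pdivrMl // -E'; apply: ub_le_sup.
  exists (1 * MW) => _ [h [h1 h2 h3] <-]; exact: even_prod_Int_le.
exists g' => //; split.
- by move=> i; have [K [b G]] := gg i; exists (s * K), b; apply: gb_scale => //; exact: ltW.
- by move=> i x; rewrite /g' ge.
- move=> x; rewrite prod_scale ?sE //; last by move=> i; exact: ltW.
  rewrite mul1r ler_pdivrMl //; exact: F.
Qed.

(* The fibres [t |-> p_i ((s+t)/sqrt 2) p_i ((s-t)/sqrt 2)] form an even family even when [p] is not,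
   and rotation invariance makes it feasible with constant [A^2 exp (- Q' s)]. *)
Lemma feas_dbl A p : 0 < A -> gbf p -> feas Q' A p -> feas Q' (even_sup * A ^+ 2) (fun i => dbl (p i)).
Proof.
move=> A0 gp F s.
have p0 i x : 0 <= p i x by have [K [b G]] := gp i; exact: gb_ge0 G.
pose h : ffam := fun i t => p i (rotp (block_proj i s) t) * p i (rotm (block_proj i s) t).
have -> : \prod_i dbl (p i) (block_proj i s) `^ c i = prod_Int h by [].
have -> : even_sup * A ^+ 2 * expR (- qform Q' s) = (A ^+ 2 * expR (- qform Q' s)) * even_sup by ring.
apply: prod_Int_le.
- by rewrite mulr_gt0 ?exprn_gt0 ?expR_gt0.
- by move=> i; have [K [b G]] := gp i; exists (K ^+ 2 * expR (- b * tdot (block_proj i s) (block_proj i s))), b; exact: gb_fibre.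
- by move=> i x; exact: fibre_even.
move=> t; rewrite prod_scale //.
have P0 (u : N.-tuple R) : 0 <= \prod_i p i (block_proj i u) `^ c i.
  by apply: prodr_ge0 => i _; exact: powR_ge0.
have := ler_pM (P0 _) (P0 _) (F (rotp s t)) (F (rotm s t)).
under eq_bigr => i _ do rewrite block_rotp.
under [X in _ * X]eq_bigr => i _ do rewrite block_rotm.
move=> hh; apply: (le_trans hh).
have -> : A * expR (- qform Q' (rotp s t)) * (A * expR (- qform Q' (rotm s t))) =
   A ^+ 2 * (expR (- qform Q' (rotp s t)) * expR (- qform Q' (rotm s t))) by ring.
rewrite -expRD -opprD qform_rot; last exact: symQ'.
by rewrite opprD expRD mulrA.
Qed.

(** By [feas_dbl] the constants obey [A_(j+1) = M A_j^2] with [M = even_sup]; after multiplication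
    by [M] the recursion is plain squaring. *)
Lemma feas_iter A p j : 0 < A -> 0 < even_sup -> gbf p -> feas Q' A p ->
  feas Q' ((even_sup * A) ^+ (2 ^ j) / even_sup) (fun i => iter j dbl (p i)).
Proof.
move=> A0 m0 gp F; elim: j => [|j IH].
  by rewrite expn0 expr1 mulrAC divff ?mul1r // gt_eqF.
have -> : (even_sup * A) ^+ (2 ^ j.+1) / even_sup = even_sup * ((even_sup * A) ^+ (2 ^ j) / even_sup) ^+ 2.
  rewrite expnS mulnC exprM; set X := (even_sup * A) ^+ (2 ^ j); field; by rewrite gt_eqF.
apply: feas_dbl IH.
- by rewrite divr_gt0 // exprn_gt0 // mulr_gt0.
- by move=> i; have [K [b G]] := gp i; have [K' G'] := gb_iter_dbl j G; exists K', b.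
Qed.

(** The largest [v] with [(v W_i)^(c_i) <= (2 / M) MW], where [M = even_sup]. The factor 2 is the
    allowance [M / 2 <= prod_Int g] in [tail_bound]. No family enters, which makes the tails
    uniform. *)
Definition Ktail i := (2 / even_sup * MW / W i `^ c i) `^ (c i)^-1.

(* The constraint with the [i]-th argument frozen at [x] and the other ones integrated. *)
Lemma tail_bound g : 0 < even_sup -> gbf g -> evf g -> feas Q' 1 g -> even_sup / 2 <= prod_Int g ->
  (forall i, 0 < Int (g i)) -> forall i, gb (Ktail i) (e / c i) (fun x => (Int (g i))^-1 * g i x).
Proof.
move=> m0 gg ge F hP Z0 i.
have g0 j x : 0 <= g j x by have [K [b G]] := gg j; exact: gb_ge0 G.
have mg j : measurable_fun setT (g j) by have [K [b G]] := gg j; exact: gb_measurable G.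
have Zi0 j : 0 <= (Int (g j))^-1 by rewrite invr_ge0 ltW.
pose p : ffam := fun j x => (Int (g j))^-1 * g j x.
have p0 j x : 0 <= p j x by rewrite mulr_ge0.
have mp j : measurable_fun setT (p j) by apply: measurable_funM => //; exact: mg.
have P0 : 0 < prod_Int g by apply: lt_le_trans hP; rewrite divr_gt0.
have Fp y : \prod_j (expR (a j * tdot (y j) (y j)) * p j (y j)) `^ c j <= (prod_Int g)^-1.
  have -> : \prod_j (expR (a j * tdot (y j) (y j)) * p j (y j)) `^ c j =
     \prod_j ((Int (g j))^-1 * (expR (a j * tdot (y j) (y j)) * g j (y j))) `^ c j.
    by apply: eq_bigr => j _; rewrite /p mulrCA.
  rewrite prod_scale => [|//|j]; last by rewrite mulr_ge0 ?expR_ge0.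
  have -> : \prod_j (Int (g j))^-1 `^ c j = (prod_Int g)^-1.
    by rewrite /prod_Int -prodfV; apply: eq_bigr => j _; rewrite powR_inv.
  rewrite -[leRHS]mulr1; apply: ler_wpM2l; first by rewrite invr_ge0 ltW.
  exact: even_prodint.
split; [exact: a0 | exact: mp | move=> x; rewrite p0 /=].
pose v := expR (a i * tdot x x) * p i x.
have v0 : 0 <= v by rewrite mulr_ge0 ?expR_ge0.
pose f : ffam := fun j y => if j == i then v else expR (a j * tdot y y) * p j y.
have A0 : 0 <= (prod_Int g)^-1 by rewrite invr_ge0 ltW.
have H := @prodint R n d c hc f w (fun j => if j == i then v * W i else 1) W (prod_Int g)^-1 A0.
have {H} : \prod_j (if j == i then v * W i else 1) `^ c j <= (prod_Int g)^-1 * \prod_j W j `^ c j.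
  apply: H => //.
  - by move=> j; rewrite /f; case: eqP => // _; apply: measurable_funM; [exact: mwi | exact: mp].
  - by move=> j y; rewrite /f; case: eqP => // _; rewrite mulr_ge0 ?expR_ge0.
  - by move=> j y; exact: expR_ge0.
  - move=> j; rewrite /f; case: eqP => [->|_].
      rewrite int_scaler //; last by move=> y; exact: expR_ge0.
      by rewrite int_gk.
    transitivity (\int[@lebR R (d j)]_x ((Int (g j))^-1 * g j x)%:E)%E.
      by apply: eq_integral => y _; apply: EFin_eq; rewrite mulrAC wwi mul1r.
    have [K [b G]] := gg j; rewrite int_scaler // -(IntE G) -EFinM mulVf // gt_eqF //.
  - by move=> j; exact: int_gk.
  - move=> y; rewrite (_ : \prod_j _ = \prod_j (expR (a j * tdot (dfwith y i x j) (dfwith y i x j)) * p j (dfwith y i x j)) `^ c j).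
      exact: Fp.
    apply: eq_bigr => j _; rewrite /f; case: eqP => [->|/eqP ji].
      by rewrite dfwithin.
    by rewrite dfwithout // eq_sym.
rewrite (bigD1 i) //= eqxx big1 ?mulr1; last first.
  by move=> j /negbTE ->; rewrite powR1.
rewrite powRM ?(ltW (W0 i)) // -/MW => h.
have WC0 : 0 < W i `^ c i by exact: powR_gt0.
have h2 : v `^ c i <= 2 / even_sup * MW / W i `^ c i.
  rewrite ler_pdivlMr //; apply: (le_trans h); apply: ler_wpM2r.
    by apply: prodr_ge0 => j _; exact: powR_ge0.
  rewrite -[2 / even_sup]invf_div lef_pV2 ?posrE // divr_gt0 //.
have h3 : v <= Ktail i.
  have ci : 0 <= (c i)^-1 by rewrite invr_ge0 ltW.
  rewrite (_ : v = (v `^ c i) `^ (c i)^-1).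
    apply: ge0_ler_powR => //; rewrite nnegrE ?powR_ge0 //.
    exact: le_trans (powR_ge0 _ _) h2.
  by rewrite -powRrM divff ?powRr1 // gt_eqF.
rewrite -/(p i x) (_ : p i x = expR (- a i * tdot x x) * v).
  by rewrite mulrC; apply: ler_wpM2r => //; exact: expR_ge0.
by rewrite /v mulrA -expRD mulNr addNr expR0 mul1r.
Qed.

End Even.
End Feas.

Section Reflect.
Context {R : realType}.
Lemma taddC k (x y : k.-tuple R) : tadd x y = tadd y x.
Proof. by apply: eq_from_tnth => j; rewrite !tnthD addrC. Qed.

Lemma int_reflect k (f : k.-tuple R -> \bar R) (x : k.-tuple R) :
  measurable_fun setT f -> (forall y, 0 <= f y)%E ->
  (\int[@lebR R k]_y f (tadd x (tscale (-1) y)) = \int[@lebR R k]_y f y)%E.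
Proof.
move=> mf f0; have mF : measurable_fun setT (fun y => f (tadd y x)).
  by apply: (mcomp mf); exact: measurable_tadd.
rewrite -(int_lebR_shift x mf f0) -(int_lebR_opp mF (fun y => f0 _)).
by apply: eq_integral => y _; rewrite taddC.
Qed.
End Reflect.

(** * Stability of the constraint under smoothing *)

Section Smooth.
Context {R : realType}.
Variables (n : nat) (d : 'I_n -> nat) (c : 'I_n -> R).
Hypothesis hc : forall i, 0 < c i.
Notation N := (dimE d).
Notation ffam := (forall i : 'I_n, (d i).-tuple R -> R).
Implicit Types (g p : ffam).
Variables (Q : 'M[R]_N) (e : R).
Hypotheses (hQ : Q^T = Q) (e0 : 0 < e).

Definition Csm := (nsq Q + 1) / e + nsq Q + 1.

Lemma Csm_ge0 : 0 <= Csm.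
Proof. by rewrite !addr_ge0 ?divr_ge0 ?addr_ge0 ?nsq_ge0 // ltW. Qed.

(** With [u = x - y], the cross term [2 <y, Q u>] is absorbed by [e |y|^2] through [bil_young]; the
    weight [e / (nsq Q + 1)] produces the first summand of [Csm]. *)
Lemma qform_smooth (x y : N.-tuple R) : qform Q x <= qform (Q + e%:M) y +
  Csm * tdot (tadd x (tscale (-1) y)) (tadd x (tscale (-1) y)).
Proof.
set u := tadd x _; have xE : x = tadd y u.
  by apply: eq_from_tnth => j; rewrite !(tnthD, tnthZ); ring.
rewrite {1}xE; move: u {xE} => u.
rewrite qformQ' (qformD _ _ hQ).
have n0 := nsq_ge0 Q.
have t0 : 0 < e / (nsq Q + 1) by rewrite divr_gt0 // ltr_wpDl.
have h1 := bil_young Q (trow y) (trow u) t0.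
have h2 : e / (nsq Q + 1) * nsq Q * nsq (trow y) <= e * tdot y y.
  rewrite -tdot_nsq; apply: ler_wpM2r; first exact: tdot_ge0.
  rewrite -mulrA ler_piMr ?(ltW e0) // mulrC ler_pdivrMr ?ltr_wpDl //; lra.
have h3 := qform_le Q u.
have h4 : nsq (trow u) / (e / (nsq Q + 1)) = (nsq Q + 1) / e * tdot u u.
  by rewrite -tdot_nsq; field; rewrite !gt_eqF // ltr_wpDl.
rewrite h4 in h1; rewrite -/u /Csm; lra.
Qed.

Section Weight.
Variables (k : nat) (de C1 : R).
Hypotheses (de0 : 0 < de) (C10 : 0 <= C1) (hu : 4 * de * C1 <= 1).
Let a' := (2 * de)^-1 - C1.
Let a'0 : 0 < a'.
Proof.
rewrite subr_gt0 -[ltRHS]mul1r ltr_pdivlMr ?mulr_gt0 //.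
have : 0 <= de * C1 by rewrite mulr_ge0 // ltW.
move: hu; rewrite -mulrA (_ : C1 * (2 * de) = 2 * (de * C1)); last by ring.
by lra.
Qed.
Let K := (Num.sqrt (2 * pi * de) ^+ k)^-1.
Let K0 : 0 < K.
Proof. by rewrite invr_gt0 exprn_gt0 // sqrtr_gt0 !mulr_gt0 // pi_gt0. Qed.
(** The smoothing kernel times [exp (C1 |x - y|^2)], the price of replacing [y] by [x] in the
    quadratic form. It is again Gaussian, with rate [a'], and its mass [SW] tends to 1 with [de]. *)
Definition sw (x y : k.-tuple R) := let z := tadd x (tscale (-1) y) in
  gauss_density de%:M z * expR (C1 * tdot z z).
Definition SW := K * Num.sqrt (pi / a') ^+ k.

Lemma swE x y : sw x y = K * expR (- a' * tdot (tadd x (tscale (-1) y)) (tadd x (tscale (-1) y))).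
Proof.
rewrite /sw gd_scalar_ker // -/K -mulrA /ker -expRD; congr (_ * expR _); rewrite /a'; ring.
Qed.

Lemma measurable_sw x : measurable_fun setT (sw x).
Proof.
rewrite (_ : sw x = fun y => K * expR (- a' * tdot (tadd x (tscale (-1) y)) (tadd x (tscale (-1) y)))).
  apply: measurable_funM => //.
  apply: (mcomp (measurable_gk a')); apply: measurable_tadd => //; exact: measurable_tscale.
by apply/funext => y; exact: swE.
Qed.

Lemma int_sw x : (\int[@lebR R k]_y (sw x y)%:E = SW%:E)%E.
Proof.
under eq_integral => y _ do rewrite swE.
rewrite int_scaler; last 3 first.
- exact: ltW.
- apply: (mcomp (measurable_gk a')); apply: measurable_tadd => //; exact: measurable_tscale.
- by move=> y; exact: expR_ge0.
have mgE : measurable_fun setT (fun y : k.-tuple R => (expR (- a' * tdot y y))%:E).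
  by apply/measurable_EFinP; exact: measurable_gk.
have g0 (y : k.-tuple R) : (0 <= (expR (- a' * tdot y y))%:E)%E by rewrite lee_fin expR_ge0.
by rewrite (int_reflect x mgE g0) int_gk.
Qed.

Lemma SW_gt0 : 0 < SW.
Proof. by rewrite mulr_gt0 // exprn_gt0 // sqrtr_gt0 divr_gt0 ?pi_gt0. Qed.

Lemma SW_le : SW <= expR (k%:R * (2 * de * C1)).
Proof.
pose u := 2 * de * C1.
have u0 : 0 <= u by rewrite !mulr_ge0 // ltW.
have u1 : 2 * u <= 1 by rewrite (_ : 2 * u = 4 * de * C1) // /u; ring.
have pg := @pi_gt0 R.
rewrite expRM_natl /SW /K -exprVn -exprMn; apply: lerXn2r; rewrite ?nnegrE ?expR_ge0 ?mulr_ge0 ?invr_ge0 ?sqrtr_ge0 //.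
rewrite -sqrtrV; last by rewrite !mulr_ge0 // ltW.
rewrite -sqrtrM; last by rewrite invr_ge0 !mulr_ge0 // ltW.
have -> : (2 * pi * de)^-1 * (pi / a') = (1 - u)^-1.
  have h : 1 - u != 0 by rewrite gt_eqF //; lra.
  have a'E : a' = (1 - u) / (2 * de) by rewrite /a' /u; field; rewrite gt_eqF.
  have hp : (pi : R) != 0 by rewrite gt_eqF.
  have hde : de != 0 by rewrite gt_eqF.
  have aux (p q v : R) : p != 0 -> q != 0 -> v != 0 -> (2 * p * q)^-1 * (p / (v / (2 * q))) = v^-1.
    by move=> p0 q0 v0; field; rewrite p0 q0 v0.
  by rewrite a'E aux.
rewrite -[leRHS](@ger0_norm _ _) ?expR_ge0 // -sqrtr_sqr; apply: ler_wsqrtr.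
(* [1 / (1 - u) <= 1 + 2 u <= exp (2 u)] for [0 <= 2 u <= 1]. *)
rewrite -expRM_natl; apply: (@le_trans _ _ (1 + 2 * u)); last exact: expR_ge1Dx.
rewrite -[leLHS]mul1r ler_pdivrMr; last by lra.
have -> : (1 + 2 * u) * (1 - u) = 1 + u * (1 - 2 * u) by ring.
by rewrite lerDl mulr_ge0 //; lra.
Qed.

End Weight.

Lemma gb_shift_gauss k K a de (q : k.-tuple R -> R) x : 0 < de -> gb K a q ->
  gb ((Num.sqrt (2 * pi * de) ^+ k)^-1 * K) a (fun y => gauss_density de%:M (tadd x (tscale (-1) y)) * q y).
Proof.
move=> de0 [a0 mq h]; split => //.
  apply: measurable_funM => //; apply: (mcomp (measurable_gd _)).
  by apply: measurable_tadd => //; exact: measurable_tscale.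
move=> y; have /andP[q0 q1] := h y.
have nn : 0 <= (Num.sqrt (2 * pi * de) ^+ k)^-1 by rewrite invr_ge0 exprn_ge0 ?sqrtr_ge0.
rewrite mulr_ge0 ?gd_ge0 //= -(mulrA _ K); apply: ler_pM => //; first exact: gd_ge0.
rewrite gd_scalar_ker // -[leRHS]mulr1; apply: ler_wpM2l => //; apply: ker_le1.
by rewrite invr_ge0 mulr_ge0 // ltW.
Qed.

(** [prodint] with the weights [sw]: the growing factor that they carry is compensated in [f], and
    [qform_smooth] gives the pointwise constraint. The slack [e] in the quadratic form is used up
    here. *)
Lemma smooth A q de : 0 < A -> gbf q -> feas c (Q + e%:M) A q -> 0 < de ->
  (forall i, 4 * de * (Csm / c i) <= 1) -> forall x : N.-tuple R,
  \prod_i smoothed de (q i) (block_proj i x) `^ c i <=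
    A * expR (- qform Q x) * expR (2 * de * Csm * N%:R).
Proof.
move=> A0 gq F de0 hu x.
have q0 i y : 0 <= q i y by have [K [b G]] := gq i; exact: gb_ge0 G.
have mq i : measurable_fun setT (q i) by have [K [b G]] := gq i; exact: gb_measurable G.
pose C1 i := Csm / c i.
have C10 i : 0 <= C1 i by rewrite divr_ge0 ?Csm_ge0 // ltW.
pose z i (y : (d i).-tuple R) := tadd (block_proj i x) (tscale (-1) y).
have mz i : measurable_fun setT (z i) by apply: measurable_tadd => //; exact: measurable_tscale.
pose f : ffam := fun i y => q i y * expR (- C1 i * tdot (z i y) (z i y)).
pose w : ffam := fun i y => sw de (C1 i) (block_proj i x) y.
have A1 : 0 <= A * expR (- qform Q x) by rewrite mulr_ge0 ?expR_ge0 // ltW.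
have H := @prodint R n d c hc f w (fun i => smoothed de (q i) (block_proj i x)) (fun i => SW (d i) de (C1 i)) _ A1.
apply: le_trans (H _ _ _ _ _ _ _ _) _.
- move=> i; apply: measurable_funM; first exact: mq.
  exact: (mcomp (measurable_gk (C1 i)) (mz i)).
- by move=> i; exact: measurable_sw.
- by move=> i y; rewrite mulr_ge0 ?expR_ge0.
- by move=> i y; rewrite mulr_ge0 ?expR_ge0 ?gd_ge0.
- move=> i; have [K [b G]] := gq i.
  rewrite /smoothed (IntE (gb_shift_gauss (block_proj i x) de0 G)); apply: eq_integral => y _; apply: EFin_eq.
  rewrite /f /w /sw -/(z i y); set g := gauss_density _ _; set T := tdot _ _.
  have -> : q i y * expR (- C1 i * T) * (g * expR (C1 i * T)) = g * q i y * (expR (- C1 i * T) * expR (C1 i * T)) by ring.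
  by rewrite -expRD mulNr addNr expR0 mulr1.
- by move=> i; exact: (int_sw de0 (C10 i) (hu i) _).
- by move=> i; exact: (SW_gt0 _ de0 (C10 i) (hu i)).
- move=> y; rewrite /f prod_scale => [|i|i]; [|exact: q0|exact: expR_ge0].
  rewrite (prod_expR c (fun i => - C1 i * tdot (z i (y i)) (z i (y i)))).
  pose Y := Defs.glue y; pose u := tadd x (tscale (-1) Y).
  have -> : \sum_i c i * (- C1 i * tdot (z i (y i)) (z i (y i))) = - (Csm * tdot u u).
    rewrite tdot_blocks mulr_sumr -sumrN; apply: eq_bigr => i _.
    rewrite block_tadd block_tscale block_glue -/(z i (y i)) /C1; field; by rewrite gt_eqF.
  have h := qform_smooth x Y; rewrite -/u in h.
  apply: le_trans (ler_wpM2r (expR_ge0 _) (feas_fam y F)) _.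
  rewrite -mulrA -expRD; apply: ler_wpM2l; first exact: ltW.
  rewrite ler_expR; lra.
apply: ler_wpM2l => //.
apply: (@le_trans _ _ (\prod_i expR ((d i)%:R * (2 * de * C1 i)) `^ c i)).
  apply: ler_prod => i _; rewrite powR_ge0 /=; have sw0 := SW_gt0 (d i) de0 (C10 i) (hu i).
  by apply: ge0_ler_powR; rewrite ?nnegrE ?expR_ge0 ?(ltW (hc i)) ?(ltW sw0) //; exact: (SW_le _ de0 (C10 i) (hu i)).
rewrite prod_expR ler_expR le_eqVlt; apply/orP; left; apply/eqP.
rewrite /dimE natr_sum mulr_sumr; apply: eq_bigr => i _; rewrite /C1; field; by rewrite gt_eqF.
Qed.

End Smooth.

(** * The bound for even families *)

Section EvenBound.
Context {R : realType}.
Variables (n : nat) (d : 'I_n -> nat) (c : 'I_n -> R) (hn : (0 < n)%N).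
Hypothesis hc : forall i, 0 < c i.
Notation N := (dimE d).
Notation ffam := (forall i : 'I_n, (d i).-tuple R -> R).
Implicit Types (g p : ffam).
Variables (Q : 'M[R]_N) (e : R).
Hypotheses (hQ : Q^T = Q) (e0 : 0 < e) (hd : forall i x, 0 <= qform Q (bmask i x)).

Lemma prod_ln (t : 'I_n -> R) : (forall i, 0 < t i) ->
  \prod_i t i `^ c i = expR (\sum_i c i * ln (t i)).
Proof. by move=> t0; rewrite -prod_expR; apply: eq_bigr => i _; rewrite lnK // posrE. Qed.

(* These linear steps are isolated from the large contexts in which they are applied. *)
Lemma le_of_smoothed (X Y l q t : R) : X <= t - l - q + t -> - X <= Y -> q <= 2 * t - l + Y.
Proof. by lra. Qed.

Lemma le_of_entropy (X C l D t : R) : X <= 2 * t - l + (X + C * t) + D -> l <= D + t * (2 + C).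
Proof. by rewrite mulrDr (mulrC t C); lra. Qed.

Lemma norm_family Q' A g : gbf g -> (forall i, 0 < Int (g i)) -> feas c Q' A g ->
  let p : ffam := fun i x => (Int (g i))^-1 * g i x in
  [/\ gbf p, forall i, Int (p i) = 1 & feas c Q' ((prod_Int c g)^-1 * A) p].
Proof.
move=> gg Z0 F p; split.
- move=> i; have [K [b G]] := gg i; exists ((Int (g i))^-1 * K), b; apply: gb_scale => //.
  by rewrite invr_ge0 ltW.
- move=> i; have [K [b G]] := gg i.
  by rewrite /p (Int_scale _ G) ?invr_ge0 ?(ltW (Z0 i)) // mulVf // gt_eqF.
- move=> x; rewrite /p prod_scale => [|i|i]; last 2 first.
  + by rewrite invr_ge0 ltW.
  + by have [K [b G]] := gg i; exact: gb_ge0 G.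
  have -> : \prod_i (Int (g i))^-1 `^ c i = (prod_Int c g)^-1.
    by rewrite /prod_Int -prodfV; apply: eq_bigr => i _; rewrite powR_inv.
  by rewrite -mulrA; apply: ler_wpM2l; [rewrite invr_ge0 prod_Int_ge0 | exact: F].
Qed.

Lemma Int_gt0 g : gbf g -> 0 < prod_Int c g -> forall i, 0 < Int (g i).
Proof.
move=> gg P0 i; have [K [b G]] := gg i.
rewrite lt_neqAle (Int_ge0 G) andbT eq_sym; apply/eqP => Z; move: P0.
by rewrite /prod_Int (bigD1 i) //= Z powR0 ?mul0r ?ltxx // gt_eqF.
Qed.

Lemma near_max th : 0 < even_sup c Q e -> th < 1 -> exists g : ffam,
  [/\ gbf g, evf g, feas c (Q + e%:M) 1 g & th * even_sup c Q e < prod_Int c g].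
Proof.
move=> m0 th1; set E := [set prod_Int c g | g in [set g : ffam | [/\ gbf g, evf g & feas c (Q + e%:M) 1 g]]].
have hs : has_sup E.
  split; last first.
    exists (1 * MW d c e) => _ [h [h1 h2 h3] <-]; exact: (even_prod_Int_le hc hQ e0 hd ler01 h1 h2 h3).
  apply/set0P/eqP => E0; move: m0; rewrite /even_sup -/E E0 sup0 ltxx //.
have ep : 0 < (1 - th) * sup E by rewrite mulr_gt0 ?subr_gt0.
have [_ [g [h1 h2 h3] <-]] := sup_adherent ep hs.
rewrite (_ : sup E - (1 - th) * sup E = th * sup E); last by ring.
by move=> h4; exists g.
Qed.

(** Order of choices: [de] from [eta], then the number [J] of doublings from [clt_kl], then the
    closeness [th] to the supremum from [J], and only then the family [g]. Smoothing and
    near-maximality cost [eta] each, the relative entropies [eta * c i]. *)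
Lemma even_bound_eps D eta : Dg_admissible c Q D -> 0 < even_sup c Q e -> 0 < eta ->
  ln (even_sup c Q e) <= D + eta * (2 + \sum_i c i).
Proof.
move=> hD m0 eta0.
pose CS := Csm Q e; have CS0 : 0 <= CS by exact: Csm_ge0.
pose X1 := \sum_i 4 * CS / c i; pose X2 := 2 * CS * N%:R / eta.
have X1p i : 0 <= 4 * CS / c i by rewrite divr_ge0 ?mulr_ge0 // ltW.
have X10 : 0 <= X1 by apply: sumr_ge0 => i _.
have X20 : 0 <= X2 by rewrite divr_ge0 ?mulr_ge0 // ltW.
(* [X1] yields the smallness required by [smooth], and [X2] bounds the exponent of its extra factor
   by [eta]. *)
pose de := (1 + X1 + X2)^-1.
have den0 : 0 < 1 + X1 + X2 by lra.
have de0 : 0 < de by rewrite invr_gt0.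
have hu i : 4 * de * (Csm Q e / c i) <= 1.
  have -> : 4 * de * (Csm Q e / c i) = 4 * CS / c i / (1 + X1 + X2) by rewrite /de -/CS; ring.
  rewrite ler_pdivrMr // mul1r.
  have : 4 * CS / c i <= X1 by rewrite /X1 (bigD1 i) //= lerDl sumr_ge0.
  lra.
have hN : 2 * de * CS * N%:R <= eta.
  have -> : 2 * de * CS * N%:R = X2 * eta / (1 + X1 + X2).
    by rewrite /de /X2 divfK ?gt_eqF //; ring.
  rewrite ler_pdivrMr // mulrC; apply: ler_wpM2l; [exact: ltW | lra].
have hj i : exists j0, forall j, (j0 <= j)%N -> forall p : (d i).-tuple R -> R,
  gb (Ktail c Q e i) (e / c i) p -> (forall x, p (tscale (-1) x) = p x) -> Int p = 1 -> kl_close p de j eta.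
  exact: clt_kl.
pose j0 i := projT1 (cid (hj i)).
pose J := (\max_i j0 i)%N.
have hJ i := projT2 (cid (hj i)) J (leq_bigmax i).
(* [2^-1] serves [tail_bound]; the other term keeps the defect below [exp eta] once it is raised to
   the power [2 ^ J]. *)
pose th := Num.max (2^-1) (expR (- (eta / 2 ^+ J))).
have P20 : 0 < (2:R) ^+ J by rewrite exprn_gt0.
have th1 : th < 1.
  rewrite gt_max invf_lt1 // ?ltr1n //= -expR0 ltr_expR oppr_lt0 divr_gt0 //.
have [g [gg ge F hP]] := near_max m0 th1.
have P0 : 0 < prod_Int c g.
  apply: lt_trans hP; by rewrite mulr_gt0 // lt_max invr_gt0 ltr0n.
have Z0 := Int_gt0 gg P0.
have [gp p1 Fp] := norm_family gg Z0 F.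
set p : ffam := (fun i x => _) in gp p1 Fp.
rewrite mulr1 in Fp.
have hP2 : even_sup c Q e / 2 <= prod_Int c g.
  apply: le_trans (ltW hP); rewrite mulrC; apply: ler_wpM2r; first exact: ltW.
  by rewrite le_max lexx.
have Gt i : gb (Ktail c Q e i) (e / c i) (p i) by exact: tail_bound.
have pe i x : p i (tscale (-1) x) = p i x by rewrite /p ge.
have kl i := hJ i (p i) (Gt i) (pe i) (p1 i).
pose S i := projT1 (cid (kl i)).
pose w i := projT1 (cid (projT2 (cid (kl i)))).
have hS i : [/\ posdef (S i), measurable_fun setT (w i), forall x, 0 <= w i x,
      (\int[@lebR R (d i)]_x (w i x * gauss_density (S i) x)%:E <= eta%:E)%E &
      forall x, 0 < smoothed de (iter J dbl (p i)) x /\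
         - ln (smoothed de (iter J dbl (p i)) x) <= - ln (gauss_density (S i) x) + w i x].
  exact: (projT2 (cid (projT2 (cid (kl i))))).
have pS i : posdef (S i) by have [] := hS i.
have PV0 : 0 < (prod_Int c g)^-1 by rewrite invr_gt0.
pose q : ffam := fun i => iter J dbl (p i).
have gq : gbf q by move=> i; have [K [b G]] := gp i; have [K' G'] := gb_iter_dbl J G; exists K', b.
have Fq : feas c (Q + e%:M) ((even_sup c Q e * (prod_Int c g)^-1) ^+ (2 ^ J) / even_sup c Q e) q.
  exact: (feas_iter hn hc hQ e0 hd J PV0 m0 gp Fp).
set AJ := _ / _ in Fq.
have AJ0 : 0 < AJ by rewrite divr_gt0 // exprn_gt0 // mulr_gt0.
have AJle : AJ <= expR (eta - ln (even_sup c Q e)).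
  rewrite expRD expRN lnK ?posrE //; apply: ler_wpM2r; first by rewrite invr_ge0 ltW.
  have -> : eta = (2 ^ J)%:R * (eta / 2 ^+ J) by rewrite natrX mulrC divfK // gt_eqF.
  rewrite expRM_natl; apply: lerXn2r; rewrite ?nnegrE ?expR_ge0 //.
    by rewrite mulr_ge0 // ltW.
  rewrite ler_pdivrMr // -ler_pdivrMl ?expR_gt0 // -expRN.
  apply: le_trans (ltW hP); apply: ler_wpM2r; first exact: ltW.
  by rewrite le_max lexx orbT.
have sm := smooth hc hQ e0 AJ0 gq Fq de0 hu.
(* A separable majorant of [qform Q], ready to be integrated against couplings with the Gaussian
   marginals [S i]. *)
have main (x : N.-tuple R) : qform Q x <= (2 * eta - ln (even_sup c Q e)) +
   \sum_i c i * (- ln (gauss_density (S i) (block_proj i x)) + w i (block_proj i x)).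
  have cv0 i : 0 < smoothed de (q i) (block_proj i x) by have [_ _ _ _ h] := hS i; have [] := h (block_proj i x).
  have := sm x; rewrite (prod_ln cv0) => h.
  have : expR (\sum_i c i * ln (smoothed de (q i) (block_proj i x))) <=
      expR (eta - ln (even_sup c Q e) + (- qform Q x) + eta).
    rewrite !(expRD _ eta) !(expRD _ (- qform Q x)); apply: (le_trans h).
    apply: ler_pM; rewrite ?expR_ge0 //; first by rewrite mulr_ge0 ?expR_ge0 // ltW.
    - by apply: ler_wpM2r => //; exact: expR_ge0.
    - by rewrite ler_expR.
  rewrite ler_expR => h1.
  have h2 : \sum_i c i * - ln (smoothed de (q i) (block_proj i x)) <=
    \sum_i c i * (- ln (gauss_density (S i) (block_proj i x)) + w i (block_proj i x)).
    apply: ler_sum => i _; apply: ler_wpM2l; first exact: ltW.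
    by have [_ _ _ _ hh] := hS i; have [] := hh (block_proj i x).
  have h3 : \sum_i c i * - ln (smoothed de (q i) (block_proj i x)) = - \sum_i c i * ln (smoothed de (q i) (block_proj i x)).
    by rewrite -sumrN; apply: eq_bigr => i _; rewrite mulrN.
  rewrite h3 in h2; exact: (le_of_smoothed h1 h2).
have iw i : integ (fun x => w i x * gauss_density (S i) x) /\
    Int (fun x => w i x * gauss_density (S i) x) <= eta.
  have [_ mw w0 hw _] := hS i.
  have wg0 x : 0 <= w i x * gauss_density (S i) x by rewrite mulr_ge0 ?gd_ge0.
  have I : integ (fun x => w i x * gauss_density (S i) x).
    apply/integrableP; split.
      by apply/measurable_EFinP; apply: measurable_funM => //; exact: measurable_gd.
    apply: le_lt_trans (ltry eta).
    by under eq_integral => x _ do rewrite /= ger0_norm //.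
  by split => //; rewrite -lee_fin integE.
pose f : ffam := fun i x => c i * (- ln (gauss_density (S i) x) + w i x).
have iln i := integ_lngd (pS i).
have fE i : (fun x => f i x * gauss_density (S i) x) =
   (fun x => c i * (- ln (gauss_density (S i) x) * gauss_density (S i) x + w i x * gauss_density (S i) x)).
  by apply/funext => x; rewrite /f; ring.
have fi i : integ (fun x => f i x * gauss_density (S i) x).
  by rewrite fE; apply: integZ; apply: integD; [exact: (iln i).1 | exact: (iw i).1].
have fI i : Int (fun x => f i x * gauss_density (S i) x) <= c i * (ent (S i) + eta).
  rewrite fE IntZ; last by apply: integD; [exact: (iln i).1 | exact: (iw i).1].
  apply: ler_wpM2l; first exact: ltW.
  rewrite IntD; [|exact: (iln i).1|exact: (iw i).1].
  by rewrite (iln i).2 lerD2l (iw i).2.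
have mf i : measurable_fun setT (f i).
  apply: measurable_funM => //; apply: measurable_funD; last by have [] := hS i.
  apply: measurableT_comp => //; apply: measurableT_comp; last exact: measurable_gd.
  exact: measurable_ln.
have := hD S pS.
under eq_bigr => i _ do rewrite gauss_entropyE // -EFinM.
rewrite sumEFin.
set sp := ereal_sup _.
have sple : (sp <= (2 * eta - ln (even_sup c Q e) + \sum_i c i * (ent (S i) + eta))%:E)%E.
  apply: ge_ereal_sup => _ [mu cpl <-].
  apply: (le_trans (coupling_le pS cpl mf fi main)).
  by rewrite lee_fin lerD2l; apply: ler_sum => i _; exact: fI.
move=> h; have := le_trans h (leeD2r D%:E sple).
rewrite -EFinD lee_fin.
under [X in _ <= _ + X + _]eq_bigr => i _ do rewrite mulrDr.
rewrite big_split /= -mulr_suml => {}h.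
apply: (le_of_entropy h).
Qed.

Lemma even_bound D : Dg_admissible c Q D -> 0 < even_sup c Q e -> ln (even_sup c Q e) <= D.
Proof.
move=> hD m0; apply/ler_addgt0Pr => t t0.
have s0 : 0 < 2 + \sum_i c i.
  by apply: ltr_pwDl => //; apply: sumr_ge0 => i _; exact: ltW.
have t1 : 0 < t / (2 + \sum_i c i) by rewrite divr_gt0.
by have := even_bound_eps hD m0 t1; rewrite divfK // gt_eqF.
Qed.

End EvenBound.

(** * General families *)

Section Admissible.
Context {R : realType}.
Variables (n : nat) (d : 'I_n -> nat) (c : 'I_n -> R).
Hypothesis hc : forall i, 0 < c i.
Notation N := (dimE d).
Variables (Q : 'M[R]_N).
Hypotheses (hQ : Q^T = Q).

Definition dblk i : 'M[R]_(d i) := \matrix_(k, l) Q (tagnat.Rank i k) (tagnat.Rank i l).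

Lemma tnth_bmask i (x : N.-tuple R) j k :
  tnth (bmask i x) (tagnat.Rank j k) = if j == i then tnth x (tagnat.Rank j k) else 0.
Proof. by rewrite tnth_mktuple tagnat.Rank1K. Qed.

Lemma qform_bmask i (x : N.-tuple R) : qform Q (bmask i x) = qform (dblk i) (block_proj i x).
Proof.
rewrite !qformE !bil_sum sum_blocks (bigD1 i) //= [X in _ + X]big1 ?addr0; last first.
  move=> j ji; apply: big1 => k _; apply: big1 => s _.
  by rewrite mxE tnth_bmask (negbTE ji) !mul0r.
apply: eq_bigr => k _; rewrite sum_blocks (bigD1 i) //= [X in _ + X]big1 ?addr0; last first.
  move=> j ji; apply: big1 => l _.
  by rewrite !mxE !tnth_bmask (negbTE ji) mulr0.
by apply: eq_bigr => l _; rewrite !mxE !tnth_bmask eqxx !tnth_block.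
Qed.

Lemma ent_rank1 k (b : 'rV[R]_k) : ent (1%:M : 'M[R]_k) <= ent (1%:M + b^T *m b).
Proof.
have p1 : posdef (1%:M : 'M[R]_k) by exact: posdef_scalar.
have d2 : 0 < (2 * pi) ^+ k :> R by rewrite exprn_gt0 // mulr_gt0 // pi_gt0.
rewrite /ent lerD2l /nrm ler_ln ?posrE; last 2 first.
- exact: gd_norm_gt0.
- by apply: gd_norm_gt0; apply: posdef_addr => //; exact: psd_gram.
apply: ler_wsqrtr; apply: ler_wpM2l; first exact: ltW.
rewrite det_rank1 // det1 mul1r invmx1 lerDl bil_scalar mul1r; exact: nsq_ge0.
Qed.

Lemma tr_rank1 k (T : 'M[R]_k) (u : 'rV[R]_k) (r : R) :
  \tr (T *m ((r *: u)^T *m (r *: u))) = r ^+ 2 * bil T u u.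
Proof.
rewrite [(r *: u)^T]linearZ /= -scalemxAl -!scalemxAr scalerA mxtraceZ -expr2; congr (_ * _).
by rewrite mulmxA mxtrace_mulC mulmxA /mxtrace big_ord1.
Qed.

(* If [Q] were negative on a vector [v] of block [i], the covariances [1 + r^2 v^T v] would send the
   supremum in [Dg_admissible] to [-oo] as [r] grows, with entropies bounded below. *)
Lemma admissible_psd D : Dg_admissible c Q D -> forall i x, 0 <= qform Q (bmask i x).
Proof.
move=> hD i x; rewrite leNgt; apply/negP => qn.
pose y := bmask i x; pose v j := block_proj j y.
pose q := - qform Q y; have q0 : 0 < q by rewrite oppr_gt0.
have v0 : 0 < tdot (v i) (v i).
  rewrite lt_neqAle tdot_ge0 andbT eq_sym; apply/eqP => v0.
  move: qn; rewrite qform_bmask.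
  have -> : block_proj i x = tzero.
    apply: trow_inj; apply/eqP; rewrite trow0 -nsq_eq0 -tdot_nsq -v0 /v /y block_bmask eqxx //.
  by rewrite qformE trow0 /bil mul0mx mul0mx mxE ltxx.
have n0 := nsq_ge0 Q.
(* Makes the Young term [t * nsq Q * |v i|^2] at most [q / 2], so that half of the negativity
   remains. *)
pose t := q / (2 * (nsq Q + 1) * tdot (v i) (v i)).
have nq : 0 < nsq Q + 1 by rewrite ltr_wpDl.
have t0 : 0 < t by rewrite divr_gt0 // mulr_gt0 // mulr_gt0.
pose C' := nsq Q + 1.
(* Blocks of a separable majorant of [qform Q]: the cross terms between block [i] and the others are
   split by Young's inequality with weight [t]. *)
pose T j : 'M[R]_(d j) := if j == i then dblk j + (t * nsq Q)%:M else (t^-1 + C')%:M.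
have bound (z : N.-tuple R) : qform Q z <= 0 + \sum_j qform (T j) (block_proj j z).
  rewrite add0r; pose u := bmask i z; pose w := tadd z (tscale (-1) u).
  have -> : z = tadd u w by apply: eq_from_tnth => j; rewrite !(tnthD, tnthZ); ring.
  rewrite (qformD _ _ hQ).
  have -> : \sum_j qform (T j) (block_proj j (tadd u w)) =
     qform Q u + t * nsq Q * tdot u u + (t^-1 + C') * tdot w w.
    have bw j : block_proj j w = if j == i then tzero else block_proj j z.
      rewrite block_tadd block_tscale block_bmask; apply: eq_from_tnth => k.
      rewrite tnthD tnthZ; case: eqP => _; rewrite ?tnth_tzero; ring.
    have -> : tadd u w = z by apply: eq_from_tnth => j; rewrite !(tnthD, tnthZ); ring.
    rewrite tdot_bmask (tdot_blocks w) (bigD1 i) //= [in X in _ = X](bigD1 i) //= bw eqxx.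
    rewrite {1}/T eqxx qformE bil_addM bil_scalar -tdot_nsq -qformE -qform_bmask -/u.
    have -> : tdot (tzero : (d i).-tuple R) tzero = 0 by rewrite tdot_nsq trow0; apply/eqP; rewrite nsq_eq0.
    rewrite [X in _ = _ + X](_ : _ = \sum_(j < n | j != i) (t^-1 + C') * tdot (block_proj j w) (block_proj j w)); last first.
      by rewrite add0r mulr_sumr.
    congr (_ + _); apply: eq_bigr => j ji.
    by rewrite bw (negbTE ji) /T (negbTE ji) qformE bil_scalar -tdot_nsq.
  have h1 := bil_young Q (trow u) (trow w) t0.
  have h2 := qform_le Q w.
  rewrite -!tdot_nsq in h1; rewrite /C'; lra.
pose S r j : 'M[R]_(d j) := 1%:M + (r *: trow (v j))^T *m (r *: trow (v j)).
have pS r j : posdef (S r j) by apply: posdef_addr; [exact: posdef_scalar | exact: psd_gram].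
pose E1 := \sum_j c j * ent (1%:M : 'M[R]_(d j)).
pose K := \sum_j \tr (T j).
have trS r j : \tr (T j *m S r j) = \tr (T j) + r ^+ 2 * qform (T j) (v j).
  rewrite /S mulmxDr mulmx1 mxtraceD; congr (_ + _).
  by rewrite tr_rank1 qformE.
have sumT : \sum_j qform (T j) (v j) <= - (q / 2).
  rewrite (bigD1 i) //= big1 ?addr0; last first.
    move=> j ji; rewrite /v /y block_bmask (negbTE ji) qformE trow0 /bil mul0mx mul0mx mxE //.
  rewrite /T eqxx qformE bil_addM bil_scalar -tdot_nsq -qformE.
  have -> : qform (dblk i) (v i) = - q.
    by rewrite /q opprK /y /v /y block_bmask eqxx qform_bmask.
  have : t * nsq Q * tdot (v i) (v i) <= q / 2.
    have -> : t * nsq Q * tdot (v i) (v i) = q / 2 * (nsq Q / (nsq Q + 1)).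
      by rewrite /t; field; rewrite !gt_eqF.
    rewrite ler_piMr ?divr_ge0 ?(ltW q0) // ler_pdivrMr //; lra.
  lra.
have key r : E1 <= K - r ^+ 2 * (q / 2) + D.
  have := hD (S r) (pS r).
  under eq_bigr => j _ do rewrite gauss_entropyE // -EFinM.
  rewrite sumEFin; set sp := ereal_sup _.
  have sple : (sp <= (0 + \sum_j \tr (T j *m S r j))%:E)%E.
    apply: ge_ereal_sup => _ [mu cpl <-].
    have fi j := (Int_trace (T j) (pS r j)).1.
    have mf j : measurable_fun setT (fun z : (d j).-tuple R => qform (T j) z).
      exact: measurable_qform.
    apply: (le_trans (coupling_le (pS r) cpl mf fi bound)).
    rewrite lee_fin lerD2l; apply: ler_sum => j _.
    by rewrite (Int_trace (T j) (pS r j)).2.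
  move=> h; have := le_trans h (leeD2r D%:E sple).
  rewrite -EFinD lee_fin add0r => {}h.
  have h1 : E1 <= \sum_j c j * ent (S r j).
    by apply: ler_sum => j _; apply: ler_wpM2l; [exact: ltW | exact: ent_rank1].
  have h2 : \sum_j \tr (T j *m S r j) <= K - r ^+ 2 * (q / 2).
    under eq_bigr => j _ do rewrite trS.
    rewrite big_split /= -mulr_sumr lerD2l -mulrN.
    by apply: ler_wpM2l => //; exact: sqr_ge0.
  by apply: (le_trans h1); apply: (le_trans h); rewrite lerD2r.
(* [r] is then taken with [r ^+ 2 * (q / 2) = X], which contradicts [key]. *)
pose X := `|K + D - E1| + 1.
have X0 : 0 < X by rewrite ltr_wpDl.
have := key (Num.sqrt (2 * X / q)).
rewrite sqr_sqrtr; last by rewrite divr_ge0 // ?mulr_ge0 // ltW.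
have -> : 2 * X / q * (q / 2) = X by field; rewrite gt_eqF.
have := ler_norm (K + D - E1); rewrite /X; lra.
Qed.

End Admissible.

(** * Means and variances under doubling *)

Section Means.
Context {R : realType}.
Variable k : nat.
Implicit Types (p : k.-tuple R -> R) (v w x y : k.-tuple R).

Definition dist2 x y : R := tdot (tadd x (tscale (-1) y)) (tadd x (tscale (-1) y)).

Lemma dist2_ge0 x y : 0 <= dist2 x y. Proof. exact: tdot_ge0. Qed.
Lemma dist2E x y : dist2 x y = tdot x x - 2 * tdot x y + tdot y y.
Proof. by rewrite /dist2 !(tdotDl, tdotDr, tdotZl, tdotZr) (tdotC y x); ring. Qed.

Lemma measurable_dist2 v : measurable_fun setT (fun x => dist2 x v).
Proof. by apply: measurable_tdot; apply: measurable_tadd => //; exact: measurable_cst. Qed.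

(* Mean [v] and total variance [V], phrased with integrals of nonnegative functions only. *)
Definition meanV p v V := forall w, (\int[@lebR R k]_x (dist2 x w * p x)%:E = (V + dist2 w v)%:E)%E.

Definition mean p : k.-tuple R := [tuple Int (fun x => tnth x j * p x) | j < k].

Lemma integ_coord K a p j : gb K a p -> integ (fun x => tnth x j * p x).
Proof.
move=> G; have p0 x : 0 <= p x by exact: gb_ge0 G.
apply: (integ_le (g := fun x => p x + tdot x x * p x)).
- by apply: measurable_funM; [exact: measurable_tnth | exact: gb_measurable G].
- by apply: integD; [exact: gb_integrable G | exact: gb_integrable (gb_moment2 G)].
move=> x; rewrite normrM (ger0_norm (p0 x)) -[X in _ <= X + _]mul1r -mulrDl; apply: ler_wpM2r => //.
have h := tnth_sqr_le x j; rewrite ler_norml.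
set t := tnth x j in h *; have : 0 <= (t - 1) ^+ 2 by exact: sqr_ge0.
have : 0 <= (t + 1) ^+ 2 by exact: sqr_ge0.
have := sqr_ge0 t; rewrite !expr2 in h *; move=> *; apply/andP; split; nra.
Qed.

Lemma meanV_mean K a p : gb K a p -> Int p = 1 -> exists2 V, 0 <= V & meanV p (mean p) V.
Proof.
move=> G p1; have p0 x : 0 <= p x by exact: gb_ge0 G.
have i0 := gb_integrable G; have i2 := gb_integrable (gb_moment2 G).
have ic j := integ_coord j G.
pose M2 := Int (fun x => tdot x x * p x).
pose V := M2 - tdot (mean p) (mean p).
have H w : (\int[@lebR R k]_x (dist2 x w * p x)%:E = (V + dist2 w (mean p))%:E)%E.
  have [s1 s2] := Int_sum (index_enum 'I_k) (fun j => integZ (tnth w j) (ic j)).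
  have E : (fun x => dist2 x w * p x) = (fun x => tdot x x * p x +
     (-2 * (\sum_j tnth w j * (tnth x j * p x)) + tdot w w * p x)).
    apply/funext => x; rewrite dist2E.
    have -> : \sum_j tnth w j * (tnth x j * p x) = tdot x w * p x.
      by rewrite /tdot mulr_suml; apply: eq_bigr => j _; ring.
    ring.
  have i3 := integZ (-2) s1; have i4 := integZ (tdot w w) i0.
  under eq_integral => x _ do rewrite (congr1 (fun h => h x) E).
  rewrite -integE; last by apply: integD => //; exact: integD.
  apply: EFin_eq; rewrite IntD //; last exact: integD.
  rewrite IntD // IntZ // IntZ // s2 p1 -/M2.
  have -> : \sum_j Int (fun x => tnth w j * (tnth x j * p x)) = tdot w (mean p).
    by apply: eq_bigr => j _; rewrite IntZ // tnth_mktuple.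
  by rewrite dist2E /V; ring.
exists V => //.
have := H (mean p); have -> : dist2 (mean p) (mean p) = 0 by rewrite dist2E; ring.
rewrite addr0 => h; rewrite -lee_fin -h; apply: int_ge0 => x.
by rewrite mulr_ge0 ?dist2_ge0.
Qed.

(** For independent copies means and variances add, so dividing by [sqrt 2] restores the variance
    and leaves the mean multiplied by [sqrt 2 = 2 * r2]. *)
Lemma meanV_dbl K a p v V : gb K a p -> Int p = 1 -> 0 <= V -> meanV p v V ->
  meanV (dbl p) (tscale (2 * r2) v) V.
Proof.
move=> G p1 V0 H w; have p0 x : 0 <= p x by exact: gb_ge0 G.
have mp := gb_measurable G.
have p1E : (\int[@lebR R k]_y (p y)%:E = 1)%E by rewrite -(IntE G) p1.
have rr : r2 ^+ 2 = 2^-1 :> R by rewrite expr2 r2_sqr.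
have mD u := measurable_dist2 u.
have mDp u : measurable_fun setT (fun x => dist2 x u * p x) by exact: measurable_funM.
have Dp0 u x : 0 <= dist2 x u * p x by rewrite mulr_ge0 ?dist2_ge0.
under eq_integral => y _ do rewrite EFinM.
rewrite (int_dbl (h := fun y => (dist2 y w)%:E) G); last 2 first.
- exact/measurable_EFinP.
- by move=> y; rewrite lee_fin dist2_ge0.
pose u0 := tadd (tscale (2 * r2) w) (tscale (-1) v).
have inner x : (\int[@lebR R k]_y ((dist2 (rotp x y) w)%:E * (p x * p y)%:E) =
   (V / 2 * p x + 2^-1 * (dist2 x u0 * p x))%:E)%E.
  pose u := tadd (tscale (2 * r2) w) (tscale (-1) x).
  transitivity (\int[@lebR R k]_y (2^-1 * p x * (dist2 y u * p y))%:E)%E.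
    apply: eq_integral => y _; rewrite -EFinM; apply: EFin_eq.
    have -> : dist2 (rotp x y) w = 2^-1 * dist2 y u.
      rewrite !dist2E /rotp /u !(tdotDl, tdotDr, tdotZl, tdotZr) (tdotC y x) (tdotC w x) (tdotC y w).
      have e1 : r2 * (r2 * tdot x x) = 2^-1 * tdot x x by rewrite mulrA -expr2 rr.
      have -> : 2 * r2 * (2 * r2 * tdot w w) = 4 * r2 ^+ 2 * tdot w w by ring.
      rewrite rr; rewrite (_ : forall a b cc dd : R, r2 * (r2 * (a + b) + r2 * (cc + dd)) = r2 ^+ 2 * (a + b + (cc + dd))) => [|*]; last by ring.
      rewrite rr; by field.
    by ring.
  rewrite int_scaler //; last by rewrite mulr_ge0 ?invr_ge0.
  rewrite H -EFinM; apply: EFin_eq.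
  have -> : dist2 u v = dist2 x u0.
    rewrite !dist2E /u /u0 !(tdotDl, tdotDr, tdotZl, tdotZr) (tdotC x w) (tdotC v w) ?(tdotC v x); ring.
  by field.
under eq_integral => x _ do rewrite inner.
have V20 : 0 <= V / 2 by rewrite divr_ge0.
rewrite ge0_int_add; last 4 first.
- exact: measurable_funM.
- exact: measurable_funM.
- by move=> x; rewrite mulr_ge0.
- by move=> x; apply: mulr_ge0 => //; rewrite invr_ge0.
rewrite !int_scaler ?invr_ge0 // p1E H mule1 -EFinM -EFinD; apply: EFin_eq.
rewrite !dist2E /u0 !(tdotDl, tdotDr, tdotZl, tdotZr) (tdotC v w).
have -> : 2 * r2 * (2 * r2 * tdot w w) = 4 * r2 ^+ 2 * tdot w w by ring.
have -> : 2 * r2 * (2 * r2 * tdot v v) = 4 * r2 ^+ 2 * tdot v v by ring.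
rewrite rr; by field.
Qed.

Lemma meanV_iter K a p v V j : gb K a p -> Int p = 1 -> 0 <= V -> meanV p v V ->
  meanV (iter j dbl p) (tscale ((2 * r2) ^+ j) v) V.
Proof.
move=> G p1 V0 H; elim: j => [|j IH].
  by rewrite expr0 (_ : tscale 1 v = v) //; apply: eq_from_tnth => i; rewrite tnthZ mul1r.
have [K' G'] := gb_iter_dbl j G; have p1' := Int_iter_dbl j G p1.
have := meanV_dbl G' p1' V0 IH; rewrite iterS.
by rewrite (_ : tscale (2 * r2) _ = tscale ((2 * r2) ^+ j.+1) v) //; apply: eq_from_tnth => i; rewrite !tnthZ exprS mulrA.
Qed.

(** [rad2 V] exceeds [2 V], so by Chebyshev less than half of the mass lies farther away; [lowt] is
    the level for which [lowt V * exp (rad2 V) * exp (- |x - v|^2)] has integral exactly [1 / 2]. *)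
Definition rad2 (V : R) := 2 * V + 1.
Definition lowt (V : R) := expR (- rad2 V) / (2 * Num.sqrt pi ^+ k).

(* Otherwise [p <= T exp (-|x-v|^2) + |x-v|^2 p / rad2 V] everywhere, and the integral of the
   right-hand side is less than 1. *)
Lemma exists_point K a p v V : gb K a p -> Int p = 1 -> 0 <= V -> meanV p v V ->
  exists2 x, dist2 x v <= rad2 V & lowt V < p x.
Proof.
move=> G p1 V0 H; apply: contrapT => nex.
have p0 x : 0 <= p x by exact: gb_ge0 G.
have mp := gb_measurable G.
have p1E : (\int[@lebR R k]_y (p y)%:E = 1)%E by rewrite -(IntE G) p1.
have r0 : 0 < rad2 V by rewrite /rad2; lra.
have sp0 : 0 < Num.sqrt pi ^+ k :> R by rewrite exprn_gt0 // sqrtr_gt0 pi_gt0.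
pose T := lowt V * expR (rad2 V).
have T0 : 0 <= T by rewrite mulr_ge0 ?expR_ge0 // divr_ge0 ?expR_ge0 // mulr_ge0 // ltW.
have TE : T * Num.sqrt pi ^+ k = 2^-1.
  by rewrite /T /lowt mulrAC expRN; field; rewrite !gt_eqF ?expR_gt0.
have pt x : p x <= T * expR (- 1 * dist2 x v) + (rad2 V)^-1 * (dist2 x v * p x).
  have q0 : 0 <= (rad2 V)^-1 * (dist2 x v * p x) by rewrite mulr_ge0 ?invr_ge0 ?mulr_ge0 ?dist2_ge0 // ltW.
  case: (leP (dist2 x v) (rad2 V)) => hx.
    have h : p x <= lowt V by rewrite leNgt; apply/negP => h; apply: nex; exists x.
    apply: (le_trans h); rewrite -[leLHS]addr0; apply: lerD => //.
    rewrite /T -mulrA -expRD -[leLHS]mulr1; apply: ler_wpM2l.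
      by rewrite divr_ge0 ?expR_ge0 // mulr_ge0 // ltW.
    by rewrite -[leLHS]expR0 ler_expR; lra.
  rewrite -[leLHS]add0r; apply: lerD; first by rewrite mulr_ge0 ?expR_ge0.
  rewrite mulrA -[leLHS]mul1r; apply: ler_wpM2r => //.
  by rewrite mulrC ler_pdivlMr // mul1r ltW.
have mg : measurable_fun setT (fun x => expR (- 1 * dist2 x v)).
  by apply: measurable_expR_comp; apply: measurable_funM => //; exact: measurable_dist2.
have mDp : measurable_fun setT (fun x => dist2 x v * p x).
  by apply: measurable_funM => //; exact: measurable_dist2.
have Dp0 x : 0 <= dist2 x v * p x by rewrite mulr_ge0 ?dist2_ge0.
have ri : 0 <= (rad2 V)^-1 by rewrite invr_ge0 ltW.
have : (1 <= (2^-1 + (rad2 V)^-1 * V)%:E)%E.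
  rewrite -p1E.
  apply: (@le_trans _ _ (\int[@lebR R k]_x (T * expR (- 1 * dist2 x v) + (rad2 V)^-1 * (dist2 x v * p x))%:E)%E).
    apply: ge0_le_int => [//||x]; last by rewrite p0 pt.
    by apply: measurable_funD; exact: measurable_funM.
  rewrite ge0_int_add; last 4 first.
  - exact: measurable_funM.
  - exact: measurable_funM.
  - by move=> x; rewrite mulr_ge0 ?expR_ge0.
  - by move=> x; apply: mulr_ge0.
  rewrite !int_scaler //.
  rewrite H (_ : dist2 v v = 0) ?addr0; last by rewrite dist2E; ring.
  have mgE : measurable_fun setT (fun x : k.-tuple R => (expR (- 1 * tdot x x))%:E).
    by apply/measurable_EFinP; exact: measurable_gk.
  have gE0 (x : k.-tuple R) : (0 <= (expR (- 1 * tdot x x))%:E)%E by rewrite lee_fin expR_ge0.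
  have := int_lebR_shift (tscale (-1) v) mgE gE0; rewrite (@int_gk R k 1 ltr01) divr1 => ->.
  by rewrite -!EFinM TE -EFinD.
rewrite leNgt => /negP; apply.
rewrite lte_fin; have : (rad2 V)^-1 * V < 2^-1.
  rewrite mulrC ltr_pdivrMr // /rad2; lra.
lra.
Qed.

End Means.

(** * Dominated families without parity *)

Section General.
Context {R : realType}.
Variables (n : nat) (d : 'I_n -> nat) (c : 'I_n -> R) (hn : (0 < n)%N).
Hypothesis hc : forall i, 0 < c i.
Notation N := (dimE d).
Notation ffam := (forall i : 'I_n, (d i).-tuple R -> R).
Implicit Types (g p : ffam).

Lemma pow2_bounded (X K : R) : (forall j, 2 ^+ j * X <= K) -> X <= 0.
Proof.
move=> H; rewrite leNgt; apply/negP => X0.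
have K0 : 0 <= `|K| / X by rewrite divr_ge0 // ltW.
have := H (Num.bound (`|K| / X)); rewrite leNgt => /negP; apply.
apply: (le_lt_trans (ler_norm K)).
rewrite -ltr_pdivrMr //; apply: (lt_le_trans (archi_boundP K0)).
by rewrite -natrX ler_nat ltnW // ltn_expl.
Qed.

Lemma le_of_doubled (A qb L W S LT l qX B qu ut rt nu nr : R) : S <= A * L - l - qX -> LT <= S ->
  qX = A * qb + qu + 2 * B -> 2 * - B <= A * W + ut -> - qu <= nu -> ut <= rt -> nu <= nr ->
  A * (qb - L - W) <= rt + nr - LT - l.
Proof. by rewrite !mulrBr; lra. Qed.

Section Fix.
Variables (Q : 'M[R]_N) (e : R).
Hypotheses (hQ : Q^T = Q) (e0 : 0 < e) (hd : forall i x, 0 <= qform Q (bmask i x)).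
Let Q' := Q + e%:M.

(** Witness: Gaussians whose product, with the powers [c i], is [exp (- (nsq Q' + 1) |x|^2)]. *)
Lemma even_sup_gt0 : 0 < even_sup c Q e.
Proof.
pose b i := (nsq Q' + 1) / c i.
have b0 i : 0 < b i by rewrite divr_gt0 // ltr_wpDl ?nsq_ge0.
pose h : ffam := fun i x => expR (- b i * tdot x x).
have gh i : gb 1 (b i) (h i).
  split; [exact: b0 | exact: measurable_gk | move=> x; rewrite mul1r lexx andbT; exact: expR_ge0].
have hh : gbf h by move=> i; exists 1, (b i).
have eh : evf h by move=> i x; rewrite /h tdotZl tdotZr (mulrA (-1)) mulrNN !mul1r.
have Fh : feas c Q' 1 h.
  move=> x; rewrite (prod_expR c (fun i => - b i * tdot (block_proj i x) (block_proj i x))) mul1r ler_expR.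
  have -> : \sum_i c i * (- b i * tdot (block_proj i x) (block_proj i x)) = - ((nsq Q' + 1) * tdot x x).
    rewrite tdot_blocks mulr_sumr -sumrN; apply: eq_bigr => i _.
    by rewrite /b; field; rewrite gt_eqF.
  by rewrite lerN2 qform_le.
have := prod_Int_le hn hc hQ e0 hd ltr01 hh eh Fh; rewrite mul1r; apply: lt_le_trans.
rewrite /prod_Int prodr_gt0 // => i _; apply: powR_gt0.
by rewrite /Int int_gk //= exprn_gt0 // sqrtr_gt0 divr_gt0 ?pi_gt0.
Qed.

(* After [j] doublings the constant in the constraint is of order [exp (2^j L)] while the mean has become
   [2^(j/2) b]; evaluating near the mean, where the density is bounded below, and letting [j] grow
   compares [<b, Q' b>] with [L]. *)
Lemma general_bound g : gbf g -> feas c Q' 1 g -> (forall i, 0 < Int (g i)) ->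
  \sum_i c i * ln (Int (g i)) +
    qform Q' (Defs.glue (fun i => mean (fun x => (Int (g i))^-1 * g i x))) <= ln (even_sup c Q e).
Proof.
move=> gg F Z0; have m0 := even_sup_gt0.
have [gp p1 Fp] := norm_family gg Z0 F.
set p : ffam := (fun i x => _) in gp p1 Fp.
rewrite mulr1 in Fp.
have PE : prod_Int c g = expR (\sum_i c i * ln (Int (g i))) by rewrite /prod_Int prod_ln.
have P0 : 0 < prod_Int c g by rewrite PE expR_gt0.
have PV0 : 0 < (prod_Int c g)^-1 by rewrite invr_gt0.
have exV i : exists2 V, 0 <= V & meanV (p i) (mean (p i)) V.
  by have [K [a G]] := gp i; exact: meanV_mean G (p1 i).
pose V i := s2val (cid2 (exV i)).
have V0 i : 0 <= V i := s2valP (cid2 (exV i)).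
have VP i : meanV (p i) (mean (p i)) (V i) := s2valP' (cid2 (exV i)).
pose b := Defs.glue (fun i => mean (p i)); rewrite -/b.
pose sg : R := 2 * r2.
have sg2 j : (sg ^+ j) ^+ 2 = 2 ^+ j.
  rewrite -exprM mulnC exprM; congr (_ ^+ _); rewrite /sg exprMn !expr2 r2_sqr; by field.
pose L := ln (even_sup c Q e) - \sum_i c i * ln (Int (g i)).
pose LT := \sum_i c i * ln (lowt (d i) (V i)).
pose rho := \sum_i rad2 (V i).
have lt0 i : 0 < lowt (d i) (V i).
  by rewrite divr_gt0 ?expR_gt0 // mulr_gt0 // exprn_gt0 // sqrtr_gt0 pi_gt0.
(* Young's inequality with weight [t] separates the scaled mean from the bounded displacement [u].
   The right-hand side does not depend on [j], so [pow2_bounded] applies, and then [t] tends to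
   0. *)
have step j t : 0 < t -> 2 ^+ j * (qform Q' b - L - t * nsq Q' * tdot b b) <=
    rho / t + (nsq Q' + 1) * rho - LT - ln (even_sup c Q e).
  move=> t0; pose q : ffam := fun i => iter j dbl (p i).
  have Fq := feas_iter hn hc hQ e0 hd j PV0 m0 gp Fp.
  have exx i : exists2 x, dist2 x (tscale (sg ^+ j) (mean (p i))) <= rad2 (V i) & lowt (d i) (V i) < q i x.
    have [K [a G]] := gp i; have [K' G'] := gb_iter_dbl j G.
    apply: (exists_point G') => //; first exact: Int_iter_dbl G (p1 i).
    exact: (meanV_iter j G (p1 i) (V0 i) (VP i)).
  pose x i := s2val (cid2 (exx i)).
  have x1 i : dist2 (x i) (tscale (sg ^+ j) (mean (p i))) <= rad2 (V i) := s2valP (cid2 (exx i)).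
  have x2 i : lowt (d i) (V i) < q i (x i) := s2valP' (cid2 (exx i)).
  have q0 i : 0 < q i (x i) by exact: lt_trans (x2 i).
  have := feas_fam x Fq; rewrite (prod_ln c q0).
  have -> : (even_sup c Q e * (prod_Int c g)^-1) ^+ (2 ^ j) / even_sup c Q e = expR (2 ^+ j * L - ln (even_sup c Q e)).
    rewrite expRD expRN lnK ?posrE //; congr (_ / _).
    rewrite -natrX expRM_natl; congr (_ ^+ _).
    by rewrite /L expRD lnK ?posrE // expRN -PE.
  rewrite -expRD ler_expR => h1.
  have h2 : LT <= \sum_i c i * ln (q i (x i)).
    apply: ler_sum => i _; apply: ler_wpM2l; first exact: ltW.
    by rewrite ler_ln ?posrE // ltW.
  pose X := Defs.glue x; pose u := tadd X (tscale (-1) (tscale (sg ^+ j) b)).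
  have u2 : tdot u u <= rho.
    rewrite tdot_blocks; apply: ler_sum => i _.
    by rewrite /u !(block_tadd, block_tscale) !block_glue; exact: x1.
  have XE : X = tadd (tscale (sg ^+ j) b) u by apply: eq_from_tnth => s; rewrite !(tnthD, tnthZ); ring.
  have hQ' : Q'^T = Q' by exact: symQ'.
  have := qformD (tscale (sg ^+ j) b) u hQ'; rewrite -XE qformZ // sg2 => h3.
  have := bil_young (- Q') (trow (tscale (sg ^+ j) b)) (trow u) t0.
  have nN : nsq (- Q') = nsq Q' by apply: eq_bigr => i _; apply: eq_bigr => s _; rewrite mxE sqrrN.
  have bN v w : bil (- Q') v w = - bil Q' v w by rewrite /bil mulmxN mulNmx mxE.
  rewrite nN bN -!tdot_nsq tdotZl tdotZr (mulrA (sg ^+ j)) -expr2 sg2 => h4.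
  have := qform_le (- Q') u; rewrite nN qformE bN -qformE => h5.
  have h6 : tdot u u / t <= rho / t by apply: ler_wpM2r => //; rewrite invr_ge0 ltW.
  have h7 : (nsq Q' + 1) * tdot u u <= (nsq Q' + 1) * rho.
    by apply: ler_wpM2l => //; rewrite addr_ge0 ?nsq_ge0.
  have E1 : t * nsq Q' * (2 ^+ j * tdot b b) = 2 ^+ j * (t * nsq Q' * tdot b b) by ring.
  rewrite E1 in h4; exact: (le_of_doubled h1 h2 h3 h4 h5 h6 h7).
have fin t : 0 < t -> qform Q' b - L - t * nsq Q' * tdot b b <= 0.
  by move=> t0; apply: (pow2_bounded (K := rho / t + (nsq Q' + 1) * rho - LT - ln (even_sup c Q e))) => j; exact: step.
suff : qform Q' b - L <= 0 by rewrite /L; lra.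
apply/ler_addgt0Pr => eps ep; rewrite add0r.
have den : 0 < nsq Q' * tdot b b + 1 by rewrite ltr_wpDl // mulr_ge0 ?nsq_ge0 ?tdot_ge0.
have t0 : 0 < eps / (nsq Q' * tdot b b + 1) by rewrite divr_gt0.
have := fin _ t0.
have : eps / (nsq Q' * tdot b b + 1) * nsq Q' * tdot b b <= eps.
  rewrite -mulrA mulrAC ler_pdivrMr //; apply: ler_wpM2l; [exact: ltW | lra].
lra.
Qed.

Lemma dominated_bound D g : Dg_admissible c Q D -> gbf g -> feas c Q' 1 g -> (forall i, 0 < Int (g i)) ->
  \sum_i c i * ln (Int (g i)) +
    qform Q (Defs.glue (fun i => mean (fun x => (Int (g i))^-1 * g i x))) <= D.
Proof.
move=> hD gg F Z0; apply: le_trans (even_bound hn hc hQ e0 hd hD even_sup_gt0).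
apply: le_trans (general_bound gg F Z0); rewrite lerD2l qformQ' lerDl.
by rewrite mulr_ge0 ?tdot_ge0 // ltW.
Qed.

End Fix.
End General.

(** * Truncation and passage to the limit *)

Section Limits.
Context {R : realType}.

Lemma cvg_sumR (I : Type) (s : seq I) (F : I -> nat -> R) (l : I -> R) :
  (forall i, F i x @[x --> \oo] --> l i) ->
  (fun m => \sum_(i <- s) F i m) x @[x --> \oo] --> \sum_(i <- s) l i.
Proof.
move=> H; elim: s => [|i s IH].
  by rewrite big_nil; under eq_fun => m do rewrite big_nil; exact: cvg_cst.
by rewrite big_cons; under eq_fun => m do rewrite big_cons; exact: (cvgD (H i) IH).
Qed.

Lemma Int_dct k (F : nat -> k.-tuple R -> R) (f h : k.-tuple R -> R) :
  (forall m, measurable_fun setT (F m)) -> measurable_fun setT f ->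
  (forall x, F m x @[m --> \oo] --> f x) -> integ h -> (forall m x, `|F m x| <= h x) ->
  Int (F m) @[m --> \oo] --> Int f.
Proof.
move=> mF mf cF ih Fh.
have iF m : integ (F m) by exact: (integ_le (mF m) ih (Fh m)).
have [|||||i _ c] := @dominated_convergence _ _ _ (@lebR R k) setT measurableT
   (fun m => EFin \o F m) (EFin \o f) (EFin \o h).
- by move=> m; apply/measurable_EFinP; exact: mF.
- exact/measurable_EFinP.
- by apply: aeW => x _; apply: cvg_EFin; [exact: nearW | exact: cF].
- exact: ih.
- by apply: aeW => x m _; rewrite /= lee_fin.
have c' : (\int[@lebR R k]_x (F m x)%:E)%E @[m --> \oo] --> (Int f)%:E by rewrite integE.
exact: (fine_cvg c').
Qed.

Definition gfun k (f : k.-tuple R -> \bar R) (x : k.-tuple R) : R := fine (expeR (- f x)).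

Section One.
Variables (k : nat) (f : k.-tuple R -> \bar R).
Hypotheses (mf : measurable_fun setT f) (fN : forall x, f x != -oo%E).
Let g := gfun f.

Lemma gfunE x : (g x)%:E = expeR (- f x).
Proof. by rewrite /g /gfun; have := fN x; case: (f x) => [r| |]. Qed.

Lemma gfun_ge0 x : 0 <= g x.
Proof. by rewrite -lee_fin gfunE expeR_ge0. Qed.

Lemma measurable_gfun : measurable_fun setT g.
Proof.
have -> : g = fun x => if f x == +oo%E then 0 else expR (- fine (f x)).
  by apply/funext => x; rewrite /g /gfun; have := fN x; case: (f x) => [r| |].
apply: measurable_fun_ifT.
- by apply: measurable_fun_eqe => //; exact: measurable_cst.
- exact: measurable_cst.
- apply: measurable_expR_comp; apply: measurableT_comp => //.
  exact: (mcomp (fine_measurable measurableT) mf).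
Qed.

Hypothesis hb : has_barycenter f.

Lemma massE : mass f = (Int g)%:E /\ 0 < Int g.
Proof.
have [/andP[m0 m1] _] := hb.
have E : mass f = (\int[@lebR R k]_x (g x)%:E)%E by apply: eq_integral => x _; rewrite gfunE.
have fm : mass f \is a fin_num by rewrite ge0_fin_numE // ltW.
have E2 : mass f = (Int g)%:E by rewrite /Int -E fineK.
by split => //; rewrite -lte_fin -E2.
Qed.

Lemma integ_gfun : integ g.
Proof.
apply/integrableP; split; first by apply/measurable_EFinP; exact: measurable_gfun.
under eq_integral => x _ do rewrite /= ger0_norm ?gfun_ge0 // gfunE.
by have [/andP[_ m1] _] := hb.
Qed.

Lemma integ_gfun_coord j : integ (fun x => tnth x j * g x).
Proof.
have mj : measurable_fun setT (fun x : k.-tuple R => tnth x j * g x).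
  by apply: measurable_funM; [exact: measurable_tnth | exact: measurable_gfun].
apply/integrableP; split; first exact/measurable_EFinP.
have [_ h] := hb; apply: le_lt_trans h; apply: ge0_le_integral => //.
- by apply: measurableT_comp => //; exact/measurable_EFinP.
- under eq_fun => x do rewrite -gfunE -EFinM.
  apply/measurable_EFinP; apply: measurable_funM; last exact: measurable_gfun.
  have mT : measurable_fun setT (fun x : k.-tuple R => tdot x x) by exact: measurable_tdot.
  have ms : measurable_fun setT (Num.sqrt : R -> R).
    by apply: continuous_measurable_fun; exact: sqrt_continuous.
  exact: (mcomp ms mT).
- move=> x _; rewrite -gfunE -EFinM /= lee_fin normrM (ger0_norm (gfun_ge0 x)).
  apply: ler_wpM2r; first exact: gfun_ge0.
  by rewrite /tnorm -sqrtr_sqr; apply: ler_wsqrtr; exact: tnth_sqr_le.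
Qed.

Lemma barE j : tnth (bar f) j = Int (fun x => tnth x j * g x) / Int g.
Proof.
rewrite tnth_mktuple (massE).1 /=; congr (_ / _); rewrite /Int; congr fine.
by apply: eq_integral => x _; rewrite -gfunE -EFinM.
Qed.

(** The cut at height [m + 1] and the Gaussian factor put [g] into the class [gb]. For [b = 1 / c_i]
    the Gaussian factors of a family multiply, with the powers [c_i], to [exp (- |x|^2 / (m + 1))],
    which matches [e = 1 / (m + 1)] in [dominated_bound]. *)
Definition trunc (b : R) (m : nat) (x : k.-tuple R) : R :=
  Num.min (g x) m.+1%:R * expR (- (m.+1%:R^-1 * b) * tdot x x).

Variable b : R.
Hypothesis b0 : 0 < b.

Lemma trunc_ge0 m x : 0 <= trunc b m x.
Proof. by rewrite mulr_ge0 ?expR_ge0 // le_min gfun_ge0 ler0n. Qed.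

Lemma trunc_le m x : trunc b m x <= g x * expR (- (m.+1%:R^-1 * b) * tdot x x).
Proof. by apply: ler_wpM2r; [exact: expR_ge0 | rewrite ge_min lexx]. Qed.

Lemma trunc_le_g m x : trunc b m x <= g x.
Proof.
apply: (le_trans (trunc_le m x)); rewrite -[leRHS]mulr1; apply: ler_wpM2l; first exact: gfun_ge0.
by rewrite -[leRHS]expR0 ler_expR mulNr oppr_le0 !mulr_ge0 ?tdot_ge0 ?invr_ge0 // ltW.
Qed.

Lemma gb_trunc m : gb m.+1%:R (m.+1%:R^-1 * b) (trunc b m).
Proof.
split.
- by rewrite mulr_gt0 ?invr_gt0.
- apply: measurable_funM; last exact: measurable_gk.
  by apply: measurable_minr => //; exact: measurable_gfun.
- move=> x; rewrite trunc_ge0 /=; apply: ler_wpM2r; first exact: expR_ge0.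
  by rewrite ge_min lexx orbT.
Qed.

Lemma cvg_trunc x : trunc b m x @[m --> \oo] --> g x.
Proof.
rewrite -[g x]mulr1; apply: cvgM.
- apply: cvg_near_cst; near=> m; apply/min_idPl.
  rewrite ltW // (lt_le_trans (archi_boundP (gfun_ge0 x))) // ler_nat ltnW // ltnS.
  near: m; exact: nbhs_infty_ge.
- rewrite -[X in _ --> X]expR0; apply: continuous_cvg; first exact: continuous_expR.
  have -> : 0 = - (0 * b) * tdot x x by rewrite mul0r oppr0 mul0r.
  apply: cvgMl; apply: cvgN; apply: cvgMl; exact: cvg_harmonic.
Unshelve. all: by end_near. Qed.

Lemma cvg_Int_trunc : Int (trunc b m) @[m --> \oo] --> Int g.
Proof.
apply: (Int_dct (h := g)).
- by move=> m; exact: gb_measurable (gb_trunc m).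
- exact: measurable_gfun.
- exact: cvg_trunc.
- exact: integ_gfun.
- by move=> m x; rewrite ger0_norm ?trunc_ge0 // trunc_le_g.
Qed.

Lemma cvg_Int_trunc_coord j :
  Int (fun x => tnth x j * trunc b m x) @[m --> \oo] --> Int (fun x => tnth x j * g x).
Proof.
apply: (Int_dct (h := fun x => `|tnth x j * g x|)).
- by move=> m; apply: measurable_funM; [exact: measurable_tnth | exact: gb_measurable (gb_trunc m)].
- by apply: measurable_funM; [exact: measurable_tnth | exact: measurable_gfun].
- by move=> x; apply: cvgMr; exact: cvg_trunc.
- have := integrable_abse (integ_gfun_coord j); exact.
- move=> m x; rewrite (normrM (tnth x j) (trunc b m x)) (normrM (tnth x j) (g x)); apply: ler_wpM2l => //.
  by rewrite !ger0_norm ?trunc_ge0 ?gfun_ge0 // trunc_le_g.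
Qed.

Lemma cvg_mean_trunc j :
  tnth (mean (fun x => (Int (trunc b m))^-1 * trunc b m x)) j @[m --> \oo] --> tnth (bar f) j.
Proof.
have E m : tnth (mean (fun x => (Int (trunc b m))^-1 * trunc b m x)) j =
   (Int (trunc b m))^-1 * Int (fun x => tnth x j * trunc b m x).
  rewrite tnth_mktuple -IntZ; last exact: integ_coord (gb_trunc m).
  by rewrite /Int; congr fine; apply: eq_integral => x _; apply: EFin_eq; ring.
under eq_fun => m do rewrite E.
rewrite barE mulrC; apply: cvgM; last exact: cvg_Int_trunc_coord.
by apply: cvgV; [rewrite gt_eqF // (massE).2 | exact: cvg_Int_trunc].
Qed.

End One.
End Limits.

(** * The inequality for arbitrary families *)

Section Part1.
Context {R : realType}.
Variables (n : nat) (d : 'I_n -> nat) (c : 'I_n -> R) (hn : (0 < n)%N).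
Hypothesis hc : forall i, 0 < c i.
Notation N := (dimE d).
Variables (Q : 'M[R]_N).
Hypotheses (hQ : Q^T = Q).
Variable f : forall i : 'I_n, (d i).-tuple R -> \bar R.
Arguments f : clear implicits.
Hypotheses (mf : forall i, measurable_fun [set: (d i).-tuple R] (f i))
  (fN : forall i x, f i x != -oo%E) (hb : forall i, has_barycenter (f i))
  (F : forall x : N.-tuple R, ((qform Q x)%:E <= \sum_(i < n) (c i)%:E * f i (block_proj i x))%E).
Arguments fN : clear implicits.
Arguments hb : clear implicits.
Arguments mf : clear implicits.

Lemma feas_gfun : feas c Q 1 (fun i => gfun (f i)).
Proof.
move=> x; rewrite mul1r.
have [[i fi]|nf] := pselect (exists i, f i (block_proj i x) = +oo%E).
  by rewrite (bigD1 i) //= {1}/gfun fi /= powR0 ?mul0r ?expR_ge0 // gt_eqF.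
have fE i : f i (block_proj i x) = (fine (f i (block_proj i x)))%:E.
  have := fN i (block_proj i x); have : f i (block_proj i x) <> +oo%E by move=> h; apply: nf; exists i.
  by case: (f i _).
have := F x.
rewrite (eq_bigr (fun i => (c i * fine (f i (block_proj i x)))%:E)); last first.
  by move=> i _; rewrite [in LHS]fE.
rewrite sumEFin lee_fin => h.
have -> : \prod_i gfun (f i) (block_proj i x) `^ c i = \prod_i expR (- fine (f i (block_proj i x))) `^ c i.
  by apply: eq_bigr => i _; rewrite /gfun fE.
rewrite prod_expR ler_expR.
under eq_bigr => i _ do rewrite mulrN.
by rewrite sumrN lerN2.
Qed.

Lemma cvg_qform_glue (Y : nat -> forall i : 'I_n, (d i).-tuple R) (y : forall i : 'I_n, (d i).-tuple R) :
  (forall i k, tnth (Y m i) k @[m --> \oo] --> tnth (y i) k) ->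
  qform Q (Defs.glue (Y m)) @[m --> \oo] --> qform Q (Defs.glue y).
Proof.
move=> H.
have T (z : forall i : 'I_n, (d i).-tuple R) s : trow (Defs.glue z) 0 s = tnth (z (tagnat.sig1 s)) (tagnat.sig2 s).
  by rewrite mxE -{1}(tagnat.sig2K s) -tnth_block block_glue.
have E z : qform Q (Defs.glue z) = \sum_i \sum_j tnth (z (tagnat.sig1 i)) (tagnat.sig2 i) * Q i j *
    tnth (z (tagnat.sig1 j)) (tagnat.sig2 j).
  by rewrite qformE bil_sum; apply: eq_bigr => i _; apply: eq_bigr => j _; rewrite !T.
rewrite E; under eq_fun => m do rewrite E.
apply: cvg_sumR => i; apply: cvg_sumR => j; apply: cvgM; last exact: H.
by apply: cvgMl; exact: H.
Qed.

(** The truncations lie below the original functions and converge to them, so masses and barycenters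
    converge by domination and the bounds for [e = 1 / (m + 1)] pass to the limit. Admissibility of
    [D] also supplies the nonnegative diagonal blocks. *)
Lemma sum_ln_mass_le D : Dg_admissible c Q D ->
  \sum_i c i * ln (Int (gfun (f i))) + calQ Q f <= D.
Proof.
move=> hD; have hd := admissible_psd hc hQ hD.
pose b i := (c i)^-1; have b0 i : 0 < b i by rewrite invr_gt0.
pose t m : forall i : 'I_n, (d i).-tuple R -> R := fun i => trunc (f i) (b i) m.
have cI i : Int (t m i) @[m --> \oo] --> Int (gfun (f i)) by exact: cvg_Int_trunc.
have Z0 i : 0 < Int (gfun (f i)) := (massE (fN i) (hb i)).2.
pose Phi m := \sum_i c i * ln (Int (t m i)) +
  qform Q (Defs.glue (fun i => mean (fun x => (Int (t m i))^-1 * t m i x))).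
have cP : Phi m @[m --> \oo] --> \sum_i c i * ln (Int (gfun (f i))) + calQ Q f.
  apply: cvgD.
    apply: cvg_sumR => i; apply: cvgMr; apply: continuous_cvg; [exact: continuous_ln | exact: cI].
  by apply: cvg_qform_glue => i k; exact: cvg_mean_trunc.
have pos : \forall m \near \oo, forall i, 0 < Int (t m i).
  have H i : \forall m \near \oo, 0 < Int (t m i) by exact: (cvgr_gt _ (cI i) _ (Z0 i)).
  exact: filter_forall.
rewrite -(cvg_lim _ cP) //; apply: limr_le; first by apply/cvg_ex; eexists; exact: cP.
near=> m.
have e0 : 0 < m.+1%:R^-1 :> R by rewrite invr_gt0.
apply: (dominated_bound hn hc hQ e0 hd hD).
- by move=> i; exists m.+1%:R, (m.+1%:R^-1 * b i); exact: gb_trunc.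
- move=> x; rewrite mul1r qformQ' opprD expRD.
  apply: (@le_trans _ _ (\prod_i (gfun (f i) (block_proj i x) *
      expR (- (m.+1%:R^-1 * b i) * tdot (block_proj i x) (block_proj i x))) `^ c i)).
    apply: ler_prod => i _; rewrite powR_ge0 /=.
    have h0 := trunc_ge0 (fN i) (b i) m (block_proj i x).
    have h1 := trunc_le (f i) (b i) m (block_proj i x).
    by apply: ge0_ler_powR; rewrite ?nnegrE ?(ltW (hc i)) // (le_trans h0).
  rewrite prod_scale => [|i|i]; [|exact: gfun_ge0|exact: expR_ge0].
  apply: ler_pM.
  + by apply: prodr_ge0 => i _; exact: powR_ge0.
  + by apply: prodr_ge0 => i _; exact: powR_ge0.
  + by have := feas_gfun x; rewrite mul1r.
  rewrite (prod_expR c (fun i => - (m.+1%:R^-1 * b i) * tdot (block_proj i x) (block_proj i x))).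
  rewrite ler_expR tdot_blocks mulr_sumr -sumrN; apply: ler_sum => i _.
  rewrite /b le_eqVlt; apply/orP; left; apply/eqP.
  by move: (m.+1%:R^-1) (tdot _ _) => s T; field; rewrite gt_eqF.
- near: m; exact: pos.
Unshelve. all: by end_near. Qed.

Lemma prod_mass_le : ((\prod_(i < n) fine (mass (f i)) `^ c i)%:E <= expeR (Dg c Q - (calQ Q f)%:E))%E.
Proof.
have Z0 i : 0 < Int (gfun (f i)) := (massE (fN i) (hb i)).2.
have -> : \prod_(i < n) fine (mass (f i)) `^ c i = expR (\sum_i c i * ln (Int (gfun (f i)))).
  by rewrite -(prod_ln c Z0); apply: eq_bigr => i _; rewrite (massE (fN i) (hb i)).1.
rewrite -[X in (X <= _)%E]/(expeR (\sum_i c i * ln (Int (gfun (f i))))%:E) lee_expeR.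
(* It suffices to compare with each admissible [D]; when there is none, [Dg] is [+oo]. *)
rewrite leeBrDr // -EFinD; apply: le_ereal_inf_tmp => _ [D hD <-].
by rewrite lee_fin; exact: sum_ln_mass_le.
Qed.

End Part1.

(** * Gaussian couplings *)

Section GaussMeasure.
Context {R : realType}.
Variables (k : nat) (S : 'M[R]_k).

Let gm0 : gauss_measure S set0 = 0%E.
Proof. by rewrite /gauss_measure integral_set0. Qed.

Let gm_ge0 A : (0 <= gauss_measure S A)%E.
Proof. by apply: integral_ge0 => x _; rewrite lee_fin gd_ge0. Qed.

Let gm_sigma_additive : semi_sigma_additive (gauss_measure S).
Proof.
move=> A mA tA mUA; rewrite /gauss_measure ge0_integral_bigcup //.
- by apply: is_cvg_ereal_nneg_natsum_cond => n _ _; exact: gm_ge0.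
- by apply/measurable_EFinP; apply: measurable_funTS; exact: measurable_gd.
- by move=> x _; rewrite lee_fin gd_ge0.
Qed.

HB.instance Definition _ := isMeasure.Build _ _ _ (gauss_measure S) gm0 gm_ge0 gm_sigma_additive.

Hypothesis pS : posdef S.

Let gm_setT : gauss_measure S setT = 1%E.
Proof. exact: int_gd. Qed.

Definition gauss_prob : probability (k.-tuple R) R :=
  HB.pack_for (probability (k.-tuple R) R) (gauss_measure S)
    (@Measure_isProbability.Build _ _ R (gauss_measure S) gm_setT).

End GaussMeasure.

(** * Marginals of Gaussian measures *)

Section Proj.
Context {R : realType}.
Notation leb := (@lebesgue_measure R).

Definition tproj k o m (x : k.-tuple R) : m.-tuple R := [tuple nth 0 x (o + j) | j < m].
Arguments tproj {k} o m x.

Lemma measurable_tproj k o m : (o + m <= k)%N -> measurable_fun setT (@tproj k o m).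
Proof.
move=> h; apply/measurable_fun_tnthP => j.
have hj : (o + j < k)%N by apply: leq_trans h; rewrite ltn_add2l.
rewrite (_ : _ \o _ = fun x => tnth x (Ordinal hj)); first exact: measurable_tnth.
by apply/funext => x /=; rewrite tnth_mktuple (tnth_nth 0).
Qed.

(** Coordinates are treated from the front: one outside the window [o, ..., o + m - 1] integrates to
    1 by [int_phi1], one inside it is kept on both sides. *)
Lemma gd1_proj k o m (h : m.-tuple R -> R) : (o + m <= k)%N -> measurable_fun setT h -> (forall y, 0 <= h y) ->
  (\int[@lebR R k]_x (h (tproj o m x) * gd1 x)%:E = \int[@lebR R m]_y (h y * gd1 y)%:E)%E.
Proof.
elim: k o m h => [|k IH] o m h le mh h0.
  have o0 : o = 0%N by move: le; rewrite leqn0 addn_eq0 => /andP[/eqP].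
  have m0 : m = 0%N by move: le; rewrite leqn0 addn_eq0 => /andP[_ /eqP].
  subst o; subst m; rewrite !int_lebR0; congr (h _ * _)%:E; exact: tuple0.
have mf : measurable_fun setT (fun x : k.+1.-tuple R => (h (tproj o m x) * gd1 x)%:E).
  apply/measurable_EFinP; apply: measurable_funM; last exact: measurable_gd1.
  exact: (mcomp mh (measurable_tproj le)).
have f0 (x : k.+1.-tuple R) : (0 <= (h (tproj o m x) * gd1 x)%:E)%E by rewrite lee_fin mulr_ge0 ?gd1_ge0.
rewrite (int_lebRS mf f0).
have tail o2 : (o2 + m <= k)%N -> (forall a (t : k.-tuple R), tproj o m (consp (a, t)) = tproj o2 m t) ->
    (\int[leb]_a \int[@lebR R k]_t (h (tproj o m (consp (a, t))) * gd1 (consp (a, t)))%:E =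
     \int[@lebR R m]_y (h y * gd1 y)%:E)%E.
  move=> le2 E.
  have mh2 : measurable_fun setT (fun t : k.-tuple R => h (tproj o2 m t) * gd1 t).
    by apply: measurable_funM; [exact: (mcomp mh (measurable_tproj le2)) | exact: measurable_gd1].
  transitivity (\int[leb]_a ((phi1 a)%:E * \int[@lebR R m]_y (h y * gd1 y)%:E))%E.
    apply: eq_integral => a _; rewrite -(IH o2 m h le2 mh h0) -int_scaler //; last 2 first.
    - exact: phi1_ge0.
    - by move=> t; rewrite mulr_ge0 ?gd1_ge0.
    by apply: eq_integral => t _; apply: EFin_eq; rewrite E gd1_consp; ring.
  have mp : measurable_fun setT (fun a : R => (phi1 a)%:E) by apply/measurable_EFinP; exact: measurable_phi1.
  rewrite ge0_integralZr //; last 2 first.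
  - by move=> a _; rewrite lee_fin phi1_ge0.
  - by apply: int_ge0 => y; rewrite mulr_ge0 ?gd1_ge0.
  by rewrite int_phi1 mul1e.
case: o le mf f0 tail => [|o] le mf f0 tail; last first.
  apply: (tail o) => // a t; apply: eq_from_tnth => j; by rewrite !tnth_mktuple addSn.
case: m h mh h0 le mf f0 tail => [|m] h mh h0 le mf f0 tail.
  by apply: (tail 0%N) => // a t; apply: eq_from_tnth => -[].
have E a (t : k.-tuple R) : tproj 0 m.+1 (consp (a, t)) = consp (a, tproj 0 m t).
  apply: eq_from_tnth => j; rewrite tnth_mktuple (tnth_nth 0) add0n.
  by case: j => -[|j] hj //=; rewrite -[RHS](tnth_nth 0 (tproj 0 m t) (Ordinal (hj : (j < m)%N))) tnth_mktuple add0n.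
have mf2 : measurable_fun setT (fun y : m.+1.-tuple R => (h y * gd1 y)%:E).
  by apply/measurable_EFinP; apply: measurable_funM => //; exact: measurable_gd1.
have f02 (y : m.+1.-tuple R) : (0 <= (h y * gd1 y)%:E)%E by rewrite lee_fin mulr_ge0 ?gd1_ge0.
rewrite (int_lebRS mf2 f02); apply: eq_integral => a _.
have mha : measurable_fun setT (fun t : m.-tuple R => h (consp (a, t))).
  apply/measurable_EFinP; apply: (measurable_fun_conspr (f := EFin \o h)).
  exact/measurable_EFinP.
transitivity ((phi1 a)%:E * \int[@lebR R m]_y (h (consp (a, y)) * gd1 y)%:E)%E.
  rewrite -(IH 0%N m (fun t => h (consp (a, t)))) //.
  rewrite -int_scaler; last 3 first.
  - exact: phi1_ge0.
  - by apply: measurable_funM; [exact: (mcomp mha (@measurable_tproj k 0 m le)) | exact: measurable_gd1].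
  - by move=> t; rewrite mulr_ge0 ?gd1_ge0.
  by apply: eq_integral => t _; apply: EFin_eq; rewrite E gd1_consp; ring.
rewrite -int_scaler; last 3 first.
- exact: phi1_ge0.
- by apply: measurable_funM => //; exact: measurable_gd1.
- by move=> t; rewrite mulr_ge0 ?gd1_ge0.
by apply: eq_integral => t _; apply: EFin_eq; rewrite gd1_consp; ring.
Qed.

End Proj.

Section Existence.
Context {R : realType}.
Variables (n : nat) (d : 'I_n -> nat).
Notation N := (dimE d).

Lemma off_le i : (off d i + d i <= N)%N.
Proof.
rewrite /off /dimE [leqRHS](bigID (fun j : 'I_n => (j < i)%N)) /= leq_add2l (bigD1 i) ?ltnn //=.
exact: leq_addr.
Qed.

Lemma gd_scalar_block i (l : R) (h : (d i).-tuple R -> R) : 0 < l -> measurable_fun setT h -> (forall y, 0 <= h y) ->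
  (\int[@lebR R N]_x (h (block_proj i x) * gauss_density l%:M x)%:E =
   \int[@lebR R (d i)]_y (h y * gauss_density l%:M y)%:E)%E.
Proof.
move=> l0 mh h0.
have mhb : measurable_fun setT (fun x : N.-tuple R => h (block_proj i x)) by apply: (mcomp mh); exact: measurable_block.
rewrite (int_gd_scale l0 mhb) // (int_gd_scale l0 mh h0).
under eq_integral => z _ do rewrite block_tscale.
apply: (gd1_proj (h := fun y => h (tscale (Num.sqrt l) y)) (off_le i)) => //.
by apply: (mcomp mh); apply: measurable_tscale => //; exact: measurable_id.
Qed.

(** In [S = l I + B^T B], passing to block [i] selects the columns of [B] in that block, so the
    marginal reduces to that of a scalar covariance. *)
Lemma gd_block i (S : 'M[R]_N) (h : (d i).-tuple R -> R) : posdef S -> measurable_fun setT h ->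
  (forall y, 0 <= h y) ->
  (\int[@lebR R N]_x (h (block_proj i x) * gauss_density S x)%:E =
   \int[@lebR R (d i)]_y (h y * gauss_density (dblk S i) y)%:E)%E.
Proof.
move=> pS mh h0; have [l l0 [B SE]] := posdef_decomp pS.
pose Bi : 'M[R]_(N, d i) := \matrix_(a, k) B a (tagnat.Rank i k).
have BE : dblk S i = l%:M + Bi^T *m Bi.
  apply/matrixP => k1 k2; rewrite SE !mxE; congr (_ + _).
    by congr (_ *+ _); rewrite -val_eqE tagnat.eq_Rank eqxx.
  by apply: eq_bigr => a _; rewrite !mxE.
have pl m : posdef (l%:M : 'M[R]_m) by exact: posdef_scalar.
have mhb : measurable_fun setT (fun x : N.-tuple R => h (block_proj i x)) by apply: (mcomp mh); exact: measurable_block.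
rewrite BE SE int_gd_gram // int_gd_gram //; apply: eq_integral => z _.
have blk (x : N.-tuple R) : block_proj i (tadd x (tmul z B)) = tadd (block_proj i x) (tmul z Bi).
  rewrite block_tadd; congr tadd; apply: eq_from_tnth => k; rewrite tnth_block !tnth_mktuple !mxE.
  by apply: eq_bigr => a _; rewrite [Bi _ _]mxE.
have := @gd_scalar_block i l (fun y => h (tadd y (tmul z Bi)) * gd1 z) l0.
move=> /(_ _ _) H.
transitivity (\int[@lebR R N]_x (h (tadd (block_proj i x) (tmul z Bi)) * gd1 z * gauss_density l%:M x)%:E)%E.
  by apply: eq_integral => x _; apply: EFin_eq; rewrite blk mulrAC.
rewrite H; last 2 first.
- apply: measurable_funM => //; apply: (mcomp mh); apply: measurable_tadd => //; exact: measurable_cst.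
- by move=> y; rewrite mulr_ge0 ?gd1_ge0.
by apply: eq_integral => x _; apply: EFin_eq; rewrite mulrAC.
Qed.

Lemma gauss_coupling_exists (S : 'M[R]_N) (pS : posdef S) (Sb : forall i, 'M[R]_(d i)) :
  (forall i, dblk S i = Sb i) -> gauss_coupling Sb (gauss_prob pS).
Proof.
move=> hS i A mA; rewrite -hS /= /gauss_measure.
have mI : measurable_fun setT (\1_A : (d i).-tuple R -> R) by exact: measurable_indic.
have I0 y : 0 <= \1_A y :> R by rewrite indicE ler0n.
have := gd_block pS mI I0.
have indE m (w : m.-tuple R -> R) (B : set (m.-tuple R)) : (\int[@lebR R m]_(x in B) (w x)%:E = \int[@lebR R m]_x (\1_B x * w x)%:E)%E.
  rewrite integral_mkcond; apply: eq_integral => x _; rewrite patchE indicE.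
  by case: ifP => _; rewrite ?mul1r ?mul0r.
move=> H; rewrite (indE (d i) (gauss_density (dblk S i)) A).
rewrite (indE N (gauss_density S) (block_proj i @^-1` A)) -H.
by apply: eq_integral => x _; rewrite !indicE.
Qed.

Lemma gauss_prob_qform (S Q : 'M[R]_N) (pS : posdef S) :
  (\int[gauss_prob pS]_x (qform Q x)%:E = (\tr (Q *m S))%:E)%E.
Proof.
have [I1 I2] := Int_trace Q pS.
rewrite -I2 integE //.
have mq : measurable_fun setT (fun x : N.-tuple R => qform Q x) by exact: measurable_qform.
apply: (density_integrable (phi := id) (mu := gauss_prob pS) (lam := @lebR R N) _ _ _ _ mq I1).2.
- exact: measurable_id.
- exact: measurable_gd.
- by move=> x; exact: gd_ge0.
- by move=> A mA.
Qed.

End Existence.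

(** * Semidefinite duality and sharpness *)

Section Pert.
Context {R : realType}.

Definition swapm k (a b : 'I_k) : 'M[R]_k := delta_mx a b + delta_mx b a.

(** The perturbation factors through two dimensions, so Sylvester's identity reduces the determinant
    to a 2 by 2 one. *)
Lemma det_swap k (S : 'M[R]_k) a b t : S \in unitmx ->
  let V := invmx S in
  \det (S + t *: swapm a b) = \det S * ((1 + t * V b a) * (1 + t * V a b) - t ^+ 2 * (V a a * V b b)).
Proof.
move=> uS V.
pose A : 'M[R]_(k, 1 + 1) := row_mx (delta_mx a 0) (delta_mx b 0).
pose B : 'M[R]_(1 + 1, k) := t *: col_mx (delta_mx 0 b) (delta_mx 0 a).
have AB : A *m B = t *: swapm a b.
  rewrite /A /B -scalemxAr mul_row_col; congr (_ *: _).
  by rewrite /swapm !mul_delta_mx.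
have -> : S + t *: swapm a b = S *m (1%:M + (V *m A) *m B).
  by rewrite mulmxDr mulmx1 !mulmxA mulmxV // mul1mx AB.
rewrite det_mulmx det_1Dmul; congr (_ * _).
have E : B *m (V *m A) = block_mx (t * V b a)%:M (t * V b b)%:M (t * V a a)%:M (t * V a b)%:M.
  rewrite /B /A mul_mx_row -scalemxAl mul_col_row.
  have e (x y : 'I_k) : delta_mx 0 x *m (V *m delta_mx y 0) = (V x y)%:M :> 'M[R]_1.
    apply/matrixP => i j; rewrite !ord1 !mxE eqxx mulr1n (bigD1 x) //= big1 ?addr0.
      rewrite mxE !eqxx mul1r mxE (bigD1 y) //= big1 ?addr0; first by rewrite mxE !eqxx mulr1.
      by move=> z zy; rewrite mxE (negbTE zy) mulr0.
    by move=> z zx; rewrite mxE eqxx (negbTE zx) mul0r.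
  by rewrite !e scale_block_mx !scale_scalar_mx.
rewrite E (_ : 1%:M = block_mx 1%:M 0 0 1%:M :> 'M[R]_(1 + 1)); last by rewrite -scalar_mx_block.
rewrite add_block_mx !add0r.
have d2 (M : 'M[R]_(1 + 1)) : \det M = M (lshift 1 0) (lshift 1 0) * M (rshift 1 0) (rshift 1 0) - M (lshift 1 0) (rshift 1 0) * M (rshift 1 0) (lshift 1 0).
  rewrite (expand_det_row M (lshift 1 0)) big_split_ord /= !big_ord1 /cofactor !det_mx11 !mxE /=.
  rewrite expr0 mul1r expr1 mulN1r mulrN; congr (_ * M _ _ - _ * M _ _); apply/val_inj => //=.
rewrite d2 block_mxEul block_mxEdr block_mxEur block_mxEdl !mxE !mulr1n; ring.
Qed.

Lemma bil_swap k (a b : 'I_k) (v : 'rV[R]_k) : bil (swapm a b) v v = 2 * (v 0 a * v 0 b).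
Proof.
have e x y : bil (delta_mx x y) v v = v 0 x * v 0 y.
  rewrite bil_sum (bigD1 x) //= [X in _ + X]big1 ?addr0; last first.
    by move=> z zx; apply: big1 => w _; rewrite mxE (negbTE zx) mulr0 mul0r.
  rewrite (bigD1 y) //= big1 ?addr0; first by rewrite mxE !eqxx mulr1.
  by move=> z zy; rewrite mxE (negbTE zy) andbF mulr0 mul0r.
by rewrite /swapm bil_addM !e; ring.
Qed.

Lemma psd_det_ge0 k (S : 'M[R]_k) : psd S -> 0 <= \det S.
Proof. by move=> /psd_decomp[B ->]; rewrite det_mulmx det_tr -expr2 sqr_ge0. Qed.

Lemma psd_posdef k (S : 'M[R]_k) : psd S -> S \in unitmx -> posdef S.
Proof.
move=> pS uS; split; first by case: pS.
move=> v v0; have [B SB] := psd_decomp pS.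
have := nsq_ge0 (v *m B^T); rewrite -bil_gram -SB le_eqVlt => /orP[/eqP z|//].
exfalso; move/eqP: v0; apply.
have : nsq (v *m B^T) = 0 by rewrite -bil_gram -SB.
move/eqP; rewrite nsq_eq0 => /eqP z2.
have : v *m S = 0 by rewrite SB mulmxA z2 mul0mx.
by move/(congr1 (fun M => M *m invmx S)); rewrite -mulmxA mulmxV // mulmx1 mul0mx.
Qed.

(** The function of [t] in the hypothesis equals 1 at 0, where it is maximal, and has derivative
    [2 (V + q)] there. Differentiation is replaced by [exp y >= 1 + y], which leaves
    [2 t (V + q) <= C t^2] for small [t] of both signs. *)
Lemma stationary_zero (V W q l : R) : 0 < l ->
  (forall t, `|t| <= l -> 0 <= (1 + t * V) * (1 + t * V) - t ^+ 2 * W /\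
     ((1 + t * V) * (1 + t * V) - t ^+ 2 * W) * expR (2 * t * q) <= 1) -> V + q = 0.
Proof.
move=> l0 H.
pose C := `|V ^+ 2 - W + 4 * V * q| + `|2 * q * (V ^+ 2 - W)|.
have C0 : 0 <= C by rewrite addr_ge0.
have key t : `|t| <= l -> `|t| <= 1 -> 2 * (t * (V + q)) <= C * t ^+ 2.
  move=> tl t1; have [h0 h1] := H t tl.
  have h2 := le_trans (ler_wpM2l h0 (expR_ge1Dx (2 * t * q))) h1.
  have e : ((1 + t * V) * (1 + t * V) - t ^+ 2 * W) * (1 + 2 * t * q) =
    1 + 2 * (t * (V + q)) + t ^+ 2 * (V ^+ 2 - W + 4 * V * q) + t ^+ 2 * (t * (2 * q * (V ^+ 2 - W))) by ring.
  rewrite e in h2.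
  have t20 := sqr_ge0 t.
  have h3 : - `|V ^+ 2 - W + 4 * V * q| <= V ^+ 2 - W + 4 * V * q by exact: lerNnormlW.
  have h4 : - `|2 * q * (V ^+ 2 - W)| <= t * (2 * q * (V ^+ 2 - W)).
    by apply: lerNnormlW; rewrite normrM ler_piMl.
  have h5 := ler_wpM2l t20 h3; have h6 := ler_wpM2l t20 h4.
  rewrite mulrC /C mulrDr; lra.
have key2 tau : 0 < tau -> tau <= l -> tau <= 1 -> 2 * `|V + q| <= C * tau.
  move=> t0 tl t1; have nt : `|tau| = tau by rewrite ger0_norm // ltW.
  have k1 := key tau; have k2 := key (- tau).
  rewrite normrN nt in k1 k2; have {}k1 := k1 tl t1; have {}k2 := k2 tl t1.
  rewrite sqrrN in k2; rewrite -(ler_pM2r t0).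
  have -> : C * tau * tau = C * tau ^+ 2 by ring.
  case: (ger0P (V + q)) => _; lra.
apply/eqP; rewrite -normr_le0; apply/ler_addgt0Pr => e e0; rewrite add0r.
pose tau := Num.min (Num.min l 1) (e / (C + 1)).
have C1 : 0 < C + 1 by rewrite ltr_wpDl.
have t0 : 0 < tau by rewrite !lt_min l0 ltr01 divr_gt0.
have := key2 tau t0; rewrite /tau !ge_min !lexx !orbT /= => /(_ isT isT) h.
have : C * tau <= e.
  apply: (@le_trans _ _ (C * (e / (C + 1)))); first by apply: ler_wpM2l => //; rewrite /tau ge_min lexx orbT.
  rewrite mulrCA ler_piMr ?(ltW e0) // ler_pdivrMr //; lra.
have := normr_ge0 (V + q); rewrite -/tau in h; lra.
Qed.

Lemma norm_2xy (x y s : R) : x ^+ 2 + y ^+ 2 <= s -> `|2 * (x * y)| <= s.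
Proof.
move=> h; rewrite ler_norml; have := sqr_ge0 (x + y); have := sqr_ge0 (x - y).
rewrite (_ : (x - y) ^+ 2 = x ^+ 2 - 2 * (x * y) + y ^+ 2); last by ring.
rewrite (_ : (x + y) ^+ 2 = x ^+ 2 + 2 * (x * y) + y ^+ 2); last by ring.
by move=> *; apply/andP; split; lra.
Qed.

End Pert.

Section Continuity.
Context {R : realType} {X : topologicalType}.
Implicit Types F G : X -> R.

Lemma cont_cstF (a : R) : continuous (fun _ : X => a).
Proof. by move=> x; exact: cvg_cst. Qed.
Lemma cont_addF F G : continuous F -> continuous G -> continuous (fun x => F x + G x).
Proof. by move=> cF cG x; apply: cvgD; [exact: cF | exact: cG]. Qed.
Lemma cont_mulF F G : continuous F -> continuous G -> continuous (fun x => F x * G x).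
Proof. by move=> cF cG x; apply: cvgM; [exact: cF | exact: cG]. Qed.
Lemma cont_sumF (I : Type) (s : seq I) (F : I -> X -> R) :
  (forall i, continuous (F i)) -> continuous (fun x => \sum_(i <- s) F i x).
Proof.
move=> H; elim: s => [|i s IH].
  rewrite (_ : (fun x => _) = fun=> 0); first exact: cont_cstF.
  by apply/funext => x; rewrite big_nil.
rewrite (_ : (fun x => _) = fun x => F i x + \sum_(j <- s) F j x); first exact: cont_addF.
by apply/funext => x; rewrite big_cons.
Qed.
Lemma cont_prodF (I : Type) (s : seq I) (F : I -> X -> R) :
  (forall i, continuous (F i)) -> continuous (fun x => \prod_(i <- s) F i x).
Proof.
move=> H; elim: s => [|i s IH].
  rewrite (_ : (fun x => _) = fun=> 1); first exact: cont_cstF.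
  by apply/funext => x; rewrite big_nil.
rewrite (_ : (fun x => _) = fun x => F i x * \prod_(j <- s) F j x); first exact: cont_mulF.
by apply/funext => x; rewrite big_cons.
Qed.

Variables (k : nat) (m : X -> 'M[R]_k).
Hypothesis hm : forall a b, continuous (fun x => m x a b).

Lemma cont_bil (v : 'rV[R]_k) : continuous (fun x => bil (m x) v v).
Proof.
rewrite (_ : (fun x => _) = fun x => \sum_i \sum_j v 0 i * m x i j * v 0 j); last first.
  by apply/funext => x; rewrite bil_sum.
apply: cont_sumF => i; apply: cont_sumF => j; apply: cont_mulF; last exact: cont_cstF.
by apply: cont_mulF; [exact: cont_cstF | exact: hm].
Qed.
Lemma cont_det : continuous (fun x => \det (m x)).
Proof.
apply: cont_sumF => s; apply: cont_mulF; first exact: cont_cstF.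
by apply: cont_prodF => i; exact: hm.
Qed.
Lemma cont_tr (Q : 'M[R]_k) : continuous (fun x => \tr (Q *m m x)).
Proof.
apply: cont_sumF => i.
rewrite (_ : (fun x => _) = fun x => \sum_j Q i j * m x j i); last by apply/funext => x; rewrite mxE.
by apply: cont_sumF => j; apply: cont_mulF; [exact: cont_cstF | exact: hm].
Qed.
Lemma cont_detexp (Q : 'M[R]_k) (e : R) : continuous (fun x => \det (m x) * expR (\tr (Q *m m x) / e)).
Proof.
apply: cont_mulF; first exact: cont_det.
have h : continuous (fun x => \tr (Q *m m x) / e) by apply: cont_mulF; [exact: cont_tr | exact: cont_cstF].
by move=> x; apply: continuous_cvg; [exact: continuous_expR | exact: h].
Qed.
End Continuity.

(** * A regularised determinant maximisation *)

Section Opt.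
Context {R : realType}.
Variables (k : nat) (E : rel 'I_k) (S0 Q : 'M[R]_k) (eps : R).
Hypotheses (Er : reflexive E) (Es : symmetric E) (pS0 : posdef S0) (hQ : Q^T = Q) (eps0 : 0 < eps).

(** Matrices are encoded as functions on index pairs so that compactness comes from Tychonoff's
    theorem. *)
Let T := prod_topology (fun _ : 'I_k * 'I_k => R).
Let mx (f : T) : 'M[R]_k := \matrix_(a, b) f (a, b).
Let unmx (M : 'M[R]_k) : T := fun ab => M ab.1 ab.2.
Let unmxK M : mx (unmx M) = M. Proof. by apply/matrixP => a b; rewrite !mxE. Qed.

Let KT := [set f : T | psd (mx f) /\ forall a b, E a b -> f (a, b) = S0 a b].
(** The exponential of [(eps ln det + tr (Q S)) / eps]: in this form the objective is continuous up
    to singular matrices, where it vanishes, so a maximiser has positive determinant. *)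
Let Phi (f : T) : R := \det (mx f) * expR (\tr (Q *m mx f) / eps).

Let contc ab : continuous (fun f : T => f ab).
Proof. exact: (@proj_continuous _ (fun _ : 'I_k * 'I_k => R) ab). Qed.

Let contm a b : continuous (fun f : T => mx f a b).
Proof.
rewrite (_ : (fun f : T => mx f a b) = (fun f : T => f (a, b))); first exact: contc.
by apply/funext => f; rewrite mxE.
Qed.

Let cont_Phi : continuous Phi.
Proof. exact: (cont_detexp contm). Qed.

Let closed_KT : closed KT.
Proof.
have -> : KT = \bigcap_(ab in setT) ((fun f : T => f ab - f (ab.2, ab.1)) @^-1` [set 0]) `&`
   (\bigcap_(v in setT) ((fun f : T => bil (mx f) v v) @^-1` [set x | 0 <= x]) `&`
    \bigcap_(ab in [set ab | E ab.1 ab.2]) ((fun f : T => f ab) @^-1` [set S0 ab.1 ab.2])).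
  apply/seteqP; split => [f [[sy p] h]|f [sy [p h]]].
    split; last split.
    - move=> [a b] _ /=; move/matrixP: sy => /(_ a b); rewrite !mxE => ->; exact: subrr.
    - by move=> v _ /=; exact: p.
    - by move=> [a b] /= Eab; exact: h.
  split; first split.
  - apply/matrixP => a b; rewrite !mxE; apply/eqP; rewrite -subr_eq0; apply/eqP; exact: (sy (b, a) I).
  - by move=> v; exact: (p v I).
  - by move=> a b Eab; exact: (h (a, b) Eab).
apply: closedI; last apply: closedI.
- apply: closed_bigI => ab _; apply: closed_comp; last exact: closed_eq.
  have ch : continuous (fun f : T => f ab + -1 * f (ab.2, ab.1)).
    by apply: cont_addF; [exact: contc | apply: cont_mulF; [exact: cont_cstF | exact: contc]].
  rewrite (_ : (fun f : T => f ab - f (ab.2, ab.1)) = (fun f : T => f ab + -1 * f (ab.2, ab.1))).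
    by move=> f _; exact: ch.
  by apply/funext => f; rewrite mulN1r.
- apply: closed_bigI => v _; apply: closed_comp; last exact: closed_ge.
  have ch : continuous (fun f : T => bil (mx f) v v) by exact: (cont_bil contm).
  by move=> f _; exact: ch.
- apply: closed_bigI => ab _; apply: closed_comp; last exact: closed_eq.
  by move=> f _; exact: contc.
Qed.

(** The diagonal is prescribed since [E] is reflexive, and testing positivity on [e_a + e_b] and
    [e_a - e_b] bounds the other entries by the diagonal ones. *)
Let compact_KT : compact KT.
Proof.
pose M := \sum_a S0 a a.
have S0d a : 0 <= S0 a a.
  have := (posdef_psd pS0).2 (delta_mx 0 a); rewrite bil_sum (bigD1 a) //= [X in _ + X]big1 ?addr0.
    rewrite (bigD1 a) //= big1 ?addr0; first by rewrite !mxE !eqxx mul1r mulr1.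
    by move=> b ba; rewrite !mxE (negbTE ba) andbF mulr0.
  by move=> b ba; apply: big1 => c _; rewrite !mxE (negbTE ba) andbF !mul0r.
have box : compact [set f : T | forall ab, `[- M, M]%classic (f ab)].
  exact: (@tychonoff _ (fun _ : 'I_k * 'I_k => R) (fun=> `[- M, M]%classic) (fun=> @segment_compact R (- M) M)).
apply: (subclosed_compact closed_KT box) => f [[sy p] h] [a b] /=.
have diag c : f (c, c) = S0 c c by exact: h.
have SM c : S0 c c <= M by rewrite /M (bigD1 c) //= lerDl sumr_ge0.
have [->|ab] := eqVneq a b.
  rewrite in_itv /= diag SM andbT; apply: le_trans (S0d b); rewrite oppr_le0; apply: sumr_ge0 => c _; exact: S0d.
have SM2 : S0 a a + S0 b b <= M.
  by rewrite /M (bigD1 a) //= (bigD1 b) ?(eq_sym b) //= addrA lerDl sumr_ge0.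
have bE (c : R) : bil (mx f) (delta_mx 0 a + c *: delta_mx 0 b) (delta_mx 0 a + c *: delta_mx 0 b) =
   f (a, a) + 2 * c * f (a, b) + c ^+ 2 * f (b, b).
  have e x y : bil (mx f) (delta_mx 0 x) (delta_mx 0 y) = f (x, y).
    rewrite bil_sum (bigD1 x) //= [X in _ + X]big1 ?addr0; last first.
      by move=> z zx; apply: big1 => w _; rewrite !mxE (negbTE zx) !mul0r.
    rewrite (bigD1 y) //= big1 ?addr0; first by rewrite !mxE !eqxx mul1r mulr1.
    by move=> z zy; rewrite !mxE (negbTE zy) andbF mulr0.
  rewrite bilDl !bilDr !bilZl !bilZr !e.
  have -> : f (b, a) = f (a, b) by move/matrixP: sy => /(_ a b); rewrite !mxE.
  ring.
have := p (delta_mx 0 a + 1 *: delta_mx 0 b); rewrite bE !diag => h1.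
have := p (delta_mx 0 a + (-1) *: delta_mx 0 b); rewrite bE !diag => h2.
rewrite in_itv /=; have := S0d a; have := S0d b => *; apply/andP; split; lra.
Qed.

(* [S] maximises [\det S * exp (\tr (Q S) / eps)] among psd matrices with the prescribed entries;
   the last condition is stationarity along [swapm a b]. *)
Lemma optimal : exists S : 'M[R]_k, [/\ posdef S, forall a b, E a b -> S a b = S0 a b &
  forall a b, ~~ E a b -> Q a b + eps * invmx S a b = 0].
Proof.
have KS0 : KT (unmx S0).
  by split; [rewrite unmxK; exact: posdef_psd | move=> a b _].
have [c cK cmax] := compact_EVT_max (ex_intro _ _ KS0) compact_KT (continuous_subspaceT cont_Phi).
have [pc hc] := set_mem cK.
pose S := mx c.
have dS : 0 < \det S.
  have : 0 < Phi c.
    apply: lt_le_trans (cmax _ (mem_set KS0)); rewrite /Phi unmxK mulr_gt0 ?expR_gt0 // posdef_det //.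
  by rewrite /Phi pmulr_lgt0 ?expR_gt0.
have uS : S \in unitmx by rewrite unitmxE unitfE gt_eqF.
have pS : posdef S by exact: psd_posdef.
exists S; split => // [a b Eab|a b nE]; first by rewrite mxE hc.
have ab : a != b by apply/eqP => e; move: nE; rewrite e Er.
have [l l0 lS] := posdef_lb pS.
have Vs : invmx S b a = invmx S a b.
  by have [/matrixP /(_ a b)] := posdef_inv pS; rewrite mxE.
(* The perturbed matrix stays psd because [l] bounds the form of [S] from below, and it keeps the
   prescribed entries because [(a, b)] and [(b, a)] lie outside [E]. *)
have step t : `|t| <= l -> 0 <= (1 + t * invmx S a b) * (1 + t * invmx S a b) - t ^+ 2 * (invmx S a a * invmx S b b) /\
    ((1 + t * invmx S a b) * (1 + t * invmx S a b) - t ^+ 2 * (invmx S a a * invmx S b b)) * expR (2 * t * (Q a b / eps)) <= 1.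
  move=> tl; pose St := S + t *: swapm a b.
  have psdt : psd St.
    split.
      have [sS _] := pS; rewrite /St linearD /= sS linearZ /= /swapm linearD /= !trmx_delta; congr (_ + _ *: _); exact: addrC.
    move=> v; rewrite /St bil_addM bil_scaleM bil_swap.
    have h1 := lS v.
    have h2 : v 0 a ^+ 2 + v 0 b ^+ 2 <= nsq v.
      by rewrite nsq_row (bigD1 a) //= (bigD1 b) ?(eq_sym b) //= addrA lerDl sumr_ge0 // => z _; exact: sqr_ge0.
    have h3 : `|2 * (v 0 a * v 0 b)| <= nsq v.
      exact: norm_2xy.
    have h4 : `|t * (2 * (v 0 a * v 0 b))| <= l * nsq v by rewrite normrM ler_pM.
    have h5 := lerNnormlW h4; lra.
  have KSt : KT (unmx St).
    split; first by rewrite unmxK.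
    move=> a' b' Eab'; rewrite /unmx /= /St /swapm !mxE hc //.
    have n1 : (a' == a) && (b' == b) = false by apply/negP => /andP[/eqP e1 /eqP e2]; move: nE; rewrite -e1 -e2 Eab'.
    have n2 : (a' == b) && (b' == a) = false by apply/negP => /andP[/eqP e1 /eqP e2]; move: nE; rewrite -e1 -e2 Es Eab'.
    by rewrite n1 n2 addr0 mulr0 addr0.
  have hm := cmax _ (mem_set KSt); rewrite /Phi unmxK -/S in hm.
  have := det_swap a b t uS; rewrite /= Vs -/St => dE.
  have tE : \tr (Q *m St) / eps = \tr (Q *m S) / eps + 2 * t * (Q a b / eps).
    rewrite /St mulmxDr mxtraceD -scalemxAr mxtraceZ /swapm mulmxDr mxtraceD.
    have e x y : \tr (Q *m delta_mx x y) = Q y x.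
      rewrite /mxtrace (bigD1 y) //= [X in _ + X]big1 ?addr0; last first.
        by move=> z zy; rewrite mxE big1 // => w _; rewrite mxE (negbTE zy) andbF mulr0.
      rewrite mxE (bigD1 x) //= big1 ?addr0; first by rewrite mxE !eqxx mulr1.
      by move=> z zx; rewrite mxE (negbTE zx) mulr0.
    rewrite !e; have -> : Q b a = Q a b by move/matrixP: hQ => /(_ a b); rewrite mxE.
    by field; rewrite gt_eqF.
  have h := hm; rewrite tE expRD dE in h.
  have := psd_det_ge0 psdt; rewrite dE pmulr_rge0 // => h0; split => //.
  set P := _ - _ in h h0 *.
  have d1 : 0 < \det S * expR (\tr (Q *m S) / eps) by rewrite mulr_gt0 ?expR_gt0.
  rewrite -(ler_pM2l d1) mulr1; apply: le_trans h.
  by rewrite le_eqVlt; apply/orP; left; apply/eqP; ring.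
have := stationary_zero l0 step.
move=> h; have : eps * (invmx S a b + Q a b / eps) = 0 by rewrite h mulr0.
by rewrite mulrDr [eps * (_ / _)]mulrC divfK ?gt_eqF // addrC.
Qed.

End Opt.

(** * Truncated quadratic functions *)

Section Truncated.
Context {R : realType}.
Variable k : nat.
Implicit Types (g : k.-tuple R -> R) (x : k.-tuple R).

(* Compares the integrals of [(x_j + 1)^2 g] and [(x_j - 1)^2 g]: only nonnegative integrands
   are reflected. *)
Lemma even_coord0 K a g j : gb K a g -> (forall x, g (tscale (-1) x) = g x) ->
  Int (fun x => tnth x j * g x) = 0.
Proof.
move=> G ge; have g0 x : 0 <= g x by exact: gb_ge0 G.
have i0 := gb_integrable G; have i1 := integ_coord j G; have i2 := covm_integ j j G.
pose F s x := (tnth x j + s) ^+ 2 * g x.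
have FE s : F s = fun x => tnth x j * tnth x j * g x + (2 * s * (tnth x j * g x) + s ^+ 2 * g x).
  by apply/funext => x; rewrite /F; ring.
have IF s : Int (F s) = Int (fun x => tnth x j * tnth x j * g x) +
    (2 * s * Int (fun x => tnth x j * g x) + s ^+ 2 * Int g).
  by rewrite FE IntD ?IntD ?IntZ //; [exact: integZ|exact: integZ|apply: integD; exact: integZ].
have mF s : measurable_fun setT (fun x => (F s x)%:E).
  apply/measurable_EFinP; apply: measurable_funM; last exact: gb_measurable G.
  by apply: measurable_funX; apply: measurable_funD => //; exact: measurable_tnth.
have F0 s x : (0 <= (F s x)%:E)%E by rewrite lee_fin mulr_ge0 ?sqr_ge0.
have : Int (F 1) = Int (F (-1)).
  rewrite /Int; congr fine; rewrite -(int_lebR_opp (mF 1) (F0 1)); apply: eq_integral => x _.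
  by apply: EFin_eq; rewrite /F tnthZ ge; ring.
rewrite !IF; lra.
Qed.

Lemma Int_mono (f g : k.-tuple R -> R) : integ f -> integ g -> (forall x, f x <= g x) -> Int f <= Int g.
Proof.
move=> If Ig fg; rewrite -lee_fin !integE //; apply: le_integral => // x _.
by rewrite lee_fin.
Qed.

Variables (S A : 'M[R]_k) (c : R).
Hypotheses (pS : posdef S) (c0 : 0 < c).

(** [A] need not be positive definite; cutting at [|x|^2 <= r] secures integrability, and the value
    [+oo] outside preserves the pointwise constraint. Evenness puts the barycenter at 0, so that
    [calQ] vanishes. *)
Definition tfun (r : nat) x : \bar R := if tdot x x <= r%:R then (qform A x / c)%:E else +oo%E.
Definition tg (r : nat) x : R := if tdot x x <= r%:R then expR (- (qform A x / c)) else 0.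

Lemma tfunN r x : tfun r x != -oo%E.
Proof. by rewrite /tfun; case: ifP. Qed.

Lemma gfun_tfun r : gfun (tfun r) = tg r.
Proof. by apply/funext => x; rewrite /gfun /tfun /tg; case: ifP. Qed.

Let mcond (r : nat) : measurable_fun setT (fun x : k.-tuple R => tdot x x <= r%:R).
Proof. by apply: measurable_fun_ler; [exact: measurable_tdot | exact: measurable_cst]. Qed.

Lemma measurable_tfun r : measurable_fun setT (tfun r).
Proof.
apply: measurable_fun_ifT; [exact: mcond | | exact: measurable_cst].
by apply/measurable_EFinP; apply: measurable_funM => //; exact: measurable_qform.
Qed.

Lemma tg_even r x : tg r (tscale (-1) x) = tg r x.
Proof.
rewrite /tg tdotZl tdotZr (mulrA (-1)) mulrNN !mul1r.
by rewrite !qformE trowZ bilZl bilZr (mulrA (-1)) mulrNN !mul1r.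
Qed.

Lemma gb_tg r : gb (expR ((nsq A + 1) * r%:R / c + r%:R)) 1 (tg r).
Proof.
split => //.
  apply: measurable_fun_ifT; [exact: mcond | | exact: measurable_cst].
  apply: measurable_expR_comp; apply: measurableT_comp => //.
  by apply: measurable_funM => //; exact: measurable_qform.
move=> x; rewrite /tg; case: ifP => h; last by rewrite lexx mulr_ge0 ?expR_ge0.
rewrite expR_ge0 /= -expRD ler_expR.
have := qform_le (- A) x.
have -> : nsq (- A) = nsq A by apply: eq_bigr => i _; apply: eq_bigr => s _; rewrite mxE sqrrN.
have -> : qform (- A) x = - qform A x by rewrite !qformE /bil mulmxN mulNmx mxE.
move=> h1; have h2 : (nsq A + 1) * tdot x x <= (nsq A + 1) * r%:R.
  by apply: ler_wpM2l => //; rewrite addr_ge0 ?nsq_ge0.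
have h3 : - (qform A x / c) <= (nsq A + 1) * r%:R / c.
  rewrite -mulNr; apply: ler_wpM2r; first by rewrite invr_ge0 ltW.
  exact: le_trans h2.
lra.
Qed.

Lemma tfun_barycenter r : 0 < Int (tg r) -> has_barycenter (tfun r).
Proof.
move=> Z0; have G := gb_tg r.
have E x : expeR (- tfun r x) = (tg r x)%:E by rewrite -gfun_tfun gfunE //; exact: tfunN.
have mE : mass (tfun r) = (Int (tg r))%:E.
  by rewrite /mass (IntE G); apply: eq_integral => x _; rewrite E.
split; first by rewrite mE lte_fin Z0 ltry.
have tg0 x : 0 <= tg r x by exact: gb_ge0 G.
have H : integ (fun x => tg r x + tdot x x * tg r x).
  by apply: integD; [exact: gb_integrable G | exact: gb_integrable (gb_moment2 G)].
have /integrableP[_] := H; apply: le_lt_trans.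
under eq_integral => x _ do rewrite E -EFinM.
have mT : measurable_fun setT (fun x : k.-tuple R => tdot x x) by exact: measurable_tdot.
have ms : measurable_fun setT (Num.sqrt : R -> R).
  by apply: continuous_measurable_fun; exact: sqrt_continuous.
apply: ge0_le_integral => //.
- by move=> x _; rewrite lee_fin mulr_ge0 ?sqrtr_ge0.
- apply/measurable_EFinP; apply: measurable_funM; first exact: (mcomp ms mT).
  exact: gb_measurable G.
- apply: measurableT_comp => //; apply/measurable_EFinP; apply: measurable_funD; first exact: gb_measurable G.
  by apply: measurable_funM => //; exact: gb_measurable G.
move=> x _; rewrite /= lee_fin ger0_norm; last by rewrite addr_ge0 ?mulr_ge0 ?tdot_ge0.
rewrite -[X in _ <= X + _]mul1r -mulrDl; apply: ler_wpM2r => //.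
have := sqr_ge0 (tnorm x - 1); have := sqr_sqrtr (tdot_ge0 x); rewrite -/(tnorm x) => <-.
have := sqr_ge0 (tnorm x); rewrite sqrrB; lra.
Qed.

Lemma bar_tfun r : 0 < Int (tg r) -> bar (tfun r) = tzero.
Proof.
move=> Z0; apply: eq_from_tnth => j.
rewrite (barE (@tfunN r) (tfun_barycenter Z0)) tnth_tzero gfun_tfun.
by rewrite (even_coord0 j (gb_tg r) (tg_even r)) mul0r.
Qed.

(* Gibbs variational principle: [exp (u - L) >= 1 + u - L] integrated against the Gaussian density,
   [L] being the mean of [u]. *)
Lemma tg_lower th : th < 1 -> exists r0, forall r, (r0 <= r)%N ->
  expR (ent S - \tr (A *m S) / c) * th <= Int (tg r).
Proof.
move=> th1; pose L := ent S - \tr (A *m S) / c.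
(* On the ball [tg r] is [exp u] times the Gaussian density; [H] is the tangent line bound for it
   divided by [exp L], and its integral is 1. *)
pose u x := - (qform A x / c) - ln (gauss_density S x).
pose H x := (1 + u x - L) * gauss_density S x.
have [K [a G]] := gb_gd pS; have i0 := gb_integrable G.
have [iA IA] := Int_trace A pS; have [il Il] := integ_lngd pS.
have HE : H = fun x => (1 - L) * gauss_density S x +
    (- c^-1 * (qform A x * gauss_density S x) + (- ln (gauss_density S x) * gauss_density S x)).
  by apply/funext => x; rewrite /H /u; ring.
have iH : integ H by rewrite HE; apply: integD; [exact: integZ | apply: integD => //; exact: integZ].
have IH : Int H = 1.
  have I1 : Int (gauss_density S) = 1 by rewrite /Int int_gd.
  rewrite HE IntD ?IntD ?IntZ //; last 3 first.
  - exact: integZ.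
  - exact: integZ.
  - by apply: integD => //; exact: integZ.
  rewrite IA Il I1 /L; ring.
pose F (r : nat) (x : k.-tuple R) : R := if tdot x x <= r%:R then H x else 0.
have mH : measurable_fun setT H by move/integrableP: iH => [/measurable_EFinP].
have mF r : measurable_fun setT (F r).
  by apply: measurable_fun_ifT; [exact: mcond | exact: mH | exact: measurable_cst].
have ia : integ (fun x => `|H x|) by exact: (integrable_abse iH).
have Fa r x : `|F r x| <= `|H x| by rewrite /F; case: ifP => // _; rewrite normr0.
have iF r : integ (F r) by exact: (integ_le (mF r) ia (Fa r)).
have cF : (Int (F r) : R) @[r --> \oo] --> (1 : R).
  rewrite -IH; apply: (Int_dct mF mH _ ia Fa) => x.
  apply: cvg_near_cst; near=> r; rewrite /F ifT //.
  rewrite ltW // (lt_le_trans (archi_boundP (tdot_ge0 x))) // ler_nat.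
  near: r; exact: nbhs_infty_ge.
have [r0 _ hr0] := cvgr_gt _ cF _ th1.
exists r0 => r r0r; have := hr0 r r0r => /= hF.
apply: (@le_trans _ _ (expR L * Int (F r))).
  by apply: ler_wpM2l; [exact: expR_ge0 | exact: ltW].
rewrite -IntZ //; apply: Int_mono; [exact: integZ | exact: gb_integrable (gb_tg r) |].
move=> x; rewrite /F /tg; case: ifP => _; last by rewrite mulr0.
have g0 := gd_gt0 x pS.
have -> : expR (- (qform A x / c)) = expR L * (expR (u x - L) * gauss_density S x).
  rewrite mulrA -expRD (_ : L + (u x - L) = u x); last by ring.
  rewrite /u expRD [X in _ * X * _]expRN lnK ?posrE //.
  by rewrite -mulrA mulVf ?mulr1 // gt_eqF.
apply: ler_wpM2l; first exact: expR_ge0.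
apply: ler_wpM2r; first exact: ltW.
by rewrite -addrA expR_ge1Dx.
Unshelve. all: by end_near. Qed.

End Truncated.

(** * Block diagonal duality and sharpness *)

Section Part2.
Context {R : realType}.
Variables (n : nat) (d : 'I_n -> nat) (c : 'I_n -> R).
Hypothesis hc : forall i, 0 < c i.
Notation N := (dimE d).
Variables (Q : 'M[R]_N).
Hypotheses (hQ : Q^T = Q).

Definition selm i : 'M[R]_(d i, N) := \matrix_(k, s) (s == tagnat.Rank i k)%:R.

Lemma rank_eq i j (k : 'I_(d i)) (l : 'I_(d j)) :
  (tagnat.Rank i k == tagnat.Rank j l) = (i == j) && (k == l :> nat).
Proof. by rewrite -val_eqE tagnat.eq_Rank. Qed.

Lemma mul_selm i m (M : 'M[R]_(N, m)) k j : (selm i *m M) k j = M (tagnat.Rank i k) j.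
Proof.
rewrite mxE (bigD1 (tagnat.Rank i k)) //= big1 ?addr0; first by rewrite mxE eqxx mul1r.
by move=> s /negbTE sk; rewrite mxE sk mul0r.
Qed.

Lemma mulmx_selmT i m (M : 'M[R]_(m, N)) k j : (M *m (selm i)^T) j k = M j (tagnat.Rank i k).
Proof. by rewrite -[M *m _]trmxK trmx_mul trmxK mxE mul_selm mxE. Qed.

Lemma dblk_selm (M : 'M[R]_N) i : dblk M i = selm i *m M *m (selm i)^T.
Proof. by apply/matrixP => a b; rewrite mulmx_selmT mul_selm mxE. Qed.

Lemma selm_selmT i j : selm j *m (selm i)^T = \matrix_(k, l) ((j == i) && (k == l :> nat))%:R.
Proof. by apply/matrixP => a b; rewrite mul_selm !mxE rank_eq. Qed.

Definition bdiag (S : forall i, 'M[R]_(d i)) : 'M[R]_N := \sum_i (selm i)^T *m S i *m selm i.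

Lemma dblk_bdiag S j : dblk (bdiag S) j = S j.
Proof.
rewrite dblk_selm /bdiag mulmx_sumr mulmx_suml (bigD1 j) //= big1 ?addr0.
  have e : selm j *m (selm j)^T = 1%:M.
    by rewrite selm_selmT; apply/matrixP => a b; rewrite !mxE eqxx val_eqE.
  by rewrite !mulmxA e mul1mx -mulmxA e mulmx1.
move=> i ij; rewrite !mulmxA selm_selmT (_ : \matrix_(_, _) _ = 0) ?mul0mx //.
by apply/matrixP => a b; rewrite !mxE eq_sym (negbTE ij).
Qed.

Lemma bdiag_posdef S : (forall i, posdef (S i)) -> posdef (bdiag S).
Proof.
move=> pS; split.
  rewrite /bdiag linear_sum; apply: eq_bigr => i _ /=.
  by rewrite !trmx_mul trmxK (pS i).1 mulmxA.
move=> v v0.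
have E : (v *m bdiag S *m v^T) 0 0 = \sum_i bil (S i) (v *m (selm i)^T) (v *m (selm i)^T).
  rewrite /bdiag mulmx_sumr mulmx_suml summxE; apply: eq_bigr => i _.
  by rewrite /bil trmx_mul trmxK !mulmxA.
have b0 i : 0 <= bil (S i) (v *m (selm i)^T) (v *m (selm i)^T) by exact: (posdef_psd (pS i)).2.
rewrite E lt_neqAle sumr_ge0 // andbT eq_sym; apply/eqP => z.
have zi i : v *m (selm i)^T = 0.
  apply/eqP; apply: contraT => w0; have := (pS i).2 _ w0.
  have /eqP := z; rewrite psumr_eq0 // => /allP /(_ i); rewrite mem_index_enum => /(_ isT) /eqP.
  by rewrite /bil => ->; rewrite ltxx.
move/eqP: v0; apply; apply/rowP => s; rewrite mxE.
have := congr1 (fun w : 'rV[R]_(d (tagnat.sig1 s)) => w 0 (tagnat.sig2 s)) (zi (tagnat.sig1 s)).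
by rewrite mulmx_selmT tagnat.sig2K mxE.
Qed.

Lemma bil_blockdiag (A : 'M[R]_N) (x : N.-tuple R) :
  (forall s t, tagnat.sig1 s != tagnat.sig1 t -> A s t = 0) ->
  qform A x = \sum_i qform (dblk A i) (block_proj i x).
Proof.
move=> hA; rewrite qformE bil_sum sum_blocks; apply: eq_bigr => i _.
rewrite qformE bil_sum; apply: eq_bigr => k _.
rewrite sum_blocks (bigD1 i) //= [X in _ + X]big1 ?addr0; last first.
  by move=> j ji; apply: big1 => l _; rewrite hA ?mulr0 ?mul0r // !tagnat.Rank1K eq_sym.
by apply: eq_bigr => l _; rewrite !mxE !tnth_block.
Qed.

Lemma tr_blockdiag (A S : 'M[R]_N) :
  (forall s t, tagnat.sig1 s != tagnat.sig1 t -> A s t = 0) ->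
  \tr (A *m S) = \sum_i \tr (dblk A i *m dblk S i).
Proof.
move=> hA; rewrite /mxtrace sum_blocks; apply: eq_bigr => i _; apply: eq_bigr => k _.
rewrite !mxE sum_blocks (bigD1 i) //= [X in _ + X]big1 ?addr0; last first.
  by move=> j ji; apply: big1 => l _; rewrite hA ?mul0r // !tagnat.Rank1K eq_sym.
by apply: eq_bigr => l _; rewrite !mxE.
Qed.

(** Approximate strong duality. By stationarity [Q + eps Sg^-1] vanishes off the diagonal blocks,
    hence is separable; it dominates [Q], and its trace against [Sg] exceeds [tr (Q Sg)] by
    [eps tr (Sg^-1 Sg) = eps N]. *)
Lemma dual_bound (S : forall i, 'M[R]_(d i)) eps : 0 < eps -> (forall i, posdef (S i)) ->
  exists Sg : 'M[R]_N, exists A : forall i, 'M[R]_(d i), [/\ posdef Sg, forall i, dblk Sg i = S i,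
   forall x : N.-tuple R, qform Q x <= \sum_i qform (A i) (block_proj i x) &
   \sum_i \tr (A i *m S i) = \tr (Q *m Sg) + eps * N%:R].
Proof.
move=> eps0 pS; pose E : rel 'I_N := fun s t => tagnat.sig1 s == tagnat.sig1 t.
have Er : reflexive E by move=> s; exact: eqxx.
have Es : symmetric E by move=> s t; exact: eq_sym.
have [Sg [pSg h1 h2]] := optimal Er Es (bdiag_posdef pS) hQ eps0.
pose A := Q + eps *: invmx Sg.
have hA s t : tagnat.sig1 s != tagnat.sig1 t -> A s t = 0.
  by move=> st; have := h2 s t st; rewrite !mxE.
have hb i : dblk Sg i = S i.
  rewrite -(dblk_bdiag S i); apply/matrixP => a b; rewrite !mxE h1 //.
  by rewrite /E !tagnat.Rank1K.
exists Sg, (dblk A); split => // [x|].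
  rewrite -bil_blockdiag // [leRHS]qformE /A bil_addM bil_scaleM -qformE lerDl.
  by apply: mulr_ge0; [exact: ltW | exact: (posdef_psd (posdef_inv pSg)).2].
under eq_bigr => i _ do rewrite -hb.
rewrite -tr_blockdiag // /A mulmxDl mxtraceD -scalemxAl mxtraceZ mulVmx ?posdef_unit //.
by rewrite mxtrace1.
Qed.

(** The gap [de] in the violated Gaussian inequality is spent in two halves: [eps * N] pays for the
    duality and [C * (de / (2 * (C + 1)))] for the truncation. The latter is strictly below
    [de / 2], which gives the strict inequality. *)
Lemma Dg_sharp D : (D%:E < Dg c Q)%E ->
   exists f : forall i : 'I_n, (d i).-tuple R -> \bar R,
     (forall i, measurable_fun [set: (d i).-tuple R] (f i)) /\
     (forall i x, f i x != -oo%E) /\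
     (forall i, has_barycenter (f i)) /\
     (forall x : N.-tuple R,
        ((qform Q x)%:E <= \sum_(i < n) (c i)%:E * f i (block_proj i x))%E) /\
     (expeR (D%:E - (calQ Q f)%:E) <
        (\prod_(i < n) fine (mass (f i)) `^ c i)%:E)%E.
Proof.
move=> hD.
have nadm : ~ Dg_admissible c Q D.
  by move=> adm; move: hD; rewrite ltNge => /negP; apply; apply: ereal_inf_lbound; exists D.
have [S [pS hS]] : exists S : forall i : 'I_n, 'M[R]_(d i), (forall i, posdef (S i)) /\
   ~ (\sum_(i < n) (c i)%:E * gauss_entropy (S i) <=
     ereal_sup [set (\int[mu]_x (qform Q x)%:E)%E | mu in [set mu | gauss_coupling S mu]] + D%:E)%E.
  by apply: contrapT => H; apply: nadm => S pS; apply: contrapT => h; apply: H; exists S.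
move: hS; set sp := ereal_sup _.
under eq_bigr => i _ do rewrite gauss_entropyE // -EFinM.
rewrite sumEFin => /negP; rewrite -ltNge; set H := \sum_i _ => hS.
have spge (Sg : 'M[R]_N) (pSg : posdef Sg) : (forall i, dblk Sg i = S i) -> ((\tr (Q *m Sg))%:E <= sp)%E.
  move=> hb; rewrite -(gauss_prob_qform Q pSg); apply: ereal_sup_ubound.
  by exists (gauss_prob pSg) => //; exact: gauss_coupling_exists.
(* The block diagonal Gaussian coupling excludes [-oo], and the strict violation [hS] excludes
   [+oo]. *)
have [sg spE] : exists sg, sp = sg%:E.
  have := spge _ (bdiag_posdef pS) (dblk_bdiag S); move: hS; case: sp {spge} => [r| |] //.
  by exists r.
rewrite spE -EFinD lte_fin in hS.
pose de := H - (sg + D); have de0 : 0 < de by rewrite subr_gt0.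
pose eps := de / (2 * (N%:R + 1)).
have N0 : 0 < N%:R + 1 :> R by rewrite ltr_wpDl.
have eps0 : 0 < eps by rewrite divr_gt0 // mulr_gt0.
have [Sg [A [pSg hb hA tA]]] := dual_bound eps0 pS.
have trle : \tr (Q *m Sg) <= sg by rewrite -lee_fin -spE; exact: spge.
have epsN : eps * N%:R <= de / 2.
  have -> : eps * N%:R = de / 2 * (N%:R / (N%:R + 1)) by rewrite /eps; field; rewrite gt_eqF.
  by rewrite ler_piMr ?divr_ge0 ?(ltW de0) // ler_pdivrMr // mul1r lerDl.
pose C := \sum_i c i; have C0 : 0 <= C by apply: sumr_ge0 => i _; exact: ltW.
have C1 : 0 < C + 1 by rewrite ltr_wpDl.
pose th := expR (- (de / (2 * (C + 1)))).
have th1 : th < 1 by rewrite -expR0 ltr_expR oppr_lt0 divr_gt0 // mulr_gt0.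
have low i := tg_lower (A i) (pS i) (hc i) th1.
pose r0 i := projT1 (cid (low i)).
pose r := (\max_i r0 i)%N.
have Zl i : expR (ent (S i) - \tr (A i *m S i) / c i) * th <= Int (tg (A i) (c i) r).
  exact: (projT2 (cid (low i)) r (leq_bigmax i)).
have Z0 i : 0 < Int (tg (A i) (c i) r).
  by apply: lt_le_trans (Zl i); rewrite mulr_gt0 ?expR_gt0.
exists (fun i => tfun (A i) (c i) r); split; first by move=> i; exact: measurable_tfun.
split; first by move=> i x; exact: tfunN.
split; first by move=> i; apply: tfun_barycenter.
split.
  move=> x.
  have [[i fi]|nf] := pselect (exists i, tfun (A i) (c i) r (block_proj i x) = +oo%E).
    have E : (\sum_(i < n) (c i)%:E * tfun (A i) (c i) r (block_proj i x) = +oo)%E.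
      rewrite (bigD1 i) //= fi gt0_muley ?lte_fin // addye //.
      rewrite -lteNye; apply: (@lt_le_trans _ _ (\sum_(j < n | j != i) (qform (A j) (block_proj j x))%:E)%E).
        by rewrite sumEFin ltNyr.
      apply: lee_sum => j _; rewrite /tfun; case: ifP => _.
        by rewrite -EFinM mulrC divfK // gt_eqF.
      by rewrite gt0_muley ?lte_fin // leey.
    by rewrite E leey.
  rewrite (eq_bigr (fun i => (qform (A i) (block_proj i x))%:E)).
    by rewrite sumEFin lee_fin; exact: hA.
  move=> i _; rewrite /tfun; case: ifP => [_|h]; first by rewrite -EFinM mulrC divfK // gt_eqF.
  by exfalso; apply: nf; exists i; rewrite /tfun h.
have -> : calQ Q (fun i => tfun (A i) (c i) r) = 0.
  rewrite /calQ qformE (_ : Defs.glue _ = tzero) ?trow0 /bil ?mul0mx ?mxE //.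
  apply: block_inj => i; rewrite block_glue bar_tfun //.
  by apply: eq_from_tnth => k; rewrite tnth_block !tnth_tzero.
rewrite sube0.
have -> : \prod_(i < n) fine (mass (tfun (A i) (c i) r)) `^ c i =
   expR (\sum_i c i * ln (Int (tg (A i) (c i) r))).
  rewrite -(prod_ln c Z0); apply: eq_bigr => i _.
  by rewrite (massE (@tfunN _ _ (A i) (c i) r) (tfun_barycenter (hc i) (Z0 i))).1 gfun_tfun.
rewrite /= lte_fin ltr_expR.
apply: (@lt_le_trans _ _ (\sum_i c i * (ent (S i) - \tr (A i *m S i) / c i + - (de / (2 * (C + 1)))))).
  have -> : \sum_i c i * (ent (S i) - \tr (A i *m S i) / c i + - (de / (2 * (C + 1)))) =
     H - \sum_i \tr (A i *m S i) - C * (de / (2 * (C + 1))).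
    rewrite /H /C mulr_suml -!sumrB; apply: eq_bigr => i _.
    by field; rewrite !gt_eqF.
  have h1 : C * (de / (2 * (C + 1))) < de / 2.
    have -> : C * (de / (2 * (C + 1))) = de / 2 * (C / (C + 1)) by field; rewrite gt_eqF.
    rewrite gtr_pMr ?divr_gt0 // ltr_pdivrMr //; lra.
  rewrite tA; move: h1 epsN trle; rewrite /de; lra.
apply: ler_sum => i _; apply: ler_wpM2l; first exact: ltW.
rewrite -ler_expR lnK ?posrE // expRD; exact: Zl.
Qed.

End Part2.

Theorem theorem3 (R : realType) (n : nat) (d : 'I_n -> nat)
  (hn : (0 < n)%N) (hd : forall i, (0 < d i)%N)
  (c : 'I_n -> R) (hc : forall i, 0 < c i)
  (Q : 'M[R]_(dimE d)) (hQ : Q^T = Q) :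
  (forall f : forall i : 'I_n, (d i).-tuple R -> \bar R,
     (forall i, measurable_fun [set: (d i).-tuple R] (f i)) ->
     (forall i x, f i x != -oo%E) ->
     (forall i, has_barycenter (f i)) ->
     (forall x : (dimE d).-tuple R,
        ((qform Q x)%:E <= \sum_(i < n) (c i)%:E * f i (block_proj i x))%E) ->
     ((\prod_(i < n) fine (mass (f i)) `^ c i)%:E
        <= expeR (Dg c Q - (calQ Q f)%:E))%E)
  /\
  (forall D : R, (D%:E < Dg c Q)%E ->
   exists f : forall i : 'I_n, (d i).-tuple R -> \bar R,
     (forall i, measurable_fun [set: (d i).-tuple R] (f i)) /\
     (forall i x, f i x != -oo%E) /\
     (forall i, has_barycenter (f i)) /\
     (forall x : (dimE d).-tuple R,
        ((qform Q x)%:E <= \sum_(i < n) (c i)%:E * f i (block_proj i x))%E) /\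
     (expeR (D%:E - (calQ Q f)%:E) <
        (\prod_(i < n) fine (mass (f i)) `^ c i)%:E)%E).
Proof.
split; last exact: Dg_sharp.
by move=> f mf fN hb F; exact: prod_mass_le.
Qed.
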